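(* There exists a constant $C<\infty$, independent of $n$, $z$ and $\beta_{\mathrm{fine}}$, such that for every integer $n\ge2$ and every $z\in\mathbb{C}$ with $\mathrm{Re}(z)<-e^{Cn^2+\beta_\star}$: (a) the formula $$\mathcal{R}_z=\mathcal{G}_z+\sum_{m=1}^\infty\ \sum_{\overrightarrow{(i,j)}\in\mathrm{Dgm}(n,m)}\mathcal{G}_z\mathcal{S}^*_{i_1j_1}\big(4\pi(\mathcal{J}_z-\beta_\star\mathbf{I})^{-1}\big)\prod_{s=2}^m\Big(\mathcal{S}_{i_{s-1}j_{s-1}}\mathcal{G}_z\mathcal{S}^*_{i_sj_s}\big(4\pi(\mathcal{J}_z-\beta_\star\mathbf{I})^{-1}\big)\Big)\mathcal{S}_{i_mj_m}\mathcal{G}_z$$ defines a bounded operator $L^2(\mathbb{R}^{2n})\to L^2(\mathbb{R}^{2n})$, the sum converging absolutely in operator norm; (b) on the subspace $L^2_{\mathrm{sym}}(\mathbb{R}^{2n})$ one has $\mathcal{R}_zu=\mathcal{R}^{\mathrm{sym}}_zu$, where $$\mathcal{R}^{\mathrm{sym}}_z:=\mathcal{G}_z+\frac{2}{n(n-1)}\Big(\sum_{i<j}\mathcal{G}_z\mathcal{S}^*_{ij}\Big)\Big(\frac1{4\pi}(\mathcal{J}_z-\beta_\star\mathbf{I})-\frac{2}{n(n-1)}\sum_{(i<j)\neq(k<\ell)}\mathcal{S}_{ij}\mathcal{G}_z\mathcal{S}^*_{k\ell}\Big)^{-1}\Big(\sum_{i<j}\mathcal{S}_{ij}\mathcal{G}_z\Big),$$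 the middle sum being over all ordered pairs of distinct index pairs $(i<j)\ne(k<\ell)$ in $\{1,\ldots,n\}$.
   Context: $\beta_{\mathrm{fine}}\in\mathbb{R}$ and a mollifier $\varphi\in C_c^\infty(\mathbb{R}^2)$, $\varphi\ge0$, $\int\varphi=1$, are fixed; constants may depend on $\varphi$. $\Phi(x):=\int_{\mathbb{R}^2}\varphi(x+y)\varphi(y)\,dy$, $\beta_\Phi:=\int_{\mathbb{R}^4}\Phi(x)\log|x-x'|\Phi(x')\,dx\,dx'$, $\beta_\star:=2(\log2+\beta_{\mathrm{fine}}-\beta_\Phi-\gamma_{\mathrm{EM}})$ with $\gamma_{\mathrm{EM}}$ the Euler–Mascheroni constant. $\mathbf{I}$ is the identity. Write $x=(x_1,\ldots,x_n)\in\mathbb{R}^{2n}$ with $x_i\in\mathbb{R}^2$, $y=(y_2,\ldots,y_n)\in\mathbb{R}^{2n-2}$ with $y_i\in\mathbb{R}^2$. $\hat f(q)=\int_{\mathbb{R}^d}e^{-\mathbf{i}y\cdot q}f(y)\frac{dy}{(2\pi)^{d/2}}$ on $\mathbb{R}^d$. $\mathcal{G}_z:=(-\frac12\sum_{i=1}^n\nabla_i^2-z\mathbf{I})^{-1}$ on $L^2(\mathbb{R}^{2n})$. For $1\le i<j\le n$, $S_{ij}:\mathbb{R}^{2n-2}\to\mathbb{R}^{2n}$ sends $y$ to the vector whose $i$-th and $j$-th components both equal $y_2$ and whose remaining components are, in order, $y_3,\ldots,y_n$; $(\mathcal{S}_{ij}u)(y):=u(S_{ij}y)$ is an unbounded operator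 $L^2(\mathbb{R}^{2n})\to L^2(\mathbb{R}^{2n-2})$: in Fourier variables, $\widehat{\mathcal{S}_{ij}f}(q_2,\ldots,q_n)=\int_{\mathbb{R}^2}\hat f(M_{ij}q)\frac{dq_1}{2\pi}$, with domain the set of $f\in L^2(\mathbb{R}^{2n})$ with $\int_{\mathbb{R}^2}|\hat f(M_{ij}(q_1,\cdot))|\,dq_1\in L^2(\mathbb{R}^{2n-2})$, where $M_{ij}q\in\mathbb{R}^{2n}$ has $i$-th component $\frac12q_2+q_1$, $j$-th component $\frac12q_2-q_1$ and remaining components, in order, $q_3,\ldots,q_n$. Its adjoint is $\widehat{\mathcal{S}^*_{ij}g}(p):=\frac1{2\pi}\hat g(p_i+p_j,p_{\overline{ij}})$, mapping $L^2(\mathbb{R}^{2n-2})$ into $\bigcap_{a>1}H^{-a}(\mathbb{R}^{2n})$, where $p_{\overline{ij}}$ is $p$ with its $i$-th and $j$-th components removed. $\mathcal{J}_z$ is the unbounded operator on $L^2(\mathbb{R}^{2n-2})$, $\widehat{\mathcal{J}_zv}(p_2,\ldots,p_n):=\log(\frac12|p|^2_{2-n}-z)\,\hat v(p_2,\ldots,p_n)$ (principal branch), $|p|^2_{2-n}:=\frac12|p_2|^2+|p_3|^2+\cdots+|p_n|^2$, with domain $\{v:\int_{\mathbb{R}^{2n-2}}|\hat v(p)\log(|p|^2_{2-n}+1)|^2dp<\infty\}$. $\mathrm{Dgm}(n,m)$ is the set of sequences $((i_k,j_k))_{k=1}^m$ with $1\le i_k<j_k\le n$ and $(i_k,j_k)\ne(i_{k+1},j_{k+1})$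 for all $k$. Products are ordered left to right. $L^2_{\mathrm{sym}}(\mathbb{R}^{2n})$ is the subspace of $u\in L^2(\mathbb{R}^{2n})$ with $u(x_1,\ldots,x_n)=u(x_{\sigma(1)},\ldots,x_{\sigma(n)})$ for all permutations $\sigma$ of $\{1,\ldots,n\}$. *)

(* Defs.v *)
From HB Require Import structures.
From mathcomp Require Import all_boot all_order all_algebra all_fingroup complex.
From mathcomp Require Import all_classical all_reals all_analysis.

Set Implicit Arguments.
Unset Strict Implicit.
Unset Printing Implicit Defensive.

Import Order.TTheory GRing.Theory Num.Theory.
Import numFieldNormedType.Exports.

Local Open Scope classical_set_scope.
Local Open Scope ring_scope.

(* The library's Lebesgue measure lives on [measurableTypeR R], an alias of R
   with its own measurability display; hence the alias [plane] of R * R. *)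
Notation plane R := (measurableTypeR R * measurableTypeR R)%type.
Notation config R n := (n.-tuple (plane R)).

(* The library's sigma-finite instance on [m1 \x m2] is not found by inference
   (it is shadowed by the one on products of subprobabilities), hence this alias. *)
Section ProductMeasure.
Context d1 d2 (T1 : measurableType d1) (T2 : measurableType d2) (R : realType).
Variables (m1 : {sigma_finite_measure set T1 -> \bar R})
          (m2 : {sigma_finite_measure set T2 -> \bar R}).

Definition product_measure : set (T1 * T2)%type -> \bar R := (m1 \x m2)%E.

HB.instance Definition _ := Measure.on product_measure.

Lemma product_measure_sigma_finite : sigma_finite setT product_measure.
Proof.
have /sigma_finiteP[F [TF ndF Foo]] := sigma_finiteT m1.
have /sigma_finiteP[G [TG ndG Goo]] := sigma_finiteT m2.
exists (fun n => F n `*` G n).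
  rewrite -setXTT TF TG predeqE => -[x y]; split.
    move=> [/= [n _ Fnx] [k _ Gky]]; exists (maxn n k) => //; split.
    - by move: x Fnx; exact/subsetPset/ndF/leq_maxl.
    - by move: y Gky; exact/subsetPset/ndG/leq_maxr.
  by move=> [n _ []/= ? ?]; split; exists n.
move=> k; have [mF Fk] := Foo k; have [mG Gk] := Goo k.
split; first exact: measurableX.
by rewrite /product_measure product_measure1E// lte_mul_pinfty// ge0_fin_numE.
Qed.

HB.instance Definition _ :=
  Measure_isSigmaFinite.Build _ _ _ product_measure product_measure_sigma_finite.

End ProductMeasure.

(* Image of a sigma-finite measure under a measurable map with a measurable left
   inverse, the latter being only needed for sigma-finiteness. *)
Section Transport.
Context d1 d2 (T1 : measurableType d1) (T2 : measurableType d2) (R : realType).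
Variables (mu : {sigma_finite_measure set T1 -> \bar R}) (f : {mfun T1 >-> T2}).
Variables (g : {mfun T2 >-> T1}) (fK : cancel f g).

Definition transport (_ : cancel f g) : set T2 -> \bar R := pushforward mu f.

Let mf : measurable_fun setT f. Proof. exact: measurable_funP. Qed.

Lemma transport0 : transport fK set0 = 0%E.
Proof. by rewrite /transport /pushforward preimage_set0 measure0. Qed.

Lemma transport_ge0 A : (0 <= transport fK A)%E.
Proof. exact: measure_ge0. Qed.

Lemma transport_sigma_additive : semi_sigma_additive (transport fK).
Proof.
move=> F mF tF mUF; rewrite /transport /pushforward preimage_bigcup.
apply: measure_semi_sigma_additive.
- by move=> n; rewrite -[X in measurable X]setTI; exact: mf.
- apply/trivIsetP => /= i j _ _ ij; rewrite -preimage_setI.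
  by move/trivIsetP : tF => /(_ _ _ _ _ ij) ->//; rewrite preimage_set0.
- by rewrite -preimage_bigcup -[X in measurable X]setTI; exact: mf.
Qed.

HB.instance Definition _ := isMeasure.Build _ _ _
  (transport fK) transport0 transport_ge0 transport_sigma_additive.

Lemma transport_sigma_finite : sigma_finite setT (transport fK).
Proof.
have [F covF mF] := sigma_finiteT mu.
exists (fun k => g @^-1` F k); first by rewrite -preimage_bigcup -covF preimage_setT.
move=> k; have [mFk fFk] := mF k; split.
  by rewrite -[X in measurable X]setTI; exact: measurable_funP.
rewrite /transport /pushforward -comp_preimage (_ : g \o f = id)//.
by apply/funext => x /=; rewrite fK.
Qed.

HB.instance Definition _ :=
  Measure_isSigmaFinite.Build _ _ _ (transport fK) transport_sigma_finite.

End Transport.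

Section Lebesgue.
Variable R : realType.

Definition plane_lebesgue : {sigma_finite_measure set (plane R) -> \bar R} :=
  product_measure (@lebesgue_measure R) (@lebesgue_measure R).

Definition cons_config n (c : (plane R * config R n)%type) : config R n.+1 :=
  [tuple of c.1 :: c.2].
Definition uncons_config n (x : config R n.+1) : (plane R * config R n)%type :=
  (tnth x ord0, [tuple of behead x]).

Lemma cons_configK n : cancel (@cons_config n) (@uncons_config n).
Proof. by case=> a x; congr pair; apply: val_inj. Qed.

Lemma measurable_cons_config n : measurable_fun setT (@cons_config n).
Proof. exact: measurable_cons. Qed.

Lemma measurable_uncons_config n : measurable_fun setT (@uncons_config n).
Proof.
by apply/measurable_fun_pair; [exact: measurable_tnth|exact: measurable_behead].
Qed.

HB.instance Definition _ n :=
  isMeasurableFun.Build _ _ _ _ (@cons_config n) (@measurable_cons_config n).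
HB.instance Definition _ n :=
  isMeasurableFun.Build _ _ _ _ (@uncons_config n) (@measurable_uncons_config n).

(* Lebesgue measure on R^{2n}. *)
Fixpoint lebesgue (n : nat) : {sigma_finite_measure set (config R n) -> \bar R} :=
  match n with
  | 0 => \d_ ([tuple] : config R 0)
  | m.+1 => transport (product_measure plane_lebesgue (lebesgue m)) (@cons_configK m)
  end.

End Lebesgue.
Arguments plane_lebesgue {R}.
Arguments lebesgue {R}.

Section PlaneGeometry.
Variable R : realType.
Implicit Types a b : plane R.

Definition add2 a b : plane R := ((a.1 : R) + b.1, (a.2 : R) + b.2).
Definition sub2 a b : plane R := ((a.1 : R) - b.1, (a.2 : R) - b.2).
Definition half2 a : plane R := ((a.1 : R) / 2, (a.2 : R) / 2).
Definition dot2 a b : R := (a.1 : R) * b.1 + (a.2 : R) * b.2.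
Definition sqn2 a : R := dot2 a a.

(* Euclidean norm: the canonical norm of R * R is the max norm. *)
Definition norm2 a : R := Num.sqrt (sqn2 a).

Definition dot n (x y : config R n) : R := \sum_(k < n) dot2 (tnth x k) (tnth y k).
Definition sqn n (x : config R n) : R := \sum_(k < n) sqn2 (tnth x k).

(* The k-th component, counted from 0; (0, 0) when k is out of range. *)
Definition component n (x : config R n) (k : nat) : plane R := nth ((0 : R), (0 : R)) x k.

End PlaneGeometry.

Section Constants.
Variable R : realType.
Implicit Types phi : R * R -> R.

Definition smooth phi :=
  forall (vs : seq (R * R)) (x : R * R),
    differentiable (foldr (fun v (g : R * R -> R) => 'D_v g) phi vs) x.

Definition mollifier phi :=
  [/\ smooth phi, compact (closure [set x | phi x != 0]), (forall x, 0 <= phi x)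
    & (\int[plane_lebesgue]_x (phi x)%:E = 1)%E].

Definition Phi phi (x : R * R) : R :=
  Rintegral plane_lebesgue setT (fun y => phi (add2 x y) * phi y).

Definition beta_Phi phi : R :=
  Rintegral (product_measure plane_lebesgue plane_lebesgue) setT
    (fun p => Phi phi p.1 * ln (norm2 (sub2 p.1 p.2)) * Phi phi p.2).

Definition gamma_EM : R :=
  limn (fun N : nat => \sum_(1 <= k < N.+1) k%:R^-1 - ln (N%:R : R)).

Definition beta_star phi (beta_fine : R) : R :=
  2 * (ln 2 + beta_fine - beta_Phi phi - gamma_EM).

End Constants.

Section Complex.
Variable R : realType.
Local Notation C := R[i].

Definition cabs (w : C) : R := Normc.normc w.

Definition cexpi (t : R) : C := Complex (cos t) (sin t).

(* Principal argument, in ]-pi, pi]. *)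
Definition carg (w : C) : R :=
  let t := acos (complex.Re w / cabs w) in if complex.Im w < 0 then - t else t.

Definition clog (w : C) : C := Complex (ln (cabs w)) (carg w).

Definition cmeasurable d (T : measurableType d) (f : T -> C) :=
  measurable_fun setT (fun x => complex.Re (f x)) /\
  measurable_fun setT (fun x => complex.Im (f x)).

Definition cintegral d (T : measurableType d) (mu : {measure set T -> \bar R})
    (f : T -> C) : C :=
  Complex (Rintegral mu setT (fun x => complex.Re (f x)))
          (Rintegral mu setT (fun x => complex.Im (f x))).

End Complex.

Section LebesgueSpaces.
Variable R : realType.
Local Notation C := R[i].

Definition cfun n := config R n -> C.

(* Borel measurable version of f; Lebesgue measure is not completed here. *)
Definition version n (w f : cfun n) :=
  cmeasurable w /\ {ae lebesgue n, forall x, w x = f x}.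

Definition Lp_norm n (p : R) (f : cfun n) : \bar R :=
  'N[lebesgue n]_(p%:E)[(fun x => (cabs (f x))%:E)].

Definition Lp n (p : R) (f : cfun n) := cmeasurable f /\ (Lp_norm p f < +oo)%E.
Definition L2 n (f : cfun n) := Lp 2 f.

Definition permute n (s : 'S_n) (x : config R n) : config R n :=
  [tuple tnth x (s k) | k < n].

Definition L2sym n (u : cfun n) :=
  L2 u /\ forall s : 'S_n, {ae lebesgue n, forall x, u x = u (permute s x)}.

Definition fourier_integral n (f : cfun n) : cfun n := fun q =>
  ((2 * pi) ^- n)%:C%C * cintegral (lebesgue n) (fun y => cexpi (- dot y q) * f y).

(* The Fourier-Plancherel transform: the extension of [fourier_integral] from the
   integrable elements of L^2 to L^2 by L^2-continuity, as a graph. *)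
Definition fourier n (f g : cfun n) :=
  [/\ L2 f, L2 g & exists fk : nat -> cfun n,
    [/\ forall k, Lp 1 (fk k) /\ L2 (fk k),
        Lp_norm 2 (fun x => fk k x - f x) @[k --> \oo] --> 0%E
      & Lp_norm 2 (fun q => fourier_integral (fk k) q - g q) @[k --> \oo] --> 0%E]].

(* Fourier transforms of the elements of H^a(R^{2n}). *)
Definition sobolev n (a : R) (h : cfun n) :=
  L2 (fun p => ((1 + sqn p) `^ (a / 2))%:C%C * h p).

End LebesgueSpaces.

(* Possibly unbounded, partially defined operators, as graphs: [A u w] means that
   u is in the domain of A and that w is a version of A u. *)
Section Operators.
Variable R : realType.
Local Notation C := R[i].

Definition op m n := cfun R m -> cfun R n -> Prop.

Definition op_id n : op n n := fun u w => cmeasurable u /\ version w u.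

Definition op_comp l m n (A : op m n) (B : op l m) : op l n :=
  fun u w => exists2 v, B u v & A v w.

Definition op_inv m n (A : op m n) : op n m := fun u w => A w u.

Definition op_add m n (A B : op m n) : op m n := fun u w =>
  exists a b, [/\ A u a, B u b & version w (fun x => a x + b x)].

Definition op_scale m n (c : C) (A : op m n) : op m n := fun u w =>
  exists2 a, A u a & version w (fun x => c * a x).

Definition op_sub m n (A B : op m n) : op m n := op_add A (op_scale (-1) B).

Definition op_sum m n (I : finType) (P : pred I) (A : I -> op m n) : op m n :=
  fun u w => exists2 a : I -> cfun R n,
    (forall i, P i -> A i u (a i)) & version w (fun x => \sum_(i | P i) a i x).

(* The operator L^2(R^{2m}) -> L^2(R^{2n}) that A represents in Fourier variables. *)
Definition unhat m n (A : op m n) : op m n := fun u w =>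
  exists uh wh, [/\ fourier u uh, A uh wh & fourier w wh].

(* Operator norm L^2 -> L^2. *)
Definition op_norm m n (A : op m n) : \bar R :=
  ereal_sup [set y : \bar R | exists u w,
    [/\ L2 u, (Lp_norm 2 u <= 1)%E, A u w & y = Lp_norm 2 w]].

(* A is (the graph of) an everywhere defined bounded linear operator
   L^2(R^{2m}) -> L^2(R^{2n}). *)
Definition bounded_operator m n (A : op m n) :=
  [/\ forall u w, A u w -> L2 u /\ L2 w,
      forall u, L2 u -> exists w, A u w,
      forall u w w', A u w -> (A u w' <-> version w' w),
      forall (c : C) u u' w w', A u w -> A u' w' ->
        A (fun x => c * u x + u' x) (fun x => c * w x + w' x)
    & (op_norm A < +oo)%E].

End Operators.

(* All the operators below are given in Fourier variables.  A tempered
   distribution whose Fourier transform is a function, such as an element of some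
   H^a, is represented by that transform; [unhat] gets back to L^2. *)
Section Model.
Variables (R : realType) (n : nat).
Local Notation C := R[i].
Local Notation pair := ('I_n * 'I_n)%type.
Implicit Types (e : pair) (z : C) (beta : R).

(* The indices other than i and j, in order. *)
Definition others e : seq 'I_n := [seq k <- enum 'I_n | (k != e.1) && (k != e.2)].

(* The components (q_2, ..., q_n) of a point of R^{2n-2} are numbered from 0. *)
Definition split_pair e (q1 : plane R) (q : config R n.-1) : config R n :=
  [tuple if k == e.1 then add2 (half2 (component q 0)) q1
         else if k == e.2 then sub2 (half2 (component q 0)) q1
         else component q (index k (others e)).+1 | k < n].

Definition merge_pair e (p : config R n) : config R n.-1 :=
  [tuple nth ((0 : R), (0 : R))
     (add2 (tnth p e.1) (tnth p e.2) :: [seq tnth p k | k <- others e]) k | k < n.-1].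

(* S_ij, the restriction to x_i = x_j, with its domain. *)
Definition trace e : op R n n.-1 := fun f g =>
  [/\ L2 f,
      ('N[lebesgue n.-1]_(2%:E)[(fun q =>
         \int[plane_lebesgue]_q1 (cabs (f (split_pair e q1 q)))%:E)] < +oo)%E
    & version g (fun q => ((2 * pi)^-1)%:C%C *
         cintegral plane_lebesgue (fun q1 => f (split_pair e q1 q)))].

(* S_ij^*, with values in H^a for every a < -1. *)
Definition trace_adj e : op R n.-1 n := fun g h =>
  L2 g /\ version h (fun p => ((2 * pi)^-1)%:C%C * g (merge_pair e p)).

(* - 1/2 sum_i nabla_i^2, on the union of the Sobolev spaces H^a. *)
Definition free_hamiltonian : op R n n := fun u w =>
  (exists a : R, sobolev a u /\ sobolev a w) /\
  version w (fun p => (sqn p / 2)%:C%C * u p).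

(* G_z, extended from L^2 to the union of the H^a, as needed after S_ij^*. *)
Definition green z : op R n n :=
  op_inv (op_sub free_hamiltonian (op_scale z (@op_id R n))).

(* |p|^2_{2-n} *)
Definition sqn_merged (p : config R n.-1) : R :=
  sqn2 (component p 0) / 2 + \sum_(k < n.-1 | (0 < k)%N) sqn2 (tnth p k).

(* J_z *)
Definition log_op z : op R n.-1 n.-1 := fun v w =>
  [/\ L2 v, L2 (fun p => v p * (ln (sqn_merged p + 1))%:C%C)
    & version w (fun p => clog ((sqn_merged p / 2)%:C%C - z) * v p)].

(* J_z - beta I *)
Definition shifted_log z beta : op R n.-1 n.-1 :=
  op_sub (log_op z) (op_scale (beta%:C%C) (@op_id R n.-1)).

(* 4 pi (J_z - beta I)^{-1} *)
Definition propagator z beta : op R n.-1 n.-1 :=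
  op_scale ((4 * pi)%:C%C) (op_inv (shifted_log z beta)).

Definition ordered_pair : pred pair := fun e => (e.1 < e.2)%N.

Definition dgm (d : seq pair) : bool :=
  all ordered_pair d && sorted (fun e e' => e != e') d.

(* The summand of R_z attached to the diagram e :: d. *)
Definition diagram_op z beta e (d : seq pair) : op R n n :=
  op_comp (op_comp (op_comp (green z) (trace_adj e)) (propagator z beta))
    (op_comp
      (foldr (@op_comp R n.-1 n.-1 n.-1) (@op_id R n.-1)
        [seq op_comp (op_comp (op_comp (trace s.1) (green z)) (trace_adj s.2))
               (propagator z beta) | s <- zip (e :: d) d])
      (op_comp (trace (last e d)) (green z))).

(* The sum over Dgm(n, m.+1), as an operator on L^2. *)
Definition diagram_sum z beta m : op R n n :=
  op_sum (fun d : m.+1.-tuple pair => dgm d)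
    (fun d => unhat (diagram_op z beta (thead d) (behead d))).

(* G_z plus the sums over Dgm(n, 1), ..., Dgm(n, M), as an operator on L^2. *)
Definition resolvent_partial_sum z beta M : op R n n :=
  op_add (unhat (green z)) (op_sum xpredT (fun m : 'I_M => diagram_sum z beta m)).

Definition pair_average : C := 2%:R / (n * n.-1)%N%:R.

(* (4 pi)^{-1} (J_z - beta I)
   - 2 / (n (n - 1)) sum_{(i < j) <> (k < l)} S_ij G_z S_kl^* *)
Definition sym_kernel z beta : op R n.-1 n.-1 :=
  op_sub (op_scale ((4 * pi)^-1)%:C%C (shifted_log z beta))
    (op_scale pair_average
      (op_sum (fun s : pair * pair =>
                 [&& ordered_pair s.1, ordered_pair s.2 & s.1 != s.2])
        (fun s => op_comp (op_comp (trace s.1) (green z)) (trace_adj s.2)))).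

Definition resolvent_sym z beta : op R n n :=
  op_add (green z)
    (op_scale pair_average
      (op_comp
        (op_comp (op_sum ordered_pair (fun e => op_comp (green z) (trace_adj e)))
                 (op_inv (sym_kernel z beta)))
        (op_sum ordered_pair (fun e => op_comp (trace e) (green z))))).

End Model.

(* Main.v *)
From HB Require Import structures.
Require Import Defs.
From mathcomp Require Import all_boot all_order all_algebra complex all_fingroup.
From mathcomp Require Import all_classical all_reals all_analysis.
From mathcomp Require Import measurable_realfun ring lra.
Import Order.TTheory GRing.Theory Num.Theory.
Import numFieldNormedType.Exports.
Local Open Scope classical_set_scope.
Local Open Scope ring_scope.
Local Arguments cabs : simpl never.

(** Everything is done in Fourier variables, where the Green operator and the
    propagator are multipliers, S*_ij lifts a function of the merged momentum
    and S_ij integrates over the relative momentum. The dictionary is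
    Plancherel's theorem for configurations: damping the inversion integral by
    exp (- eps |q|_1), whose transform is a product of one-dimensional Poisson
    kernels, shows that the Fourier transform contracts the energy and
    preserves pairings with indicators of boxes, hence that it extends to an
    isometry of L^2 onto itself.

    For {i,j} <> {k,l}, S_ij G_z S*_kl is bounded by 3, whatever n and z are:
    pick a momentum a that belongs to the first pair only and a momentum b that
    belongs to the second only, and apply the Schur test with the weight
    sqrt ((|b_c| + rho) / (|a_c| + rho)) in each of the two coordinates c. If
    Re z < - exp (c + beta), then |log (|p|^2/2 - z) - beta| >= c, so the
    propagator is bounded by 4 pi / c. There are at most n^2 pairs, and with
    c = 24 pi n^2 each vertex of a diagram contributes at most
    n^2 * 3 * (4 pi / c) = 1/2: the series over diagrams is geometric.

    On a symmetric function, S_ij G_z u does not depend on the pair and is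
    symmetric in the unmerged momenta. Both properties make the sum over the
    chains ending in a fixed pair equal to a power of the kernel averaged over
    all pairs, and the series over diagrams becomes the Neumann series of the
    inverse in the symmetric resolvent. *)

(** * Complex-valued functions *)

(** Three points shape the development. Operators are graphs on functions that are not identified up
    to null sets. Each one is therefore traded for a function on representatives with an explicit
    bound ([linear_bounded]), together with a proof that the graph consists of the versions of its
    values ([represents]); sums and compositions then become a calculus of functions. Next, [trace]
    is unbounded and [trace_adj] leaves L^2. They are never bounded alone, only inside the blocks S
    G, G S* and S G S*, and whenever [trace] occurs its domain condition comes from the same
    estimate as the norm. Finally, the constant 3 comes from (x + y + t)^2 <= 3 (x^2 + y^2 + t^2)
    with t = sqrt (- Re z). The remaining one-dimensional integrals are scale invariant and do not
    see z, and dropping all momenta but a and b from the denominator removes n. *)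

Section Modulus.
Context {R : realType}.
Local Notation C := R[i].
Implicit Types (v w : C).

Lemma cabs_ge0 w : 0 <= cabs w. Proof. by case: w => a b; exact: sqrtr_ge0. Qed.
Lemma cabs0 : cabs (0 : C) = 0. Proof. exact: Normc.normc0. Qed.
Lemma cabs1 : cabs (1 : C) = 1. Proof. exact: Normc.normc1. Qed.
Lemma cabsM v w : cabs (v * w) = cabs v * cabs w. Proof. exact: Normc.normcM. Qed.
Lemma cabsV w : cabs w^-1 = (cabs w)^-1. Proof. exact: Normc.normcV. Qed.
Lemma cabsD v w : cabs (v + w) <= cabs v + cabs w. Proof. exact: le_normcD. Qed.
Lemma cabsN w : cabs (- w) = cabs w. Proof. exact: normcN. Qed.
Lemma cabsBC v w : cabs (v - w) = cabs (w - v).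
Proof. by rewrite -cabsN opprB. Qed.
Lemma cabs_eq0 w : (cabs w == 0) = (w == 0).
Proof.
by apply/eqP/eqP => [/Normc.eq0_normc//|->]; exact: cabs0.
Qed.
Lemma cabs_sqr w : cabs w ^+ 2 = complex.Re w ^+ 2 + complex.Im w ^+ 2.
Proof. by case: w => a b; rewrite /cabs/= sqr_sqrtr// addr_ge0// sqr_ge0. Qed.
Lemma cabs_real (x : R) : cabs (x%:C)%C = `|x|.
Proof. by rewrite /cabs/= expr0n/= addr0 sqrtr_sqr. Qed.
Lemma cabsJ w : cabs (conjc w) = cabs w.
Proof. by case: w => a b; rewrite /cabs/= sqrrN. Qed.
Lemma cabs_Re w : `|complex.Re w| <= cabs w.
Proof.
rewrite -(@ler_pXn2r _ 2)// ?nnegrE ?cabs_ge0//.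
by rewrite cabs_sqr real_normK ?num_real// lerDl sqr_ge0.
Qed.
Lemma cabs_Im w : `|complex.Im w| <= cabs w.
Proof.
rewrite -(@ler_pXn2r _ 2)// ?nnegrE ?cabs_ge0//.
by rewrite cabs_sqr real_normK ?num_real// lerDr sqr_ge0.
Qed.
Lemma cabs_le_ReIm w : cabs w <= `|complex.Re w| + `|complex.Im w|.
Proof.
rewrite -(@ler_pXn2r _ 2)// ?nnegrE ?cabs_ge0 ?addr_ge0//.
rewrite cabs_sqr sqrrD !real_normK ?num_real//.
by rewrite -addrA lerD2l lerDr mulrn_wge0// mulr_ge0.
Qed.
Lemma cabs_cexpi (t : R) : cabs (cexpi t) = 1.
Proof. by rewrite /cabs/= cos2Dsin2 sqrtr1. Qed.
Lemma cexpiD (s t : R) : cexpi (s + t) = cexpi s * cexpi t.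
Proof. by rewrite /cexpi cosD sinD/=; congr (Complex _ _); rewrite addrC mulrC. Qed.
Lemma cexpi0 : cexpi (0 : R) = 1.
Proof. by rewrite /cexpi cos0 sin0. Qed.
Lemma conj_cexpi (t : R) : conjc (cexpi t) = cexpi (- t).
Proof. by rewrite /cexpi/= cosN sinN. Qed.
Lemma cReD v w : complex.Re (v + w) = complex.Re v + complex.Re w.
Proof. by case: v w => ? ? []. Qed.
Lemma cImD v w : complex.Im (v + w) = complex.Im v + complex.Im w.
Proof. by case: v w => ? ? []. Qed.
Lemma cReN w : complex.Re (- w) = - complex.Re w. Proof. by case: w. Qed.
Lemma cImN w : complex.Im (- w) = - complex.Im w. Proof. by case: w. Qed.
Lemma cReM v w : complex.Re (v * w) =
  complex.Re v * complex.Re w - complex.Im v * complex.Im w.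
Proof. by case: v w => ? ? []. Qed.
Lemma cImM v w : complex.Im (v * w) =
  complex.Re v * complex.Im w + complex.Im v * complex.Re w.
Proof. by case: v w => ? ? []. Qed.
Lemma cReJ w : complex.Re (conjc w) = complex.Re w. Proof. by case: w. Qed.
Lemma cImJ w : complex.Im (conjc w) = - complex.Im w. Proof. by case: w. Qed.
Lemma cReV w : complex.Re w^-1 = complex.Re w / cabs w ^+ 2.
Proof. by rewrite cabs_sqr; case: w. Qed.
Lemma cImV w : complex.Im w^-1 = - complex.Im w / cabs w ^+ 2.
Proof. by rewrite cabs_sqr; case: w => a b; rewrite /= mulNr. Qed.
Lemma complex_eq v w :
  complex.Re v = complex.Re w -> complex.Im v = complex.Im w -> v = w.
Proof. by case: v w => ? ? [] ? ? /= -> ->. Qed.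
Lemma conj_mulE w : conjc w * w = ((cabs w ^+ 2)%:C)%C.
Proof. by rewrite cabs_sqr; case: w => a b; apply: complex_eq => /=; ring. Qed.
End Modulus.

Section ComplexMeasurable.
Context {R : realType} {d} {T : measurableType d}.
Local Notation C := R[i].
Implicit Types f g : T -> C.

Lemma cmeasurable_cst (c : C) : cmeasurable (fun _ : T => c).
Proof. by split; exact: measurable_cst. Qed.
Lemma cmeasurableD f g : cmeasurable f -> cmeasurable g ->
  cmeasurable (fun x => f x + g x).
Proof.
move=> [f1 f2] [g1 g2]; split.
  by under eq_fun do rewrite cReD; exact: measurable_funD.
by under eq_fun do rewrite cImD; exact: measurable_funD.
Qed.
Lemma cmeasurableN f : cmeasurable f -> cmeasurable (fun x => - f x).
Proof.
move=> [f1 f2]; split.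
  by under eq_fun do rewrite cReN; exact: measurable_funN.
by under eq_fun do rewrite cImN; exact: measurable_funN.
Qed.
Lemma cmeasurableB f g : cmeasurable f -> cmeasurable g ->
  cmeasurable (fun x => f x - g x).
Proof. by move=> mf mg; apply: cmeasurableD => //; exact: cmeasurableN. Qed.
Lemma cmeasurableM f g : cmeasurable f -> cmeasurable g ->
  cmeasurable (fun x => f x * g x).
Proof.
move=> [f1 f2] [g1 g2]; split.
  under eq_fun do rewrite cReM.
  by apply: measurable_funB; exact: measurable_funM.
under eq_fun do rewrite cImM.
by apply: measurable_funD; exact: measurable_funM.
Qed.
Lemma cmeasurableJ f : cmeasurable f -> cmeasurable (fun x => conjc (f x)).
Proof.
move=> [f1 f2]; split; first by under eq_fun do rewrite cReJ.
by under eq_fun do rewrite cImJ; exact: measurable_funN.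
Qed.
Lemma measurable_cabs_sqr f : cmeasurable f ->
  measurable_fun setT (fun x => cabs (f x) ^+ 2).
Proof.
move=> [f1 f2]; under eq_fun do rewrite cabs_sqr.
by apply: measurable_funD; exact: measurable_funX.
Qed.
Lemma measurable_cabs f : cmeasurable f -> measurable_fun setT (fun x => cabs (f x)).
Proof.
move=> mf; have -> : (fun x => cabs (f x)) = fun x => Num.sqrt (cabs (f x) ^+ 2).
  by apply/funext => x; rewrite sqrtr_sqr ger0_norm// cabs_ge0.
have ms : measurable_fun setT (@Num.sqrt R).
  by apply: continuous_measurable_fun => x; exact: sqrt_continuous.
by apply: (measurableT_comp ms); exact: measurable_cabs_sqr.
Qed.
(** Writing 1/f as f (f^2)^(-1) reduces the claim to the measurability of real powers of a
    nonnegative function; both sides vanish where f does. *)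
Lemma measurable_funV (f : T -> R) : measurable_fun setT f ->
  measurable_fun setT (fun x => (f x)^-1).
Proof.
move=> mf; have -> : (fun x => (f x)^-1) = fun x => f x * (f x ^+ 2) `^ (-1).
  apply/funext => x; rewrite powR_inv1 ?sqr_ge0// expr2.
  have [->|f0] := eqVneq (f x) 0; first by rewrite invr0 mul0r.
  by rewrite invfM mulrA divff// mul1r.
apply: measurable_funM => //.
by apply: (measurableT_comp (measurable_powR (-1))); exact: measurable_funX.
Qed.
Lemma cmeasurableV f : cmeasurable f -> cmeasurable (fun x => (f x)^-1).
Proof.
move=> mf; have [f1 f2] := mf; have m2 := measurable_cabs_sqr _ mf.
split.
  under eq_fun do rewrite cReV.
  by apply: measurable_funM => //; exact: measurable_funV.
under eq_fun do rewrite cImV.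
by apply: measurable_funM; [exact: measurable_funN|exact: measurable_funV].
Qed.
Lemma cmeasurable_real (f : T -> R) : measurable_fun setT f ->
  cmeasurable (fun x => (f x)%:C%C).
Proof. by move=> mf; split => //=; exact: measurable_cst. Qed.
Lemma cmeasurable_comp d' (T' : measurableType d') f (h : T' -> T) :
  cmeasurable f -> measurable_fun setT h -> cmeasurable (fun x => f (h x)).
Proof. by move=> [f1 f2] mh; split; [apply: (measurableT_comp f1)|apply: (measurableT_comp f2)]. Qed.
Lemma cmeasurable_sum (I : Type) (s : seq I) (P : pred I) (F : I -> T -> C) :
  (forall i, P i -> cmeasurable (F i)) ->
  cmeasurable (fun x => \sum_(i <- s | P i) F i x).
Proof.
move=> mF; elim: s => [|i s IH].
  by under eq_fun do rewrite big_nil; exact: cmeasurable_cst.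
case Pi : (P i); last by under eq_fun do rewrite big_cons Pi.
by under eq_fun do rewrite big_cons Pi; apply: cmeasurableD => //; exact: mF.
Qed.
Lemma cmeasurable_cexpi (f : T -> R) : measurable_fun setT f ->
  cmeasurable (fun x => cexpi (f x)).
Proof.
move=> mf; split.
  apply: (measurableT_comp _ mf); apply: continuous_measurable_fun.
  exact: continuous_cos.
apply: (measurableT_comp _ mf); apply: continuous_measurable_fun.
exact: continuous_sin.
Qed.
End ComplexMeasurable.

Section ComplexIntegral.
Context {R : realType} {d} {T : measurableType d}.
Variable mu : {measure set T -> \bar R}.
Local Notation C := R[i].
Implicit Types f g : T -> C.

Definition cintegrable f :=
  mu.-integrable setT (fun x => (complex.Re (f x))%:E) /\
  mu.-integrable setT (fun x => (complex.Im (f x))%:E).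

Lemma cintegrable_measurable f : cintegrable f -> cmeasurable f.
Proof.
by move=> [/measurable_int/measurable_EFinP f1 /measurable_int/measurable_EFinP f2].
Qed.

Lemma measurable_cabsE f : cmeasurable f ->
  measurable_fun setT (fun x => (cabs (f x))%:E).
Proof. by move=> mf; apply/measurable_EFinP; exact: measurable_cabs. Qed.

Lemma cintegrableP f : cmeasurable f ->
  cintegrable f <-> (\int[mu]_x (cabs (f x))%:E < +oo)%E.
Proof.
move=> mf; have [f1 f2] := mf; split=> [[i1 i2]|fi].
  move: i1 i2 => /integrableP[_ i1] /integrableP[_ i2].
  apply: (@le_lt_trans _ _ (\int[mu]_x (`|(complex.Re (f x))%:E| + `|(complex.Im (f x))%:E|)%E)%E).
    apply: ge0_le_integral => //.
    - by move=> x _; rewrite lee_fin cabs_ge0.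
    - exact: measurable_cabsE.
    - by apply: emeasurable_funD; apply/measurableT_comp => //; apply/measurable_EFinP.
    - by move=> x _; rewrite -EFinD lee_fin cabs_le_ReIm.
  rewrite ge0_integralD//; first by rewrite lte_add_pinfty.
  - by apply/measurableT_comp => //; apply/measurable_EFinP.
  - by apply/measurableT_comp => //; apply/measurable_EFinP.
have h (g : T -> R) : measurable_fun setT g -> (forall x, `|g x| <= cabs (f x)) ->
    mu.-integrable setT (fun x => (g x)%:E).
  move=> mg gf; apply/integrableP; split; first exact/measurable_EFinP.
  apply: le_lt_trans fi; apply: ge0_le_integral => //.
  - by apply/measurableT_comp => //; apply/measurable_EFinP.
  - exact: measurable_cabsE.
  - by move=> x _; rewrite lee_fin.
by split; apply: h => // x; [exact: cabs_Re|exact: cabs_Im].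
Qed.

Lemma le_cintegrable f (g : T -> R) : cmeasurable f ->
  mu.-integrable setT (EFin \o g) -> (forall x, cabs (f x) <= g x) -> cintegrable f.
Proof.
move=> mf /integrableP[mg ig] fg; apply/cintegrableP => //.
apply: le_lt_trans ig; apply: ge0_le_integral => //.
- by move=> x _; rewrite lee_fin cabs_ge0.
- exact: measurable_cabsE.
- exact/measurableT_comp.
- by move=> x _; rewrite lee_fin (le_trans (fg x))// ler_norm.
Qed.

Lemma cintegrable_cabs f : cintegrable f -> mu.-integrable setT (fun x => (cabs (f x))%:E).
Proof.
move=> fi; have mf := cintegrable_measurable f fi.
apply/integrableP; split; first exact: measurable_cabsE.
under eq_integral do rewrite gee0_abs ?lee_fin ?cabs_ge0//.
by apply/cintegrableP.
Qed.

Lemma cintegrableD f g : cintegrable f -> cintegrable g ->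
  cintegrable (fun x => f x + g x).
Proof.
move=> [f1 f2] [g1 g2]; split.
  by under eq_fun do rewrite cReD EFinD; exact: integrableD.
by under eq_fun do rewrite cImD EFinD; exact: integrableD.
Qed.

Lemma cintegrableM_bounded f g (k : R) : cintegrable f -> cmeasurable g ->
  (forall x, cabs (g x) <= k) -> cintegrable (fun x => g x * f x).
Proof.
move=> fi mg gk; have mf := cintegrable_measurable f fi.
apply: (le_cintegrable _ (fun x => k * cabs (f x))).
- exact: cmeasurableM.
- apply: (eq_integrable measurableT (fun x => k%:E * (cabs (f x))%:E)%E) => //.
  by apply: integrableZl => //; exact: cintegrable_cabs.
- by move=> x; rewrite cabsM ler_wpM2r// cabs_ge0.
Qed.

Lemma cintegrableZ (c : C) f : cintegrable f -> cintegrable (fun x => c * f x).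
Proof.
move=> fi; apply: (cintegrableM_bounded _ _ (cabs c)) => //.
Qed.

Lemma cintegrableJ f : cintegrable f -> cintegrable (fun x => conjc (f x)).
Proof.
move=> [f1 f2]; split; first by under eq_fun do rewrite cReJ.
by under eq_fun do rewrite cImJ EFinN; exact: integrableN.
Qed.

Lemma cintegralD f g : cintegrable f -> cintegrable g ->
  cintegral mu (fun x => f x + g x) = cintegral mu f + cintegral mu g.
Proof.
move=> [f1 f2] [g1 g2]; rewrite /cintegral; apply: complex_eq => /=.
  rewrite -RintegralD//; apply: eq_Rintegral => x _; exact: cReD.
rewrite -RintegralD//; apply: eq_Rintegral => x _; exact: cImD.
Qed.

Lemma cintegralZ (c : C) f : cintegrable f ->
  cintegral mu (fun x => c * f x) = c * cintegral mu f.
Proof.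
move=> [f1 f2]; have Z (a : R) (g : T -> R) : mu.-integrable setT (fun x => (g x)%:E) ->
    mu.-integrable setT (fun x => (a * g x)%:E).
  by move=> ?; under eq_fun do rewrite EFinM; exact: integrableZl.
rewrite /cintegral; apply: complex_eq => /=.
  rewrite cReM/= -!RintegralZl// -RintegralB//; [|exact: Z..].
  by apply: eq_Rintegral => x _; rewrite cReM.
rewrite cImM/= -!RintegralZl// -RintegralD//; [|exact: Z..].
by apply: eq_Rintegral => x _; rewrite cImM.
Qed.

Lemma cintegralN f : cintegrable f -> cintegral mu (fun x => - f x) = - cintegral mu f.
Proof.
move=> fi; rewrite -mulN1r -cintegralZ//; congr cintegral.
by apply/funext => x; rewrite mulN1r.
Qed.

Lemma cintegralJ f : cintegrable f ->
  cintegral mu (fun x => conjc (f x)) = conjc (cintegral mu f).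
Proof.
move=> [f1 f2]; rewrite /cintegral; apply: complex_eq => /=.
  by apply: eq_Rintegral => x _; exact: cReJ.
rewrite -mulN1r -RintegralZl//; apply: eq_Rintegral => x _.
by rewrite mulN1r; exact: cImJ.
Qed.

(** A unimodular factor u turns the integral I into |I|, so that |I| is the integral of Re (u f),
    which is at most |f| pointwise. *)
Lemma cabs_cintegral f : cintegrable f ->
  ((cabs (cintegral mu f))%:E <= \int[mu]_x (cabs (f x))%:E)%E.
Proof.
move=> fi; set I := cintegral mu f.
have [->|I0] := eqVneq I 0.
  by rewrite cabs0; apply: integral_ge0 => x _; rewrite lee_fin cabs_ge0.
pose u : C := conjc I / ((cabs I)%:C)%C.
have cI0 : cabs I != 0 by rewrite cabs_eq0.
have u1 : cabs u = 1.
  by rewrite /u cabsM cabsV cabs_real cabsJ ger0_norm ?cabs_ge0// divff.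
have uI : u * I = ((cabs I)%:C)%C.
  apply: (mulIf (x := (cabs I)%:C%C)); first by rewrite -cabs_eq0 cabs_real normr_eq0.
  rewrite /u mulrAC divfK; last by rewrite -cabs_eq0 cabs_real normr_eq0.
  by rewrite conj_mulE expr2 rmorphM.
have -> : (cabs I)%:E = (\int[mu]_x (complex.Re (u * f x))%:E)%E.
  have [ui _] := cintegrableZ u _ fi.
  rewrite -[RHS]fineK; last exact: integrable_fin_num.
  by congr EFin; have := cintegralZ u _ fi; rewrite -/I uI => /(congr1 (@complex.Re R)) /=.
have [ui _] := cintegrableZ u _ fi.
apply: le_integral => //; first exact: cintegrable_cabs.
move=> x _; rewrite lee_fin (le_trans (ler_norm _))// (le_trans (cabs_Re _))//.
by rewrite cabsM u1 mul1r.
Qed.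

Lemma cintegral_ae f g : cmeasurable f -> cmeasurable g ->
  {ae mu, forall x, f x = g x} -> cintegral mu f = cintegral mu g.
Proof.
move=> [f1 f2] [g1 g2] fg; rewrite /cintegral /Rintegral; congr (Complex (fine _) (fine _)).
  apply: ae_eq_integral => //; try exact/measurable_EFinP.
  by apply: filterS fg => x fgx _; rewrite fgx.
apply: ae_eq_integral => //; try exact/measurable_EFinP.
by apply: filterS fg => x fgx _; rewrite fgx.
Qed.

Lemma eq_cintegral f g : f =1 g -> cintegral mu f = cintegral mu g.
Proof. by move=> /funext ->. Qed.

End ComplexIntegral.

Section ComplexFubini.
Context {R : realType} {d1 d2} {T1 : measurableType d1} {T2 : measurableType d2}.
Variables (m1 : {sigma_finite_measure set T1 -> \bar R}).
Variables (m2 : {sigma_finite_measure set T2 -> \bar R}).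
Local Notation C := R[i].
Implicit Types F : T1 * T2 -> C.

(** Tonelli's theorem covers nonnegative functions; the positive and negative parts are treated
    separately, which avoids any integrability assumption. *)
Lemma measurable_param_integral (f : T1 * T2 -> \bar R) : measurable_fun setT f ->
  measurable_fun setT (fun x => \int[m2]_y f (x, y))%E.
Proof.
move=> mf; have mp := measurable_funepos mf; have mn := measurable_funeneg mf.
have Hp := @measurable_fun_fubini_tonelli_F _ _ _ _ _ m2 (f^\+)%E mp (@funepos_ge0 _ _ f).
have Hn := @measurable_fun_fubini_tonelli_F _ _ _ _ _ m2 (f^\-)%E mn (@funeneg_ge0 _ _ f).
rewrite (_ : (fun x => _) = (fubini_F m2 f^\+ \- fubini_F m2 f^\-)%E).
  exact: emeasurable_funB.
apply/funext => x; rewrite integralE /fubini_F; congr (_ - _)%E.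
  by apply: eq_integral => y _; rewrite !funeposE.
by apply: eq_integral => y _; rewrite !funenegE.
Qed.

Lemma cmeasurable_param_cintegral F : cmeasurable F ->
  cmeasurable (fun x => cintegral m2 (fun y => F (x, y))).
Proof.
move=> [F1 F2]; split.
  apply: (measurableT_comp (@fine_measurable _ _ measurableT)).
  by apply: (measurable_param_integral (fun x => (complex.Re (F x))%:E)); apply/measurable_EFinP.
apply: (measurableT_comp (@fine_measurable _ _ measurableT)).
by apply: (measurable_param_integral (fun x => (complex.Im (F x))%:E)); apply/measurable_EFinP.
Qed.

Lemma cintegrable_prodP F : cmeasurable F ->
  cintegrable (m1 \x m2)%E F <->
  (\int[m1]_x \int[m2]_y (cabs (F (x, y)))%:E < +oo)%E.
Proof.
move=> mF; rewrite cintegrableP//.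
rewrite (fubini_tonelli1 (fun z => (cabs (F z))%:E))//.
  exact: measurable_cabsE.
by move=> x; rewrite lee_fin cabs_ge0.
Qed.

Lemma cfubini1 F : cintegrable (m1 \x m2)%E F ->
  cintegral (m1 \x m2)%E F = cintegral m1 (fun x => cintegral m2 (fun y => F (x, y))).
Proof.
move=> [i1 i2]; have h (g : T1 * T2 -> R) :
    (m1 \x m2)%E.-integrable setT (fun z => (g z)%:E) ->
    Rintegral (m1 \x m2)%E setT g = Rintegral m1 setT (fun x => Rintegral m2 setT (fun y => g (x, y))).
  move=> ig; rewrite /Rintegral -(integral12_prod_meas1 ig) /fubini_F.
  congr fine; apply: ae_eq_integral => //.
  - exact: (measurable_fubini_F ig).
  - apply/measurable_EFinP; apply: (measurableT_comp (@fine_measurable _ _ measurableT)).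
    exact: (measurable_fubini_F ig).
  (* [Rintegral] applies [fine], which sends an infinite inner integral to 0; almost every slice is
     integrable, so this changes nothing. *)
  - have := ae_integrable1 ig; apply: filterS => x ix _.
    by rewrite fineK//; exact: integrable_fin_num.
by rewrite /cintegral; congr Complex; exact: h.
Qed.

Lemma cfubini2 F : cintegrable (m1 \x m2)%E F ->
  cintegral (m1 \x m2)%E F = cintegral m2 (fun y => cintegral m1 (fun x => F (x, y))).
Proof.
move=> [i1 i2]; have h (g : T1 * T2 -> R) :
    (m1 \x m2)%E.-integrable setT (fun z => (g z)%:E) ->
    Rintegral (m1 \x m2)%E setT g = Rintegral m2 setT (fun y => Rintegral m1 setT (fun x => g (x, y))).
  move=> ig; rewrite /Rintegral -(integral21_prod_meas1 ig) /fubini_G.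
  congr fine; apply: ae_eq_integral => //.
  - exact: (measurable_fubini_G ig).
  - apply/measurable_EFinP; apply: (measurableT_comp (@fine_measurable _ _ measurableT)).
    exact: (measurable_fubini_G ig).
  - have := ae_integrable2 ig; apply: filterS => x ix _.
    by rewrite fineK//; exact: integrable_fin_num.
by rewrite /cintegral; congr Complex; exact: h.
Qed.

End ComplexFubini.

(** * The space L^2 *)

Section L2Norm.
Context {R : realType} {n : nat}.
Local Notation C := R[i].
Local Notation mu := (@lebesgue R n).
Local Notation N2 f := (@Lp_norm R n 2 f%R).
Implicit Types f g : cfun R n.

Definition energy f : \bar R := (\int[mu]_x (cabs (f x) ^+ 2)%:E)%E.

Lemma energy_ge0 f : (0 <= energy f)%E.
Proof. by apply: integral_ge0 => x _; rewrite lee_fin sqr_ge0. Qed.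

Lemma Lp_norm2E f : N2 f = sqrte (energy f).
Proof.
rewrite -poweR12_sqrt ?energy_ge0// /Lp_norm unlock; congr (_ `^ _)%E.
apply: eq_integral => x _ /=.
by rewrite ger0_norm ?cabs_ge0// powR_mulrn// cabs_ge0.
Qed.

Lemma Lp_norm2_ge0 f : (0 <= N2 f)%E. Proof. exact: Lnorm_ge0. Qed.
Hint Resolve Lp_norm2_ge0 energy_ge0 : core.

Lemma energy_Lp_norm2 f : energy f = (N2 f * N2 f)%E.
Proof. by rewrite Lp_norm2E -[RHS]/(sqrte (energy f) ^+ 2)%E sqr_sqrte. Qed.

Lemma Lp_norm2_le_energy f g (k : R) : 0 <= k ->
  (energy f <= (k ^+ 2)%:E * energy g)%E -> (N2 f <= k%:E * N2 g)%E.
Proof.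
move=> k0 fg; rewrite !Lp_norm2E.
have -> : (k%:E = sqrte (k ^+ 2)%:E)%E by rewrite /= sqrtr_sqr ger0_norm.
rewrite -sqrteM ?lee_fin ?sqr_ge0// lee_sqrt//.
by rewrite mule_ge0// lee_fin sqr_ge0.
Qed.

Lemma Lp_norm2_mono f g : cmeasurable f -> cmeasurable g ->
  {ae mu, forall x, cabs (f x) <= cabs (g x)} -> (N2 f <= N2 g)%E.
Proof.
move=> mf mg fg; rewrite -[leRHS]mul1e; apply: Lp_norm2_le_energy => //.
rewrite expr1n mul1e; apply: ae_ge0_le_integral => //.
- by move=> x _; rewrite lee_fin sqr_ge0.
- by apply/measurable_EFinP; exact: measurable_cabs_sqr.
- by move=> x _; rewrite lee_fin sqr_ge0.
- by apply/measurable_EFinP; exact: measurable_cabs_sqr.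
- by apply: filterS fg => x fgx _; rewrite lee_fin ler_pXn2r// nnegrE cabs_ge0.
Qed.

Lemma Lp_norm2_ae f g : cmeasurable f -> cmeasurable g ->
  {ae mu, forall x, f x = g x} -> N2 f = N2 g.
Proof.
move=> mf mg fg; apply/eqP; rewrite eq_le !Lp_norm2_mono//.
  by apply: filterS fg => x ->.
by apply: filterS fg => x ->.
Qed.

Lemma le_Lp_norm2D f g : cmeasurable f -> cmeasurable g ->
  (N2 (fun x => f x + g x) <= N2 f + N2 g)%E.
Proof.
move=> mf mg.
pose h : cfun R n := fun x => ((cabs (f x) + cabs (g x))%:C)%C.
have mh : cmeasurable h.
  by apply: cmeasurable_real; apply: measurable_funD; exact: measurable_cabs.
have fgh : (N2 (fun x => f x + g x) <= N2 h)%E.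
  apply: Lp_norm2_mono => //; first exact: cmeasurableD.
  apply: aeW => x; rewrite cabs_real ger0_norm ?addr_ge0 ?cabs_ge0//.
  exact: cabsD.
apply: (le_trans fgh).
have := @minkowski_EFin _ _ _ mu (fun x => cabs (f x)) (fun x => cabs (g x)) 2.
move=> /(_ (measurable_cabs _ mf) (measurable_cabs _ mg)); rewrite ler1n => /(_ isT).
apply: le_trans; rewrite le_eqVlt; apply/orP; left; apply/eqP.
apply: eq_Lnorm => x /=.
by rewrite /h cabs_real ger0_norm// addr_ge0// cabs_ge0.
Qed.

Lemma Lp_norm2Z (c : C) f : cmeasurable f ->
  N2 (fun x => c * f x) = ((cabs c)%:E * N2 f)%E.
Proof.
move=> mf; have e : energy (fun x => c * f x) = ((cabs c ^+ 2)%:E * energy f)%E.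
  rewrite /energy -ge0_integralZl_EFin//.
  - by apply: eq_integral => x _; rewrite cabsM exprMn.
  - by move=> x _; rewrite lee_fin sqr_ge0.
  - by apply/measurable_EFinP; exact: measurable_cabs_sqr.
  - by rewrite sqr_ge0.
apply/eqP; rewrite eq_le; apply/andP; split.
  by apply: Lp_norm2_le_energy; rewrite ?cabs_ge0// e.
have [->|c0] := eqVneq c 0; first by rewrite cabs0 mul0e.
have c1 : 0 < cabs c by rewrite lt_def cabs_eq0 c0 cabs_ge0.
rewrite muleC -lee_pdivlMr// muleC.
apply: Lp_norm2_le_energy; first by rewrite invr_ge0 cabs_ge0.
by rewrite e muleA -EFinM -exprMn mulVf ?expr1n ?mul1e// cabs_eq0.
Qed.

Lemma Lp_norm2_0 : N2 (fun=> 0) = 0%E.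
Proof.
rewrite Lp_norm2E /energy; under eq_integral do rewrite cabs0 expr0n/=.
by rewrite integral0 sqrte0.
Qed.

Lemma Lp_norm2_eq0 f : cmeasurable f -> N2 f = 0%E -> {ae mu, forall x, f x = 0}.
Proof.
move=> mf f0; have := @Lnorm_eq0_eq0 _ _ _ mu (fun x => (cabs (f x))%:E) 2%:E.
have h2 : (0 < 2%:E :> \bar R)%E by rewrite lte_fin.
move=> /(_ (measurable_cabsE _ mf) h2 f0).
by apply: filterS => x /(_ I)/= /eqP; rewrite eqe cabs_eq0 => /eqP.
Qed.

Lemma L2P f : L2 f <-> cmeasurable f /\ (energy f < +oo)%E.
Proof.
rewrite /L2 /Lp Lp_norm2E; split=> -[mf fy]; split => //.
  by rewrite -ge0_fin_numE// -sqrte_fin_num// ge0_fin_numE// sqrte_ge0.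
by rewrite -ge0_fin_numE ?sqrte_ge0// sqrte_fin_num// ge0_fin_numE.
Qed.

Lemma L2_measurable f : L2 f -> cmeasurable f. Proof. by case. Qed.

Lemma L2_cst0 : L2 ((fun=> 0) : cfun R n).
Proof. by split; [exact: cmeasurable_cst|rewrite Lp_norm2_0 ltry]. Qed.

Lemma L2_le f g (k : R) : cmeasurable f -> L2 g -> 0 <= k ->
  (N2 f <= k%:E * N2 g)%E -> L2 f.
Proof.
move=> mf [mg gy] k0 fg; split => //; apply: le_lt_trans fg _.
by apply: lte_mul_pinfty.
Qed.

Lemma L2_bounded f (k : R) : cmeasurable f -> (N2 f <= k%:E)%E -> L2 f.
Proof. by move=> mf fk; split => //; rewrite (le_lt_trans fk)// ltry. Qed.

Lemma Lp_norm2_le f g (k : R) : cmeasurable f -> cmeasurable g -> 0 <= k ->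
  {ae mu, forall x, cabs (f x) <= k * cabs (g x)} -> (N2 f <= k%:E * N2 g)%E.
Proof.
move=> mf mg k0 fg; have kE : cabs (k%:C)%C = k by rewrite cabs_real ger0_norm.
rewrite -[in leRHS]kE -Lp_norm2Z//; apply: Lp_norm2_mono => //.
  by apply: cmeasurableM => //; exact: cmeasurable_cst.
by apply: filterS fg => x; rewrite cabsM kE.
Qed.

Lemma L2_dom f g (k : R) : cmeasurable f -> L2 g -> 0 <= k ->
  {ae mu, forall x, cabs (f x) <= k * cabs (g x)} -> L2 f.
Proof.
move=> mf gL k0 fg; apply: (L2_le f g k) => //.
by apply: Lp_norm2_le => //; exact: L2_measurable.
Qed.

Lemma L2D f g : L2 f -> L2 g -> L2 (fun x => f x + g x).
Proof.
move=> [mf fy] [mg gy]; split; first exact: cmeasurableD.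
by rewrite (le_lt_trans (le_Lp_norm2D _ _ mf mg))// lte_add_pinfty.
Qed.

Lemma L2Z (c : C) f : L2 f -> L2 (fun x => c * f x).
Proof.
move=> [mf fy]; split; first by apply: cmeasurableM => //; exact: cmeasurable_cst.
by rewrite Lp_norm2Z// lte_mul_pinfty// lee_fin cabs_ge0.
Qed.

Lemma L2B f g : L2 f -> L2 g -> L2 (fun x => f x - g x).
Proof.
move=> fL gL; have := L2D _ _ fL (L2Z (-1) _ gL).
by congr L2; apply/funext => x; rewrite mulN1r.
Qed.

Lemma L2_sum (I : Type) (s : seq I) (P : pred I) (F : I -> cfun R n) :
  (forall i, P i -> L2 (F i)) -> L2 (fun x => \sum_(i <- s | P i) F i x).
Proof.
move=> LF; elim: s => [|i s IH].
  by under eq_fun do rewrite big_nil; exact: L2_cst0.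
case Pi : (P i); last by under eq_fun do rewrite big_cons Pi.
by under eq_fun do rewrite big_cons Pi; apply: L2D => //; exact: LF.
Qed.

Lemma le_Lp_norm2_sum (I : Type) (s : seq I) (P : pred I) (F : I -> cfun R n) :
  (forall i, P i -> cmeasurable (F i)) ->
  (N2 (fun x => \sum_(i <- s | P i) F i x) <= \sum_(i <- s | P i) N2 (F i))%E.
Proof.
move=> mF; elim: s => [|i s IH].
  by under eq_fun do rewrite big_nil; rewrite Lp_norm2_0 big_nil.
case Pi : (P i); last by under eq_fun do rewrite big_cons Pi; rewrite big_cons Pi.
under eq_fun do rewrite big_cons Pi; rewrite big_cons Pi.
rewrite (le_trans (le_Lp_norm2D _ _ _ _))//; first exact: mF.
  exact: cmeasurable_sum.
by rewrite leeD2l.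
Qed.

Lemma Lp_norm2N f : N2 (fun x => - f x) = N2 f.
Proof.
by rewrite !Lp_norm2E; congr sqrte; apply: eq_integral => x _; rewrite cabsN.
Qed.

Lemma Lp_norm2_J f : N2 (fun x => conjc (f x)) = N2 f.
Proof.
by rewrite !Lp_norm2E; congr sqrte; apply: eq_integral => x _; rewrite cabsJ.
Qed.

Lemma Lp_norm2BC f g : N2 (fun x => f x - g x) = N2 (fun x => g x - f x).
Proof. by rewrite -Lp_norm2N; congr (N2 _); apply/funext => x; rewrite opprB. Qed.

Lemma le_Lp_norm2B (h f g : cfun R n) : cmeasurable f -> cmeasurable g -> cmeasurable h ->
  (N2 (fun x => f x - g x) <= N2 (fun x => f x - h x) + N2 (fun x => h x - g x))%E.
Proof.
move=> mf mg mh; rewrite (le_trans _ (le_Lp_norm2D _ _ _ _))//; try exact: cmeasurableB.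
by under [in leRHS]eq_fun do rewrite addrA subrK.
Qed.

Lemma L2_conj f : L2 f -> L2 (fun x => conjc (f x)).
Proof. by move=> [mf fy]; split; [exact: cmeasurableJ|rewrite Lp_norm2_J]. Qed.

Lemma version_trans (f g h : cfun R n) : version f g -> version g h -> version f h.
Proof.
by move=> [mf fg] [mg gh]; split => //; apply: filterS2 fg gh => x -> ->.
Qed.

Lemma version_sym (f g : cfun R n) : cmeasurable g -> version f g -> version g f.
Proof. by move=> mg [mf fg]; split => //; apply: filterS fg => x ->. Qed.

Lemma version_refl f : cmeasurable f -> version f f.
Proof. by move=> mf; split => //; exact: aeW. Qed.

Lemma version_L2 f g : version g f -> L2 f -> L2 g.
Proof.
by move=> [mg gf] [mf fy]; split => //; rewrite (Lp_norm2_ae g f).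
Qed.

Lemma version_dist0 f g : cmeasurable f -> cmeasurable g ->
  N2 (fun x => f x - g x) = 0%E <-> version f g.
Proof.
move=> mf mg; split=> [fg0|[_ fg]].
  split => //; have := Lp_norm2_eq0 _ (cmeasurableB _ _ mf mg) fg0.
  by apply: filterS => x /eqP; rewrite subr_eq0 => /eqP.
rewrite -Lp_norm2_0; apply: Lp_norm2_ae; [exact: cmeasurableB|exact: cmeasurable_cst|].
by apply: filterS fg => x ->; rewrite subrr.
Qed.

Lemma version_dist_lt f g : cmeasurable f -> cmeasurable g ->
  (forall e : R, 0 < e -> (N2 (fun x => f x - g x) <= e%:E)%E) -> version f g.
Proof.
move=> mf mg h; apply/version_dist0 => //; apply/eqP; rewrite eq_le Lp_norm2_ge0 andbT.
by apply/lee_addgt0Pr => e e0; rewrite add0e; exact: h.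
Qed.

End L2Norm.

Section CauchySchwarz.
Context {R : realType} {d} {T : measurableType d}.
Variable mu : {measure set T -> \bar R}.

Lemma cauchy_schwarz (f g : T -> R) : measurable_fun setT f -> measurable_fun setT g ->
  (\int[mu]_x (`|f x| * `|g x|)%:E <=
   sqrte (\int[mu]_x (f x ^+ 2)%:E) * sqrte (\int[mu]_x (g x ^+ 2)%:E))%E.
Proof.
move=> mf mg; have h2 : (2^-1 + 2^-1 = 1 :> R) by lra.
have e (h : T -> R) : ('N[mu]_(2%:E)[EFin \o h] = sqrte (\int[mu]_x (h x ^+ 2)%:E))%E.
  rewrite -poweR12_sqrt; last by apply: integral_ge0 => x _; rewrite lee_fin sqr_ge0.
  rewrite unlock; congr (_ `^ _)%E; apply: eq_integral => x _ /=.
  by rewrite powR_mulrn// real_normK// num_real.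
have := hoelder mu mf mg (ltr0n R 2) (ltr0n R 2) h2; rewrite Lnorm1 !e; apply: le_trans.
rewrite le_eqVlt; apply/orP; left; apply/eqP; apply: eq_integral => x _ /=.
by rewrite normrM.
Qed.

End CauchySchwarz.

(** * Completeness of L^2, for series with geometrically decreasing norms *)

Section L2Series.
Context {R : realType} {n : nat}.
Local Notation C := R[i].
Local Notation mu := (@lebesgue R n).
Local Notation N2 f := (@Lp_norm R n 2 f%R).
Variable F : nat -> cfun R n.

Definition abs_partial x (L : nat) : R := \sum_(k < L) cabs (F k x).

(** The square is used because its integral is what the triangle inequality in L^2 bounds, so that
    monotone convergence applies to it directly. *)
Definition summable_at : set (config R n) :=
  [set x | limn (fun L => (abs_partial x L ^+ 2)%:E) < +oo]%E.

(* The terms are cut off outside of [summable_at] so that the limits exist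
   everywhere and are measurable. *)
Definition cut_term k x : C := if x \in summable_at then F k x else 0.

Definition L2_series x : C :=
  Complex (limn (fun L => \sum_(k < L) complex.Re (cut_term k x)))
          (limn (fun L => \sum_(k < L) complex.Im (cut_term k x))).

Hypothesis mF : forall k, cmeasurable (F k).

Lemma abs_partial_ge0 x L : 0 <= abs_partial x L.
Proof. by apply: sumr_ge0 => k _; exact: cabs_ge0. Qed.

Lemma abs_partial_nd x : nondecreasing_seq (abs_partial x).
Proof.
apply/nondecreasing_seqP => L; rewrite /abs_partial big_ord_recr/= lerDl.
exact: cabs_ge0.
Qed.

Lemma abs_partial_sqr_nd x : nondecreasing_seq (fun L => (abs_partial x L ^+ 2)%:E).
Proof.
move=> K L KL; rewrite lee_fin ler_pXn2r// ?nnegrE ?abs_partial_ge0//.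
exact: abs_partial_nd.
Qed.

Lemma measurable_abs_partial L : measurable_fun setT (abs_partial ^~ L).
Proof. by apply: measurable_sum => k; exact: measurable_cabs. Qed.

Let mlim : measurable_fun setT (fun x => limn (fun L => (abs_partial x L ^+ 2)%:E)).
Proof.
apply: (emeasurable_fun_cvg (fun L x => (abs_partial x L ^+ 2)%:E)) => [L|x _].
  by apply/measurable_EFinP; apply: measurable_funX; exact: measurable_abs_partial.
by apply: ereal_nondecreasing_is_cvgn; exact: abs_partial_sqr_nd.
Qed.

Lemma measurable_summable_at : measurable summable_at.
Proof.
rewrite -[X in measurable X]setTI; apply: emeasurable_fun_infty_o => //.
Qed.

Lemma cmeasurable_cut_term k : cmeasurable (cut_term k).
Proof.
have mb : measurable_fun setT (fun x => x \in summable_at).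
  apply: (measurable_fun_bool true); rewrite setTI.
  rewrite (_ : _ @^-1` _ = summable_at); first exact: measurable_summable_at.
  by apply/seteqP; split => x; [exact: set_mem|exact: mem_set].
have [m1 m2] := mF k.
have -> : cut_term k = fun x => Complex (if x \in summable_at then complex.Re (F k x) else 0)
    (if x \in summable_at then complex.Im (F k x) else 0).
  by apply/funext => x; rewrite /cut_term; case: ifP => //; case: (F k x).
by split; apply: measurable_fun_ifT.
Qed.

Lemma summable_at_bounded x : summable_at x -> exists B, forall L, abs_partial x L <= B.
Proof.
rewrite /summable_at/=.
have h L : ((abs_partial x L ^+ 2)%:E <= limn (fun L => (abs_partial x L ^+ 2)%:E))%E.
  have nd := abs_partial_sqr_nd x; apply: lime_ge; first exact: ereal_nondecreasing_is_cvgn.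
  by near=> K; apply: nd; near: K; exact: nbhs_infty_ge.
move: h; case: (limn _) => [r| |]// h _; last by have := h 0%N; rewrite leeNy_eq.
(* A bound on the square root of r that needs no root: r <= (r + 1)^2. *)
exists (r + 1) => L; have := h L; rewrite lee_fin => hL.
have r0 : 0 <= r by rewrite (le_trans _ hL)// sqr_ge0.
rewrite -(@ler_pXn2r _ 2)// ?nnegrE ?abs_partial_ge0 ?addr_ge0//.
by rewrite (le_trans hL)// sqrrD expr1n mulr1; have := sqr_ge0 r; lra.
Unshelve. all: by end_near. Qed.

(** [P] stands for the real or the imaginary part. On [summable_at] the moduli have bounded partial
    sums, hence absolute convergence; elsewhere every term is 0. *)
Lemma cvg_cut_term (P : C -> R) x : P 0 = 0 -> (forall w, `|P w| <= cabs w) ->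
  cvgn (fun L => \sum_(k < L) P (cut_term k x)).
Proof.
move=> P0 Pc; rewrite /cut_term; have [xS|xS] := boolP (x \in summable_at); last first.
  rewrite (_ : (fun L => _) = fun=> 0); first exact: is_cvg_cst.
  by apply/funext => L; rewrite big1.
have /summable_at_bounded[B hB] := set_mem xS.
have -> : (fun L => \sum_(k < L) P (F k x)) = series (fun k => P (F k x)).
  by apply/funext => L; rewrite /normed_series_of /series/= big_mkord.
apply: normed_cvg; rewrite (_ : [normed _] = fun L => \sum_(k < L) `|P (F k x)|); last first.
  by apply/funext => L; rewrite /normed_series_of /series/= big_mkord.
apply: nondecreasing_is_cvgn.
  by apply/nondecreasing_seqP => L; rewrite big_ord_recr/= lerDl normr_ge0.
exists B => _ [L _ <-]; rewrite (le_trans _ (hB L))//.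
by apply: ler_sum => k _; exact: Pc.
Qed.

Let cvgRe x := @cvg_cut_term (@complex.Re R) x erefl (@cabs_Re R).
Let cvgIm x := @cvg_cut_term (@complex.Im R) x erefl (@cabs_Im R).

Lemma cmeasurable_L2_series : cmeasurable L2_series.
Proof.
split.
  apply: (@measurable_fun_cvg _ _ _ setT (fun L x => \sum_(k < L) complex.Re (cut_term k x))) => [L|x _].
    by apply: measurable_sum => k; have [] := cmeasurable_cut_term k.
  exact: cvgRe.
apply: (@measurable_fun_cvg _ _ _ setT (fun L x => \sum_(k < L) complex.Im (cut_term k x))) => [L|x _].
  by apply: measurable_sum => k; have [] := cmeasurable_cut_term k.
exact: cvgIm.
Qed.

Variable c : R.
Hypothesis NF : forall k, (N2 (F k) <= (c * 2^-1 ^+ k)%:E)%E.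

Let c0 : 0 <= c.
Proof. by have := le_trans (Lp_norm2_ge0 (F 0%N)) (NF 0%N); rewrite expr0 mulr1 lee_fin. Qed.

Lemma geometric_tail M L : \sum_(M <= k < L) c * 2^-1 ^+ k <= c * 2 * 2^-1 ^+ M.
Proof.
have h K : \sum_(0 <= k < K) c * 2^-1 ^+ (M + k) = c * 2 * 2^-1 ^+ M * (1 - 2^-1 ^+ K).
  elim: K => [|K IH]; first by rewrite big_nil expr0 subrr mulr0.
  by rewrite big_nat_recr//= IH exprD exprS; field.
have [ML|LM] := leqP M L; last first.
  by rewrite big_geq ?(ltnW LM)// !mulr_ge0// exprn_ge0.
rewrite -{1}[M]add0n big_addn; under eq_bigr do rewrite addnC.
rewrite h ler_piMr ?mulr_ge0 ?exprn_ge0// lerBlDr lerDl exprn_ge0//.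
Qed.

Lemma Lp_norm2_block M L :
  (N2 (fun x => \sum_(M <= k < L) F k x) <= (c * 2 * 2^-1 ^+ M)%:E)%E.
Proof.
rewrite (le_trans (le_Lp_norm2_sum _ _ _ _ _))//.
rewrite (le_trans (lee_sum _ (fun k _ => NF k)))//.
by rewrite sumEFin lee_fin geometric_tail.
Qed.

(** Beppo Levi's argument: the squared partial sums increase, their integrals stay below (2 c)^2 by
    the triangle inequality and the geometric sum, and an integrable limit is finite almost
    everywhere. *)
Lemma ae_summable_at : {ae mu, forall x, x \in summable_at}.
Proof.
have iI : (\int[mu]_x limn (fun L => (abs_partial x L ^+ 2)%:E) < +oo)%E.
  rewrite monotone_convergence//; first last.
  - by move=> x _; exact: abs_partial_sqr_nd.
  - by move=> L x _; rewrite lee_fin sqr_ge0.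
  - by move=> L; apply/measurable_EFinP; apply: measurable_funX; exact: measurable_abs_partial.
  apply: (@le_lt_trans _ _ ((c * 2) ^+ 2)%:E); last exact: ltry.
  apply: lime_le.
    apply: ereal_nondecreasing_is_cvgn => K L KL; apply: ge0_le_integral => //.
    - by move=> x _; rewrite lee_fin sqr_ge0.
    - by apply/measurable_EFinP; apply: measurable_funX; exact: measurable_abs_partial.
    - by apply/measurable_EFinP; apply: measurable_funX; exact: measurable_abs_partial.
    - by move=> x _; exact: abs_partial_sqr_nd.
  apply: nearW => L.
  pose G k : cfun R n := fun x => ((cabs (F k x))%:C)%C.
  have mG k : cmeasurable (G k) by apply: cmeasurable_real; exact: measurable_cabs.
  have NG : (N2 (fun x => \sum_(k < L) G k x) <= (c * 2)%:E)%E.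
    rewrite (le_trans (le_Lp_norm2_sum _ _ _ _ _))//.
    apply: (@le_trans _ _ (\sum_(k < L) (c * 2^-1 ^+ k)%:E)%E).
      apply: lee_sum => k _; rewrite (le_trans _ (NF _))//; apply: Lp_norm2_mono => //.
      by apply: aeW => x; rewrite /G cabs_real ger0_norm// cabs_ge0.
    rewrite sumEFin lee_fin -(big_mkord xpredT (fun k => c * 2^-1 ^+ k)).
    by rewrite (le_trans (geometric_tail 0 L))// expr0 mulr1.
  have -> : (\int[mu]_x (abs_partial x L ^+ 2)%:E = energy (fun x => \sum_(k < L) G k x)%R)%E.
    apply: eq_integral => x _; congr EFin; congr (_ ^+ 2).
    by rewrite /G -rmorph_sum cabs_real ger0_norm// abs_partial_ge0.
  by rewrite energy_Lp_norm2 expr2 EFinM; apply: (lee_pmul _ _ NG NG); exact: Lp_norm2_ge0.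
have il : mu.-integrable setT (fun x => limn (fun L => (abs_partial x L ^+ 2)%:E)).
  apply/integrableP; split; first exact: mlim.
  rewrite (eq_integral (fun x => limn (fun L => (abs_partial x L ^+ 2)%:E)))//.
  move=> x _; rewrite gee0_abs//; apply: lime_ge.
    by apply: ereal_nondecreasing_is_cvgn; exact: abs_partial_sqr_nd.
  by apply: nearW => L; rewrite lee_fin sqr_ge0.
have := integrable_ae measurableT il; apply: filterS => x /(_ I) fx.
rewrite inE /summable_at/=; move: fx; case: (limn _) => // r _; exact: ltry.
Qed.

Lemma limn_einf_le (u : nat -> \bar R) (B : \bar R) M :
  (forall L, (M <= L)%N -> (u L <= B)%E) -> (limn_einf u <= B)%E.
Proof.
move=> uB; rewrite limn_einf_lim; apply: lime_le; first exact: is_cvg_einfs.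
near=> L; apply: (@le_trans _ _ (u L)); last by apply: uB; near: L; exact: nbhs_infty_ge.
by apply: ereal_inf_lbound; exists L => /=.
Unshelve. all: by end_near. Qed.

(** Almost everywhere the cut terms are the original ones, so a difference of two partial sums is a
    block, bounded in norm by [Lp_norm2_block]. Letting the upper index tend to infinity, Fatou's
    lemma carries this bound to the pointwise limit. *)
Lemma L2_series_dist M :
  (N2 (fun x => L2_series x - \sum_(k < M) F k x) <= (c * 2 * 2^-1 ^+ M)%:E)%E.
Proof.
have mS := cmeasurable_L2_series.
have mcut L : cmeasurable (fun x => \sum_(k < L) cut_term k x).
  by apply: cmeasurable_sum => k _; exact: cmeasurable_cut_term.
have mFs L : cmeasurable (fun x => \sum_(k < L) F k x) by exact: cmeasurable_sum.
have cutE : {ae mu, forall x, forall L, \sum_(k < L) F k x = \sum_(k < L) cut_term k x}.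
  by have := ae_summable_at; apply: filterS => x xS L; apply: eq_bigr => k _;
    rewrite /cut_term xS.
pose D L : cfun R n := fun x => \sum_(k < L) cut_term k x - \sum_(k < M) cut_term k x.
have mD L : cmeasurable (D L) by exact: cmeasurableB.
set e := c * 2 * 2^-1 ^+ M; have e0 : 0 <= e by rewrite !mulr_ge0// exprn_ge0.
rewrite (Lp_norm2_ae _ (fun x => L2_series x - \sum_(k < M) cut_term k x)); first last.
- by apply: filterS cutE => x ->.
- exact: cmeasurableB.
- exact: cmeasurableB.
suff h : (energy (fun x => L2_series x - \sum_(k < M) cut_term k x)%R <= (e ^+ 2)%:E)%E.
  rewrite Lp_norm2E.
  have -> : (e%:E = sqrte (e ^+ 2)%:E)%E by rewrite /= sqrtr_sqr ger0_norm.
  by rewrite lee_sqrt// lee_fin sqr_ge0.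
have cvD x : ((cabs (D L x) ^+ 2)%:E @[L --> \oo] -->
     (cabs (L2_series x - \sum_(k < M) cut_term k x) ^+ 2)%:E)%E.
  apply: cvg_EFin; first exact: nearW.
  rewrite cabs_sqr cReD cImD cReN cImN.
  have -> : fine \o (fun L => (cabs (D L x) ^+ 2)%:E) = fun L =>
     (\sum_(k < L) complex.Re (cut_term k x) - complex.Re (\sum_(k < M) cut_term k x)) ^+ 2 +
     (\sum_(k < L) complex.Im (cut_term k x) - complex.Im (\sum_(k < M) cut_term k x)) ^+ 2.
    apply/funext => L /=; rewrite cabs_sqr /D cReD cImD cReN cImN.
    have e1 K : complex.Re (\sum_(k < K) cut_term k x) = \sum_(k < K) complex.Re (cut_term k x).
      by rewrite (big_morph (@complex.Re R) (@cReD R) erefl).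
    have e2 K : complex.Im (\sum_(k < K) cut_term k x) = \sum_(k < K) complex.Im (cut_term k x).
      by rewrite (big_morph (@complex.Im R) (@cImD R) erefl).
    by rewrite !e1 !e2.
  apply: cvgD.
    by apply: cvgM; apply: cvgB; try exact: cvg_cst; exact: cvgRe.
  by apply: cvgM; apply: cvgB; try exact: cvg_cst; exact: cvgIm.
have -> : energy (fun x => L2_series x - \sum_(k < M) cut_term k x) =
   (\int[mu]_x limn_einf (fun L => (cabs (D L x) ^+ 2)%:E))%E.
  apply: eq_integral => x _.
  by have /cvg_limn_einf_sup[-> _] := cvD x.
apply: (le_trans (fatou _ _ _ _)) => //.
- by move=> L; apply/measurable_EFinP; exact: measurable_cabs_sqr.
- by move=> L x _; rewrite lee_fin sqr_ge0.
apply: (limn_einf_le _ _ M) => L ML.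
have : (N2 (D L) <= e%:E)%E.
  rewrite (Lp_norm2_ae _ (fun x => \sum_(M <= k < L) F k x)).
  - exact: Lp_norm2_block.
  - exact: mD.
  - exact: cmeasurable_sum.
  - apply: filterS cutE => x xE; rewrite /D -!xE -!(big_mkord xpredT (fun k => F k x)).
    by rewrite (@big_cat_nat _ _ _ M 0 L)//= addrAC subrr add0r.
have -> : (\int[mu]_x (cabs (D L x) ^+ 2)%:E = energy (D L))%E by [].
by rewrite energy_Lp_norm2 expr2 EFinM => h; apply: (lee_pmul _ _ h h); exact: Lp_norm2_ge0.
Qed.

Lemma L2_series_L2 : L2 L2_series.
Proof.
apply: (L2_bounded _ (c * 2)); first exact: cmeasurable_L2_series.
have := L2_series_dist 0; rewrite expr0 mulr1.
by under eq_fun do rewrite big_ord0 subr0.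
Qed.

End L2Series.

(** * Measure-preserving changes of variables *)

Section MeasurePreserving.
Context {R : realType} {d1 d2} {T1 : measurableType d1} {T2 : measurableType d2}.
Variables (m1 : {measure set T1 -> \bar R}) (m2 : {measure set T2 -> \bar R}).

Definition preserves (phi : T1 -> T2) :=
  measurable_fun setT phi /\ forall A, measurable A -> m2 A = m1 (phi @^-1` A).

Variable phi : T1 -> T2.
Hypothesis Hphi : preserves phi.

Lemma ge0_integral_preserves (f : T2 -> \bar R) : measurable_fun setT f ->
  (forall y, 0 <= f y)%E -> (\int[m2]_y f y = \int[m1]_x f (phi x))%E.
Proof.
move=> mf f0; have [mphi H] := Hphi.
rewrite (eq_measure_integral (pushforward m1 phi))//; last by move=> A mA _; exact: H.
by rewrite (ge0_integral_pushforward mphi)// preimage_setT.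
Qed.

Lemma integral_preserves (f : T2 -> \bar R) : measurable_fun setT f ->
  (\int[m2]_y f y = \int[m1]_x f (phi x))%E.
Proof.
move=> mf; rewrite integralE [RHS]integralE; congr (_ - _)%E.
  rewrite ge0_integral_preserves//; last exact: measurable_funepos.
  by apply: eq_integral => x _; rewrite !funeposE.
rewrite ge0_integral_preserves//; last exact: measurable_funeneg.
by apply: eq_integral => x _; rewrite !funenegE.
Qed.

Lemma cintegral_preserves (f : T2 -> R[i]) : cmeasurable f ->
  cintegral m2 f = cintegral m1 (fun x => f (phi x)).
Proof.
move=> [f1 f2]; rewrite /cintegral/Rintegral; congr (Complex (fine _) (fine _)).
  by rewrite (integral_preserves (fun y => (complex.Re (f y))%:E))//; exact/measurable_EFinP.
by rewrite (integral_preserves (fun y => (complex.Im (f y))%:E))//; exact/measurable_EFinP.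
Qed.

Lemma cintegrable_preserves (f : T2 -> R[i]) : cmeasurable f ->
  cintegrable m2 f <-> cintegrable m1 (fun x => f (phi x)).
Proof.
move=> mf; have [mphi _] := Hphi; rewrite !cintegrableP//.
  rewrite ge0_integral_preserves//; first exact: measurable_cabsE.
  by move=> y; rewrite lee_fin cabs_ge0.
exact: cmeasurable_comp.
Qed.

End MeasurePreserving.

Lemma preserves_comp {R : realType} {d1 d2 d3} {T1 : measurableType d1}
    {T2 : measurableType d2} {T3 : measurableType d3}
    (m1 : {measure set T1 -> \bar R}) (m2 : {measure set T2 -> \bar R})
    (m3 : {measure set T3 -> \bar R}) (f : T1 -> T2) (g : T2 -> T3) :
  preserves m1 m2 f -> preserves m2 m3 g -> preserves m1 m3 (g \o f).
Proof.
move=> [mf Hf] [mg Hg]; split; first exact: measurableT_comp.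
move=> A mA; rewrite Hg// Hf//.
by rewrite -[X in measurable X]setTI; exact: mg.
Qed.

Lemma preserves_integral {R : realType} {d1 d2} {T1 : measurableType d1}
    {T2 : measurableType d2}
    (m1 : {measure set T1 -> \bar R}) (m2 : {measure set T2 -> \bar R}) (phi : T1 -> T2) :
  measurable_fun setT phi ->
  (forall f : T2 -> \bar R, measurable_fun setT f -> (forall y, 0 <= f y)%E ->
    (\int[m2]_y f y = \int[m1]_x f (phi x))%E) ->
  preserves m1 m2 phi.
Proof.
move=> mphi H; split => // A mA.
have := H (fun y => (\1_A y)%:E); rewrite integral_indic// setIT.
rewrite (_ : (fun x => (\1_A (phi x))%:E) = (fun x => (\1_(phi @^-1` A) x)%:E))//.
rewrite integral_indic//; last by rewrite -[X in measurable X]setTI; exact: mphi.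
rewrite setIT; apply => //; first by apply/measurable_EFinP; exact: measurable_indic.
Qed.

Section LineGeometry.
Context {R : realType}.
Local Notation leb := (@lebesgue_measure R).

Lemma preserves_opp : preserves leb leb (-%R : measurableTypeR R -> measurableTypeR R).
Proof.
split; first exact: oppr_measurable.
by move=> A mA; rewrite -[RHS]/(pushforward leb _ A) lebesgue_measureN.
Qed.

Lemma preserves_shift (c : R) :
  preserves leb leb (fun x : measurableTypeR R => x + c : measurableTypeR R).
Proof.
have ms : measurable_fun [set: measurableTypeR R] (fun x : measurableTypeR R => x + c : measurableTypeR R).
  by apply: measurable_funD => //; exact: measurable_cst.
split=> // A mA; rewrite -[RHS]/(pushforward leb _ A).
apply: lebesgue_measure_unique => //= _ [[a b]] _ <-.
rewrite /pushforward (_ : _ @^-1` _ = `]a - c, b - c]%classic); last first.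
  by apply/seteqP; split => x /=; rewrite !in_itv/= ltrBlDr lerBrDr.
rewrite !lebesgue_measure_itv/= !lte_fin ltrD2r; case: ifP => // _.
by rewrite -!EFinD; congr EFin; ring.
Qed.

Lemma preserves_reflect (c : R) :
  preserves leb leb (fun x : measurableTypeR R => c - x : measurableTypeR R).
Proof.
have := preserves_comp _ _ _ _ _ preserves_opp (preserves_shift c).
by congr preserves; apply/funext => x /=; rewrite addrC.
Qed.
End LineGeometry.

Section ProductPreserving.
Context {R : realType} {d1 d2} {T1 : measurableType d1} {T2 : measurableType d2}.
Variables (m1 : {sigma_finite_measure set T1 -> \bar R}).
Variables (m2 : {sigma_finite_measure set T2 -> \bar R}).

Lemma preserves_prod (f : T1 -> T1) (g : T2 -> T2) :
  preserves m1 m1 f -> preserves m2 m2 g ->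
  preserves (product_measure m1 m2) (product_measure m1 m2) (fun p => (f p.1, g p.2)).
Proof.
move=> Hf Hg; have [mf _] := Hf; have [mg _] := Hg.
apply: preserves_integral.
  by apply: measurable_fun_pair; apply: measurableT_comp.
move=> h mh h0.
have mh' : measurable_fun setT (fun p : T1 * T2 => h (f p.1, g p.2)).
  apply: measurableT_comp => //.
  by apply: measurable_fun_pair; apply: measurableT_comp.
rewrite /product_measure (fubini_tonelli1 h mh h0) (fubini_tonelli1 _ mh' (fun=> h0 _)).
have mF := measurable_fun_fubini_tonelli_F (m2 := m2) h mh h0.
rewrite (ge0_integral_preserves _ _ _ Hf (fubini_F m2 h) mF); last first.
  by move=> x; apply: integral_ge0 => y _; exact: h0.
apply: eq_integral => x _; rewrite /fubini_F.
rewrite (ge0_integral_preserves _ _ _ Hg (fun y => h (f x, y)))//.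
by apply: (measurableT_comp mh); exact: measurable_pair1.
Qed.

Lemma ge0_integral_prod (F : T1 * T2 -> \bar R) : measurable_fun setT F ->
  (forall x, 0 <= F x)%E ->
  (\int[product_measure m1 m2]_z F z = \int[m1]_x \int[m2]_y F (x, y))%E.
Proof. by move=> mF F0; rewrite /product_measure fubini_tonelli1. Qed.

End ProductPreserving.

Section PlaneGeometryFacts.
Context {R : realType}.
Local Notation mu := (@plane_lebesgue R).

Lemma preserves_add2 (c : plane R) : preserves mu mu (fun x => add2 x c).
Proof. by have := preserves_prod _ _ _ _ (preserves_shift c.1) (preserves_shift c.2). Qed.

Lemma preserves_sub2 (c : plane R) : preserves mu mu (sub2 c).
Proof. by have := preserves_prod _ _ _ _ (preserves_reflect c.1) (preserves_reflect c.2). Qed.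

End PlaneGeometryFacts.

(** * Boxes as a generating family for measures on configurations *)

Section Boxes.
Context {R : realType}.

Lemma preserves_cons n :
  preserves (product_measure plane_lebesgue (lebesgue n)) (@lebesgue R n.+1) (@cons_config R n).
Proof. by split; [exact: measurable_cons_config|]. Qed.

(** Half-open sides make boxes stable under intersection and match the intervals that generate the
    measurable sets of the line. *)
Definition rect (a b : plane R) : set (plane R) := `]a.1, b.1]%classic `*` `]a.2, b.2]%classic.

Definition box {n} (a b : 'I_n -> plane R) : set (config R n) :=
  [set x | forall k, rect (a k) (b k) (tnth x k)].

Lemma measurable_rect (a b : plane R) : measurable (rect a b).
Proof. by apply: measurableX. Qed.

Lemma measurable_box n (a b : 'I_n -> plane R) : measurable (box a b).
Proof.
rewrite (_ : box a b = \bigcap_(k in [set: 'I_n])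
    ((fun x : config R n => tnth x k) @^-1` rect (a k) (b k))).
  apply: fin_bigcap_measurable; first exact: finite_finset.
  move=> k _; rewrite -[X in measurable X]setTI.
  by apply: measurable_tnth => //; exact: measurable_rect.
by apply/seteqP; split => x /= h k; [move=> _|]; exact: h.
Qed.

Lemma lebesgue_rect_lty (a b : plane R) : (plane_lebesgue (rect a b) < +oo)%E.
Proof.
have h (s t : R) : (@lebesgue_measure R `]s, t]%classic < +oo)%E.
  by rewrite lebesgue_measure_itv/=; case: ifP => _; rewrite ?ltry// -EFinB ltry.
rewrite /plane_lebesgue/= /product_measure product_measure1E//.
apply: lte_mul_pinfty; [exact: measure_ge0| |exact: h].
by rewrite ge0_fin_numE ?measure_ge0//; exact: h.
Qed.

Lemma lebesgue_box n (a b : 'I_n -> plane R) :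
  (lebesgue n (box a b) = \prod_(k < n) plane_lebesgue (rect (a k) (b k)))%E.
Proof.
elim: n a b => [|n IH] a b.
  rewrite big_ord0 /lebesgue/= diracE mem_set//.
  by case.
have [_ H] := preserves_cons n; rewrite H; last exact: measurable_box.
rewrite (_ : _ @^-1` _ = rect (a ord0) (b ord0) `*` box (a \o lift ord0) (b \o lift ord0)).
  rewrite big_ord_recl -(IH (a \o lift ord0) (b \o lift ord0)).
  by apply: product_measure1E; [exact: measurable_rect|exact: measurable_box].
apply/seteqP; split=> [[c x] h|[c x] [/= h1 h2]].
  by split => [|k]; [have := h ord0|have := h (lift ord0 k); rewrite tnthS].
move=> k; case: (unliftP ord0 k) => [j ->|->]; last exact: h1.
by have := h2 j; rewrite tnthS.
Qed.

Definition boxes n : set (set (config R n)) := [set box p.1 p.2 | p in [set: ('I_n -> plane R) * ('I_n -> plane R)]].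

Lemma boxes_setI n : setI_closed (boxes n).
Proof.
move=> _ _ [[a b] _ <-] [[a' b'] _ <-].
exists (fun k => (Num.max (a k).1 (a' k).1, Num.max (a k).2 (a' k).2),
        fun k => (Num.min (b k).1 (b' k).1, Num.min (b k).2 (b' k).2)) => //.
have e (s t s' t' x : R) : (Num.max s s' < x <= Num.min t t') = (s < x <= t) && (s' < x <= t').
  by rewrite gt_max le_min; do !case: (_ < _); do ! case: (_ <= _).
apply/seteqP; split=> x /=.
  by move=> h; split=> k; have := h k; rewrite /rect/= !in_itv/= !e => -[/andP[? ?] /andP[? ?]].
by move=> [h1 h2] k; have := h1 k; have := h2 k; rewrite /rect/= !in_itv/= !e => -[? ?] [? ?]; split; apply/andP.
Qed.

(** An exhaustion by sets of finite measure. It serves the uniqueness of measures, and later as the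
    cut-off in [real_box_test] and [L2_approx]. *)
Definition cube n (N : nat) : set (config R n) :=
  box (fun=> (- N%:R, - N%:R)) (fun=> (N%:R, N%:R)).

Lemma cube_cover n : \bigcup_N (cube n N) = setT.
Proof.
rewrite -subTset => x _.
have h (s : R) : exists N : nat, forall M, (N <= M)%N -> - M%:R < s <= M%:R.
  exists (Num.trunc `|s|).+1 => M NM.
  have : `|s| < M%:R by rewrite (lt_le_trans (truncnS_gt _))// ler_nat.
  by rewrite ltr_norml => /andP[-> /ltW ->].
have /(_ _)/cid-/all_sig[f Hf] (k : 'I_n) : exists N : nat, forall M, (N <= M)%N ->
    rect (- M%:R, - M%:R) (M%:R, M%:R) (tnth x k).
  have [N1 h1] := h (tnth x k).1; have [N2 h2] := h (tnth x k).2.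
  exists (maxn N1 N2) => M; rewrite geq_max => /andP[M1 M2].
  by split; rewrite /= in_itv/= ?h1 ?h2.
by exists (\max_k f k) => // k; apply: Hf; exact: leq_bigmax.
Qed.

(** The nontrivial inclusion says that the identity is measurable from the sigma-algebra of boxes to
    the product one, which can be checked on each real coordinate. *)
Lemma measurable_boxesE n : measurable = <<s boxes n >>.
Proof.
apply/seteqP; split; last first.
  apply: smallest_sub; first exact: sigma_algebra_measurable.
  by move=> _ [[a b] _ <-]; exact: measurable_box.
have mid : measurable_fun [set: g_sigma_algebraType (boxes n)] (fun x => x : config R n).
  apply/measurable_fun_tnthP => k.
  have h (c : bool) : measurable_fun [set: g_sigma_algebraType (boxes n)]
      (fun x => (if c then (tnth x k).1 else (tnth x k).2) : measurableTypeR R).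
    apply: (@measurability _ _ _ _ _ _ (@ocitv R)) => //.
    move=> _ [_ [[a b] _ <-] <-].
    (* Box [N] confines one component of coordinate [k], the one chosen by [c], to ]a, b] and
       everything else to ]-N, N]; the union over N keeps only the first constraint. *)
    pose aa N : 'I_n -> plane R := fun j => if j == k then
       (if c then (a, - N%:R) else (- N%:R, a)) else (- N%:R, - N%:R).
    pose bb N : 'I_n -> plane R := fun j => if j == k then
       (if c then (b, N%:R) else (N%:R, b)) else (N%:R, N%:R).
    rewrite (_ : _ `&` _ = \bigcup_N box (aa N) (bb N)).
      by apply: bigcup_measurable => N _; apply: sub_sigma_algebra; exists (aa N, bb N).
    apply/seteqP; split => x /=.
      move=> [_]; rewrite in_itv/= => ab.
      have [N _ xN] : (\bigcup_N cube n N) x by rewrite cube_cover.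
      exists N => // j; rewrite /aa /bb; case: eqVneq => [->|_]; last exact: xN.
      by have := xN k; move: ab; case: (c) => ab [/= x1 x2]; split; rewrite //= in_itv.
    move=> [N _ /(_ k)]; rewrite /aa /bb eqxx => h; split => //; rewrite in_itv/=.
    by move: h; case: (c) => -[/=]; rewrite !in_itv.
  rewrite (_ : _ \o _ = fun x => ((tnth x k).1, (tnth x k).2)).
    by apply: measurable_fun_pair; [exact: (h true)|exact: (h false)].
  by apply/funext => x /=; case: (tnth x k).
move=> A mA; rewrite -[A]setTI; exact: mid.
Qed.

Lemma measure_unique_boxes n (m1 m2 : {measure set (config R n) -> \bar R}) :
  (forall a b, m1 (box a b) = m2 (box a b)) -> (forall a b, m1 (box a b) < +oo)%E ->
  forall A, measurable A -> m1 A = m2 A.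
Proof.
move=> m12 m1y A mA; apply: (measure_unique (boxes n) (cube n)) => //.
- exact: measurable_boxesE.
- exact: boxes_setI.
- by move=> N; eexists (_, _).
- exact: cube_cover.
- by move=> _ [[a b] _ <-]; exact: m12.
- by move=> k; exact: m1y.
Qed.

Lemma lebesgue_box_lty n (a b : 'I_n -> plane R) : (lebesgue n (box a b) < +oo)%E.
Proof.
rewrite lebesgue_box -ge0_fin_numE; last by apply: prode_ge0 => k _.
elim/big_ind: _ => //; first by move=> x y; exact: fin_numM.
by move=> k _; rewrite ge0_fin_numE//; exact: lebesgue_rect_lty.
Qed.

End Boxes.

Section Permute.
Context {R : realType} {n : nat}.
Implicit Types s : 'S_n.

Lemma tnth_permute s (x : config R n) k : tnth (permute s x) k = tnth x (s k).
Proof. by rewrite tnth_mktuple. Qed.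

Lemma measurable_permute s : measurable_fun setT (@permute R n s).
Proof.
apply/measurable_fun_tnthP => k.
rewrite (_ : _ \o _ = fun x => tnth x (s k)); first exact: measurable_tnth.
by apply/funext => x /=; rewrite tnth_permute.
Qed.

HB.instance Definition _ s :=
  isMeasurableFun.Build _ _ _ _ (@permute R n s) (measurable_permute s).

(** The preimage of a box is the box with permuted sides, of equal volume since the product of the
    side areas is only reindexed; agreement on boxes suffices. *)
Lemma preserves_permute s : preserves (lebesgue n) (lebesgue n) (@permute R n s).
Proof.
split; first exact: measurable_permute.
move=> A mA; rewrite -[RHS]/(pushforward (lebesgue n) (permute s) A).
apply: measure_unique_boxes => // [a b|a b]; last exact: lebesgue_box_lty.
rewrite -[RHS]/(lebesgue n (permute s @^-1` box a b)) (_ : _ @^-1` _ = box (a \o s^-1%g) (b \o s^-1%g)); last first.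
  apply/seteqP; split => x /= h k.
    by have := h (s^-1%g k); rewrite tnth_permute permKV.
  by have := h (s k); rewrite /= permK tnth_permute.
apply: (etrans (lebesgue_box n a b)); apply: esym.
apply: (etrans (lebesgue_box n _ _)); rewrite [RHS](reindex_inj (@perm_inj _ s^-1%g)).
exact: eq_bigr.
Qed.

Lemma sqn_permute s (x : config R n) : sqn (permute s x) = sqn x.
Proof.
rewrite /sqn [RHS](reindex_inj (@perm_inj _ s)).
by apply: eq_bigr => k _; rewrite tnth_permute.
Qed.

Lemma dot_permute s (x y : config R n) : dot (permute s x) (permute s y) = dot x y.
Proof.
rewrite /dot [RHS](reindex_inj (@perm_inj _ s)).
by apply: eq_bigr => k _; rewrite !tnth_permute.
Qed.

Lemma permuteM s t (x : config R n) : permute (s * t)%g x = permute s (permute t x).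
Proof. by apply: eq_from_tnth => k; rewrite !tnth_permute permM. Qed.

End Permute.

Section MeasurableGeometry.
Context {R : realType} {d} {T : measurableType d}.
Implicit Types f g : T -> plane R.

Lemma measurable_plane_fst f : measurable_fun setT f -> measurable_fun setT (fun x => (f x).1 : R).
Proof. by move=> mf; exact: (measurableT_comp measurable_fst mf). Qed.
Lemma measurable_plane_snd f : measurable_fun setT f -> measurable_fun setT (fun x => (f x).2 : R).
Proof. by move=> mf; exact: (measurableT_comp measurable_snd mf). Qed.

Lemma measurable_add2 f g : measurable_fun setT f -> measurable_fun setT g ->
  measurable_fun setT (fun x => add2 (f x) (g x)).
Proof.
move=> mf mg; apply: measurable_fun_pair.
  by apply: measurable_funD; exact: measurable_plane_fst.
by apply: measurable_funD; exact: measurable_plane_snd.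
Qed.
Lemma measurable_sub2 f g : measurable_fun setT f -> measurable_fun setT g ->
  measurable_fun setT (fun x => sub2 (f x) (g x)).
Proof.
move=> mf mg; apply: measurable_fun_pair.
  by apply: measurable_funB; exact: measurable_plane_fst.
by apply: measurable_funB; exact: measurable_plane_snd.
Qed.
Lemma measurable_half2 f : measurable_fun setT f -> measurable_fun setT (fun x => half2 (f x)).
Proof.
move=> mf; apply: measurable_fun_pair.
  by apply: measurable_funM => //; exact: measurable_plane_fst.
by apply: measurable_funM => //; exact: measurable_plane_snd.
Qed.
Lemma measurable_dot2 f g : measurable_fun setT f -> measurable_fun setT g ->
  measurable_fun setT (fun x => dot2 (f x) (g x)).
Proof.
move=> mf mg; apply: measurable_funD; apply: measurable_funM.
- exact: measurable_plane_fst.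
- exact: measurable_plane_fst.
- exact: measurable_plane_snd.
- exact: measurable_plane_snd.
Qed.
Lemma measurable_component n (F : T -> config R n) k : measurable_fun setT F ->
  measurable_fun setT (fun x => component (F x) k).
Proof.
move=> mF; have [kn|nk] := ltnP k n.
  rewrite (_ : (fun x => _) = (fun x => tnth x (Ordinal kn)) \o F).
    by apply: measurableT_comp => //; exact: measurable_tnth.
  by apply/funext => x /=; rewrite (tnth_nth (0, 0)).
rewrite (_ : (fun x => _) = cst (0, 0)); first exact: measurable_cst.
by apply/funext => x; rewrite /component nth_default// size_tuple.
Qed.
Lemma measurable_tnth_comp n (F : T -> config R n) k : measurable_fun setT F ->
  measurable_fun setT (fun x => tnth (F x) k).
Proof. by move=> mF; exact: (measurableT_comp (@measurable_tnth _ _ _ k) mF). Qed.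
Lemma measurable_dot n (F G : T -> config R n) : measurable_fun setT F -> measurable_fun setT G ->
  measurable_fun setT (fun x => dot (F x) (G x)).
Proof.
by move=> mF mG; apply: measurable_sum => k; apply: measurable_dot2; exact: measurable_tnth_comp.
Qed.
Lemma measurable_sqn n (F : T -> config R n) : measurable_fun setT F ->
  measurable_fun setT (fun x => sqn (F x)).
Proof. by move=> mF; exact: measurable_dot. Qed.
Lemma measurable_cons_comp n f (F : T -> config R n) : measurable_fun setT f ->
  measurable_fun setT F -> measurable_fun setT (fun x => cons_config (f x, F x)).
Proof.
by move=> mf mF; apply: (measurableT_comp (@measurable_cons_config _ _)); exact: measurable_fun_pair.
Qed.
Lemma measurable_behead_comp n (F : T -> config R n.+1) : measurable_fun setT F ->
  measurable_fun setT (fun x => [tuple of behead (F x)]).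
Proof. by move=> mF; exact: (measurableT_comp (@measurable_behead _ _ _) mF). Qed.
End MeasurableGeometry.

Section PlaneAlgebra.
Context {R : realType}.
Implicit Types a b c : plane R.
Lemma add2C a b : add2 a b = add2 b a.
Proof. by congr pair; exact: addrC. Qed.
Lemma sub2_half a b : sub2 a (add2 b (half2 a)) = sub2 (half2 a) b.
Proof. by congr pair => /=; field. Qed.
Lemma add2_halves a b : add2 (add2 (half2 a) b) (sub2 (half2 a) b) = a.
Proof. by case: a b => a1 a2 [b1 b2]; congr pair => /=; field. Qed.
Lemma sqn2_halves a b : sqn2 (add2 (half2 a) b) + sqn2 (sub2 (half2 a) b) = sqn2 a / 2 + 2 * sqn2 b.
Proof. by rewrite /sqn2 /dot2 /=; field. Qed.
Lemma sqn2_ge0 a : 0 <= sqn2 a.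
Proof. by rewrite /sqn2/dot2 -!expr2 addr_ge0// sqr_ge0. Qed.
Lemma sqn_ge0 n (x : config R n) : 0 <= sqn x.
Proof. by apply: sumr_ge0 => k _; exact: sqn2_ge0. Qed.
End PlaneAlgebra.

Section Shear.
Context {R : realType}.
Local Notation mu := (@plane_lebesgue R).

(** Passing from relative and total momenta to individual ones is a composite of two shears: a = p +
    q/2 for fixed q, then b = q - a for fixed a. Each is a translation in the variable being
    integrated, so no Jacobian appears. *)
Lemma ge0_integral_shear (G : plane R * plane R -> \bar R) : measurable_fun setT G ->
  (forall x, 0 <= G x)%E ->
  (\int[mu]_p \int[mu]_q G (add2 (half2 q) p, sub2 (half2 q) p) = \int[mu]_a \int[mu]_b G (a, b))%E.
Proof.
move=> mG G0.
pose H (z : plane R * plane R) := G (add2 (half2 z.2) z.1, sub2 (half2 z.2) z.1).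
have mH : measurable_fun setT H.
  apply: measurableT_comp => //; apply: measurable_fun_pair.
    by apply: measurable_add2 => //; exact: measurable_half2.
  by apply: measurable_sub2 => //; exact: measurable_half2.
rewrite (fubini_tonelli (m1 := mu) (m2 := mu) H mH (fun=> G0 _)).
pose K (z : plane R * plane R) := G (z.1, sub2 z.2 z.1).
have mK : measurable_fun setT K.
  apply: measurableT_comp => //; apply: measurable_fun_pair => //.
  exact: measurable_sub2.
rewrite (eq_integral (fun q => \int[mu]_a K (a, q))%E); last first.
  move=> q _; rewrite (ge0_integral_preserves _ _ _ (preserves_add2 (half2 q)) (fun a => K (a, q))).
  - by apply: eq_integral => p _; rewrite /H /K/= sub2_half add2C.
  - by apply: (measurableT_comp mK); exact: measurable_pair2.
  - by move=> a; exact: G0.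
rewrite -(fubini_tonelli (m1 := mu) (m2 := mu) K mK (fun=> G0 _)).
apply: eq_integral => a _.
rewrite (ge0_integral_preserves _ _ _ (preserves_add2 (- a.1, - a.2)) (fun b => G (a, b)))//.
by apply: (measurableT_comp mG); exact: measurable_pair1.
Qed.
End Shear.

Section ConfigIntegral.
Context {R : realType}.
Lemma ge0_integral_cons n (F : config R n.+1 -> \bar R) : measurable_fun setT F ->
  (forall x, 0 <= F x)%E ->
  (\int[lebesgue n.+1]_x F x = \int[plane_lebesgue]_a \int[lebesgue n]_x F (cons_config (a, x)))%E.
Proof.
move=> mF F0; rewrite (ge0_integral_preserves _ _ _ (preserves_cons n))//.
rewrite (ge0_integral_prod _ _ (fun z => F (cons_config z)))//.
by apply: (measurableT_comp mF); exact: measurable_cons_config.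
Qed.
End ConfigIntegral.

(** * Relative and merged momenta of a pair *)

Section SplitPair.
Context {R : realType} {m : nat}.
Local Notation pair := ('I_m.+2 * 'I_m.+2)%type.
Implicit Types (e : pair) (q : config R m.+1) (w : plane R).

(** The position from which coordinate [k] of [split_pair e] is read when the pair is stored in
    front: 0 and 1 for the pair itself, then the other indices in order. This makes every
    [split_pair e] a permutation of the single map [pair_front]. *)
Definition slot e (k : 'I_m.+2) : 'I_m.+2 :=
  if k == e.1 then ord0 else if k == e.2 then inord 1 else inord (index k (others e)).+2.

Lemma mem_others e k : (k \in others e) = (k != e.1) && (k != e.2).
Proof. by rewrite mem_filter mem_enum andbT. Qed.

Lemma uniq_others e : uniq (others e).
Proof. by rewrite filter_uniq// enum_uniq. Qed.

Lemma size_others e : e.1 != e.2 -> size (others e) = m.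
Proof.
move=> e12; rewrite -[others e]/([seq k <- enum 'I_m.+2 | predI (predC1 e.1) (predC1 e.2) k]).
rewrite size_filter.
have := count_predC (predI (predC1 e.1) (predC1 e.2)) (enum 'I_m.+2).
rewrite size_enum_ord (_ : count (predC _) _ = 2%N) ?addn2; first by case.
rewrite (eq_count (a2 := [pred k | k \in [:: e.1; e.2]])); last first.
  by move=> k; rewrite !inE/= negb_and !negbK.
rewrite -size_filter; apply: (@perm_size _ _ [:: e.1; e.2]); apply: uniq_perm.
- by rewrite filter_uniq// enum_uniq.
- by rewrite /= inE e12.
- by move=> k; rewrite mem_filter mem_enum andbT !inE.
Qed.

Lemma index_others_lt e k : e.1 != e.2 -> k != e.1 -> k != e.2 -> (index k (others e) < m)%N.
Proof. move=> e12 k1 k2; apply: leq_trans (eq_leq (size_others e e12)).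
by rewrite index_mem mem_others k1. Qed.

Lemma slot_inj e : e.1 != e.2 -> injective (slot e).
Proof.
move=> e12 k l; rewrite /slot.
have v1 : (inord 1 : 'I_m.+2) = 1%N :> nat by rewrite inordK.
have vk j : j != e.1 -> j != e.2 ->
    (inord (index j (others e)).+2 : 'I_m.+2) = (index j (others e)).+2 :> nat.
  by move=> j1 j2; rewrite inordK// !ltnS; exact: index_others_lt.
case: (eqVneq k e.1) => [->|k1]; case: (eqVneq l e.1) => [->|l1] //.
- by case: (eqVneq l e.2) => [_|l2] /(congr1 val) /=; rewrite ?v1 ?vk.
- by case: (eqVneq k e.2) => [_|k2] /(congr1 val) /=; rewrite ?v1 ?vk.
case: (eqVneq k e.2) => [->|k2]; case: (eqVneq l e.2) => [->|l2] //.
- by move=> /(congr1 val) /=; rewrite v1 vk.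
- by move=> /(congr1 val) /=; rewrite v1 vk.
move=> /(congr1 val) /=; rewrite !vk// => -[h].
by rewrite -(nth_index k (_ : k \in others e)) ?mem_others ?k1// h nth_index// mem_others l1.
Qed.

Definition slot_perm e (e12 : e.1 != e.2) : 'S_m.+2 := perm (slot_inj e e12).

Definition pair_front (w : plane R) q : config R m.+2 :=
  cons_config (add2 (half2 (component q 0)) w,
    cons_config (sub2 (half2 (component q 0)) w, [tuple of behead q])).

Lemma split_pairE e (e12 : e.1 != e.2) w q :
  split_pair e w q = permute (slot_perm e e12) (pair_front w q).
Proof.
apply: eq_from_tnth => k; rewrite tnth_mktuple tnth_permute permE /slot.
case: eqVneq => [_|k1]; first by rewrite (tnth_nth (0, 0)).
case: eqVneq => [_|k2]; first by rewrite (tnth_nth (0, 0)) inordK.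
rewrite (tnth_nth (0, 0)) inordK ?ltnS; last exact: index_others_lt.
by rewrite /= nth_behead.
Qed.

Lemma measurable_pair_front d (T : measurableType d) (f : T -> plane R) (g : T -> config R m.+1) :
  measurable_fun setT f -> measurable_fun setT g ->
  measurable_fun setT (fun x => pair_front (f x) (g x)).
Proof.
move=> mf mg; have mh : measurable_fun setT (fun x => half2 (component (g x) 0)).
  by apply: measurable_half2; exact: measurable_component.
apply: measurable_cons_comp; first exact: measurable_add2.
apply: measurable_cons_comp; first exact: measurable_sub2.
exact: measurable_behead_comp.
Qed.

Lemma measurable_split_pair d (T : measurableType d) e (f : T -> plane R) (g : T -> config R m.+1) :
  e.1 != e.2 -> measurable_fun setT f -> measurable_fun setT g ->
  measurable_fun setT (fun x => split_pair e (f x) (g x)).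
Proof.
move=> e12 mf mg; under eq_fun do rewrite (split_pairE e e12).
by apply: (measurableT_comp (measurable_permute _)); exact: measurable_pair_front.
Qed.

Lemma behead_cons n (c : plane R) (x : config R n) :
  [tuple of behead (cons_config (c, x))] = x.
Proof. exact: val_inj. Qed.

(** Tonelli isolates the first two planes, on which the map is the shear of [ge0_integral_shear];
    the remaining momenta are spectators. *)
Lemma preserves_pair_front :
  preserves (product_measure plane_lebesgue (lebesgue m.+1)) (lebesgue m.+2)
    (fun p => pair_front p.1 p.2).
Proof.
apply: preserves_integral; first exact: measurable_pair_front.
move=> f mf f0.
pose G (z : plane R * plane R) : \bar R :=
  (\int[lebesgue m]_x f (cons_config (z.1, cons_config (z.2, x))))%E.
have mh d (T : measurableType d) (a b : T -> plane R) (c : T -> config R m) :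
    measurable_fun setT a -> measurable_fun setT b -> measurable_fun setT c ->
    measurable_fun setT (fun x => f (cons_config (a x, cons_config (b x, c x)))).
  move=> ma mb mc; apply: (measurableT_comp mf).
  by apply: measurable_cons_comp => //; exact: measurable_cons_comp.
have mG : measurable_fun setT G.
  apply: (measurable_fun_fubini_tonelli_F (m2 := lebesgue m)
    (fun z : (plane R * plane R) * config R m => f (cons_config (z.1.1, cons_config (z.1.2, z.2))))).
    apply: mh => //; apply: measurableT_comp => //.
  by move=> z; exact: f0.
have G0 z : (0 <= G z)%E by apply: integral_ge0 => x _; exact: f0.
have mp : measurable_fun setT (fun p : plane R * config R m.+1 => f (pair_front p.1 p.2)).
  by apply: (measurableT_comp mf); exact: measurable_pair_front.
rewrite (ge0_integral_prod plane_lebesgue (lebesgue m.+1) _ mp (fun=> f0 _)).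
rewrite (ge0_integral_cons _ f mf f0).
have -> : (\int[plane_lebesgue]_a \int[lebesgue m.+1]_x f (cons_config (a, x)) =
    \int[plane_lebesgue]_a \int[plane_lebesgue]_b G (a, b))%E.
  apply: eq_integral => a _; rewrite ge0_integral_cons//.
  by apply: (measurableT_comp mf); apply: measurable_cons_comp => //; exact: measurable_cst.
rewrite -(ge0_integral_shear _ mG G0); apply: eq_integral => p _.
have mq : measurable_fun setT (fun q => f (pair_front p q)).
  by apply: (measurableT_comp mf); exact: measurable_pair_front.
rewrite (ge0_integral_cons _ _ mq (fun=> f0 _)).
by apply: eq_integral => q _; apply: eq_integral => x _; rewrite /pair_front behead_cons.
Qed.

Lemma preserves_split_pair e : e.1 != e.2 ->
  preserves (product_measure plane_lebesgue (lebesgue m.+1)) (lebesgue m.+2)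
    (fun p => @split_pair R _ e p.1 p.2).
Proof.
move=> e12; have := preserves_comp _ _ _ _ _ preserves_pair_front (preserves_permute (slot_perm e e12)).
by congr preserves; apply/funext => p /=; rewrite split_pairE.
Qed.

Lemma tnth_split_pair1 e w q : tnth (split_pair e w q) e.1 = add2 (half2 (component q 0)) w.
Proof. by rewrite tnth_mktuple eqxx. Qed.
Lemma tnth_split_pair2 e w q : e.1 != e.2 ->
  tnth (split_pair e w q) e.2 = sub2 (half2 (component q 0)) w.
Proof. by move=> e12; rewrite tnth_mktuple eq_sym (negbTE e12) eqxx. Qed.
Lemma tnth_split_pair3 e w q k : k != e.1 -> k != e.2 ->
  tnth (split_pair e w q) k = component q (index k (others e)).+1.
Proof. by move=> k1 k2; rewrite tnth_mktuple (negbTE k1) (negbTE k2). Qed.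

Lemma split_pairK e w q : e.1 != e.2 -> merge_pair e (split_pair e w q) = q.
Proof.
move=> e12; apply: eq_from_tnth => k; rewrite tnth_mktuple.
rewrite tnth_split_pair1 tnth_split_pair2// add2_halves.
case: k => -[|k] kn /=; first by rewrite (tnth_nth (0, 0)).
have km : (k < size (others e))%N by rewrite size_others.
rewrite (nth_map e.1)//.
have := mem_nth e.1 km; rewrite mem_others => /andP[h1 h2].
by rewrite tnth_split_pair3// index_uniq ?uniq_others// (tnth_nth (0, 0)).
Qed.

(** The parallelogram identity |q/2 + w|^2 + |q/2 - w|^2 = |q|^2/2 + 2 |w|^2 is the origin of the
    factor 1/2 on the merged momentum in [sqn_merged]. *)
Lemma sqn_split_pair e w q : e.1 != e.2 ->
  sqn (split_pair e w q) = sqn_merged (n := m.+2) q + 2 * sqn2 w.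
Proof.
move=> e12; rewrite (split_pairE e e12) sqn_permute /sqn /sqn_merged.
have tn0 n (c : plane R) (x : config R n) : tnth (cons_config (c, x)) ord0 = c by [].
have tnS n (c : plane R) (x : config R n) k : tnth (cons_config (c, x)) (lift ord0 k) = tnth x k.
  by rewrite tnthS.
rewrite big_ord_recl big_ord_recl !tn0 !tnS !tn0 addrA sqn2_halves addrAC; congr (_ + _ + _).
rewrite [RHS]big_mkcond big_ord_recl/= add0r; apply: eq_bigr => k _.
rewrite !tnS; congr sqn2.
by rewrite !(tnth_nth (0, 0))/= nth_behead.
Qed.

Lemma measurable_merge_pair d (T : measurableType d) e (f : T -> config R m.+2) :
  measurable_fun setT f -> measurable_fun setT (fun x => merge_pair e (f x)).
Proof.
move=> mf; apply/measurable_fun_tnthP => k; case: k => -[|k] kn.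
  rewrite (_ : _ \o _ = fun x => add2 (tnth (f x) e.1) (tnth (f x) e.2)).
    by apply: measurable_add2; exact: measurable_tnth_comp.
  by apply/funext => x /=; rewrite tnth_mktuple.
have [km|mk] := ltnP k (size (others e)).
  rewrite (_ : _ \o _ = fun x => tnth (f x) (nth e.1 (others e) k)).
    exact: measurable_tnth_comp.
  by apply/funext => x /=; rewrite tnth_mktuple/= (nth_map e.1).
rewrite (_ : _ \o _ = cst (0, 0)); first exact: measurable_cst.
by apply/funext => x /=; rewrite tnth_mktuple/= nth_default// size_map.
Qed.

Lemma measurable_sqn_merged d (T : measurableType d) (f : T -> config R m.+1) :
  measurable_fun setT f -> measurable_fun setT (fun x => sqn_merged (n := m.+2) (f x)).
Proof.
move=> mf; apply: measurable_funD.
  by apply: measurable_funM => //; apply: measurable_dot2; exact: measurable_component.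
under eq_fun do rewrite big_mkcond/=.
have h (k : 'I_m.+1) : measurable_fun setT (fun x => if (0 < k)%N then sqn2 (tnth (f x) k) else 0).
  case: (0 < k)%N; last exact: measurable_cst.
  by apply: measurable_dot2; exact: measurable_tnth_comp.
exact: (measurable_sum _ h).
Qed.

Lemma sqn_merged_ge0 q : 0 <= sqn_merged (n := m.+2) q.
Proof.
by rewrite addr_ge0 ?divr_ge0 ?sqn2_ge0// sumr_ge0// => k _; exact: sqn2_ge0.
Qed.

End SplitPair.

(** * The Poisson kernel *)

Section LineIntegrals.
Context {R : realType}.
Local Notation leb := (@lebesgue_measure R).

Lemma ge0_integral_halfline (f F : R -> R) (l : R) :
  (forall x, 0 <= x -> 0 <= f x) -> (forall x, 0 <= x -> {for x, continuous f}) ->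
  (forall x : R, 0 <= x -> is_derive x 1 F (f x)) -> F x @[x --> +oo] --> l ->
  (\int[leb]_(x in `[0%R, +oo[) (f x)%:E = l%:E - (F 0)%:E)%E.
Proof.
move=> f0 cf dF Fl; apply: (ge0_continuous_FTC2y f0 _ Fl) => //.
- apply/continuous_within_itvcyP; split.
    by move=> x; rewrite in_itv/= andbT => /ltW /cf.
  by apply: cvg_at_right_filter; exact: cf.
- by move=> x /ltW /dF [].
- apply: cvg_at_right_filter; have [h _] := dF _ (lexx 0).
  by apply: differentiable_continuous; apply/derivable1_diffP.
- by move=> x; rewrite in_itv/= andbT => /ltW /dF [_ <-]; rewrite derive1E.
Qed.

(** Writing the integrand as f |x| leaves all requirements on the half-line; this matters for
    [schur_line], which contains a square root and a quotient. *)
Lemma integral_even (f : R -> R) :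
  (forall x, 0 <= x -> 0 <= f x) -> (forall x, 0 <= x -> {for x, continuous f}) ->
  (\int[leb]_x (f `|x|)%:E = 2%:E * \int[leb]_(x in `[0%R, +oo[) (f x)%:E)%E.
Proof.
move=> f0 cf; rewrite (ge0_symfun_integralT (f := fun x => f `|x|)).
- rewrite -set_itvcy; congr (_ * _)%E; apply: eq_integral => x.
  by rewrite inE/= in_itv/= andbT => x0; rewrite ger0_norm.
- by move=> x; exact: f0.
- move=> x; apply: (@continuous_comp _ _ _ (fun x : R => `|x|) f); first exact: norm_continuous.
  exact: cf.
- by move=> x /=; rewrite normrN.
Qed.

(** The Cauchy density of width [eps]. It has mass one and is 1/(2 pi) times the transform of exp (-
    eps |s|), see [cintegral_exp_abs]. *)
Definition poisson1 (eps t : R) : R := eps / (pi * (eps ^+ 2 + t ^+ 2)).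

Lemma poisson1_ge0 (eps t : R) : 0 < eps -> 0 <= poisson1 eps t.
Proof.
move=> e0; apply: divr_ge0; first exact: ltW.
by apply: mulr_ge0; [exact: pi_ge0|rewrite addr_ge0// sqr_ge0].
Qed.

Lemma is_derive_poisson1 (eps c x : R) : 0 < eps ->
  is_derive x 1 (fun s : R => atan ((s - c) / eps) / pi) (poisson1 eps (x - c)).
Proof.
move=> e0.
have h1 : is_derive x 1 (fun s : R => (s - c) / eps) eps^-1.
  rewrite (_ : (fun s => _) = eps^-1 *: (id \- cst c)); last first.
    by apply/funext => s /=; rewrite mulrC.
  by apply: is_derive_eq; rewrite subr0 /GRing.scale/= mulr1.
have h2 : is_derive x 1 (atan \o (fun s : R => (s - c) / eps))
    ((1 + ((x - c) / eps) ^+ 2)^-1 * eps^-1).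
  exact: (@is_derive1_comp _ _ (fun s : R => (s - c) / eps)).
rewrite (_ : (fun s => _) = pi^-1 *: (atan \o (fun s => (s - c) / eps))); last first.
  by apply/funext => s /=; rewrite mulrC.
apply: is_derive_eq; rewrite /GRing.scale/= /poisson1.
have p0 : pi != 0 :> R by rewrite gt_eqF// pi_gt0.
have d0 : eps ^+ 2 + (x - c) ^+ 2 != 0 by rewrite gt_eqF// ltr_wpDr ?sqr_ge0// exprn_gt0.
by move: (pi : R) p0 => P p0; field; rewrite d0 p0 (gt_eqF e0).
Qed.

Lemma continuous_poisson1 (eps : R) : 0 < eps -> continuous (poisson1 eps).
Proof.
move=> e0 x; apply: cvgM; first exact: cvg_cst.
apply: cvgV; first by rewrite gt_eqF// mulr_gt0 ?pi_gt0// ltr_wpDr ?sqr_ge0// exprn_gt0.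
apply: cvgM; first exact: cvg_cst.
by apply: cvgD; [exact: cvg_cst|exact: exprn_continuous].
Qed.

Lemma integral_poisson1 (eps c : R) : 0 < eps ->
  (\int[leb]_x (poisson1 eps (c - x))%:E = 1)%E.
Proof.
move=> e0; have e1 : eps != 0 by rewrite gt_eqF.
have mp : measurable_fun setT (fun x => (poisson1 eps x)%:E).
  by apply/measurable_EFinP; apply: continuous_measurable_fun; exact: continuous_poisson1.
rewrite -(ge0_integral_preserves _ _ _ (preserves_reflect c) (fun x => (poisson1 eps x)%:E) mp); last first.
  by move=> x; rewrite lee_fin poisson1_ge0.
rewrite (eq_integral (fun x : measurableTypeR R => (poisson1 eps `|x : R|)%:E)); last first.
  by move=> x _; rewrite /poisson1 real_normK// num_real.
rewrite integral_even; first last.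
- by move=> x _; exact: continuous_poisson1.
- by move=> x _; exact: poisson1_ge0.
pose F (s : R) : R := atan ((s - 0) / eps) / pi.
have F0 : F 0 = 0 by rewrite /F subr0 mul0r atan0 mul0r.
have dF (x : R) : 0 <= x -> is_derive x 1 F (poisson1 eps x).
  by move=> _; have := is_derive_poisson1 eps 0 x e0; rewrite subr0.
have Fl : F x @[x --> +oo] --> (2^-1 : R).
  rewrite (_ : 2^-1 = pi / 2 / pi :> R); last first.
    by rewrite mulrAC divff ?mul1r// gt_eqF// pi_gt0.
  apply: cvgM; last exact: cvg_cst.
  have h : ((s - 0) / eps : R) @[s --> +oo] --> +oo.
    by under eq_fun do rewrite subr0; apply: gt0_cvgMly; rewrite ?invr_gt0.
  exact: (cvg_comp (fun s : R => (s - 0) / eps) atan h (@cvgy_atan R)).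
have h := ge0_integral_halfline (poisson1 eps) F _ (fun x _ => poisson1_ge0 eps x e0)
  (fun x _ => continuous_poisson1 eps e0 x) dF Fl.
by rewrite h F0 sube0 -EFinM divff.
Qed.

Lemma integral_poisson1_itv (eps c a b : R) : 0 < eps ->
  (\int[leb]_(x in `]a, b]) (poisson1 eps (c - x))%:E =
   (if (a < b)%R then (atan ((b - c) / eps) - atan ((a - c) / eps)) / pi else 0)%:E)%E.
Proof.
move=> e0; case: ltP => [ab|ba]; last first.
  by rewrite set_itv_ge ?integral_set0// bnd_simp -leNgt.
have psym x : poisson1 eps (c - x) = poisson1 eps (x - c).
  by rewrite /poisson1 -[X in _ + X ^+ 2]opprB sqrrN.
have cp : continuous (fun x : R => poisson1 eps (x - c)).
  move=> x; apply: (@continuous_comp _ _ _ (fun x => x - c) (poisson1 eps)).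
    by apply: cvgB; [exact: cvg_id|exact: cvg_cst].
  exact: continuous_poisson1.
under eq_integral do rewrite psym.
have mp (D : set (measurableTypeR R)) : measurable_fun D (fun x => (poisson1 eps (x - c))%:E).
  apply: measurable_funTS; apply/measurable_EFinP; exact: continuous_measurable_fun.
rewrite integral_itv_obnd_cbnd; last exact: mp.
have cF : continuous (fun s : R => atan ((s - c) / eps) / pi).
  by move=> x; have [h _] := is_derive_poisson1 eps c x e0;
    apply: differentiable_continuous; apply/derivable1_diffP.
rewrite (@continuous_FTC2 _ _ (fun s : R => atan ((s - c) / eps) / pi))//.
- by rewrite -EFinB -mulrBl.
- by apply: continuous_subspaceT.
- split.
  + by move=> x _; have [] := is_derive_poisson1 eps c x e0.
  + by apply: cvg_at_right_filter; exact: cF.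
  + by apply: cvg_at_left_filter; exact: cF.
- by move=> x _; rewrite derive1E; have [_ ->] := is_derive_poisson1 eps c x e0.
Qed.

End LineIntegrals.

Section ExponentialTransform.
Context {R : realType}.
Local Notation leb := (@lebesgue_measure R).
Variable eps : R.
Hypothesis e0 : 0 < eps.

Let e1 : eps != 0. Proof. by rewrite gt_eqF. Qed.

Let d0 (t : R) : eps ^+ 2 + t ^+ 2 != 0.
Proof. by rewrite gt_eqF// ltr_wpDr ?sqr_ge0// exprn_gt0. Qed.

(** Replacing cos by 1 + cos makes the integrand nonnegative, so that the fundamental theorem on the
    half-line applies; the part due to 1 is subtracted later. *)
Lemma integral_exp_cos (t : R) :
  (\int[leb]_s (expR (- (eps * `|s|)) * (1 + cos (t * `|s|)))%:E =
   (2 / eps + 2 * eps / (eps ^+ 2 + t ^+ 2))%:E)%E.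
Proof.
pose f s : R := expR (- (eps * s)) * (1 + cos (t * s)).
have f0 s : 0 <= s -> 0 <= f s.
  move=> _; rewrite mulr_ge0 ?expR_ge0//; have := cos_geN1 (t * s); lra.
(* An antiderivative: - exp (- eps s) / eps for the constant part, and exp (- eps s) (t sin (t s) -
   eps cos (t s)) / (eps^2 + t^2) for the cosine part. *)
pose F (s : R) : R := expR (- (eps * s)) *
   (- eps^-1 + (t * sin (t * s) - eps * cos (t * s)) / (eps ^+ 2 + t ^+ 2)).
have dlin (k x : R) : is_derive x 1 (fun s : R => k * s) k.
  rewrite (_ : (fun s => _) = k *: id); last by apply/funext.
  by apply: is_derive_eq; rewrite /GRing.scale/= mulr1.
have dexp (x : R) : is_derive x 1 (fun s : R => expR (- (eps * s))) (- eps * expR (- (eps * x))).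
  have h : is_derive x 1 (fun s : R => - (eps * s)) (- eps).
    by under eq_fun do rewrite -mulNr; exact: dlin.
  have := @is_derive1_comp _ expR (fun s : R => - (eps * s)) x _ _ (is_derive_expR _) h.
  by rewrite mulrC.
have dsin (x : R) : is_derive x 1 (fun s : R => sin (t * s)) (cos (t * x) * t).
  exact: (@is_derive1_comp _ sin (fun s : R => t * s) x _ _ (is_derive_sin _) (dlin t x)).
have dcos (x : R) : is_derive x 1 (fun s : R => cos (t * s)) (- sin (t * x) * t).
  exact: (@is_derive1_comp _ cos (fun s : R => t * s) x _ _ (is_derive_cos _) (dlin t x)).
have dF (x : R) : 0 <= x -> is_derive x 1 F (f x).
  move=> _; pose D := (eps ^+ 2 + t ^+ 2)^-1.
  rewrite (_ : F = (fun s : R => expR (- (eps * s))) \*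
     (cst (- eps^-1) \+ D *: (t *: (fun s : R => sin (t * s)) \- eps *: (fun s : R => cos (t * s))))).
    by apply: is_derive_eq; rewrite /GRing.scale/= /GRing.scale/= /f /D; field; rewrite d0.
  by apply/funext => s; rewrite /F /D /= /GRing.scale/= /GRing.scale/= [in RHS](mulrC _^-1).
have ce : expR (- (eps * x)) @[x --> +oo] --> (0 : R).
  have h : (eps * s : R) @[s --> +oo] --> +oo by exact: gt0_cvgMry.
  exact: (cvg_comp (fun s : R => eps * s) (fun s : R => expR (- s)) h (@cvgr_expR R)).
pose K : R := eps^-1 + (`|t| + eps) / (eps ^+ 2 + t ^+ 2).
have ev0 : 0 <= eps^-1 by rewrite invr_ge0 (ltW e0).
have FK s : `|F s| <= expR (- (eps * s)) * K.
  rewrite /F normrM ger0_norm ?expR_ge0// ler_wpM2l ?expR_ge0//.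
  rewrite (le_trans (ler_normD _ _))// normrN (ger0_norm ev0) lerD2l.
  rewrite normrM [X in _ * X]ger0_norm ?invr_ge0 ?addr_ge0 ?sqr_ge0//.
  rewrite ler_wpM2r ?invr_ge0 ?addr_ge0 ?sqr_ge0//.
  rewrite (le_trans (ler_normB _ _))// !normrM lerD//.
    by rewrite ler_piMr// sin_max.
  by rewrite (ger0_norm (ltW e0)) ler_piMr ?(ltW e0)// cos_max.
have Fl : F x @[x --> +oo] --> (0 : R).
  have cK : expR (- (eps * x)) * K @[x --> +oo] --> (0 : R).
    by rewrite -[X in _ --> X](mul0r K); apply: cvgM => //; exact: cvg_cst.
  apply/norm_cvg0P; apply: (squeeze_cvgr _ (cvg_cst 0) cK).
  by apply: nearW => s /=; rewrite FK normr_ge0.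
have cexp : continuous (fun s : R => expR (- (eps * s))).
  by move=> s; apply: differentiable_continuous; apply/derivable1_diffP; have [] := dexp s.
have ccos : continuous (fun s : R => cos (t * s)).
  by move=> s; apply: differentiable_continuous; apply/derivable1_diffP; have [] := dcos s.
have cf s : {for s, continuous f}.
  apply: cvgM; first exact: cexp.
  by apply: cvgD; [exact: cvg_cst|exact: ccos].
have := integral_even f f0 (fun s _ => cf s).
rewrite (ge0_integral_halfline f F 0 f0 (fun s _ => cf s) dF Fl) => ->.
rewrite sub0e -EFinN -EFinM; congr EFin.
rewrite /F mulr0 oppr0 expR0 mul1r mulr0 sin0 cos0 mulr0 sub0r mulr1.
by field; rewrite d0 e1.
Qed.

Lemma continuous_exp_abs : continuous (fun s : R => expR (- (eps * `|s|))).
Proof.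
move=> x; apply: (@continuous_comp _ _ _ (fun s : R => - (eps * `|s|)) expR); last exact: continuous_expR.
by apply: cvgN; apply: cvgM; [exact: cvg_cst|exact: norm_continuous].
Qed.

Let mexp : measurable_fun setT (fun s : R => expR (- (eps * `|s|))).
Proof. exact: (continuous_measurable_fun continuous_exp_abs). Qed.
Let mcos (t : R) : measurable_fun setT (fun s : R => cos (t * s)).
Proof.
apply: (measurableT_comp (continuous_measurable_fun (@continuous_cos R))).
by apply: measurable_funM => //; exact: measurable_cst.
Qed.

(** This is the case t = 0 of [integral_exp_cos], where 1 + cos 0 = 2, halved. *)
Lemma integral_exp_abs : (\int[leb]_s (expR (- (eps * `|s|)))%:E = (2 / eps)%:E)%E.
Proof.
have := integral_exp_cos 0; under eq_integral do rewrite mul0r cos0 mulrC EFinM.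
rewrite ge0_integralZl_EFin//.
  rewrite expr0n/= addr0 (_ : 2 / eps + _ = (1 + 1) * (2 / eps)); last by field.
  move=> h; rewrite -[LHS]mul1e (_ : 1%E = (2^-1 * (1 + 1))%:E :> \bar R); last first.
    by congr EFin; lra.
  by rewrite EFinM -muleA h -EFinM; congr EFin; field.
exact/measurable_EFinP.
Qed.

Lemma integrable_exp_abs : leb.-integrable setT (fun s => (expR (- (eps * `|s|)))%:E).
Proof.
apply/integrableP; split; first exact/measurable_EFinP.
under eq_integral do rewrite gee0_abs ?lee_fin ?expR_ge0//.
by rewrite integral_exp_abs ltry.
Qed.

Lemma cintegrable_exp_abs (t : R) :
  cintegrable leb (fun s => cexpi (t * s) * ((expR (- (eps * `|s : R|)))%:C)%C).
Proof.
apply: (le_cintegrable _ _ (fun s : measurableTypeR R => expR (- (eps * `|s : R|)))).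
- apply: cmeasurableM; last exact: cmeasurable_real.
  by apply: cmeasurable_cexpi; apply: measurable_funM => //; exact: measurable_cst.
- exact: integrable_exp_abs.
- by move=> s; rewrite cabsM cabs_cexpi mul1r cabs_real ger0_norm// expR_ge0.
Qed.

Lemma cintegral_exp_abs (t : R) :
  cintegral leb (fun s => cexpi (t * s) * ((expR (- (eps * `|s : R|)))%:C)%C) =
  ((2 * pi * poisson1 eps t)%:C)%C.
Proof.
have [i1 i2] := cintegrable_exp_abs t; rewrite /cintegral; congr Complex.
  have c1 s : complex.Re (cexpi (t * s) * ((expR (- (eps * `|s : R|)))%:C)%C) =
      expR (- (eps * `|s|)) * (1 + cos (t * `|s|)) - expR (- (eps * `|s|)).
    rewrite cReM/= mulr0 subr0 mulrDr mulr1 addrC addKr mulrC; congr (_ * _).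
    by case: (ler0P s) => // _; rewrite mulrN cosN.
  transitivity (Rintegral leb setT (fun s : measurableTypeR R =>
      expR (- (eps * `|s : R|)) * (1 + cos (t * `|s : R|)) - expR (- (eps * `|s : R|)))).
    by apply: eq_Rintegral => s _; exact: c1.
  rewrite RintegralB//; last 2 first.
  - apply/integrableP; split.
      apply/measurable_EFinP; apply: measurable_funM => //.
      apply: measurable_funD; first exact: measurable_cst.
      by apply: (measurableT_comp (mcos t)); exact: normr_measurable.
    under eq_integral do rewrite gee0_abs ?lee_fin ?mulr_ge0 ?expR_ge0 -?lerBlDl ?sub0r ?cos_geN1//.
    by rewrite integral_exp_cos ltry.
  - exact: integrable_exp_abs.
  rewrite /Rintegral integral_exp_cos integral_exp_abs/= addrAC subrr add0r /poisson1.
  have p0 : pi != 0 :> R by rewrite gt_eqF// pi_gt0.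
  by move: (pi : R) p0 => P p0; field; rewrite d0 p0.
have c2 s : complex.Im (cexpi (t * s) * ((expR (- (eps * `|s : R|)))%:C)%C) =
    sin (t * s) * expR (- (eps * `|s|)).
  by rewrite cImM/= mulr0 add0r.
(* The imaginary part is the integral of an odd function, hence equal to its own opposite. *)
set J := Rintegral _ _ _; suff : J = - J by move=> /eqP; rewrite -addr_eq0 -mulr2n mulrn_eq0/= => /eqP.
rewrite {1}/J /Rintegral.
rewrite (integral_preserves _ _ _ preserves_opp); last exact: (measurable_int _ i2).
rewrite -fineN -integralN; last exact: integrable_add_def.
congr fine; apply: eq_integral => s _.
by rewrite -EFinN; congr EFin; rewrite !c2 normrN mulrN sinN mulNr.
Qed.

End ExponentialTransform.

(** * Integrals of functions that factor over the coordinates *)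

Section ProductIntegrals.
Context {R : realType}.
Local Notation C := R[i].

Lemma cmeasurable_prod d (T : measurableType d) (I : Type) (s : seq I) (F : I -> T -> C) :
  (forall i, cmeasurable (F i)) -> cmeasurable (fun x => \prod_(i <- s) F i x).
Proof.
move=> mF; elim: s => [|i s IH].
  by under eq_fun do rewrite big_nil; exact: cmeasurable_cst.
by under eq_fun do rewrite big_cons; exact: cmeasurableM.
Qed.

Lemma cintegral_prod d1 d2 (T1 : measurableType d1) (T2 : measurableType d2)
    (m1 : {sigma_finite_measure set T1 -> \bar R}) (m2 : {sigma_finite_measure set T2 -> \bar R})
    (f : T1 -> C) (g : T2 -> C) : cintegrable m1 f -> cintegrable m2 g ->
  cintegrable (product_measure m1 m2) (fun z => f z.1 * g z.2) /\
  cintegral (product_measure m1 m2) (fun z => f z.1 * g z.2) = cintegral m1 f * cintegral m2 g.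
Proof.
move=> fi gi; have mf := cintegrable_measurable _ _ fi; have mg := cintegrable_measurable _ _ gi.
have mfg : cmeasurable (fun z : T1 * T2 => f z.1 * g z.2).
  by apply: cmeasurableM; [exact: (cmeasurable_comp _ _ _ _ mf measurable_fst)|exact: (cmeasurable_comp _ _ _ _ mg measurable_snd)].
have fgi : cintegrable (m1 \x m2)%E (fun z => f z.1 * g z.2).
  apply/cintegrable_prodP => //=.
  under eq_integral => x _.
    under eq_integral do rewrite cabsM EFinM.
    rewrite ge0_integralZl_EFin ?cabs_ge0//; last 2 first.
    - by move=> y _; rewrite lee_fin cabs_ge0.
    - exact: measurable_cabsE.
    over.
  move: gi => /(cintegrableP _ _ mg); move: fi => /(cintegrableP _ _ mf).
  set I := (\int[m1]_x _)%E => Iy; set J := (\int[m2]_x _)%E => Jy.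
  have J0 : (0 <= J)%E by apply: integral_ge0 => y _; rewrite lee_fin cabs_ge0.
  rewrite ge0_integralZr//; last 2 first.
  - exact: measurable_cabsE.
  - by move=> x _; rewrite lee_fin cabs_ge0.
  rewrite lte_mul_pinfty// ?ge0_fin_numE//; apply: integral_ge0 => y _; rewrite lee_fin cabs_ge0//.
split => //; rewrite /product_measure cfubini1//=.
under eq_cintegral do rewrite cintegralZ//.
under eq_cintegral do rewrite mulrC.
by rewrite cintegralZ// mulrC.
Qed.

Lemma cintegral_config_prod n (f : 'I_n -> plane R -> C) :
  (forall k, cintegrable plane_lebesgue (f k)) ->
  cintegrable (lebesgue n) (fun x => \prod_(k < n) f k (tnth x k)) /\
  cintegral (lebesgue n) (fun x => \prod_(k < n) f k (tnth x k)) =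
    \prod_(k < n) cintegral plane_lebesgue (f k).
Proof.
elim: n f => [|n IH] f fi.
  rewrite big_ord0; under eq_fun do rewrite big_ord0; split.
    apply/cintegrableP; first exact: cmeasurable_cst.
    by rewrite /= cabs1 integral_dirac//= diracT mul1e ltry.
  rewrite /cintegral /Rintegral; congr Complex; by rewrite integral_dirac//= indicT ?mul1r ?mulr0.
have [i2 e2] := IH (fun k => f (lift ord0 k)) (fun k => fi _).
have [i e] := cintegral_prod _ _ _ _ _ _ _ _ (fi ord0) i2.
have mf : cmeasurable (fun x => \prod_(k < n.+1) f k (tnth x k)).
  apply: cmeasurable_prod => k; apply: (cmeasurable_comp _ _ (f k)).
    exact: cintegrable_measurable (fi k).
  exact: measurable_tnth.
have eP z : \prod_(k < n.+1) f k (tnth (cons_config z) k) =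
    f ord0 z.1 * \prod_(k < n) f (lift ord0 k) (tnth z.2 k).
  rewrite big_ord_recl; congr (_ * _).
  by apply: eq_bigr => k _; rewrite tnthS; congr (f _ (tnth _ _)); exact: val_inj.
split.
  apply/(cintegrable_preserves _ _ _ (preserves_cons n) _ mf).
  by under eq_fun do rewrite eP.
rewrite (cintegral_preserves _ _ _ (preserves_cons n) _ mf).
by under eq_cintegral do rewrite eP; rewrite e e2 big_ord_recl.
Qed.

Lemma ge0_integral_config_prod n (g : 'I_n -> plane R -> R) :
  (forall k, measurable_fun setT (g k)) -> (forall k a, 0 <= g k a) ->
  (\int[lebesgue n]_x (\prod_(k < n) g k (tnth x k))%:E =
   \prod_(k < n) \int[plane_lebesgue]_a (g k a)%:E)%E.
Proof.
elim: n g => [|n IH] g mg g0.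
  rewrite big_ord0; under eq_integral do rewrite big_ord0.
  by rewrite /= integral_dirac//= diracT mul1e.
have mp m' (h : 'I_m' -> plane R -> R) : (forall k, measurable_fun setT (h k)) ->
    measurable_fun setT (fun x : config R m' => \prod_(k < m') h k (tnth x k)).
  move=> mh; apply: measurable_prod => k _; apply: (measurableT_comp (mh k)).
  exact: measurable_tnth.
rewrite ge0_integral_cons; first last.
- by move=> x; rewrite lee_fin prodr_ge0.
- by apply/measurable_EFinP; exact: mp.
rewrite big_ord_recl -(IH (fun k => g (lift ord0 k)))//.
under eq_integral => a _.
  rewrite (eq_integral (fun x => (g ord0 a)%:E * (\prod_(k < n) g (lift ord0 k) (tnth x k))%:E)%E); last first.
    move=> x _; rewrite big_ord_recl EFinM; congr (_ * _%:E)%E.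
    by apply: eq_bigr => k _; rewrite tnthS; congr (g _ (tnth _ _)); exact: val_inj.
  rewrite ge0_integralZl_EFin//; last 2 first.
  - by move=> x _; rewrite lee_fin prodr_ge0.
  - by apply/measurable_EFinP; exact: (mp n (fun k => g (lift ord0 k)) (fun k => mg _)).
  over.
rewrite ge0_integralZr//.
- exact/measurable_EFinP.
- by move=> a _; rewrite lee_fin.
- by apply: integral_ge0 => x _; rewrite lee_fin prodr_ge0.
Qed.

Lemma ge0_integral_plane_prod (f g : R -> R) : measurable_fun setT f -> measurable_fun setT g ->
  (forall x, 0 <= f x) -> (forall x, 0 <= g x) ->
  (\int[plane_lebesgue]_a (f a.1 * g a.2)%:E =
   \int[lebesgue_measure]_x (f x)%:E * \int[lebesgue_measure]_x (g x)%:E)%E.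
Proof.
move=> mf mg f0 g0; rewrite ge0_integral_prod; first last.
- by move=> x; rewrite lee_fin mulr_ge0.
- apply/measurable_EFinP; apply: measurable_funM.
    exact: (measurableT_comp mf measurable_fst).
  exact: (measurableT_comp mg measurable_snd).
set J := (\int[lebesgue_measure]_x (g x)%:E)%E.
transitivity (\int[lebesgue_measure]_x ((f x)%:E * J))%E.
  apply: eq_integral => x _; rewrite /J -ge0_integralZl_EFin//.
    by move=> y _; rewrite lee_fin.
  exact/measurable_EFinP.
rewrite ge0_integralZr//.
- exact/measurable_EFinP.
- by move=> a _; rewrite lee_fin.
- by apply: integral_ge0 => x _; rewrite lee_fin.
Qed.

End ProductIntegrals.

Lemma conjcM (R : realType) (a b : R[i]) : conjc (a * b) = conjc a * conjc b.
Proof. exact: rmorphM. Qed.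

Lemma complexM (R : realType) (a b : R) : ((a * b)%:C = a%:C * b%:C)%C.
Proof. exact: rmorphM. Qed.

Section PoissonKernel.
Context {R : realType} {n : nat}.
Local Notation C := R[i].
Local Notation mu := (@lebesgue R n).

Definition l1norm (q : config R n) : R := \sum_(k < n) (`|(tnth q k).1 : R| + `|(tnth q k).2 : R|).

Definition damping (eps : R) (q : config R n) : R := expR (- (eps * l1norm q)).

Definition poisson (eps : R) (x y : config R n) : R :=
  \prod_(k < n) (poisson1 eps ((tnth x k).1 - (tnth y k).1 : R) *
                 poisson1 eps ((tnth x k).2 - (tnth y k).2 : R)).

Lemma l1norm_ge0 q : 0 <= l1norm q.
Proof. by apply: sumr_ge0 => k _; rewrite addr_ge0. Qed.

Lemma damping_ge0 eps q : 0 <= damping eps q. Proof. exact: expR_ge0. Qed.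

Lemma damping_le1 eps q : 0 < eps -> damping eps q <= 1.
Proof. by move=> e0; rewrite -expR0 ler_expR oppr_le0 mulr_ge0 ?l1norm_ge0// ltW. Qed.

Lemma poisson1N (eps t : R) : poisson1 eps (- t) = poisson1 eps t.
Proof. by rewrite /poisson1 sqrrN. Qed.

Lemma poisson_sym eps x y : poisson eps x y = poisson eps y x.
Proof.
by apply: eq_bigr => k _; rewrite -poisson1N opprB -[poisson1 eps (_ - (tnth y k).2)]poisson1N opprB.
Qed.

Lemma poisson_ge0 eps x y : 0 < eps -> 0 <= poisson eps x y.
Proof. by move=> e0; apply: prodr_ge0 => k _; rewrite mulr_ge0// poisson1_ge0. Qed.

Lemma measurable_damping eps d (T : measurableType d) (f : T -> config R n) :
  measurable_fun setT f -> measurable_fun setT (fun x => damping eps (f x)).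
Proof.
move=> mf; apply: (measurableT_comp (@measurable_expR R)); apply: measurable_funN.
apply: measurable_funM; first exact: measurable_cst.
apply: measurable_sum => k; apply: measurable_funD; apply: (measurableT_comp (@normr_measurable R setT)).
  by apply: measurable_plane_fst; exact: measurable_tnth_comp.
by apply: measurable_plane_snd; exact: measurable_tnth_comp.
Qed.

Lemma measurable_poisson eps d (T : measurableType d) (f g : T -> config R n) : 0 < eps ->
  measurable_fun setT f -> measurable_fun setT g ->
  measurable_fun setT (fun x => poisson eps (f x) (g x)).
Proof.
move=> e0 mf mg; have mp : measurable_fun setT (poisson1 eps).
  by apply: continuous_measurable_fun; exact: continuous_poisson1.
apply: measurable_prod => k _; apply: measurable_funM; apply: (measurableT_comp mp); apply: measurable_funB.
- by apply: measurable_plane_fst; exact: measurable_tnth_comp.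
- by apply: measurable_plane_fst; exact: measurable_tnth_comp.
- by apply: measurable_plane_snd; exact: measurable_tnth_comp.
- by apply: measurable_plane_snd; exact: measurable_tnth_comp.
Qed.

Lemma cexpi_sum (I : Type) (s : seq I) (F : I -> R) :
  cexpi (\sum_(i <- s) F i) = \prod_(i <- s) cexpi (F i).
Proof.
elim: s => [|i s IH]; first by rewrite !big_nil cexpi0.
by rewrite !big_cons cexpiD IH.
Qed.

(** Phase and damping both factor over the 2n real coordinates, thanks to the 1-norm in the damping;
    each coordinate contributes 2 pi times a Cauchy density. *)
Lemma damping_transform (eps : R) (x y : config R n) : 0 < eps ->
  cintegrable mu (fun q => cexpi (dot y q - dot x q) * ((damping eps q)%:C)%C) /\
  cintegral mu (fun q => cexpi (dot y q - dot x q) * ((damping eps q)%:C)%C) =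
    (((2 * pi) ^+ (2 * n) * poisson eps x y)%:C)%C.
Proof.
move=> e0.
pose g (t s : R) : C := cexpi (t * s) * ((expR (- (eps * `|s|)))%:C)%C.
pose f (k : 'I_n) (a : plane R) : C :=
  g ((tnth y k).1 - (tnth x k).1) a.1 * g ((tnth y k).2 - (tnth x k).2) a.2.
have ff k := cintegral_prod _ _ _ _ _ _ _ _
  (cintegrable_exp_abs eps e0 ((tnth y k).1 - (tnth x k).1))
  (cintegrable_exp_abs eps e0 ((tnth y k).2 - (tnth x k).2)).
have [i e] := cintegral_config_prod n f (fun k => (ff k).1).
have eF : (fun q => cexpi (dot y q - dot x q) * ((damping eps q)%:C)%C) =
    (fun q => \prod_(k < n) f k (tnth q k)).
  apply/funext => q; rewrite /dot -sumrB cexpi_sum /damping /l1norm mulr_sumr -sumrN.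
  rewrite expR_sum rmorph_prod -big_split/=; apply: eq_bigr => k _.
  rewrite /f /g mulrACA -cexpiD; congr (cexpi _ * _).
    by rewrite /dot2; ring.
  by rewrite mulrDr opprD expRD rmorphM.
rewrite eF; split => //; rewrite e.
have -> : (2 * pi) ^+ (2 * n) = \prod_(k < n) (2 * pi) ^+ 2 :> R.
  by rewrite prodr_const card_ord exprM.
rewrite -big_split/= rmorph_prod.
apply: eq_bigr => k _; rewrite (ff k).2 !cintegral_exp_abs// -rmorphM; congr (_%:C)%C.
rewrite -[poisson1 eps ((tnth y k).1 - _)]poisson1N -[poisson1 eps ((tnth y k).2 - _)]poisson1N.
by rewrite !opprB; ring.
Qed.

Lemma integral_poisson (eps : R) (x : config R n) : 0 < eps ->
  (\int[mu]_y (poisson eps x y)%:E = 1)%E.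
Proof.
move=> e0; have mp (c : R) : measurable_fun setT (fun t : R => poisson1 eps (c - t)).
  apply: (measurableT_comp (continuous_measurable_fun (continuous_poisson1 eps e0))).
  by apply: measurable_funB => //; exact: measurable_cst.
pose g (k : 'I_n) (a : plane R) : R :=
  poisson1 eps ((tnth x k).1 - a.1) * poisson1 eps ((tnth x k).2 - a.2).
rewrite (ge0_integral_config_prod n g).
- rewrite big1// => k _.
  rewrite (ge0_integral_plane_prod (fun t => poisson1 eps ((tnth x k).1 - t)) (fun t => poisson1 eps ((tnth x k).2 - t)))//.
  + by rewrite !integral_poisson1// mule1.
  + by move=> t; exact: poisson1_ge0.
  + by move=> t; exact: poisson1_ge0.
- move=> k; apply: measurable_funM.
    exact: (measurableT_comp (mp _) measurable_fst).
  exact: (measurableT_comp (mp _) measurable_snd).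
- by move=> k a; rewrite mulr_ge0// poisson1_ge0.
Qed.

End PoissonKernel.

(** * Plancherel's theorem *)

Section FourierIntegral.
Context {R : realType} {n : nat}.
Local Notation C := R[i].
Local Notation mu := (@lebesgue R n).
Local Notation N2 f := (@Lp_norm R n 2 f%R).
Local Notation FI := (@fourier_integral R n).
Implicit Types f h : cfun R n.

Lemma Lp1P f : Lp 1 f <-> cintegrable mu f.
Proof.
rewrite /Lp /Lp_norm; split=> [[mf]|fi].
  rewrite Lnorm1 => fy; apply/cintegrableP => //; apply: le_lt_trans fy.
  by under [leRHS]eq_integral do rewrite gee0_abs ?lee_fin ?cabs_ge0//.
split; first exact: cintegrable_measurable fi.
rewrite Lnorm1; under eq_integral do rewrite gee0_abs ?lee_fin ?cabs_ge0//.
by apply/cintegrableP => //; exact: cintegrable_measurable fi.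
Qed.

Definition fourier_cst : R := (2 * pi) ^- n.

Lemma cmeasurable_phase d (T : measurableType d) (a b : T -> config R n) :
  measurable_fun setT a -> measurable_fun setT b ->
  cmeasurable (fun x => cexpi (- dot (a x) (b x)) : C).
Proof.
by move=> ma mb; apply: cmeasurable_cexpi; apply: measurable_funN; exact: measurable_dot.
Qed.

Lemma cmeasurable_fourier_integral f : cmeasurable f -> cmeasurable (FI f).
Proof.
move=> mf; apply: cmeasurableM; first exact: cmeasurable_cst.
apply: (cmeasurable_param_cintegral _ (fun z : config R n * config R n => cexpi (- dot z.2 z.1) * f z.2)).
apply: cmeasurableM; first exact: cmeasurable_phase.
exact: (cmeasurable_comp _ _ _ _ mf measurable_snd).
Qed.

Lemma cintegrable_phase f q : cintegrable mu f ->
  cintegrable mu (fun y => cexpi (- dot y q) * f y).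
Proof.
move=> fi; apply: (cintegrableM_bounded _ _ _ 1) => //.
  by apply: cmeasurable_phase => //; exact: measurable_cst.
by move=> y; rewrite cabs_cexpi.
Qed.

Lemma fourier_integral_lin (c : C) f h q : cintegrable mu f -> cintegrable mu h ->
  FI (fun x => c * f x + h x) q = c * FI f q + FI h q.
Proof.
move=> fi hi; rewrite /fourier_integral mulrCA -mulrDr; congr (_ * _).
rewrite -cintegralZ; last exact: cintegrable_phase.
rewrite -cintegralD; [|exact: cintegrableZ (cintegrable_phase _ _ fi)|exact: cintegrable_phase].
by apply: eq_cintegral => y; rewrite mulrDr mulrCA.
Qed.

Lemma fourier_integralB f h q : cintegrable mu f -> cintegrable mu h ->
  FI (fun x => f x - h x) q = FI f q - FI h q.
Proof.
move=> fi hi; have -> : (fun x => f x - h x) = (fun x => -1 * h x + f x).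
  by apply/funext => x; rewrite mulN1r [RHS]addrC.
by rewrite (fourier_integral_lin (-1) h f q hi fi) mulN1r [LHS]addrC.
Qed.

Lemma fourier_integral_bounded f : cintegrable mu f ->
  exists K : R, forall q, cabs (FI f q) <= K.
Proof.
move=> fi; have /integrableP[_] := cintegrable_cabs _ _ fi.
set I := (\int[mu]_x _)%E => Iy; exists (`|fourier_cst| * fine I) => q.
rewrite /fourier_integral cabsM cabs_real ler_wpM2l// -lee_fin fineK; last first.
  by rewrite ge0_fin_numE//; apply: integral_ge0.
rewrite (le_trans (cabs_cintegral _ _ (cintegrable_phase _ q fi)))//.
rewrite le_eqVlt; apply/orP; left; apply/eqP; apply: eq_integral => y _.
by rewrite cabsM cabs_cexpi mul1r gee0_abs// lee_fin cabs_ge0.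
Qed.

Lemma cintegrable_fourierM f h : cintegrable mu f -> cintegrable mu h ->
  cintegrable mu (fun q => FI f q * h q).
Proof.
move=> fi hi; have [K hK] := fourier_integral_bounded f fi.
apply: (cintegrableM_bounded _ _ _ K) => //.
by apply: cmeasurable_fourier_integral; exact: cintegrable_measurable fi.
Qed.

(** Both sides are the integral of c exp (- i y.q) f(y) h(q) over the product space, c being the
    normalising constant, taken in the two orders. *)
Lemma fourier_multiplication f h : cintegrable mu f -> cintegrable mu h ->
  cintegral mu (fun q => FI f q * h q) = cintegral mu (fun x => f x * FI h x).
Proof.
move=> fi hi; have mf := cintegrable_measurable _ _ fi; have mh := cintegrable_measurable _ _ hi.
pose F (z : config R n * config R n) : C :=
  ((fourier_cst%:C)%C * cexpi (- dot z.2 z.1)) * (h z.1 * f z.2).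
have iF : cintegrable (product_measure mu mu) F.
  apply: (cintegrableM_bounded _ _ _ `|fourier_cst|).
  - by have [] := cintegral_prod _ _ _ _ _ _ _ _ hi fi.
  - by apply: cmeasurableM; [exact: cmeasurable_cst|exact: cmeasurable_phase].
  - by move=> z; rewrite cabsM cabs_real cabs_cexpi mulr1.
have -> : cintegral mu (fun q => FI f q * h q) = cintegral mu (fun q => cintegral mu (fun y => F (q, y))).
  apply: eq_cintegral => q; rewrite /fourier_integral mulrC mulrCA.
  rewrite -cintegralZ; last exact: cintegrable_phase.
  rewrite -cintegralZ; last exact: cintegrableZ (cintegrable_phase _ _ fi).
  by apply: eq_cintegral => y; rewrite /F/= -!mulrA; congr (_ * _); rewrite mulrCA.
rewrite -(cfubini1 mu mu F iF) (cfubini2 mu mu F iF).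
apply: eq_cintegral => y; rewrite /fourier_integral mulrCA.
rewrite -cintegralZ; last exact: cintegrable_phase.
rewrite -cintegralZ; last exact: cintegrableZ (cintegrable_phase _ _ hi).
apply: eq_cintegral => q; rewrite /F/= -!mulrA; congr (_ * _).
rewrite [RHS]mulrCA [f y * _]mulrC; congr (cexpi (- _) * _).
by rewrite /dot; apply: eq_bigr => k _; rewrite /dot2 mulrC [X in _ + X]mulrC.
Qed.

Lemma cintegrable_damping (eps : R) : 0 < eps -> cintegrable mu (fun q => ((damping eps q)%:C)%C).
Proof.
move=> e0; have x0 : config R n by exact: [tuple (0, 0) | _ < n].
have [i _] := damping_transform eps x0 x0 e0.
by move: i; congr cintegrable; apply/funext => q; rewrite subrr cexpi0 mul1r.
Qed.

Lemma cintegrable_damped (eps : R) h : 0 < eps -> cintegrable mu h ->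
  cintegrable mu (fun q => conjc (FI h q) * ((damping eps q)%:C)%C).
Proof.
move=> e0 hi; have [K hK] := fourier_integral_bounded h hi.
apply: (cintegrableM_bounded _ _ _ K); first exact: cintegrable_damping.
  by apply: cmeasurableJ; apply: cmeasurable_fourier_integral; exact: cintegrable_measurable hi.
by move=> q; rewrite cabsJ.
Qed.

(** Inversion with a damping factor: in the double integral, doing the momentum integration first
    produces the Poisson kernel, and the two normalising constants cancel its factor (2 pi)^(2n). *)
Lemma fourier_damped (eps : R) h x : 0 < eps -> cintegrable mu h ->
  FI (fun q => conjc (FI h q) * ((damping eps q)%:C)%C) x =
  cintegral mu (fun y => conjc (h y) * ((poisson eps x y)%:C)%C).
Proof.
move=> e0 hi; have ki := cintegrable_damped _ _ e0 hi; have mh := cintegrable_measurable _ _ hi.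
pose F (z : config R n * config R n) : C :=
  (((fourier_cst ^+ 2)%:C)%C * cexpi (dot z.2 z.1 - dot x z.1)) * (((damping eps z.1)%:C)%C * conjc (h z.2)).
have iF : cintegrable (product_measure mu mu) F.
  apply: (cintegrableM_bounded _ _ _ `|fourier_cst ^+ 2|).
  - by have [] := cintegral_prod _ _ _ _ _ _ _ _ (cintegrable_damping _ e0) (cintegrableJ _ _ hi).
  - apply: cmeasurableM; first exact: cmeasurable_cst.
    apply: cmeasurable_cexpi; apply: measurable_funB; apply: measurable_dot => //.
  - by move=> z; rewrite cabsM cabs_real cabs_cexpi mulr1.
have dotC (u v : config R n) : dot u v = dot v u.
  by rewrite /dot; apply: eq_bigr => k _; rewrite /dot2 mulrC [X in _ + X]mulrC.
transitivity (cintegral mu (fun q => cintegral mu (fun y => F (q, y)))).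
  rewrite /fourier_integral -cintegralZ; last exact: cintegrable_phase.
  apply: eq_cintegral => q.
  have e1 : conjc (FI h q) =
      (fourier_cst%:C)%C * cintegral mu (fun y => conjc (cexpi (- dot y q) * h y)).
    rewrite cintegralJ; last exact: cintegrable_phase.
    by rewrite /fourier_integral rmorphM; congr (_ * _); rewrite /fourier_cst; apply/complex_eq; rewrite /= ?oppr0.
  have e2 y : F (q, y) = ((fourier_cst%:C)%C * (fourier_cst%:C)%C * cexpi (- dot q x) * ((damping eps q)%:C)%C) *
      conjc (cexpi (- dot y q) * h y).
    rewrite conjcM conj_cexpi opprK (dotC q x).
    transitivity (((fourier_cst ^+ 2)%:C)%C * cexpi (dot y q - dot x q) * (((damping eps q)%:C)%C * conjc (h y))) => //.
    by rewrite cexpiD expr2 complexM; ring.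
  rewrite (eq_cintegral _ _ _ e2) cintegralZ ?e1//; first by ring.
  by apply: cintegrableJ; exact: cintegrable_phase.
rewrite -(cfubini1 mu mu F iF) (cfubini2 mu mu F iF).
apply: eq_cintegral => y.
have [i e] := damping_transform eps x y e0.
transitivity (cintegral mu (fun q => (((fourier_cst ^+ 2)%:C)%C * conjc (h y)) *
    (cexpi (dot y q - dot x q) * ((damping eps q)%:C)%C))).
  by apply: eq_cintegral => q; rewrite /F/=; ring.
rewrite cintegralZ// e [_ * conjc _]mulrC -mulrA -complexM; congr (_ * (_%:C)%C).
rewrite /fourier_cst -exprVn -exprM mulnC mulrA -exprMn mulVf ?expr1n ?mul1r//.
by rewrite mulf_neq0// gt_eqF// pi_gt0.
Qed.

Lemma fourier_pairing (eps : R) f h : 0 < eps -> cintegrable mu f -> cintegrable mu h ->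
  cintegral mu (fun q => FI f q * (conjc (FI h q) * ((damping eps q)%:C)%C)) =
  cintegral mu (fun x => f x * cintegral mu (fun y => conjc (h y) * ((poisson eps x y)%:C)%C)).
Proof.
move=> e0 fi hi; rewrite (fourier_multiplication f _ fi (cintegrable_damped _ _ e0 hi)).
by apply: eq_cintegral => x; rewrite fourier_damped.
Qed.

End FourierIntegral.

Section ComplexLimits.
Context {R : realType} {d} {T : measurableType d}.
Variable mu : {measure set T -> \bar R}.
Local Notation C := R[i].

(** Without integrability the right-hand side is +oo, and the estimate holds trivially. *)
Lemma cabs_cintegral_le (f : T -> C) : cmeasurable f ->
  ((cabs (cintegral mu f))%:E <= \int[mu]_x (cabs (f x))%:E)%E.
Proof.
move=> mf; have [fy|] := ltP (\int[mu]_x (cabs (f x))%:E)%E +oo%E.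
  by apply: cabs_cintegral; apply/cintegrableP.
by rewrite leye_eq => /eqP ->; rewrite leey.
Qed.

Lemma cintegral_ge0 (G : T -> R) :
  cintegral mu (fun x => ((G x)%:C)%C) = ((fine (\int[mu]_x (G x)%:E)%E)%:C)%C.
Proof. by apply: complex_eq => //=; rewrite /Rintegral integral0. Qed.

Lemma cabs_cintegral_ge0 (G : T -> R) : (forall x, 0 <= G x) ->
  cintegrable mu (fun x => ((G x)%:C)%C) ->
  ((cabs (cintegral mu (fun x => ((G x)%:C)%C)))%:E = \int[mu]_x (G x)%:E)%E.
Proof.
move=> G0 [Gi _]; have I0 : (0 <= \int[mu]_x (G x)%:E)%E by apply: integral_ge0 => x _; rewrite lee_fin.
rewrite cintegral_ge0 cabs_real ger0_norm ?fine_ge0// fineK//.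
exact: (integrable_fin_num measurableT Gi).
Qed.

Lemma cvg_cabs_unique (a : nat -> C) (A B : C) :
  (cabs (a k - A))%:E @[k --> \oo] --> 0%E -> (cabs (a k - B))%:E @[k --> \oo] --> 0%E -> A = B.
Proof.
move=> hA hB; have h : ((cabs (a k - A))%:E + (cabs (a k - B))%:E)%E @[k --> \oo] --> (0 + 0)%E.
  exact: cvgeD.
have le0 : ((cabs (A - B))%:E <= 0 + 0)%E.
  rewrite -(cvg_lim _ h)//; apply: lime_ge; first by apply/cvg_ex; exists (0 + 0)%E.
  apply: nearW => k; rewrite -EFinD lee_fin [cabs (a k - A)]cabsBC.
  by rewrite (le_trans _ (cabsD _ _))// subrKA.
apply/eqP; rewrite -subr_eq0 -cabs_eq0; move: le0; rewrite adde0 lee_fin => h0.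
by rewrite eq_le h0 cabs_ge0.
Qed.

(** Dominated convergence: weights in [0, 1] differ by at most 1, so |f| dominates. It is used with
    the damping factors, and with the Poisson averages of the indicator of a box. *)
Lemma cintegral_weight_cvg (f : T -> C) (c_ : nat -> T -> R) (c : T -> R) :
  cintegrable mu f -> (forall k, measurable_fun setT (c_ k)) -> measurable_fun setT c ->
  (forall k x, 0 <= c_ k x <= 1) -> (forall x, 0 <= c x <= 1) ->
  {ae mu, forall x, c_ k x @[k --> \oo] --> c x} ->
  (cabs (cintegral mu (fun x => ((c_ k x)%:C)%C * f x) -
         cintegral mu (fun x => ((c x)%:C)%C * f x)))%:E @[k --> \oo] --> 0%E.
Proof.
move=> fi mc_ mc c_01 c01 cc; have mf := cintegrable_measurable _ _ fi.
have cfi (w : T -> R) : measurable_fun setT w -> (forall x, 0 <= w x <= 1) ->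
    cintegrable mu (fun x => ((w x)%:C)%C * f x).
  move=> mw w01; apply: (cintegrableM_bounded _ _ _ 1) => //.
  by move=> x; rewrite cabs_real ger0_norm; case/andP: (w01 x).
have mh k : measurable_fun setT (fun x => (`|c_ k x - c x| * cabs (f x))%:E).
  apply/measurable_EFinP; apply: measurable_funM; last exact: measurable_cabs.
  by apply: (measurableT_comp (@normr_measurable R setT)); exact: measurable_funB.
have [] := @dominated_convergence _ _ _ mu setT measurableT
  (fun k x => (`|c_ k x - c x| * cabs (f x))%:E) (cst 0%E) (fun x => (cabs (f x))%:E) mh.
- exact: measurable_cst.
- apply: filterS cc => x cx _; apply: cvg_EFin; first by apply: nearW.
  rewrite (_ : (_ \o _) = (fun k => `|c_ k x - c x| * cabs (f x))) // -(mul0r (cabs (f x))).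
  apply: cvgM; last exact: cvg_cst.
  rewrite -(normr0 R) -(subrr (c x)); apply: cvg_norm; apply: cvgB => //; exact: cvg_cst.
- exact: cintegrable_cabs.
- apply: aeW => x k _; rewrite lee_fin normrM normr_id [X in _ * X]ger0_norm ?cabs_ge0//.
  apply: ler_piMl; first exact: cabs_ge0.
  by rewrite ler_norml; have := c_01 k x; have := c01 x; lra.
move=> _ _; rewrite integral0 => cv0.
apply: (@squeeze_cvge _ _ _ _ (cst 0%E) _ _ _ _ _ cv0); last exact: cvg_cst.
apply: nearW => k; rewrite lee_fin cabs_ge0/=.
have i1 := cfi _ (mc_ k) (c_01 k); have i2 := cfi _ mc c01.
have i3 : cintegrable mu (fun x => - (((c x)%:C)%C * f x)).
  have := cintegrableZ _ (-1) _ i2; congr cintegrable; apply/funext => x; exact: mulN1r.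
rewrite -cintegralN// -cintegralD// (le_trans (cabs_cintegral_le _ _))//.
  by apply: cmeasurableD; apply: cintegrable_measurable; [exact: i1|exact: i3].
rewrite le_eqVlt; apply/orP; left; apply/eqP; apply: eq_integral => x _.
by rewrite -mulrBl -rmorphB cabsM cabs_real.
Qed.

End ComplexLimits.

Section Contraction.
Context {R : realType} {n : nat}.
Local Notation C := R[i].
Local Notation mu := (@lebesgue R n).
Local Notation N2 f := (@Lp_norm R n 2 f%R).
Local Notation FI := (@fourier_integral R n).

Lemma damping_cvg (q : config R n) : damping (harmonic k) q @[k --> \oo] --> (1 : R).
Proof.
have h : (- (harmonic k * l1norm q) : R) @[k --> \oo] --> (0 : R).
  rewrite -[X in _ --> X]oppr0 -[X in _ --> - X](mul0r (l1norm q)); apply: cvgN.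
  by apply: cvgM; [exact: cvg_harmonic|exact: cvg_cst].
have := cvg_comp _ _ h (@continuous_expR R 0).
by rewrite expR0.
Qed.

(* The damped energy is the pairing of [f] with its Poisson regularisation; bound
   |f x| |f y| by (|f x|^2 + |f y|^2) / 2 and use that the kernel has mass one. *)
Lemma energy_damped_le (eps : R) (f : cfun R n) : 0 < eps -> cintegrable mu f ->
  (\int[mu]_q (cabs (FI f q) ^+ 2 * damping eps q)%:E <= energy f)%E.
Proof.
move=> e0 fi; have mf := cintegrable_measurable _ _ fi.
have eG q : FI f q * (conjc (FI f q) * ((damping eps q)%:C)%C) =
    ((cabs (FI f q) ^+ 2 * damping eps q)%:C)%C.
  by rewrite mulrA [FI f q * _]mulrC conj_mulE complexM.
have ki := cintegrable_damped _ _ e0 fi.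
have iG : cintegrable mu (fun q => ((cabs (FI f q) ^+ 2 * damping eps q)%:C)%C).
  by have := cintegrable_fourierM f _ fi ki; congr cintegrable; apply/funext.
rewrite -(cabs_cintegral_ge0 _ _ _ iG); last by move=> q; rewrite mulr_ge0 ?sqr_ge0 ?damping_ge0.
rewrite -(eq_cintegral _ _ _ eG) (fourier_multiplication _ _ fi ki).
have mK : cmeasurable (fun x => f x * FI (fun q => conjc (FI f q) * ((damping eps q)%:C)%C) x).
  by apply: cmeasurableM => //; apply: cmeasurable_fourier_integral; exact: cintegrable_measurable ki.
apply: (le_trans (cabs_cintegral_le _ _ mK)).
have mp : measurable_fun setT (fun z : config R n * config R n => poisson eps z.1 z.2).
  exact: measurable_poisson.
have mf1 : measurable_fun setT (fun z : config R n * config R n => cabs (f z.1) ^+ 2).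
  by apply: measurable_cabs_sqr; exact: (cmeasurable_comp _ _ _ _ mf measurable_fst).
have mf2 : measurable_fun setT (fun z : config R n * config R n => cabs (f z.2) ^+ 2).
  by apply: measurable_cabs_sqr; exact: (cmeasurable_comp _ _ _ _ mf measurable_snd).
pose A (z : config R n * config R n) : \bar R := (cabs (f z.1) ^+ 2 * poisson eps z.1 z.2)%:E.
pose B (z : config R n * config R n) : \bar R := (cabs (f z.2) ^+ 2 * poisson eps z.1 z.2)%:E.
have A0 z : (0 <= A z)%E by rewrite lee_fin mulr_ge0 ?sqr_ge0 ?poisson_ge0.
have B0 z : (0 <= B z)%E by rewrite lee_fin mulr_ge0 ?sqr_ge0 ?poisson_ge0.
have mA : measurable_fun setT A by apply/measurable_EFinP; exact: measurable_funM.
have mB : measurable_fun setT B by apply/measurable_EFinP; exact: measurable_funM.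
have mAx x : measurable_fun setT (fun y => A (x, y)).
  exact: (measurableT_comp mA (pair1_measurable x)).
have mBx x : measurable_fun setT (fun y => B (x, y)).
  exact: (measurableT_comp mB (pair1_measurable x)).
have eA : (\int[mu]_x \int[mu]_y A (x, y) = energy f)%E.
  apply: eq_integral => x _; rewrite /A/=.
  under eq_integral do rewrite EFinM.
  rewrite ge0_integralZl_EFin ?sqr_ge0//; first by rewrite integral_poisson// mule1.
    by move=> y _; rewrite lee_fin poisson_ge0.
  apply/measurable_EFinP; apply: measurable_poisson => //; exact: measurable_cst.
have eB : (\int[mu]_x \int[mu]_y B (x, y) = energy f)%E.
  rewrite (fubini_tonelli B mB B0) -eA; apply: eq_integral => x _.
  by apply: eq_integral => y _; rewrite /A /B/= poisson_sym.
have mIA : measurable_fun setT (fun x => \int[mu]_y A (x, y))%E by exact: measurable_param_integral.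
have mIB : measurable_fun setT (fun x => \int[mu]_y B (x, y))%E by exact: measurable_param_integral.
have IA0 x : (0 <= \int[mu]_y A (x, y))%E by exact: integral_ge0.
have IB0 x : (0 <= \int[mu]_y B (x, y))%E by exact: integral_ge0.
(* Both double integrals equal [energy f], so the energy is half of their sum; the identity also has
   to be checked when the energy is infinite. *)
have -> : energy f = (\int[mu]_x (2^-1%:E * (\int[mu]_y A (x, y) + \int[mu]_y B (x, y))))%E.
  rewrite ge0_integralZl_EFin//; last by apply: emeasurable_funD.
    rewrite ge0_integralD// eA eB; move: (energy_ge0 f).
    case: (energy f) => [r _| |]//; last by rewrite addye// gt0_muley// lte_fin.
    by rewrite -EFinD -EFinM; congr EFin; lra.
  by move=> x _; rewrite adde_ge0.
apply: ge0_le_integral => //.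
- by move=> x _; rewrite lee_fin cabs_ge0.
- by apply/measurable_EFinP; exact: measurable_cabs.
- by apply: measurable_funeM; exact: emeasurable_funD.
move=> x _; rewrite (fourier_damped _ _ _ e0 fi) cabsM EFinM -ge0_integralD//.
rewrite -ge0_integralZl_EFin//; [|by move=> y _; rewrite adde_ge0|exact: emeasurable_funD].
have mpx : measurable_fun setT (fun y => poisson eps x y).
  by apply: measurable_poisson => //; exact: measurable_cst.
have mI : cmeasurable (fun y => conjc (f y) * ((poisson eps x y)%:C)%C).
  by apply: cmeasurableM; [exact: cmeasurableJ|exact: cmeasurable_real].
have mI' := measurable_cabsE _ mI.
apply: (le_trans (lee_wpmul2l _ (cabs_cintegral_le mu _ mI))); first by rewrite lee_fin cabs_ge0.
rewrite -ge0_integralZl_EFin ?cabs_ge0//; last by move=> y _; rewrite lee_fin cabs_ge0.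
apply: ge0_le_integral => //.
- by move=> y _; rewrite -EFinM lee_fin mulr_ge0 ?cabs_ge0.
- by apply: measurable_funeM.
- by apply: measurable_funeM; exact: emeasurable_funD.
move=> y _; rewrite /A /B/= -EFinD -!EFinM lee_fin cabsM cabsJ cabs_real ger0_norm ?poisson_ge0//.
have := poisson_ge0 eps x y e0; have := sqr_ge0 (cabs (f x) - cabs (f y)); nra.
Qed.

(** With [eps] equal to [harmonic k], that is 1/(k + 1), the damping factors increase to 1, and
    monotone convergence removes them from [energy_damped_le]. *)
Lemma fourier_integral_contraction (f : cfun R n) : cintegrable mu f -> (N2 (FI f) <= N2 f)%E.
Proof.
move=> fi; have mf := cintegrable_measurable _ _ fi.
have mF : cmeasurable (FI f) by exact: cmeasurable_fourier_integral.
rewrite -[leRHS]mul1e; apply: Lp_norm2_le_energy => //; rewrite expr1n mul1e.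
pose g k q : \bar R := (cabs (FI f q) ^+ 2 * damping (harmonic k) q)%:E.
have -> : energy (FI f) = (\int[mu]_q limn (g^~ q))%E.
  apply: eq_integral => q _; apply/esym/cvg_lim => //; apply: cvg_EFin; first exact: nearW.
  rewrite -[X in _ --> X]mulr1; apply: cvgM; first exact: cvg_cst.
  exact: damping_cvg.
have h0 k : 0 < harmonic k :> R by exact: harmonic_gt0.
rewrite (monotone_convergence mu measurableT).
- apply: lime_le; last by apply: nearW => k; exact: energy_damped_le.
  apply: ereal_nondecreasing_is_cvgn => k l kl; apply: ge0_le_integral => //.
  + by move=> q _; rewrite lee_fin mulr_ge0 ?sqr_ge0 ?damping_ge0.
  + by apply/measurable_EFinP; apply: measurable_funM; [exact: measurable_cabs_sqr|exact: measurable_damping].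
  + by apply/measurable_EFinP; apply: measurable_funM; [exact: measurable_cabs_sqr|exact: measurable_damping].
  move=> q _; rewrite lee_fin ler_wpM2l ?sqr_ge0// ler_expR lerN2 ler_wpM2r ?l1norm_ge0//.
  by rewrite /= lef_pV2 ?posrE// ler_nat ltnS.
- move=> k; apply/measurable_EFinP; apply: measurable_funM; first exact: measurable_cabs_sqr.
  exact: measurable_damping.
- by move=> k q _; rewrite lee_fin mulr_ge0 ?sqr_ge0 ?damping_ge0.
- move=> q _ k l kl; rewrite lee_fin ler_wpM2l ?sqr_ge0// ler_expR lerN2 ler_wpM2r ?l1norm_ge0//.
  by rewrite /= lef_pV2 ?posrE// ler_nat ltnS.
Qed.

End Contraction.

(** * Inversion tested on indicators of boxes *)

Section PoissonInterval.
Context {R : realType}.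

(** The mass that the Cauchy density centred at [c] gives to ]a, b], in closed form so that its
    limit can be read off the arctangent. *)
Definition poisson_itv (eps a b c : R) : R :=
  if a < b then (atan ((b - c) / eps) - atan ((a - c) / eps)) / pi else 0.

Lemma poisson_itv01 eps a b c : 0 < eps -> 0 <= poisson_itv eps a b c <= 1.
Proof.
move=> e0; rewrite /poisson_itv -!lee_fin -(integral_poisson1_itv eps c a b e0).
have p0 t : (0 <= (poisson1 eps (c - t))%:E)%E by rewrite lee_fin poisson1_ge0.
rewrite integral_ge0//= -(integral_poisson1 eps c e0).
apply: ge0_subset_integral => //; apply/measurable_EFinP.
apply: (measurableT_comp (continuous_measurable_fun (continuous_poisson1 eps e0))).
by apply: measurable_funB => //; exact: measurable_cst.
Qed.

Lemma measurable_poisson_itv eps a b d (T : measurableType d) (f : T -> R) :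
  measurable_fun setT f -> measurable_fun setT (fun x => poisson_itv eps a b (f x)).
Proof.
move=> mf; rewrite /poisson_itv; case: (a < b); last exact: measurable_cst.
have matan : measurable_fun setT (@atan R).
  by apply: continuous_measurable_fun => x; exact: continuous_atan.
apply: measurable_funM; last exact: measurable_cst.
by apply: measurable_funB; apply: (measurableT_comp matan); apply: measurable_funM;
  try exact: measurable_cst; apply: measurable_funB => //; exact: measurable_cst.
Qed.

Lemma cvg_atan_scaled (s : R) : s != 0 ->
  atan (s / harmonic k) @[k --> \oo] --> (if 0 < s then pi / 2 else - (pi / 2)).
Proof.
have pos (t : R) : 0 < t -> atan (t / harmonic k) @[k --> \oo] --> (pi / 2 : R).
  move=> t0; have h : (t / harmonic k : R) @[k --> \oo] --> +oo.
    have h1 : (k.+1%:R : R) @[k --> \oo] --> +oo.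
      by have := @cvgr_idn R; rewrite -(cvg_shiftS (fun n => n%:R : R)).
    have := cvg_comp _ _ h1 (@gt0_cvgMry _ _ _ t id t0 (@cvg_id _ _)).
    move=> /(_ _); rewrite (_ : (_ \o _) = (fun k => t / harmonic k)); first exact.
    by apply/funext => k; rewrite /= invrK.
  exact: (cvg_comp _ _ h (@cvgy_atan R)).
rewrite neq_lt => /orP[s0|s0]; last by rewrite s0; exact: pos.
rewrite ltNge (ltW s0)/=.
rewrite (_ : (fun k => _) = (fun k => - atan ((- s) / harmonic k))); last first.
  by apply/funext => k; rewrite mulNr atanN opprK.
by apply: cvgN; apply: pos; rewrite oppr_gt0.
Qed.

(** Inside the interval the two arctangents tend to opposite limits, outside to the same one. The
    endpoints are excluded because, when a < b, the limit there is 1/2. *)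
Lemma cvg_poisson_itv (a b c : R) : c != a -> c != b ->
  poisson_itv (harmonic k) a b c @[k --> \oo] --> (\1_(`]a, b]%classic) c : R).
Proof.
move=> ca cb; rewrite /poisson_itv indicE mem_setE in_itv/=.
have [ab|ba] := ltP a b; last first.
  rewrite (_ : (a < c <= b) = false); first exact: cvg_cst.
  by apply/negbTE/negP => /andP[ac cb']; have := lt_le_trans ac (le_trans cb' ba); rewrite ltxx.
have bc0 : b - c != 0 by rewrite subr_eq0 eq_sym.
have ac0 : a - c != 0 by rewrite subr_eq0 eq_sym.
have hb := cvg_atan_scaled (b - c) bc0; have ha := cvg_atan_scaled (a - c) ac0.
have -> : (((a < c <= b)%R)%:R : R) =
   ((if 0 < b - c then pi / 2 else - (pi / 2)) - (if 0 < a - c then pi / 2 else - (pi / 2))) / pi.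
  have p0 : pi != 0 :> R by rewrite gt_eqF// pi_gt0.
  rewrite !subr_gt0 [c <= b]le_eqVlt (negbTE cb)/=.
  have [lac|lca|eac] := ltgtP a c; last by rewrite eac eqxx in ca.
    by clear ha hb; move: (pi : R) p0 => P p0; case: (c < b) => /=; rewrite ?mulr1n ?mulr0n; field.
  by rewrite /= (lt_trans lca ab) subrr mul0r.
by apply: cvgM; [exact: cvgB|exact: cvg_cst].
Qed.

End PoissonInterval.

Lemma cabs_cvg_ext {R : realType} (a b : nat -> R[i]) (A B : R[i]) :
  (cabs (a k - A))%:E @[k --> \oo] --> 0%E -> (forall k, b k = a k) -> B = A ->
  (cabs (b k - B))%:E @[k --> \oo] --> 0%E.
Proof. by move=> h /funext -> ->. Qed.

Lemma cvgn_prod {R : realType} (I : Type) (r : seq I) (F : nat -> I -> R) (l : I -> R) :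
  (forall i, F k i @[k --> \oo] --> l i) ->
  \prod_(i <- r) F k i @[k --> \oo] --> \prod_(i <- r) l i.
Proof.
move=> h; elim: r => [|i r IH].
  by rewrite big_nil; under eq_fun do rewrite big_nil; exact: cvg_cst.
by rewrite big_cons; under eq_fun do rewrite big_cons; exact: cvgM.
Qed.

Section BoxInversion.
Context {R : realType} {n : nat}.
Local Notation C := R[i].
Local Notation mu := (@lebesgue R n).
Local Notation N2 f := (@Lp_norm R n 2 f%R).
Local Notation FI := (@fourier_integral R n).

Lemma indic01 T (A : set T) x : 0 <= (\1_A x : R) <= 1.
Proof. by rewrite indicE; case: (_ \in _); rewrite ?lexx ?ler01. Qed.

Definition cindic (A : set (config R n)) : cfun R n := fun x => ((\1_A x : R)%:C)%C.

Lemma cabs_cindic A x : cabs (cindic A x) = \1_A x.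
Proof. by rewrite cabs_real ger0_norm//; case/andP: (indic01 _ A x). Qed.

Lemma cmeasurable_cindic A : measurable A -> cmeasurable (cindic A).
Proof. by move=> mA; apply: cmeasurable_real; exact: measurable_indic. Qed.

Lemma cintegrable_cindic A : measurable A -> (mu A < +oo)%E -> cintegrable mu (cindic A).
Proof.
move=> mA Ay; apply/cintegrableP; first exact: cmeasurable_cindic.
rewrite (eq_integral (fun x => (\1_A x)%:E)); last by move=> x _; rewrite cabs_cindic.
by rewrite integral_indic// setIT.
Qed.

Lemma L2_cindic A : measurable A -> (mu A < +oo)%E -> L2 (cindic A).
Proof.
move=> mA Ay; apply/L2P; split; first exact: cmeasurable_cindic.
rewrite /energy (eq_integral (fun x => (\1_A x)%:E)).
  by rewrite integral_indic// setIT.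
by move=> x _; rewrite cabs_cindic indicE; case: (_ \in _); rewrite ?expr1n ?expr0n.
Qed.

Lemma indic_box (a b : 'I_n -> plane R) x : (\1_(box a b) x : R) =
  \prod_(k < n) (\1_(`](a k).1, (b k).1]%classic) (tnth x k).1 *
                 \1_(`](a k).2, (b k).2]%classic) (tnth x k).2).
Proof.
have [xB|xB] := pselect (box a b x).
  rewrite indicE mem_set// big1// => k _; have [h1 h2] := xB k.
  by rewrite !indicE !mem_set// mulr1.
rewrite indicE memNset//; move/existsNP: xB => [k hk].
rewrite (bigD1 k)//= !indicE.
have [h1|h1] := pselect (`](a k).1, (b k).1]%classic (tnth x k).1); last by rewrite (memNset h1) !mul0r.
have [h2|h2] := pselect (`](a k).2, (b k).2]%classic (tnth x k).2); last by rewrite (memNset h2) mulr0 mul0r.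
by case: hk.
Qed.

Lemma cintegral_poisson_box (eps : R) (a b : 'I_n -> plane R) x : 0 < eps ->
  cintegral mu (fun y => conjc (cindic (box a b) y) * ((poisson eps x y)%:C)%C) =
  ((\prod_(k < n) (poisson_itv eps (a k).1 (b k).1 (tnth x k).1 *
                   poisson_itv eps (a k).2 (b k).2 (tnth x k).2))%:C)%C.
Proof.
move=> e0; pose f (s t c u : R) : R := \1_(`]s, t]%classic) u * poisson1 eps (c - u).
have mp (c : R) : measurable_fun setT (fun t : R => poisson1 eps (c - t)).
  apply: (measurableT_comp (continuous_measurable_fun (continuous_poisson1 eps e0))).
  by apply: measurable_funB => //; exact: measurable_cst.
have f0 s t c u : 0 <= f s t c u.
  by rewrite mulr_ge0 ?poisson1_ge0//; case/andP: (indic01 _ `]s, t]%classic u).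
have mf s t c : measurable_fun setT (f s t c).
  by apply: measurable_funM => //; apply: measurable_indic; exact: measurable_itv.
have ff s t c : (\int[lebesgue_measure]_u (f s t c u)%:E = (poisson_itv eps s t c)%:E)%E.
  rewrite -(integral_poisson1_itv eps c s t e0) [RHS]integral_mkcond.
  apply: eq_integral => u _; rewrite patchE /f indicE.
  by case: ifPn => _; rewrite ?mul1r ?mul0r.
pose g k (c : plane R) : R := f (a k).1 (b k).1 (tnth x k).1 c.1 * f (a k).2 (b k).2 (tnth x k).2 c.2.
transitivity (cintegral mu (fun y => ((\prod_(k < n) g k (tnth y k))%:C)%C)).
  apply: eq_cintegral => y; rewrite /cindic (_ : conjc _ = ((\1_(box a b) y : R)%:C)%C); last first.
    by apply: complex_eq => //=; rewrite oppr0.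
  rewrite -complexM indic_box -big_split/=; congr (_%:C)%C; apply: eq_bigr => k _.
  by rewrite /g /f mulrACA.
rewrite cintegral_ge0 ge0_integral_config_prod//.
- rewrite (eq_bigr (fun k => (poisson_itv eps (a k).1 (b k).1 (tnth x k).1 *
     poisson_itv eps (a k).2 (b k).2 (tnth x k).2)%:E)); first by rewrite prodEFin.
  move=> k _; rewrite /g (ge0_integral_plane_prod (f (a k).1 (b k).1 (tnth x k).1) (f (a k).2 (b k).2 (tnth x k).2))//.
  by rewrite !ff.
- move=> k; apply: measurable_funM; first exact: (measurableT_comp (mf _ _ _) measurable_fst).
  exact: (measurableT_comp (mf _ _ _) measurable_snd).
- by move=> k c; rewrite mulr_ge0.
Qed.

(** The measure of the cylinder is an integral of a product over coordinates. Its factor at [k] is 0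
    while the others are infinite, and 0 times +oo is 0. *)
Lemma ae_tnth_notin (k : 'I_n) (A : set (plane R)) :
  measurable A -> plane_lebesgue A = 0%E -> {ae mu, forall x, ~ A (tnth x k)}.
Proof.
move=> mA A0; exists [set x | A (tnth x k)].
have mk : measurable_fun setT (fun x : config R n => tnth x k).
  exact: (measurable_tnth_comp _ id k (@measurable_id _ _ setT)).
have mAk : measurable [set x : config R n | A (tnth x k)].
  by rewrite -[X in measurable X]setTI; exact: (mk measurableT A).
split => //; last by move=> x /contrapT.
pose g (j : 'I_n) (a : plane R) : R := if j == k then \1_A a else 1.
have -> : mu [set x | A (tnth x k)] = (\int[mu]_x (\prod_(j < n) g j (tnth x j))%:E)%E.
  transitivity (\int[mu]_x (\1_[set x : config R n | A (tnth x k)] x)%:E)%E.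
    by rewrite integral_indic// setIT.
  apply: eq_integral => x _.
  rewrite (bigD1 k)//= big1 => [|j jk]; last by rewrite /g (negbTE jk).
  by rewrite /g eqxx !mulr1 !indicE.
rewrite ge0_integral_config_prod.
- rewrite (bigD1 k)//= [X in (X * _)%E](_ : _ = 0%E) ?mul0e// /g eqxx.
  by rewrite integral_indic// setIT.
- by move=> j; rewrite /g; case: eqP => _; [exact: measurable_indic|exact: measurable_cst].
- by move=> j c; rewrite /g; case: eqP => _; rewrite // indicE.
Qed.

Lemma ae_tnth1_neq (k : 'I_n) (s : R) : {ae mu, forall x, (tnth x k).1 != s}.
Proof.
have A0 : plane_lebesgue ([set s] `*` [set: R]) = 0%E.
  rewrite /plane_lebesgue/= /product_measure product_measure1E//.
  by apply: etrans (mul0e _); congr (_ * _)%E; exact: lebesgue_measure_set1.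
have := ae_tnth_notin k _ (measurableX (measurable_set1 s) measurableT) A0.
by apply: filterS => x xs; apply/eqP => xE; apply: xs.
Qed.

Lemma ae_tnth2_neq (k : 'I_n) (s : R) : {ae mu, forall x, (tnth x k).2 != s}.
Proof.
have A0 : plane_lebesgue ([set: R] `*` [set s]) = 0%E.
  rewrite /plane_lebesgue/= /product_measure product_measure1E//.
  by apply: etrans (mule0 _); congr (_ * _)%E; exact: lebesgue_measure_set1.
have := ae_tnth_notin k _ (measurableX measurableT (measurable_set1 s)) A0.
by apply: filterS => x xs; apply/eqP => xE; apply: xs.
Qed.

Lemma cabs_L2M (f g : cfun R n) : L2 f -> L2 g ->
  (\int[mu]_x (cabs (f x * g x))%:E <= N2 f * N2 g)%E.
Proof.
move=> [mf _] [mg _]; rewrite !Lp_norm2E.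
apply: le_trans (cauchy_schwarz mu _ _ (measurable_cabs _ mf) (measurable_cabs _ mg)).
rewrite le_eqVlt; apply/orP; left; apply/eqP; apply: eq_integral => x _.
by rewrite cabsM !ger0_norm ?cabs_ge0.
Qed.

Lemma cintegrable_L2M (f g : cfun R n) : L2 f -> L2 g -> cintegrable mu (fun x => f x * g x).
Proof.
move=> fL gL; apply/cintegrableP; first by apply: cmeasurableM; apply: L2_measurable.
apply: (le_lt_trans (cabs_L2M _ _ fL gL)); rewrite lte_mul_pinfty ?Lp_norm2_ge0//.
  by rewrite ge0_fin_numE ?Lp_norm2_ge0//; case: fL.
by case: gL.
Qed.

Lemma cintegral_L2_cvg (f_ : nat -> cfun R n) (f v : cfun R n) :
  (forall k, L2 (f_ k)) -> L2 f -> L2 v ->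
  N2 (fun x => f_ k x - f x) @[k --> \oo] --> 0%E ->
  (cabs (cintegral mu (fun x => f_ k x * v x) - cintegral mu (fun x => f x * v x)))%:E
    @[k --> \oo] --> 0%E.
Proof.
move=> f_L fL vL cv; have h : (N2 (fun x => f_ k x - f x)%R * N2 v)%E @[k --> \oo] --> 0%E.
  rewrite -(mul0e (N2 v)); apply: cvgeM => //; last exact: cvg_cst.
  by rewrite mule_def_fin// ge0_fin_numE ?Lp_norm2_ge0//; case: vL.
apply: (@squeeze_cvge _ _ _ _ (cst 0%E) _ _ _ _ _ h); last exact: cvg_cst.
apply: nearW => k; rewrite lee_fin cabs_ge0/=.
apply: le_trans (cabs_L2M _ _ (L2B _ _ (f_L k) fL) vL).
have i1 := cintegrable_L2M _ _ (f_L k) vL; have i2 := cintegrable_L2M _ _ fL vL.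
have i3 : cintegrable mu (fun x => - (f x * v x)).
  have := cintegrableZ _ (-1) _ i2; congr cintegrable; apply/funext => x; exact: mulN1r.
rewrite -cintegralN// -cintegralD// (_ : (fun x => _ + _) = (fun x => (f_ k x - f x) * v x)).
  apply: cabs_cintegral_le; apply: cintegrable_measurable.
  by apply: cintegrable_L2M => //; exact: L2B.
by apply/funext => x; rewrite mulrBl.
Qed.

Lemma L2_fourier_integral (f : cfun R n) : cintegrable mu f -> L2 f -> L2 (FI f).
Proof.
move=> fi fL; apply: (L2_le (FI f) f 1) => //; last by rewrite mul1e; exact: fourier_integral_contraction.
by apply: cmeasurable_fourier_integral; exact: L2_measurable.
Qed.

Lemma fourier_box_pairing (f : cfun R n) (a b : 'I_n -> plane R) : cintegrable mu f -> L2 f ->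
  cintegral mu (fun q => FI f q * conjc (FI (cindic (box a b)) q)) =
  cintegral mu (fun x => f x * cindic (box a b) x).
Proof.
move=> fi fL; set B := box a b.
have mB : measurable B by exact: measurable_box.
have By : (mu B < +oo)%E by exact: lebesgue_box_lty.
have Bi := cintegrable_cindic B mB By; have BL := L2_cindic B mB By.
have h0 k : 0 < harmonic k :> R by exact: harmonic_gt0.
apply: (cvg_cabs_unique (fun k => cintegral mu (fun q =>
  FI f q * (conjc (FI (cindic B) q) * ((damping (harmonic k) q)%:C)%C)))).
- have gi : cintegrable mu (fun q => FI f q * conjc (FI (cindic B) q)).
    by apply: cintegrable_L2M; [exact: L2_fourier_integral|apply: L2_conj; exact: L2_fourier_integral].
  apply: (cabs_cvg_ext _ _ _ _ (cintegral_weight_cvg mu _ (fun k => damping (harmonic k)) (fun=> 1) gi _ _ _ _ _)); last 2 first.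
  + by move=> k; apply: eq_cintegral => q; rewrite mulrA mulrC.
  + by apply: eq_cintegral => q; rewrite mul1r.
  + by move=> k; exact: measurable_damping.
  + exact: measurable_cst.
  + by move=> k q; rewrite damping_ge0 damping_le1.
  + by move=> q; rewrite ler01 lexx.
  + by apply: aeW => q; exact: damping_cvg.
- pose w k (x : config R n) : R := \prod_(j < n) (poisson_itv (harmonic k) (a j).1 (b j).1 (tnth x j).1 *
     poisson_itv (harmonic k) (a j).2 (b j).2 (tnth x j).2).
  apply: (cabs_cvg_ext _ _ _ _ (cintegral_weight_cvg mu _ w (\1_B) fi _ _ _ _ _)); last 2 first.
  + move=> k; rewrite fourier_pairing//; apply: eq_cintegral => x.
    by rewrite cintegral_poisson_box// mulrC.
  + by apply: eq_cintegral => x; rewrite mulrC.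
  + move=> k; apply: measurable_prod => j _; apply: measurable_funM; apply: measurable_poisson_itv.
      by apply: measurable_plane_fst; exact: measurable_tnth_comp.
    by apply: measurable_plane_snd; exact: measurable_tnth_comp.
  + exact: measurable_indic.
  + move=> k x; apply/andP; split.
      by apply: prodr_ge0 => j _; rewrite mulr_ge0//; apply: (proj1 (andP (poisson_itv01 _ _ _ _ _))).
    apply: prodr_ile1 => j _.
    have /andP[p0 p1] := poisson_itv01 (harmonic k) (a j).1 (b j).1 (tnth x j).1 (h0 k).
    have /andP[q0 q1] := poisson_itv01 (harmonic k) (a j).2 (b j).2 (tnth x j).2 (h0 k).
    by rewrite mulr_ge0// mulr_ile1.
  + exact: indic01.
  (* The points lying on the faces of the box, where the pointwise limit fails, form a null set. *)
  + have hh : {ae mu, forall x, forall j : 'I_n, [/\ (tnth x j).1 != (a j).1, (tnth x j).1 != (b j).1,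
        (tnth x j).2 != (a j).2 & (tnth x j).2 != (b j).2]}.
      apply: filter_forall => j.
      near=> x; split.
      * by near: x; exact: ae_tnth1_neq.
      * by near: x; exact: ae_tnth1_neq.
      * by near: x; exact: ae_tnth2_neq.
      * by near: x; exact: ae_tnth2_neq.
    apply: filterS hh => x hx; rewrite indic_box /w.
    apply: cvgn_prod => j; have [x1 x2 x3 x4] := hx j.
    by apply: cvgM; apply: cvg_poisson_itv.
Unshelve. all: by end_near. Qed.

End BoxInversion.

(** * Functions that vanish because their integrals over boxes do *)

Section Density.
Context {R : realType} {d} {T : measurableType d}.
Variables (mu : {measure set T -> \bar R}) (f : T -> \bar R).
Variables (mf : measurable_fun setT f) (f0 : forall x, (0 <= f x)%E).

(** The proofs of measurability and nonnegativity are arguments so that the measure structure can be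
    attached to the term itself. *)
Definition density of measurable_fun setT f & (forall x, (0 <= f x)%E) : set T -> \bar R :=
  fun A => (\int[mu]_(x in A) f x)%E.

Let density0 : density mf f0 set0 = 0%E. Proof. exact: integral_set0. Qed.

Let density_ge0 A : (0 <= density mf f0 A)%E. Proof. exact: integral_ge0. Qed.

Let density_sigma_additive : semi_sigma_additive (density mf f0).
Proof. exact: semi_sigma_additive_nng_induced. Qed.

HB.instance Definition _ := isMeasure.Build _ _ _
  (density mf f0) density0 density_ge0 density_sigma_additive.

End Density.

Section BoxTest.
Context {R : realType} {n : nat}.
Local Notation C := R[i].
Local Notation mu := (@lebesgue R n).
Local Notation N2 f := (@Lp_norm R n 2 f%R).

(* The positive and negative parts of [u], cut off to a cube, are the densities of
   two finite measures that agree on boxes, hence everywhere. *)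
Lemma real_box_test (u : config R n -> R) : measurable_fun setT u ->
  (forall a b, mu.-integrable (box a b) (EFin \o u)) ->
  (forall a b, \int[mu]_(x in box a b) (u x)%:E = 0)%E ->
  {ae mu, forall x, u x = 0}.
Proof.
move=> mu_ iu u0; have mE : measurable_fun setT (EFin \o u) by exact/measurable_EFinP.
have mcube N : measurable (@cube R n N) by exact: measurable_box.
have bc (a b : 'I_n -> plane R) N : exists a' b', box a b `&` cube n N = box a' b'.
  have [p _ <-] := boxes_setI n (box a b) (cube n N) (ex_intro2 _ _ (a, b) I erefl)
    (ex_intro2 _ _ (fun=> (- N%:R, - N%:R), fun=> (N%:R, N%:R)) I erefl).
  by exists p.1, p.2.
pose P N := ((EFin \o u)^\+ \_ (@cube R n N))%E.
pose M N := ((EFin \o u)^\- \_ (@cube R n N))%E.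
have mP N : measurable_fun setT (P N).
  by apply/(measurable_restrictT _ (mcube N)); apply: measurable_funTS; exact: measurable_funepos.
have mM N : measurable_fun setT (M N).
  by apply/(measurable_restrictT _ (mcube N)); apply: measurable_funTS; exact: measurable_funeneg.
have P0 N x : (0 <= P N x)%E by rewrite /P patchE; case: ifP => // _; rewrite funeposE le_max lexx orbT.
have M0 N x : (0 <= M N x)%E by rewrite /M patchE; case: ifP => // _; rewrite funenegE le_max lexx orbT.
have PM N A : measurable A -> (\int[mu]_(x in A) P N x = \int[mu]_(x in A) M N x)%E.
  move=> mA; apply: (measure_unique_boxes _ (density mu _ (mP N) (P0 N)) (density mu _ (mM N) (M0 N))) => //.
    move=> a b; rewrite /= /density /P /M -!integral_mkcondr.
    have [a' [b' ->]] := bc a b N; have : (0 = \int[mu]_(x in box a' b') (EFin \o u)^\+ x - \int[mu]_(x in box a' b') (EFin \o u)^\- x)%E.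
      by rewrite -(u0 a' b') [LHS]integralE.
    have := integrable_pos_fin_num (measurable_box _ a' b') (iu a' b').
    have := integrable_neg_fin_num (measurable_box _ a' b') (iu a' b').
    case: (\int[mu]_(x in _) _)%E => // r _; case: (\int[mu]_(x in _) _)%E => // s _.
    by rewrite -EFinB => -[] /esym /eqP; rewrite subr_eq0 => /eqP ->.
  move=> a b; rewrite /= /density /P -integral_mkcondr.
  have [a' [b' ->]] := bc a b N; have := integrable_pos_fin_num (measurable_box _ a' b') (iu a' b').
  by rewrite ge0_fin_numE//; apply: integral_ge0 => x _; rewrite funeposE le_max lexx orbT.
have mpos : measurable [set x | 0 < u x].
  rewrite (_ : [set x | 0 < u x] = setT `&` u @^-1` `]0, +oo[%classic).
    by apply: mu_ => //; exact: measurable_itv.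
  by rewrite setTI; apply/seteqP; split => x /=; rewrite in_itv/= andbT.
have mneg : measurable [set x | u x < 0].
  rewrite (_ : [set x | u x < 0] = setT `&` u @^-1` `]-oo, 0[%classic).
    by apply: mu_ => //; exact: measurable_itv.
  by rewrite setTI; apply/seteqP; split => x /=; rewrite in_itv.
(* Where u > 0 the negative part is zero, so by [PM] the positive part has zero integral over that
   set and vanishes almost everywhere on it. *)
have aeP N : {ae mu, forall x, 0 < u x -> P N x = 0%E}.
  apply: (ae_eq_integral_abs mu mpos (measurable_funTS (mP N))).1.
  under eq_integral do rewrite gee0_abs//.
  rewrite PM//; apply: integral0_eq => x /= ux; rewrite /M patchE; case: ifP => // _.
  by rewrite funenegE; apply/max_idPr; rewrite -EFinN lee_fin oppr_le0 ltW.
have aeM N : {ae mu, forall x, u x < 0 -> M N x = 0%E}.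
  apply: (ae_eq_integral_abs mu mneg (measurable_funTS (mM N))).1.
  under eq_integral do rewrite gee0_abs//.
  rewrite -PM//; apply: integral0_eq => x /= ux; rewrite /P patchE; case: ifP => // _.
  by rewrite funeposE; apply/max_idPr; rewrite lee_fin ltW.
have ae1 : {ae mu, forall x, forall N, (0 < u x -> P N x = 0%E) /\ (u x < 0 -> M N x = 0%E)}.
  by apply/ae_foralln => N; apply: filterS2 (aeP N) (aeM N).
apply: filterS ae1 => x h.
have [N _ xN] : (\bigcup_N (cube n N)) x by rewrite cube_cover.
have [h1 h2] := h N; have [ux|ux|//] := ltgtP (u x) 0.
  have := h2 ux; rewrite /M patchE mem_set// funenegE.
  by rewrite maxEle -EFinN lee_fin ifF; [case; lra|apply/negbTE; rewrite -ltNge; lra].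
have := h1 ux; rewrite /P patchE mem_set// funeposE.
by rewrite maxEle lee_fin ifF; [case; lra|apply/negbTE; rewrite -ltNge; lra].
Qed.

Lemma integral_mul_indic (u : config R n -> R) (B : set (config R n)) :
  (\int[mu]_x (u x * \1_B x)%:E = \int[mu]_(x in B) (u x)%:E)%E.
Proof.
rewrite [RHS]integral_mkcond; apply: eq_integral => x _; rewrite patchE indicE.
by case: ifPn => _; rewrite ?mulr1 ?mulr0.
Qed.

Lemma box_test (h : cfun R n) : L2 h ->
  (forall a b, cintegral mu (fun x => h x * cindic (box a b) x) = 0) ->
  {ae mu, forall x, h x = 0}.
Proof.
move=> hL h0; have [mRe mIm] := L2_measurable _ hL.
have mB (a b : 'I_n -> plane R) : measurable (box a b) by exact: measurable_box.
have hi (a b : 'I_n -> plane R) : cintegrable mu (fun x => h x * cindic (box a b) x).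
  by apply: cintegrable_L2M => //; apply: L2_cindic => //; exact: lebesgue_box_lty.
(* [p] is the real or the imaginary part; all that is used is that it commutes with the integral and
   with real factors. *)
have key (p : C -> R) : measurable_fun setT (fun x => p (h x)) ->
    (forall w (r : R), p (w * (r%:C)%C) = p w * r) ->
    (forall f, cintegrable mu f -> mu.-integrable setT (fun x => (p (f x))%:E)) ->
    (forall f, p (cintegral mu f) = Rintegral mu setT (fun x => p (f x))) -> p 0 = 0 ->
    {ae mu, forall x, p (h x) = 0}.
  move=> mp pM pI pint p0; apply: real_box_test => // a b.
    have := pI _ (hi a b); rewrite (_ : (fun x => _) = (EFin \o (fun x => p (h x))) \_ (box a b)).
      by move/(integrable_mkcond _ (mB a b)).
    apply/funext => x; rewrite /cindic pM patchE indicE.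
    by case: ifPn => _; rewrite ?mulr1 ?mulr0.
  rewrite -integral_mul_indic.
  have := pI _ (hi a b); have := pint (fun x => h x * cindic (box a b) x).
  rewrite h0 p0 /Rintegral.
  rewrite (_ : (fun x => (p (h x * _))%:E) = (fun x => (p (h x) * \1_(box a b) x)%:E)).
    move=> e ii; have fi := integrable_fin_num measurableT ii.
    by rewrite -[LHS]fineK// -e.
  by apply/funext => x; rewrite pM.
have aeRe := key (@complex.Re R) mRe _ _ _ _.
have aeIm := key (@complex.Im R) mIm _ _ _ _.
apply: filterS2 (aeRe _ _ _ _) (aeIm _ _ _ _) => //.
- by move=> x h1 h2; apply: complex_eq.
- by move=> w r; rewrite cReM/= mulr0 subr0.
- by move=> f [].
- by move=> w r; rewrite cImM/= mulr0 add0r.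
- by move=> f [].
Qed.

End BoxTest.

Section L2Approximation.
Context {R : realType} {n : nat}.
Local Notation C := R[i].
Local Notation mu := (@lebesgue R n).
Local Notation N2 f := (@Lp_norm R n 2 f%R).

Lemma cvg0_geometric (u : nat -> \bar R) (c : R) :
  (forall k, 0 <= u k <= (c * 2^-1 ^+ k)%:E)%E -> u k @[k --> \oo] --> 0%E.
Proof.
move=> h; apply: (@squeeze_cvge _ _ _ _ (cst 0%E) _ (fun k => (c * 2^-1 ^+ k)%:E)).
- exact: nearW.
- exact: cvg_cst.
- apply: cvg_EFin; first exact: nearW.
  apply: (@cvg_geometric R c 2^-1); rewrite ger0_norm ?invr_ge0//.
  by rewrite invf_lt1// ltr1n.
Qed.

(** Cut-offs to growing cubes converge by domination by |f|^2, and each is integrable as a product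
    of two square-integrable functions. *)
Lemma L2_approx (f : cfun R n) (e : R) : L2 f -> 0 < e ->
  exists g, [/\ cintegrable mu g, L2 g & (N2 (fun x => g x - f x) <= e%:E)%E].
Proof.
move=> fL e0; have mf := L2_measurable _ fL.
have mcube N : measurable (@cube R n N) by exact: measurable_box.
have cL N : L2 (cindic (@cube R n N)) by apply: L2_cindic => //; exact: lebesgue_box_lty.
have mcf N : cmeasurable (fun x => cindic (@cube R n N) x * f x).
  by apply: cmeasurableM => //; exact: cmeasurable_cindic.
have cfL N : L2 (fun x => cindic (@cube R n N) x * f x).
  apply: (L2_dom _ f 1) => //; apply: aeW => x; rewrite cabsM mul1r cabs_cindic.
  by rewrite ler_piMl ?cabs_ge0//; case/andP: (indic01 _ (cube n N) x).
have [|||||_ _] := @dominated_convergence _ _ _ mu setT measurableT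
  (fun N x => (cabs (cindic (@cube R n N) x * f x - f x) ^+ 2)%:E) (cst 0%E)
  (fun x => (cabs (f x) ^+ 2)%:E).
- by move=> N; apply/measurable_EFinP; apply: measurable_cabs_sqr; exact: cmeasurableB.
- exact: measurable_cst.
- apply: aeW => x _; have [N _ xN] : (\bigcup_N (cube n N)) x by rewrite cube_cover.
  apply: cvg_near_cst; exists N => // M /= NM; rewrite /cindic indicE mem_set.
    by rewrite mul1r subrr cabs0 expr0n.
  move=> k; have := xN k; rewrite /rect/= => -[]; rewrite !in_itv/=.
  have := NM; rewrite -(ler_nat R) => NM'.
  by move=> /andP[? ?] /andP[? ?]; split; apply/andP; split; lra.
- have /L2P[_ fy] := fL; apply/integrableP; split.
    by apply/measurable_EFinP; exact: measurable_cabs_sqr.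
  by rewrite (eq_integral (fun x => (cabs (f x) ^+ 2)%:E))// => x _; rewrite gee0_abs// lee_fin sqr_ge0.
- apply: aeW => x N _; rewrite gee0_abs ?lee_fin ?sqr_ge0//.
  rewrite ler_pXn2r ?nnegrE ?cabs_ge0// /cindic indicE.
  by case: (_ \in _); rewrite ?mul1r ?mul0r ?subrr ?cabs0 ?cabs_ge0// sub0r cabsN.
rewrite integral0 => /fine_cvgP[fin] /cvgr_lt /(_ (e ^+ 2)).
rewrite exprn_gt0// => /(_ isT) lt.
near \oo => N; exists (fun x => cindic (@cube R n N) x * f x); split => //.
  exact: cintegrable_L2M.
rewrite Lp_norm2E -[leRHS]/(e%:E) (_ : e = Num.sqrt (e ^+ 2)); last by rewrite sqrtr_sqr ger0_norm ?ltW.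
rewrite -[leRHS]/(sqrte (e ^+ 2)%:E) lee_sqrt// ?lee_fin ?sqr_ge0//.
have fN : (\int[mu]_x (cabs (cindic (@cube R n N) x * f x - f x) ^+ 2)%:E)%E \is a fin_num by near: N.
rewrite /energy -(fineK fN) lee_fin ltW//; by near: N.
Unshelve. all: by end_near. Qed.

End L2Approximation.

Section Plancherel.
Context {R : realType} {n : nat}.
Local Notation C := R[i].
Local Notation mu := (@lebesgue R n).
Local Notation N2 f := (@Lp_norm R n 2 f%R).
Local Notation FI := (@fourier_integral R n).

Lemma Lp_norm2_fin (f : cfun R n) : L2 f -> N2 f \is a fin_num.
Proof. by move=> fL; rewrite ge0_fin_numE ?Lp_norm2_ge0//; case: fL. Qed.

Lemma fourier_version (f f' g g' : cfun R n) : fourier f g -> version f' f -> version g' g ->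
  fourier f' g'.
Proof.
move=> [fL gL [fk [fkL cf cg]]] ff' gg'.
have [mf' af'] := ff'; have [mg' ag'] := gg'.
split; [exact: version_L2 ff' fL|exact: version_L2 gg' gL|exists fk; split => //].
- rewrite (_ : (fun k => N2 _) = (fun k => N2 (fun x => fk k x - f x)))//.
  apply/funext => k; have [_ [mk _]] := fkL k; apply: Lp_norm2_ae.
  + exact: cmeasurableB.
  + by apply: cmeasurableB => //; exact: L2_measurable.
  + by apply: filterS af' => x ->.
- rewrite (_ : (fun k => N2 _) = (fun k => N2 (fun x => FI (fk k) x - g x)))//.
  apply/funext => k; have [/Lp1P ik _] := fkL k.
  have mk := cmeasurable_fourier_integral _ (cintegrable_measurable _ _ ik).
  apply: Lp_norm2_ae.
  + exact: cmeasurableB.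
  + by apply: cmeasurableB => //; exact: L2_measurable.
  + by apply: filterS ag' => x ->.
Qed.

Lemma fourier_lin (c : C) (f f' g g' : cfun R n) : fourier f g -> fourier f' g' ->
  fourier (fun x => c * f x + f' x) (fun x => c * g x + g' x).
Proof.
move=> [fL gL [fk [fkL cf cg]]] [fL' gL' [fk' [fkL' cf' cg']]].
have sq (a a' : nat -> cfun R n) (b b' : cfun R n) : (forall k, L2 (a k)) -> (forall k, L2 (a' k)) ->
    L2 b -> L2 b' -> N2 (fun x => a k x - b x) @[k --> \oo] --> 0%E ->
    N2 (fun x => a' k x - b' x) @[k --> \oo] --> 0%E ->
    N2 (fun x => (c * a k x + a' k x) - (c * b x + b' x)) @[k --> \oo] --> 0%E.
  move=> aL aL' bL bL' h h'.
  have hs : ((cabs c)%:E * N2 (fun x => a k x - b x)%R + N2 (fun x => a' k x - b' x)%R)%E @[k --> \oo] --> 0%E.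
    rewrite -[X in _ --> X]adde0 -[X in _ --> (X + _)%E](mule0 (cabs c)%:E).
    by apply: cvgeD => //; apply: cvgeMl.
  apply: (@squeeze_cvge _ _ _ _ (cst 0%E) _ _ _ _ _ hs); last exact: cvg_cst.
  apply: nearW => k; rewrite Lp_norm2_ge0/=.
  have mab : cmeasurable (fun x => a k x - b x) by apply: cmeasurableB; apply: L2_measurable.
  have mab' : cmeasurable (fun x => a' k x - b' x) by apply: cmeasurableB; apply: L2_measurable.
  rewrite -Lp_norm2Z// (_ : (fun x => _ - _) = (fun x => c * (a k x - b x) + (a' k x - b' x))).
    by apply: le_Lp_norm2D => //; apply: cmeasurableM => //; exact: cmeasurable_cst.
  by apply/funext => x; ring.
have i k : cintegrable mu (fk k) by apply/Lp1P; case: (fkL k).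
have i' k : cintegrable mu (fk' k) by apply/Lp1P; case: (fkL' k).
have l k : L2 (fk k) by case: (fkL k).
have l' k : L2 (fk' k) by case: (fkL' k).
split; [exact: L2D (L2Z _ _ fL) fL'|exact: L2D (L2Z _ _ gL) gL'|].
exists (fun k x => c * fk k x + fk' k x); split.
- move=> k; split; last exact: L2D (L2Z _ _ (l k)) (l' k).
  by apply/Lp1P; apply: cintegrableD => //; exact: cintegrableZ.
- exact: sq.
- rewrite (_ : (fun k => N2 _) = (fun k => N2 (fun x => (c * FI (fk k) x + FI (fk' k) x) - (c * g x + g' x)))).
    by apply: sq => // k; apply: L2_fourier_integral.
  by apply/funext => k; congr Lp_norm; apply/funext => x; rewrite fourier_integral_lin.
Qed.

Lemma fourier_le (f g : cfun R n) : fourier f g -> (N2 g <= N2 f)%E.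
Proof.
move=> [fL gL [fk [fkL cf cg]]].
have i k : cintegrable mu (fk k) by apply/Lp1P; case: (fkL k).
have l k : L2 (fk k) by case: (fkL k).
have h : (N2 (fun x => FI (fk k) x - g x)%R + (N2 (fun x => fk k x - f x)%R + N2 f))%E @[k --> \oo] --> (0 + (0 + N2 f))%E.
  by apply: cvgeD; [|exact: cg|apply: cvgeD; [|exact: cf|exact: cvg_cst]];
    rewrite ?add0e fin_num_adde_defl// Lp_norm2_fin.
rewrite -[leRHS]add0e -[leRHS]add0e -(cvg_lim _ h)//; apply: lime_ge.
  by apply/cvg_ex; eexists; exact: h.
apply: nearW => k.
have mF : cmeasurable (FI (fk k)) by apply: L2_measurable; exact: L2_fourier_integral.
have mg := L2_measurable _ gL; have mf := L2_measurable _ fL; have mk := L2_measurable _ (l k).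
apply: (@le_trans _ _ (N2 (fun x => FI (fk k) x - g x)%R + N2 (FI (fk k)))%E).
  rewrite -[N2 (fun x => FI (fk k) x - g x)]Lp_norm2BC.
  rewrite [X in (X <= _)%E](_ : N2 g = N2 (fun x => (g x - FI (fk k) x) + FI (fk k) x)).
    by apply: le_Lp_norm2D => //; exact: cmeasurableB.
  by congr Lp_norm; apply/funext => x; rewrite subrK.
apply: leeD2l; apply: (le_trans (fourier_integral_contraction _ (i k))).
rewrite [X in (X <= _)%E](_ : N2 (fk k) = N2 (fun x => (fk k x - f x) + f x)).
  by apply: le_Lp_norm2D => //; exact: cmeasurableB.
by congr Lp_norm; apply/funext => x; rewrite subrK.
Qed.

(** Approximants at distance 2^-k from f have transforms whose successive differences have norm at
    most 2^-k + 2^-(k+1), by contraction. The limit is the first transform plus the [L2_series] of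
    these differences, whose partial sums telescope. *)
Lemma fourier_total (f : cfun R n) : L2 f -> exists g, fourier f g.
Proof.
move=> fL; have mf := L2_measurable _ fL.
have ap k : exists g, [/\ cintegrable mu g, L2 g & (N2 (fun x => g x - f x)%R <= (2^-1 ^+ k)%:E)%E].
  by apply: L2_approx => //; rewrite exprn_gt0// invr_gt0.
have [g_ hg] := choice ap.
have ig k : cintegrable mu (g_ k) by case: (hg k).
have lg k : L2 (g_ k) by case: (hg k).
have dg k : (N2 (fun x => g_ k x - f x)%R <= (2^-1 ^+ k)%:E)%E by case: (hg k).
have mg k := L2_measurable _ (lg k).
pose F k x : C := FI (g_ k.+1) x - FI (g_ k) x.
have mFI k : cmeasurable (FI (g_ k)) by apply: L2_measurable; exact: L2_fourier_integral.
have mF k : cmeasurable (F k) by exact: cmeasurableB.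
have NF k : (N2 (F k) <= (2 * 2^-1 ^+ k)%:E)%E.
  have id : cintegrable mu (fun x => g_ k.+1 x - g_ k x).
    rewrite (_ : (fun x => _) = (fun x => -1 * g_ k x + g_ k.+1 x)).
      by apply: cintegrableD => //; exact: cintegrableZ.
    by apply/funext => x; rewrite mulN1r addrC.
  rewrite (_ : F k = FI (fun x => g_ k.+1 x - g_ k x)); last first.
    by apply/funext => x; rewrite fourier_integralB.
  apply: (le_trans (fourier_integral_contraction _ id)).
  apply: (le_trans (le_Lp_norm2B f _ _ (mg _) (mg _) mf)).
  apply: (le_trans (leeD (dg k.+1) _)); first by rewrite Lp_norm2BC; exact: dg.
  rewrite -EFinD lee_fin exprS; have : 0 <= 2^-1 ^+ k :> R by rewrite exprn_ge0// invr_ge0.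
  lra.
pose S := L2_series F; have mS : cmeasurable S by exact: cmeasurable_L2_series.
have SL : L2 S by exact: (L2_series_L2 F mF 2 NF).
exists (fun x => FI (g_ 0) x + S x); split => //; first by apply: L2D => //; exact: L2_fourier_integral.
exists g_; split.
- by move=> k; split => //; apply/Lp1P.
- by apply: (cvg0_geometric _ 1) => k; rewrite Lp_norm2_ge0/= mul1r; exact: dg.
- apply: (cvg0_geometric _ (2 * 2)) => k; rewrite Lp_norm2_ge0/=.
  rewrite Lp_norm2BC (_ : (fun x => _) = (fun x => S x - \sum_(j < k) F j x)).
    exact: (L2_series_dist F mF 2 NF).
  apply/funext => x; rewrite -(big_mkord xpredT (fun j => F j x)) telescope_sumr//.
  by ring.
Qed.

(** This is the inversion theorem: conjugating before and after makes the transform an involution.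
    If h is the transform of the conjugate of g, pairing h with a box moves the transform onto the
    box ([fourier_multiplication]), and [fourier_box_pairing] moves it back; [box_test] then
    identifies h with the conjugate of f. Isometry and surjectivity are both read off from here. *)
Lemma fourier_conj (f g : cfun R n) : fourier f g ->
  fourier (fun x => conjc (g x)) (fun x => conjc (f x)).
Proof.
move=> fg; have [fL gL [fk [fkL cf cg]]] := fg.
have [h hh] := fourier_total _ (L2_conj _ gL).
have [_ hL [gk [gkL cg' ch]]] := hh.
apply: (fourier_version _ _ _ _ hh); first by apply: version_refl; apply: L2_measurable; exact: L2_conj.
have Lf' := L2_conj _ fL; split; first exact: L2_measurable.
have ae0 : {ae mu, forall x, conjc (f x) - h x = 0}.
  apply: box_test; first exact: L2B.
  move=> a b; set B := box a b.
  have mB : measurable B by exact: measurable_box.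
  have By : (mu B < +oo)%E by exact: lebesgue_box_lty.
  have Bi := cintegrable_cindic B mB By; have BL := L2_cindic B mB By.
  have FBL := L2_fourier_integral _ Bi BL.
  have ifk k : cintegrable mu (fk k) by apply/Lp1P; case: (fkL k).
  have lfk k : L2 (fk k) by case: (fkL k).
  have igk k : cintegrable mu (gk k) by apply/Lp1P; case: (gkL k).
  have lgk k : L2 (gk k) by case: (gkL k).
  have e1 : cintegral mu (fun x => h x * cindic B x) =
      cintegral mu (fun x => conjc (g x) * FI (cindic B) x).
    apply: (cvg_cabs_unique (fun k => cintegral mu (fun x => FI (gk k) x * cindic B x))).
      by apply: cintegral_L2_cvg => // k; exact: L2_fourier_integral.
    apply: (cabs_cvg_ext _ _ _ _ (cintegral_L2_cvg gk (fun x => conjc (g x)) _ lgk (L2_conj _ gL) FBL cg')) => // k.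
    exact: fourier_multiplication.
  have e2 : cintegral mu (fun x => g x * conjc (FI (cindic B) x)) =
      cintegral mu (fun x => f x * cindic B x).
    apply: (cvg_cabs_unique (fun k => cintegral mu (fun x => FI (fk k) x * conjc (FI (cindic B) x)))).
      by apply: cintegral_L2_cvg => //; [move=> k; exact: L2_fourier_integral|exact: L2_conj].
    apply: (cabs_cvg_ext _ _ _ _ (cintegral_L2_cvg fk f _ lfk fL BL cf)) => // k.
    exact: fourier_box_pairing.
  have e3 : cintegral mu (fun x => conjc (f x) * cindic B x) = cintegral mu (fun x => h x * cindic B x).
    rewrite e1; apply: (can_inj (@conjcK R)).
    rewrite -!cintegralJ; [|exact: (cintegrable_L2M _ _ (L2_conj _ gL))|exact: (cintegrable_L2M _ _ (L2_conj _ fL))].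
    rewrite (eq_cintegral _ _ (fun x => f x * cindic B x)); last first.
      by move=> x; rewrite conjcM conjcK /cindic; congr (_ * _); apply: complex_eq; rewrite //= oppr0.
    by rewrite -e2; apply: eq_cintegral => x; rewrite [RHS]conjcM conjcK.
  have i1 : cintegrable mu (fun x => conjc (f x) * cindic B x) by exact: cintegrable_L2M.
  have i2 : cintegrable mu (fun x => - (h x * cindic B x)).
    have := cintegrableZ _ (-1) _ (cintegrable_L2M _ _ hL BL).
    by congr cintegrable; apply/funext => x; exact: mulN1r.
  rewrite (eq_cintegral _ _ (fun x => conjc (f x) * cindic B x + - (h x * cindic B x))).
    rewrite cintegralD// cintegralN; last exact: cintegrable_L2M.
    by rewrite e3 subrr.
  by move=> x; rewrite mulrBl.
by apply: filterS ae0 => x /eqP; rewrite subr_eq0 => /eqP.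
Qed.

(** Contraction applied in both directions, the way back being [fourier_conj]. *)
Lemma fourier_isometry (f g : cfun R n) : fourier f g -> N2 g = N2 f.
Proof.
move=> fg; apply/eqP; rewrite eq_le (fourier_le _ _ fg)/=.
by have := fourier_le _ _ (fourier_conj _ _ fg); rewrite !Lp_norm2_J.
Qed.

Lemma fourier_surj (g : cfun R n) : L2 g -> exists f, fourier f g.
Proof.
move=> gL; have [h hh] := fourier_total _ (L2_conj _ gL).
exists (fun x => conjc (h x)); have := fourier_conj _ _ hh.
by rewrite (_ : (fun x => conjc (conjc (g x))) = g)//; apply/funext => x; rewrite conjcK.
Qed.

(** Permutations preserve Lebesgue measure and the scalar product, hence commute with the transform;
    this carries symmetry over to Fourier variables. *)
Lemma fourier_permute s (f g : cfun R n) : fourier f g ->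
  fourier (fun x => f (permute s x)) (fun q => g (permute s q)).
Proof.
have pL (h : cfun R n) : cmeasurable h -> N2 (fun x => h (permute s x)) = N2 h.
  move=> mh; rewrite !Lp_norm2E; congr sqrte; apply/esym.
  apply: (ge0_integral_preserves _ _ _ (preserves_permute s) (fun x => (cabs (h x) ^+ 2)%:E)).
    by apply/measurable_EFinP; exact: measurable_cabs_sqr.
  by move=> x; rewrite lee_fin sqr_ge0.
have mL (h : cfun R n) : cmeasurable h -> cmeasurable (fun x => h (permute s x)).
  by move=> mh; exact: (cmeasurable_comp _ _ _ _ mh (measurable_permute s)).
have LL (h : cfun R n) : L2 h -> L2 (fun x => h (permute s x)).
  move=> hL; have mh := L2_measurable _ hL; split; first exact: mL.
  by rewrite pL//; case: hL.
have Li (h : cfun R n) : cintegrable mu h -> cintegrable mu (fun x => h (permute s x)).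
  move=> hi; apply: (cintegrable_preserves _ _ _ (preserves_permute s) h _).1 => //.
  exact: cintegrable_measurable hi.
have FIp (h : cfun R n) q : cmeasurable h -> FI (fun x => h (permute s x)) q = FI h (permute s q).
  move=> mh; rewrite /fourier_integral; congr (_ * _).
  rewrite [RHS](cintegral_preserves _ _ _ (preserves_permute s)).
    by apply: eq_cintegral => y; rewrite dot_permute.
  by apply: cmeasurableM => //; apply: cmeasurable_phase => //; exact: measurable_cst.
move=> [fL gL [fk [fkL cf cg]]].
have mf := L2_measurable _ fL; have mg := L2_measurable _ gL.
split; [exact: LL|exact: LL|exists (fun k x => fk k (permute s x)); split].
- by move=> k; have [/Lp1P ik lk] := fkL k; split; [apply/Lp1P; exact: Li|exact: LL].
- rewrite (_ : (fun k => N2 _) = (fun k => N2 (fun x => fk k x - f x)))//.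
  apply/funext => k; have [_ [mk _]] := fkL k.
  by rewrite -[RHS]pL//; exact: cmeasurableB.
- rewrite (_ : (fun k => N2 _) = (fun k => N2 (fun x => FI (fk k) x - g x)))//.
  apply/funext => k; have [/Lp1P ik [mk _]] := fkL k.
  rewrite -[RHS]pL//; last by apply: cmeasurableB => //; exact: cmeasurable_fourier_integral.
  by congr Lp_norm; apply/funext => q; rewrite FIp.
Qed.

End Plancherel.

Section FourierUniqueness.
Context {R : realType} {n : nat}.
Implicit Types f g : cfun R n.

Lemma fourier_fun f g g' : fourier f g -> fourier f g' -> version g' g.
Proof.
move=> h h'; have [_ gL _] := h; have [_ gL' _] := h'.
apply/version_dist0; [exact: L2_measurable|exact: L2_measurable|].
have hh := fourier_lin (-1) _ _ _ _ h h'.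
rewrite (_ : (fun x => g' x - g x) = (fun x => -1 * g x + g' x)).
  rewrite (fourier_isometry _ _ hh) -[RHS](@Lp_norm2_0 R n); congr Lp_norm.
  by apply/funext => x; rewrite mulN1r addNr.
by apply/funext => x; rewrite mulN1r addrC.
Qed.

Lemma fourier_inj f f' g : fourier f g -> fourier f' g -> version f' f.
Proof.
move=> h h'; have [fL _ _] := h; have [fL' _ _] := h'.
apply/version_dist0; [exact: L2_measurable|exact: L2_measurable|].
have hh := fourier_lin (-1) _ _ _ _ h h'.
rewrite (_ : (fun x => f' x - f x) = (fun x => -1 * f x + f' x)).
  rewrite -(fourier_isometry _ _ hh) -[RHS](@Lp_norm2_0 R n); congr Lp_norm.
  by apply/funext => x; rewrite mulN1r addNr.
by apply/funext => x; rewrite mulN1r addrC.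
Qed.

End FourierUniqueness.

(** * Operators in Fourier variables *)

Section FunctionOperators.
Context {R : realType}.
Local Notation C := R[i].

(** Linearity is demanded only almost everywhere: the trace is an integral over slices, additive
    where the slices are integrable, and the sum of a series is cut off outside a set that depends
    on the input. *)
Definition linear_bounded {a b : nat} (F : cfun R a -> cfun R b) (K : R) :=
  [/\ 0 <= K,
      forall u, L2 u -> cmeasurable (F u),
      forall u, L2 u -> (Lp_norm 2 (F u) <= K%:E * Lp_norm 2 u)%E
    & forall (c : C) u v, L2 u -> L2 v ->
        {ae lebesgue b, forall x, F (fun y => (c * u y + v y)%R) x = c * F u x + F v x}].

Lemma linear_bounded_L2 a b (F : cfun R a -> cfun R b) K u :
  linear_bounded F K -> L2 u -> L2 (F u).
Proof.
move=> [K0 mF bF _] uL; split; first exact: mF.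
by apply: (le_lt_trans (bF _ uL)); rewrite lte_mul_pinfty ?lee_fin//; case: uL.
Qed.

Lemma linear_bounded_mono a b (F : cfun R a -> cfun R b) K L :
  linear_bounded F K -> K <= L -> linear_bounded F L.
Proof.
move=> [K0 mF bF lF] KL; split => //; first exact: le_trans KL.
by move=> u uL; rewrite (le_trans (bF _ uL))// lee_wpmul2r ?Lp_norm2_ge0// lee_fin.
Qed.

Lemma version_lin b (c : C) (f f' g g' : cfun R b) : version f f' -> version g g' ->
  version (fun x => c * f x + g x) (fun x => c * f' x + g' x).
Proof.
move=> [mf af] [mg ag]; split.
  by apply: cmeasurableD => //; apply: cmeasurableM => //; exact: cmeasurable_cst.
by apply: filterS2 af ag => x -> ->.
Qed.

Lemma version_sum b (I : finType) (P : pred I) (f g : I -> cfun R b) :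
  (forall i, P i -> version (f i) (g i)) ->
  version (fun x => \sum_(i | P i) f i x) (fun x => \sum_(i | P i) g i x).
Proof.
move=> h; split; first by apply: cmeasurable_sum => i /h[].
have ae : {ae lebesgue b, forall x, forall i, P i -> f i x = g i x}.
  apply: filter_forall => i; case Pi : (P i); last exact: aeW.
  by have [_ ] := h i Pi; apply: filterS => x -> _.
by apply: filterS ae => x hx; apply: eq_bigr => i Pi; exact: hx.
Qed.

(** The difference of the inputs has norm zero, hence so has its image, and almost-everywhere
    linearity splits that image. *)
Lemma linear_bounded_version a b (F : cfun R a -> cfun R b) K u v :
  linear_bounded F K -> L2 u -> version v u -> version (F v) (F u).
Proof.
move=> [K0 mF bF lF] uL vu; have vL := version_L2 _ _ vu uL.
split; first exact: mF.
have dL : L2 (fun y => -1 * u y + v y) by exact: L2D (L2Z _ _ uL) vL.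
have d0 : Lp_norm 2 (fun y => (-1 * u y + v y)%R) = 0%E.
  rewrite -[RHS](@Lp_norm2_0 R a); apply: Lp_norm2_ae.
  - exact: L2_measurable.
  - exact: cmeasurable_cst.
  - by have [_] := vu; apply: filterS => x ->; rewrite mulN1r addNr.
have F0 : Lp_norm 2 (F (fun y => (-1 * u y + v y)%R)) = 0%E.
  by apply/eqP; rewrite eq_le Lp_norm2_ge0 andbT (le_trans (bF _ dL))// d0 mule0.
have z := Lp_norm2_eq0 _ (mF _ dL) F0.
by apply: filterS2 z (lF (-1) _ _ uL vL) => x -> /esym/eqP; rewrite mulN1r addrC subr_eq0 => /eqP.
Qed.

Lemma linear_bounded_lin a b (F : cfun R a -> cfun R b) K (c : C) u v :
  linear_bounded F K -> L2 u -> L2 v ->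
  version (F (fun y => c * u y + v y)) (fun x => c * F u x + F v x).
Proof.
move=> [K0 mF bF lF] uL vL; split; last exact: lF.
by apply: mF; exact: L2D (L2Z _ _ uL) vL.
Qed.

Lemma linear_bounded_0 a b (F : cfun R a -> cfun R b) K :
  linear_bounded F K -> version (F (fun=> 0)) (fun=> 0).
Proof.
move=> [K0 mF bF _]; have L0 := @L2_cst0 R a.
apply/version_dist0; [exact: mF|exact: cmeasurable_cst|].
apply/eqP; rewrite eq_le Lp_norm2_ge0 andbT.
rewrite (_ : (fun x => _) = F (fun=> 0)); last by apply/funext => x; rewrite subr0.
by apply: (le_trans (bF _ L0)); rewrite Lp_norm2_0 mule0.
Qed.

Lemma linear_bounded_bigsum a b (F : cfun R a -> cfun R b) K (I : finType) (P : pred I)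
    (u : I -> cfun R a) :
  linear_bounded F K -> (forall i, P i -> L2 (u i)) ->
  version (F (fun x => \sum_(i | P i) u i x)) (fun x => \sum_(i | P i) F (u i) x).
Proof.
move=> bF uL; have eP (f : I -> C) : \sum_(i | P i) f i = \sum_(i <- seq.filter P (index_enum I)) f i.
  by rewrite big_filter.
have -> : (fun x => \sum_(i | P i) u i x) = (fun x => \sum_(i <- seq.filter P (index_enum I)) u i x).
  by apply/funext => x; rewrite eP.
have -> : (fun x => \sum_(i | P i) F (u i) x) = (fun x => \sum_(i <- seq.filter P (index_enum I)) F (u i) x).
  by apply/funext => x; rewrite eP.
have : {in seq.filter P (index_enum I), forall i, L2 (u i)}.
  by move=> i; rewrite mem_filter => /andP[/uL].
elim: (seq.filter _ _) => [_|i s IH hL].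
  have := linear_bounded_0 _ _ _ _ bF; congr version.
    by congr F; apply/funext => x; rewrite big_nil.
  by apply/funext => x; rewrite big_nil.
have sL : {in s, forall i, L2 (u i)} by move=> j js; apply: hL; rewrite inE js orbT.
have iL : L2 (u i) by apply: hL; rewrite inE eqxx.
have ssL : L2 (fun x => \sum_(j <- s) u j x).
  rewrite (_ : (fun x => _) = (fun x => \sum_(j <- s | j \in s) u j x)); first exact: L2_sum.
  by apply/funext => x; rewrite big_seq_cond; under eq_bigl do rewrite andbT.
have -> : (fun x => \sum_(j <- i :: s) u j x) = (fun x => 1 * u i x + \sum_(j <- s) u j x).
  by apply/funext => x; rewrite big_cons mul1r.
apply: version_trans (linear_bounded_lin _ _ _ _ _ _ _ bF iL ssL) _.
have -> : (fun x => \sum_(j <- i :: s) F (u j) x) = (fun x => 1 * F (u i) x + \sum_(j <- s) F (u j) x).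
  by apply/funext => x; rewrite big_cons mul1r.
apply: version_lin; last exact: IH.
by apply: version_refl; apply: L2_measurable; exact: linear_bounded_L2 bF iL.
Qed.

Lemma linear_bounded_id a : linear_bounded (@id (cfun R a)) 1.
Proof.
split=> //; first by move=> u; exact: L2_measurable.
  by move=> u _; rewrite mul1e.
by move=> c u v _ _; exact: aeW.
Qed.

Lemma linear_bounded_comp a b c (F : cfun R b -> cfun R c) (G : cfun R a -> cfun R b) K L :
  linear_bounded F K -> linear_bounded G L -> linear_bounded (F \o G) (K * L).
Proof.
move=> bF bG; have [K0 mF nF lF] := bF; have [L0 mG nG lG] := bG.
have GL u : L2 u -> L2 (G u) by exact: linear_bounded_L2 bG.
split.
- exact: mulr_ge0.
- by move=> u /GL; exact: mF.
- move=> u uL; apply: (le_trans (nF _ (GL _ uL))).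
  by rewrite EFinM -muleA lee_wpmul2l ?lee_fin// nG.
- move=> k u v uL vL /=.
  have lL : L2 (fun y => k * G u y + G v y) by exact: L2D (L2Z _ _ (GL _ uL)) (GL _ vL).
  have [_ h1] := linear_bounded_version _ _ _ _ _ _ bF lL (linear_bounded_lin _ _ _ _ k _ _ bG uL vL).
  by apply: filterS2 h1 (lF k _ _ (GL _ uL) (GL _ vL)) => x -> ->.
Qed.

Lemma linear_bounded_scale a b (F : cfun R a -> cfun R b) K (c : C) :
  linear_bounded F K -> linear_bounded (fun u x => c * F u x) (cabs c * K).
Proof.
move=> [K0 mF nF lF]; split.
- by rewrite mulr_ge0// cabs_ge0.
- by move=> u uL; apply: cmeasurableM; [exact: cmeasurable_cst|exact: mF].
- move=> u uL; rewrite Lp_norm2Z; last exact: mF.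
  by rewrite EFinM -muleA lee_wpmul2l ?lee_fin ?cabs_ge0// nF.
- move=> k u v uL vL; apply: filterS (lF k _ _ uL vL) => x ->.
  by rewrite mulrDr mulrCA.
Qed.

Lemma linear_bounded_sum a b (I : finType) (P : pred I) (F : I -> cfun R a -> cfun R b)
    (K : I -> R) :
  (forall i, P i -> linear_bounded (F i) (K i)) ->
  linear_bounded (fun u x => \sum_(i | P i) F i u x) (\sum_(i | P i) K i).
Proof.
move=> h; split.
- by apply: sumr_ge0 => i /h[].
- by move=> u uL; apply: cmeasurable_sum => i /h[_ mF _ _]; exact: mF.
- move=> u uL; apply: (@le_trans _ _ (\sum_(i | P i) (K i)%:E * Lp_norm 2 u)%E).
    rewrite (le_trans (le_Lp_norm2_sum _ _ _ _ _))//; first by move=> i /h[_ mF _ _]; exact: mF.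
    by apply: lee_sum => i /h[_ _ nF _]; exact: nF.
  rewrite -sumEFin ge0_sume_distrl//.
  by move=> i /h[]; rewrite lee_fin.
- move=> k u v uL vL.
  have ae : {ae lebesgue b, forall x, forall i, P i ->
      F i (fun y => (k * u y + v y)%R) x = k * F i u x + F i v x}.
    apply: filter_forall => i; case Pi : (P i); last exact: aeW.
    by have [_ _ _ lF] := h i Pi; apply: filterS (lF k _ _ uL vL) => x -> _.
  apply: filterS ae => x hx; rewrite mulr_sumr -big_split/=.
  by apply: eq_bigr => i Pi; exact: hx.
Qed.

Lemma linear_bounded_add a b (F G : cfun R a -> cfun R b) K L :
  linear_bounded F K -> linear_bounded G L ->
  linear_bounded (fun u x => F u x + G u x) (K + L).
Proof.
move=> bF bG.
have := linear_bounded_sum _ _ bool xpredT (fun i : bool => if i then F else G)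
  (fun i : bool => if i then K else L) (fun i _ => if i return linear_bounded (if i then F else G) (if i then K else L) then bF else bG).
rewrite big_bool/= ; congr linear_bounded.
by apply/funext => u; apply/funext => x; rewrite big_bool.
Qed.

(** Inputs are restricted to L^2 because [green] also accepts functions from Sobolev spaces of
    negative order, on which nothing is claimed. *)
Definition represents {a b : nat} (A : op R a b) (F : cfun R a -> cfun R b) :=
  forall u, L2 u -> forall w, A u w <-> version w (F u).

Lemma represents_id a : represents (@op_id R a) id.
Proof. by move=> u uL w; split=> [[]|]//; split => //; exact: L2_measurable. Qed.

Lemma represents_comp a b c (A : op R b c) (B : op R a b) F K G L :
  represents A F -> linear_bounded F K -> represents B G -> linear_bounded G L ->
  represents (op_comp A B) (F \o G).
Proof.
move=> AF bF BG bG u uL w; have GL := linear_bounded_L2 _ _ _ _ _ bG uL; split.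
  move=> [v /(BG _ uL) vG /(AF _ (version_L2 _ _ vG GL)) wF].
  exact: version_trans wF (linear_bounded_version _ _ _ _ _ _ bF GL vG).
move=> wF; exists (G u); last exact/AF.
by apply/BG => //; apply: version_refl; exact: L2_measurable.
Qed.

Lemma represents_scale a b (A : op R a b) F K (c : C) : represents A F -> linear_bounded F K ->
  represents (op_scale c A) (fun u x => c * F u x).
Proof.
move=> AF bF u uL w; have FL := linear_bounded_L2 _ _ _ _ _ bF uL.
have z0 : @version R b (fun=> 0) (fun=> 0) by apply: version_refl; exact: cmeasurable_cst.
have cE (f : cfun R b) : (fun x => c * f x + 0) = (fun x => c * f x) by apply/funext => x; rewrite addr0.
split=> [[v /(AF _ uL) vF wv]|wF].
  by apply: version_trans wv _; have := version_lin _ c _ _ _ _ vF z0; rewrite !cE.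
by exists (F u) => //; apply/AF => //; apply: version_refl; exact: L2_measurable.
Qed.

Lemma represents_add a b (A B : op R a b) F K G L : represents A F -> linear_bounded F K ->
  represents B G -> linear_bounded G L ->
  represents (op_add A B) (fun u x => F u x + G u x).
Proof.
move=> AF bF BG bG u uL w; have FL := linear_bounded_L2 _ _ _ _ _ bF uL.
have GL := linear_bounded_L2 _ _ _ _ _ bG uL.
split=> [[v [v' [/(AF _ uL) vF /(BG _ uL) vG wv]]]|wF].
  apply: version_trans wv _; have := version_lin _ 1 _ _ _ _ vF vG.
  by congr version; apply/funext => x; rewrite mul1r.
exists (F u), (G u); split => //.
  by apply/AF => //; apply: version_refl; exact: L2_measurable.
by apply/BG => //; apply: version_refl; exact: L2_measurable.
Qed.

Lemma represents_sum a b (I : finType) (P : pred I) (A : I -> op R a b) F K :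
  (forall i, P i -> represents (A i) (F i)) -> (forall i, P i -> linear_bounded (F i) (K i)) ->
  represents (op_sum P A) (fun u x => \sum_(i | P i) F i u x).
Proof.
move=> AF bF u uL w; split=> [[v vA wv]|wF].
  apply: version_trans wv _; apply: version_sum => i Pi.
  by apply/(AF i Pi) => //; exact: vA.
exists (fun i => F i u) => // i Pi; apply/(AF i Pi) => //.
by apply: version_refl; apply: L2_measurable; exact: linear_bounded_L2 (bF i Pi) uL.
Qed.

(* [A] is the operator on L^2 that [F] describes in Fourier variables. *)
Definition fourier_represents {a b : nat} (A : op R a b) (F : cfun R a -> cfun R b) :=
  forall u uh, fourier u uh -> forall w, A u w <-> fourier w (F uh).

(** Plays the role of [unhat] for an operator that is given directly as a function in Fourier
    variables; the sum of the series over diagrams is of this kind. *)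
Definition unhat_fun {a b : nat} (F : cfun R a -> cfun R b) : op R a b :=
  fun u w => exists2 uh, fourier u uh & fourier w (F uh).

Lemma fourier_represents_unhat_fun a b (F : cfun R a -> cfun R b) K : linear_bounded F K ->
  fourier_represents (unhat_fun F) F.
Proof.
move=> bF u uh uuh w; split=> [[uh' uuh' wF]|wF]; last by exists uh.
have [_ uhL _] := uuh; have [wL _ _] := wF.
apply: (fourier_version _ _ _ _ wF); first by apply: version_refl; exact: L2_measurable.
have [_ uhL' _] := uuh'.
exact: (linear_bounded_version _ _ _ _ _ _ bF uhL' (fourier_fun _ _ _ uuh' uuh)).
Qed.

Lemma fourier_represents_unhat a b (A : op R a b) F K : represents A F -> linear_bounded F K ->
  fourier_represents (unhat A) F.
Proof.
move=> AF bF u uh uuh w; have [_ uhL _] := uuh; split.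
  move=> [uh' [wh [uuh' /AF]]]; have [_ uhL' _] := uuh'.
  move=> /(_ uhL') whF wwh; have [wL whL _] := wwh.
  apply: (fourier_version _ _ _ _ wwh); first by apply: version_refl; exact: L2_measurable.
  apply: version_trans (linear_bounded_version _ _ _ _ _ _ bF uhL' (fourier_fun _ _ _ uuh' uuh)) _.
  by apply: version_sym => //; apply: L2_measurable; exact: linear_bounded_L2 bF uhL'.
move=> wF; exists uh, (F uh); split => //; apply/AF => //.
by apply: version_refl; apply: L2_measurable; exact: linear_bounded_L2 bF uhL.
Qed.

(** Recovering the summands from their sum requires a preimage of each under the transform: this is
    where surjectivity is used. *)
Lemma fourier_represents_add a b (A B : op R a b) F K G L :
  fourier_represents A F -> linear_bounded F K ->
  fourier_represents B G -> linear_bounded G L ->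
  fourier_represents (op_add A B) (fun u x => F u x + G u x).
Proof.
move=> AF bF BG bG u uh uuh w; have [_ uhL _] := uuh.
have addE (f g : cfun R b) : (fun x => 1 * f x + g x) = (fun x => f x + g x).
  by apply/funext => x; rewrite mul1r.
split.
  move=> [v [v' [/(AF _ _ uuh) vF /(BG _ _ uuh) vG wv]]].
  have := fourier_lin 1 _ _ _ _ vF vG; rewrite !addE => h; have [_ sL _] := h.
  by apply: (fourier_version _ _ _ _ h) => //; apply: version_refl; exact: L2_measurable.
move=> wF; have [v vF] := fourier_surj _ (linear_bounded_L2 _ _ _ _ _ bF uhL).
have [v' vG] := fourier_surj _ (linear_bounded_L2 _ _ _ _ _ bG uhL).
exists v, v'; split; [exact: (AF _ _ uuh _).2|exact: (BG _ _ uuh _).2|].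
by have := fourier_lin 1 _ _ _ _ vF vG; rewrite !addE => h; exact: fourier_inj h wF.
Qed.

Lemma fourier_represents_scale a b (A : op R a b) F K (c : C) :
  fourier_represents A F -> linear_bounded F K ->
  fourier_represents (op_scale c A) (fun u x => c * F u x).
Proof.
move=> AF bF u uh uuh w; have [_ uhL _] := uuh.
have four0 : @fourier R b (fun=> 0) (fun=> 0).
  have [g hg] := fourier_total _ (@L2_cst0 R b).
  have := fourier_lin (-1) _ _ _ _ hg hg.
  rewrite (_ : (fun x => -1 * 0 + 0) = (fun=> 0)); last by apply/funext => x; rewrite mulr0 addr0.
  by rewrite (_ : (fun x => -1 * g x + g x) = (fun=> 0))//; apply/funext => x; rewrite mulN1r addNr.
have sc (f g : cfun R b) : fourier f g -> fourier (fun x => c * f x) (fun x => c * g x).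
  move=> fg; have := fourier_lin c _ _ _ _ fg four0.
  by congr fourier; apply/funext => x; rewrite addr0.
split.
  move=> [v /(AF _ _ uuh) /sc vF wv]; have [_ sL _] := vF.
  by apply: (fourier_version _ _ _ _ vF) => //; apply: version_refl; exact: L2_measurable.
move=> wF; have [v vF] := fourier_surj _ (linear_bounded_L2 _ _ _ _ _ bF uhL).
by exists v; [exact: (AF _ _ uuh _).2|exact: fourier_inj (sc _ _ vF) wF].
Qed.

Lemma fourier_bigsum b (I : finType) (P : pred I) (f g : I -> cfun R b) :
  (forall i, P i -> fourier (f i) (g i)) ->
  fourier (fun x => \sum_(i | P i) f i x) (fun x => \sum_(i | P i) g i x).
Proof.
move=> h; have four0 : @fourier R b (fun=> 0) (fun=> 0).
  have [k hk] := fourier_total _ (@L2_cst0 R b).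
  have := fourier_lin (-1) _ _ _ _ hk hk.
  rewrite (_ : (fun x => -1 * 0 + 0) = (fun=> 0)); last by apply/funext => x; rewrite mulr0 addr0.
  by rewrite (_ : (fun x => -1 * k x + k x) = (fun=> 0))//; apply/funext => x; rewrite mulN1r addNr.
have eP (k : I -> cfun R b) : (fun x => \sum_(i | P i) k i x) =
    (fun x => \sum_(i <- seq.filter P (index_enum I)) k i x).
  by apply/funext => x; rewrite big_filter.
rewrite !eP; have : {in seq.filter P (index_enum I), forall i, fourier (f i) (g i)}.
  by move=> i; rewrite mem_filter => /andP[/h].
elim: (seq.filter _ _) => [_|i s IH hL].
  by move: four0; congr fourier; apply/funext => x; rewrite big_nil.
have hs := IH (fun j js => hL j (mem_behead (s := i :: s) js)).
have := fourier_lin 1 _ _ _ _ (hL i (mem_head _ _)) hs.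
by congr fourier; apply/funext => x; rewrite big_cons mul1r.
Qed.

Lemma fourier_represents_sum a b (I : finType) (P : pred I) (A : I -> op R a b) F K :
  (forall i, P i -> fourier_represents (A i) (F i)) ->
  (forall i, P i -> linear_bounded (F i) (K i)) ->
  fourier_represents (op_sum P A) (fun u x => \sum_(i | P i) F i u x).
Proof.
move=> AF bF u uh uuh w; have [_ uhL _] := uuh; split.
  move=> [v vA wv].
  have h : fourier (fun x => \sum_(i | P i) v i x) (fun x => \sum_(i | P i) F i uh x).
    by apply: fourier_bigsum => i Pi; apply/(AF i Pi _ _ uuh); exact: vA.
  have [_ sL _] := h.
  by apply: (fourier_version _ _ _ _ h) => //; apply: version_refl; exact: L2_measurable.
move=> wF.
have hv i : exists v, P i -> fourier v (F i uh).
  case Pi : (P i); last by exists (fun=> 0).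
  by have [v vF] := fourier_surj _ (linear_bounded_L2 _ _ _ _ _ (bF i Pi) uhL); exists v.
have [v hv'] := choice hv.
exists v; first by move=> i Pi; apply/(AF i Pi _ _ uuh); exact: hv'.
exact: fourier_inj (fourier_bigsum _ _ _ _ _ hv') wF.
Qed.

(** The isometry carries the bound from Fourier variables. The lower bound needs an element in the
    set of norms, since the supremum of the empty set is -oo; the input 0 provides one. *)
Lemma op_norm_le a b (A : op R a b) F K : fourier_represents A F -> linear_bounded F K ->
  (0 <= op_norm A <= K%:E)%E.
Proof.
move=> AF bF; have [K0 _ nF _] := bF; apply/andP; split.
  have [uh uuh] := fourier_total _ (@L2_cst0 R a); have [_ uhL _] := uuh.
  have [w wF] := fourier_surj _ (linear_bounded_L2 _ _ _ _ _ bF uhL).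
  apply: (le_trans (Lp_norm2_ge0 w)); apply: ereal_sup_ubound.
  exists (fun=> 0), w; split => //; first exact: L2_cst0.
    by rewrite Lp_norm2_0.
  exact: (AF _ _ uuh _).2.
apply: ge_ereal_sup => _ [u [w [uL u1 Auw ->]]].
have [uh uuh] := fourier_total _ uL; have [_ uhL _] := uuh.
have /(AF _ _ uuh) wF := Auw.
rewrite -(fourier_isometry _ _ wF) (le_trans (nF _ uhL))// (fourier_isometry _ _ uuh).
by rewrite -[leRHS]mule1 lee_wpmul2l ?lee_fin.
Qed.

Lemma bounded_operatorP a b (A : op R a b) F K : fourier_represents A F -> linear_bounded F K ->
  (forall u w, A u w -> L2 u) -> bounded_operator A.
Proof.
move=> AF bF Adom; split.
- move=> u w Auw; have uL := Adom _ _ Auw; split => //.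
  by have [uh uuh] := fourier_total _ uL; have /(AF _ _ uuh)[] := Auw.
- move=> u uL; have [uh uuh] := fourier_total _ uL; have [_ uhL _] := uuh.
  have [w wF] := fourier_surj _ (linear_bounded_L2 _ _ _ _ _ bF uhL).
  by exists w; exact: (AF _ _ uuh _).2.
- move=> u w w' Auw; have uL := Adom _ _ Auw.
  have [uh uuh] := fourier_total _ uL; have /(AF _ _ uuh) wF := Auw.
  split=> [/(AF _ _ uuh) wF'|w'w]; first exact: fourier_inj wF wF'.
  apply/(AF _ _ uuh); apply: (fourier_version _ _ _ _ wF w'w); apply: version_refl.
  by apply: L2_measurable; case: wF.
- move=> c u u' w w' Auw Auw'.
  have [uh uuh] := fourier_total _ (Adom _ _ Auw).
  have [uh' uuh'] := fourier_total _ (Adom _ _ Auw').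
  have /(AF _ _ uuh) wF := Auw; have /(AF _ _ uuh') wF' := Auw'.
  apply/(AF _ _ (fourier_lin c _ _ _ _ uuh uuh')).
  have h := fourier_lin c _ _ _ _ wF wF'; have [lL _ _] := h.
  apply: (fourier_version _ _ _ _ h); first by apply: version_refl; exact: L2_measurable.
  have [_ uhL _] := uuh; have [_ uhL' _] := uuh'.
  exact: linear_bounded_lin bF uhL uhL'.
- by have /andP[_] := op_norm_le _ _ _ _ _ AF bF; move/le_lt_trans; apply; rewrite ltry.
Qed.

Lemma bounded_unhat a b (A : op R a b) F K : represents A F -> linear_bounded F K ->
  bounded_operator (unhat A) /\ (op_norm (unhat A) <= K%:E)%E.
Proof.
move=> AF bF; have h := fourier_represents_unhat _ _ _ _ _ AF bF; split.
  by apply: (bounded_operatorP _ _ _ _ _ h bF) => u w [uh [wh [[]]]].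
by have /andP[] := op_norm_le _ _ _ _ _ h bF.
Qed.

End FunctionOperators.

Lemma integral_indic_null {R : realType} d (T : measurableType d)
    (mu : {measure set T -> \bar R}) (A : set T) :
  measurable A -> mu A = 0%E -> (\int[mu]_x (\1_A x : R)%:E = 0)%E.
Proof. by move=> mA A0; rewrite integral_indic// setIT. Qed.

(** * Traces *)

Section SplitIntegral.
Context {R : realType} {m : nat}.
Local Notation C := R[i].
Local Notation n := m.+2.
Local Notation pair := ('I_n * 'I_n)%type.
Local Notation leb := (@plane_lebesgue R).
Implicit Types (e : pair) (f : cfun R n).

Lemma ge0_integral_split e (F : config R n -> \bar R) : e.1 != e.2 ->
  measurable_fun setT F -> (forall p, 0 <= F p)%E ->
  (\int[lebesgue n]_p F p =
   \int[lebesgue m.+1]_q \int[leb]_w F (@split_pair R n e w q))%E.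
Proof.
move=> e12 mF F0; rewrite (ge0_integral_preserves _ _ _ (preserves_split_pair e e12) F)//.
have mS : measurable_fun setT (fun p : plane R * config R m.+1 => @split_pair R n e p.1 p.2).
  exact: measurable_split_pair.
have mG : measurable_fun setT (fun p : plane R * config R m.+1 => F (@split_pair R n e p.1 p.2)).
  exact: (measurableT_comp mF mS).
rewrite ge0_integral_prod//.
exact: (@fubini_tonelli _ _ _ _ _ leb (lebesgue m.+1) (fun p : plane R * config R m.+1 => F (@split_pair R n e p.1 p.2))).
Qed.

Lemma energy_split e f : e.1 != e.2 -> cmeasurable f ->
  (energy f = \int[lebesgue m.+1]_q \int[leb]_w (cabs (f (@split_pair R n e w q)) ^+ 2)%:E)%E.
Proof.
move=> e12 mf; rewrite /energy (ge0_integral_split e)//.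
  by apply/measurable_EFinP; exact: measurable_cabs_sqr.
by move=> p; rewrite lee_fin sqr_ge0.
Qed.

Lemma measurable_splitE e d (T : measurableType d) (F : T -> plane R) (G : T -> config R m.+1)
    (h : config R n -> \bar R) : e.1 != e.2 -> measurable_fun setT h ->
  measurable_fun setT F -> measurable_fun setT G ->
  measurable_fun setT (fun x => h (@split_pair R n e (F x) (G x))).
Proof.
move=> e12 mh mF mG.
exact: (measurableT_comp mh (measurable_split_pair _ _ e _ _ e12 mF mG)).
Qed.

Lemma measurable_integral_split e (h : config R n -> \bar R) : e.1 != e.2 ->
  measurable_fun setT h ->
  measurable_fun setT (fun q => \int[leb]_w h (@split_pair R n e w q))%E.
Proof.
move=> e12 mh.
apply: (measurable_param_integral leb (fun z : config R m.+1 * plane R => h (@split_pair R n e z.2 z.1))).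
exact: measurable_splitE.
Qed.

(** The indicator of a null set has zero integral, hence zero integral on almost every slice. This
    is what makes the trace insensitive to the choice of a version. *)
Lemma ae_split e (P : config R n -> Prop) : e.1 != e.2 ->
  {ae lebesgue n, forall p, P p} ->
  {ae lebesgue m.+1, forall q, {ae leb, forall w, P (@split_pair R n e w q)}}.
Proof.
move=> e12 [A [mA A0 PA]].
have m1 : measurable_fun setT (fun p => (\1_A p : R)%:E) by apply/measurable_EFinP; exact: measurable_indic.
have i0 : (\int[lebesgue m.+1]_q \int[leb]_w (\1_A (@split_pair R n e w q) : R)%:E = 0)%E.
  rewrite -(ge0_integral_split e (fun p => (\1_A p : R)%:E))//.
  exact: integral_indic_null.
have I0 q : (0 <= \int[leb]_w (\1_A (@split_pair R n e w q) : R)%:E)%E.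
  by apply: integral_ge0 => w _; rewrite lee_fin indicE.
have mI := measurable_integral_split e _ e12 m1.
have : (\int[lebesgue m.+1]_q `|\int[leb]_w (\1_A (@split_pair R n e w q) : R)%:E| = 0)%E.
  by rewrite -i0; apply: eq_integral => q _; rewrite gee0_abs.
move/(ae_eq_integral_abs (lebesgue m.+1) measurableT mI) => ae1.
apply: filterS ae1 => q /(_ I) hq.
have mq : measurable_fun setT (fun w => (\1_A (@split_pair R n e w q) : R)%:E).
  by apply: (measurable_splitE e _ _ id (fun=> q) (fun p => (\1_A p : R)%:E)).
have : (\int[leb]_w `|(\1_A (@split_pair R n e w q) : R)%:E| = 0)%E.
  by rewrite -[RHS]hq; apply: eq_integral => w _; rewrite gee0_abs// lee_fin indicE.
move/(ae_eq_integral_abs leb measurableT mq); apply: filterS => w /(_ I) /=.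
move=> hw; apply: contrapT => nP; have Aw : A (@split_pair R n e w q) by apply: PA.
by move: hw; rewrite indicE mem_set// => -[] /eqP; rewrite oner_eq0.
Qed.

Definition trace_fun e : cfun R n -> cfun R m.+1 := fun f q =>
  ((2 * pi)^-1)%:C%C * cintegral leb (fun w => f (@split_pair R n e w q)).

(** The quantity in the domain condition of [trace]. It is extended-real valued, so its square is
    written as a product. *)
Definition abs_trace e f (q : config R m.+1) : \bar R :=
  (\int[leb]_w (cabs (f (@split_pair R n e w q)))%:E)%E.

Lemma abs_trace_ge0 e f q : (0 <= abs_trace e f q)%E.
Proof. by apply: integral_ge0 => w _; rewrite lee_fin cabs_ge0. Qed.

Lemma cmeasurable_slice e f q : e.1 != e.2 -> cmeasurable f ->
  cmeasurable (fun w => f (@split_pair R n e w q)).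
Proof.
move=> e12 mf; apply: (cmeasurable_comp _ _ f _ mf).
exact: (measurable_split_pair _ _ e id (fun=> q)).
Qed.

Lemma measurable_abs_trace e f : e.1 != e.2 -> cmeasurable f -> measurable_fun setT (abs_trace e f).
Proof. by move=> e12 mf; exact: (measurable_integral_split e (fun p => (cabs (f p))%:E) e12 (measurable_cabsE _ mf)). Qed.

Lemma cmeasurable_trace_fun e f : e.1 != e.2 -> cmeasurable f -> cmeasurable (trace_fun e f).
Proof.
move=> e12 mf; apply: cmeasurableM; first exact: cmeasurable_cst.
apply: (cmeasurable_param_cintegral leb (fun z : config R m.+1 * plane R => f (@split_pair R n e z.2 z.1))).
apply: (cmeasurable_comp _ _ f _ mf); exact: (measurable_split_pair _ _ e _ _ e12).
Qed.

Lemma Lnorm_abs_trace e f : ('N[lebesgue m.+1]_(2%:E)[abs_trace e f])%E =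
  sqrte (\int[lebesgue m.+1]_q (abs_trace e f q * abs_trace e f q))%E.
Proof.
rewrite -poweR12_sqrt; last by apply: integral_ge0 => q _; rewrite mule_ge0// abs_trace_ge0.
rewrite unlock; congr (_ `^ _)%E; apply: eq_integral => q _.
rewrite gee0_abs ?abs_trace_ge0//; have := abs_trace_ge0 e f q.
case: (abs_trace e f q) => [r r0| |]//=; first by rewrite powR_mulrn// -EFinM expr2.
by rewrite ifF// gt_eqF.
Qed.

Lemma cabs_trace_fun e f q : e.1 != e.2 -> cmeasurable f ->
  ((cabs (trace_fun e f q) ^+ 2)%:E <=
   (((2 * pi)^-1) ^+ 2)%:E * (abs_trace e f q * abs_trace e f q))%E.
Proof.
move=> e12 mf; rewrite /trace_fun cabsM cabs_real exprMn EFinM real_normK ?num_real//.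
apply: lee_wpmul2l; first by rewrite lee_fin sqr_ge0.
have h := cabs_cintegral_le leb _ (cmeasurable_slice e f q e12 mf).
by rewrite expr2 EFinM; apply: lee_pmul => //; rewrite lee_fin cabs_ge0.
Qed.

Lemma trace_represents e f : e.1 != e.2 -> L2 f ->
  (\int[lebesgue m.+1]_q (abs_trace e f q * abs_trace e f q) < +oo)%E ->
  forall g, trace (n := n) e f g <-> version g (trace_fun e f).
Proof.
move=> e12 fL fy g; split=> [[]|]//= vg; split => //.
have := Lnorm_abs_trace e f; rewrite /abs_trace /= => ->.
by move: fy; case: (\int[_]_q _)%E => //= r _; rewrite ltry.
Qed.

Lemma ae_abs_trace_fin e f : e.1 != e.2 -> cmeasurable f ->
  (\int[lebesgue m.+1]_q (abs_trace e f q * abs_trace e f q) < +oo)%E ->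
  {ae lebesgue m.+1, forall q, cintegrable leb (fun w => f (@split_pair R n e w q))}.
Proof.
move=> e12 mf fy.
have mA := measurable_abs_trace e f e12 mf.
have mAA : measurable_fun setT (fun q => abs_trace e f q * abs_trace e f q)%E by exact: emeasurable_funM.
have ii : (lebesgue m.+1).-integrable setT (fun q => abs_trace e f q * abs_trace e f q)%E.
  apply/integrableP; split => //.
  rewrite (eq_integral (fun q => abs_trace e f q * abs_trace e f q)%E)// => q _.
  by rewrite gee0_abs// mule_ge0// abs_trace_ge0.
apply: filterS (integrable_ae measurableT ii) => q /(_ I) hq.
apply/cintegrableP; first exact: cmeasurable_slice.
rewrite -/(abs_trace e f q); move: hq (abs_trace_ge0 e f q).
by case: (abs_trace e f q) => // r _ _; rewrite ltry.
Qed.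

Lemma trace_fun_ae e f g : e.1 != e.2 -> cmeasurable f -> cmeasurable g ->
  {ae lebesgue n, forall p, f p = g p} ->
  {ae lebesgue m.+1, forall q, trace_fun e f q = trace_fun e g q /\ abs_trace e f q = abs_trace e g q}.
Proof.
move=> e12 mf mg fg; apply: filterS (ae_split e _ e12 fg) => q hq; split.
  by congr (_ * _); apply: cintegral_ae => //; exact: cmeasurable_slice.
apply: ge0_ae_eq_integral => //.
- by apply: measurable_cabsE; exact: cmeasurable_slice.
- by apply: measurable_cabsE; exact: cmeasurable_slice.
- by move=> w _; rewrite lee_fin cabs_ge0.
- by move=> w _; rewrite lee_fin cabs_ge0.
- by apply: filterS hq => w -> _.
Qed.

Lemma integral_abs_trace_ae e f g : e.1 != e.2 -> cmeasurable f -> cmeasurable g ->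
  {ae lebesgue n, forall p, f p = g p} ->
  (\int[lebesgue m.+1]_q (abs_trace e f q * abs_trace e f q) =
   \int[lebesgue m.+1]_q (abs_trace e g q * abs_trace e g q))%E.
Proof.
move=> e12 mf mg fg; apply: ge0_ae_eq_integral => //.
- by apply: emeasurable_funM; exact: measurable_abs_trace.
- by apply: emeasurable_funM; exact: measurable_abs_trace.
- by move=> q _; rewrite mule_ge0// abs_trace_ge0.
- by move=> q _; rewrite mule_ge0// abs_trace_ge0.
- by apply: filterS (trace_fun_ae e f g e12 mf mg fg) => q [_ ->] _.
Qed.

Section TraceComposition.
Context {a : nat}.
Variables (e : pair) (H : cfun R a -> cfun R n) (K0 K : R).
Hypotheses (e12 : e.1 != e.2) (bH : linear_bounded H K0) (Kge0 : 0 <= K).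
Hypothesis HK : forall u, L2 u ->
  (\int[lebesgue m.+1]_q (abs_trace e (H u) q * abs_trace e (H u) q) <=
   ((2 * pi * K) ^+ 2)%:E * energy u)%E.

Let Hfin u : L2 u ->
  (\int[lebesgue m.+1]_q (abs_trace e (H u) q * abs_trace e (H u) q) < +oo)%E.
Proof.
move=> uL; apply: (le_lt_trans (HK _ uL)).
by rewrite lte_mul_pinfty ?lee_fin ?sqr_ge0//; have [] := (L2P u).1 uL.
Qed.

(** One estimate on [abs_trace] gives everything: the norm bound, its factor 2 pi cancelling the
    normalisation of the trace, and additivity, because almost every slice is then integrable. *)
Lemma linear_bounded_trace : linear_bounded (trace_fun e \o H) K.
Proof.
have [_ mH _ lH] := bH; split => //.
- by move=> u uL; apply: cmeasurable_trace_fun => //; exact: mH.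
- move=> u uL.
  have mHu := mH _ uL; have mA := measurable_abs_trace e _ e12 mHu.
  have mAA : measurable_fun setT (fun q => abs_trace e (H u) q * abs_trace e (H u) q)%E.
    exact: emeasurable_funM.
  rewrite -[leRHS]/(K%:E * Lp_norm 2 u)%E.
  have en : (energy ((trace_fun e \o H) u) <= (K ^+ 2)%:E * energy u)%E.
    apply: (@le_trans _ _ (\int[lebesgue m.+1]_q ((((2 * pi)^-1) ^+ 2)%:E * (abs_trace e (H u) q * abs_trace e (H u) q)))%E).
      apply: ge0_le_integral => //.
      + by move=> q _; rewrite lee_fin sqr_ge0.
      + apply/measurable_EFinP; apply: measurable_cabs_sqr; exact: cmeasurable_trace_fun.
      + exact: measurable_funeM.
      + by move=> q _; exact: cabs_trace_fun.
    rewrite ge0_integralZl_EFin ?sqr_ge0//; last by move=> q _; rewrite mule_ge0// abs_trace_ge0.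
    apply: (le_trans (lee_wpmul2l _ (HK _ uL))); first by rewrite lee_fin sqr_ge0.
    rewrite muleA -EFinM -exprMn mulrA mulVf ?mul1r//.
    by rewrite mulf_neq0// gt_eqF// pi_gt0.
  rewrite !Lp_norm2E (_ : K%:E = sqrte (K ^+ 2)%:E); last by rewrite /= sqrtr_sqr ger0_norm.
  by rewrite -sqrteM ?lee_fin ?sqr_ge0// lee_sqrt// ?mule_ge0 ?lee_fin ?sqr_ge0 ?energy_ge0.
- move=> c u v uL vL; have lL : L2 (fun y => c * u y + v y) by exact: L2D (L2Z _ _ uL) vL.
  have ml : cmeasurable (fun p => c * H u p + H v p).
    by apply: cmeasurableD; [apply: cmeasurableM; [exact: cmeasurable_cst|exact: mH]|exact: mH].
  have a1 := trace_fun_ae e _ _ e12 (mH _ lL) ml (lH c _ _ uL vL).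
  have a2 := ae_abs_trace_fin e _ e12 (mH _ uL) (Hfin _ uL).
  have a3 := ae_abs_trace_fin e _ e12 (mH _ vL) (Hfin _ vL).
  apply: filterS3 a1 a2 a3 => q [h _] h2 h3 /=; rewrite h /trace_fun mulrCA -mulrDr; congr (_ * _).
  by rewrite -cintegralZ// -cintegralD//; exact: cintegrableZ.
Qed.

Lemma represents_trace (A : op R a n) : represents A H ->
  represents (op_comp (trace (n := n) e) A) (trace_fun e \o H).
Proof.
move=> AH u uL w; have [_ mH _ _] := bH; have HL := linear_bounded_L2 _ _ _ _ _ bH uL; split.
  move=> [v /(AH _ uL) vH]; have [mv av] := vH; have vL := version_L2 _ _ vH HL.
  have fy : (\int[lebesgue m.+1]_q (abs_trace e v q * abs_trace e v q) < +oo)%E.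
    by rewrite (integral_abs_trace_ae e v (H u))//; [exact: Hfin|exact: mH].
  move/(trace_represents e v e12 vL fy) => wv; apply: version_trans wv _.
  split; first exact: cmeasurable_trace_fun.
  by apply: filterS (trace_fun_ae e _ _ e12 mv (mH _ uL) av) => q [].
move=> wF; exists (H u); last by apply/trace_represents => //; exact: Hfin.
by apply/AH => //; apply: version_refl; exact: mH.
Qed.

End TraceComposition.

End SplitIntegral.

Section PlaneBound.
Context {R : realType}.

(** Up to the factor pi / sqrt E the integrand is the Cauchy density of width sqrt E. *)
Lemma integral_inv_quadratic (E : R) : 0 < E ->
  (\int[@lebesgue_measure R]_t ((E + t ^+ 2)^-1)%:E = (pi / Num.sqrt E)%:E)%E.
Proof.
move=> E0; have s0 : 0 < Num.sqrt E by rewrite sqrtr_gt0.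
have p0 : 0 < pi :> R by exact: pi_gt0.
have mp : measurable_fun setT (fun t : R => poisson1 (Num.sqrt E) (0 - t)).
  apply: (measurableT_comp (continuous_measurable_fun (continuous_poisson1 _ s0))).
  by apply: measurable_funB => //; exact: measurable_cst.
rewrite (eq_integral (fun t : measurableTypeR R => ((pi / Num.sqrt E)%:E * (poisson1 (Num.sqrt E) (0 - (t : R)))%:E)%E)).
  rewrite ge0_integralZl_EFin//.
  - by rewrite integral_poisson1// mule1.
  - by move=> t _; rewrite lee_fin poisson1_ge0.
  - exact/measurable_EFinP.
  - by rewrite divr_ge0// ltW.
move=> t _; rewrite -EFinM /poisson1 sub0r sqrrN sqr_sqrtr ?(ltW E0)//; congr EFin.
have d0 : E + t ^+ 2 != 0 by rewrite gt_eqF// ltr_wpDr// sqr_ge0.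
move: (pi : R) (Num.sqrt E) p0 s0 => P s p0 s0; field.
by rewrite d0 !gt_eqF.
Qed.

(** From (E + |w|^2)^2 >= (E + w_1^2) (E + w_2^2) the integral is at most a product of two line
    integrals. The exact value is pi / E, but the product bound avoids polar coordinates. *)
Lemma integral_inv_plane (E : R) : 0 < E ->
  (\int[plane_lebesgue]_w (((E + sqn2 w) ^+ 2)^-1)%:E <= (pi ^+ 2 / E)%:E)%E.
Proof.
move=> E0; have p0 : 0 < pi :> R by exact: pi_gt0.
have mq : measurable_fun setT (fun t : R => (E + t ^+ 2)^-1).
  apply: measurable_funV; apply: measurable_funD; first exact: measurable_cst.
  exact: measurable_funX.
have q0 (t : R) : 0 < E + t ^+ 2 by rewrite ltr_wpDr// sqr_ge0.
have -> : pi ^+ 2 / E = pi / Num.sqrt E * (pi / Num.sqrt E) :> R.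
  by rewrite mulrACA -invfM -expr2 -expr2 sqr_sqrtr// ltW.
rewrite EFinM -integral_inv_quadratic// -(ge0_integral_plane_prod (fun t => (E + t ^+ 2)^-1) (fun t => (E + t ^+ 2)^-1))//; last 2 first.
- by move=> t; rewrite invr_ge0 ltW.
- by move=> t; rewrite invr_ge0 ltW.
have ms : measurable_fun setT (fun w : plane R => sqn2 w).
  by apply: measurable_dot2; exact: measurable_id.
have s0 (w : plane R) : 0 < E + sqn2 w by rewrite ltr_wpDr// sqn2_ge0.
apply: ge0_le_integral => //.
- by move=> w _; rewrite lee_fin invr_ge0 sqr_ge0.
- apply/measurable_EFinP; apply: measurable_funV; apply: measurable_funX.
  by apply: measurable_funD => //; exact: measurable_cst.
- apply/measurable_EFinP; apply: measurable_funM.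
    exact: (measurableT_comp mq measurable_fst).
  exact: (measurableT_comp mq measurable_snd).
- move=> w _; rewrite lee_fin -invfM lef_pV2 ?posrE ?mulr_gt0 ?exprn_gt0//.
  rewrite /sqn2 /dot2; move: (w.1 : R) (w.2 : R) => x y.
  have := mulr_ge0 (ltW E0) (sqr_ge0 x); have := mulr_ge0 (ltW E0) (sqr_ge0 y).
  have := mulr_ge0 (sqr_ge0 x) (sqr_ge0 y); have := sqr_ge0 (x ^+ 2); have := sqr_ge0 (y ^+ 2).
  by rewrite !expr2; nra.
Qed.

Lemma Lp_norm2_le_energies a b (f : cfun R a) (g : cfun R b) (k : R) : 0 <= k ->
  (energy f <= (k ^+ 2)%:E * energy g)%E -> (Lp_norm 2 f <= k%:E * Lp_norm 2 g)%E.
Proof.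
move=> k0 h; rewrite !Lp_norm2E (_ : k%:E = sqrte (k ^+ 2)%:E); last by rewrite /= sqrtr_sqr ger0_norm.
by rewrite -sqrteM ?lee_fin ?sqr_ge0// lee_sqrt// ?mule_ge0 ?lee_fin ?sqr_ge0 ?energy_ge0.
Qed.

End PlaneBound.

(** * Green operators and their traces *)

Section Green.
Context {R : realType} {n : nat}.
Local Notation C := R[i].
Variable z : C.
Hypothesis hz : 0 < - complex.Re z.

Implicit Types s : R.

Definition resolvent_den (s : R) : C := (s / 2)%:C%C - z.

Lemma cabs_resolvent_den s : s / 2 - complex.Re z <= cabs (resolvent_den s).
Proof.
have := cabs_Re (resolvent_den s); rewrite {1}/resolvent_den cReD cReN /=.
by apply: le_trans; exact: ler_norm.
Qed.

Lemma cabs_resolvent_den_gt0 s : 0 <= s -> 0 < cabs (resolvent_den s).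
Proof. by move=> s0; apply: lt_le_trans (cabs_resolvent_den s); (have hz0 := hz; lra). Qed.

Lemma resolvent_den_neq0 s : 0 <= s -> resolvent_den s != 0.
Proof. by move=> s0; rewrite -cabs_eq0 gt_eqF// cabs_resolvent_den_gt0. Qed.

Lemma cmeasurable_resolvent_den d (T : measurableType d) (f : T -> R) :
  measurable_fun setT f -> cmeasurable (fun x => resolvent_den (f x)).
Proof.
move=> mf; apply: cmeasurableB; last exact: cmeasurable_cst.
apply: cmeasurable_real; apply: measurable_funM => //; exact: measurable_cst.
Qed.

Definition green_fun (f : cfun R n) : cfun R n := fun p => f p / resolvent_den (sqn p).

Lemma cmeasurable_green_fun f : cmeasurable f -> cmeasurable (green_fun f).
Proof.
move=> mf; apply: cmeasurableM => //; apply: cmeasurableV.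
by apply: cmeasurable_resolvent_den; exact: measurable_sqn.
Qed.

Lemma cabs_green_fun f p : cabs (green_fun f p) <= (- complex.Re z)^-1 * cabs (f p).
Proof.
have s0 := sqn_ge0 _ p; rewrite cabsM cabsV mulrC ler_wpM2r ?cabs_ge0//.
rewrite lef_pV2 ?posrE ?cabs_resolvent_den_gt0// .
by apply: le_trans (cabs_resolvent_den _); (have hz0 := hz; lra).
Qed.

Lemma linear_bounded_green : linear_bounded green_fun (- complex.Re z)^-1.
Proof.
have r0 : 0 <= (- complex.Re z)^-1 by rewrite invr_ge0; (have hz0 := hz; lra).
split => //.
- by move=> u uL; apply: cmeasurable_green_fun; exact: L2_measurable.
- move=> u uL; have mu_ := L2_measurable _ uL; apply: Lp_norm2_le => //.
    exact: cmeasurable_green_fun.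
  by apply: aeW => p; exact: cabs_green_fun.
- by move=> c u v _ _; apply: aeW => p; rewrite /green_fun mulrDl mulrA.
Qed.

(** The weighted hypothesis, f in H^-2, is shared by the elements of L^2 and by the range of S*_ij;
    both uses of the resolvent go through this statement. *)
Lemma green_spec f w : cmeasurable f ->
  L2 (fun p => ((1 + sqn p) `^ (- 2 / 2))%:C%C * f p) ->
  (green z f w <-> version w (green_fun f)).
Proof.
move=> mf fL; have d0 p := resolvent_den_neq0 _ (sqn_ge0 n p); split.
  move=> [a [b [[_ [ma aa]] [c [d [mw [_ ad]] [_ ac]] [_ ab]] [_ af]]]].
  split => //; have h1 : {ae lebesgue n, forall p, a p = ((sqn p / 2)%:C)%C * w p /\ d p = w p}.
    by apply: filterS2 aa ad.
  have h2 : {ae lebesgue n, forall p, c p = z * d p /\ b p = -1 * c p}.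
    by apply: filterS2 ac ab.
  apply: filterS3 h1 h2 af => p [ha hd] [hc hb] hf.
  rewrite /green_fun hf ha hb hc hd mulN1r -mulrBl -/(resolvent_den (sqn p)).
  by rewrite mulrAC divff ?mul1r.
move=> [mw aw].
have ms : measurable_fun setT (fun p : config R n => sqn p) by exact: measurable_sqn.
have mE : cmeasurable (fun p : config R n => ((sqn p / 2)%:C)%C).
  by apply: cmeasurable_real; apply: measurable_funM => //; exact: measurable_cst.
have mH : cmeasurable (fun p => ((sqn p / 2)%:C)%C * w p) by exact: cmeasurableM.
have mzw : cmeasurable (fun p => z * w p) by apply: cmeasurableM => //; exact: cmeasurable_cst.
have mW : cmeasurable (fun p : config R n => (((1 + sqn p) `^ (- 2 / 2))%:C)%C).
  have -> : (fun p : config R n => (((1 + sqn p) `^ (- 2 / 2))%:C)%C) = (fun p => (((1 + sqn p)^-1)%:C)%C).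
    apply/funext => p; congr (_%:C)%C; rewrite mulNr divff// powR_inv1//.
    by rewrite addr_ge0// sqn_ge0.
  apply: cmeasurable_real; apply: measurable_funV; apply: measurable_funD => //; exact: measurable_cst.
exists (fun p => ((sqn p / 2)%:C)%C * w p), (fun p => -1 * (z * w p)); split.
- split; last exact: version_refl.
  (* The same exponent serves twice: |w| is at most |f| / (- Re z), and |p|^2 |w| / 2 is at most
     |f|. *)
  exists (- 2); split.
    apply: (L2_dom _ _ (- complex.Re z)^-1 _ fL); first exact: cmeasurableM.
      by rewrite invr_ge0; (have hz0 := hz; lra).
    apply: filterS aw => p ->; rewrite cabsM [X in _ <= _ * X]cabsM mulrCA ler_wpM2l ?cabs_ge0//.
    exact: cabs_green_fun.
  apply: (L2_dom _ _ 1 _ fL) => //; first exact: cmeasurableM.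
  apply: filterS aw => p ->; rewrite mul1r cabsM [X in _ <= X]cabsM ler_wpM2l ?cabs_ge0//.
  rewrite /green_fun !cabsM cabsV mulrCA ler_piMr ?cabs_ge0//.
  have s0 := sqn_ge0 _ p; rewrite ler_pdivrMr ?cabs_resolvent_den_gt0// mul1r cabs_real ger0_norm; last by (have hz0 := hz; lra).
  by apply: le_trans (cabs_resolvent_den _); (have hz0 := hz; lra).
- exists (fun p => z * w p).
    exists w; last exact: version_refl.
    by split => //; exact: version_refl.
  by apply: version_refl; apply: cmeasurableM => //; exact: cmeasurable_cst.
- split => //; apply: filterS aw => p ->.
  by rewrite mulN1r -mulrBl -/(resolvent_den (sqn p)) /green_fun mulrC divfK.
Qed.

Lemma L2_sobolev_weight (f : cfun R n) : L2 f ->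
  L2 (fun p => ((1 + sqn p) `^ (- 2 / 2))%:C%C * f p).
Proof.
move=> fL; have eW p : (1 + sqn p) `^ (- 2 / 2) = (1 + @sqn R n p)^-1.
  by rewrite mulNr divff// powR_inv1// addr_ge0// sqn_ge0.
have ms : measurable_fun setT (fun p : config R n => sqn p) by exact: measurable_sqn.
apply: (L2_dom _ f 1) => //.
  apply: cmeasurableM; last exact: L2_measurable.
  rewrite (_ : (fun p => _) = (fun p : config R n => (((1 + sqn p)^-1)%:C)%C)); last by apply/funext => p; rewrite eW.
  by apply: cmeasurable_real; apply: measurable_funV; apply: measurable_funD => //; exact: measurable_cst.
apply: aeW => p; rewrite eW cabsM ler_wpM2r ?cabs_ge0// cabs_real ger0_norm; have s0 := sqn_ge0 _ p.
  by rewrite invf_le1; (have hz0 := hz; lra).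
by rewrite invr_ge0; (have hz0 := hz; lra).
Qed.

Lemma represents_green : represents (green z) green_fun.
Proof.
by move=> f fL w; apply: green_spec; [exact: L2_measurable|exact: L2_sobolev_weight].
Qed.

End Green.

Section GreenTrace.
Context {R : realType} {m : nat}.
Local Notation C := R[i].
Local Notation n := m.+2.
Local Notation pair := ('I_n * 'I_n)%type.
Local Notation leb := (@plane_lebesgue R).
Variables (z : C) (e : pair).
Hypotheses (hz : 0 < - complex.Re z) (e12 : e.1 != e.2).
Local Notation r := (- complex.Re z).

Let r0 : 0 < r := hz.

Definition lift_fun (u : cfun R m.+1) : cfun R n :=
  fun p => ((2 * pi)^-1)%:C%C * u (merge_pair e p).

Lemma cmeasurable_lift_fun u : cmeasurable u -> cmeasurable (lift_fun u).
Proof.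
move=> mu_; apply: cmeasurableM; first exact: cmeasurable_cst.
by apply: (cmeasurable_comp _ _ u _ mu_); exact: measurable_merge_pair.
Qed.

(** Along a slice |p|^2 / 2 equals half of [sqn_merged] plus |w|^2, so the denominator is at least r
    + |w|^2 in modulus, uniformly in q. *)
Lemma integral_den_slice q :
  (\int[leb]_w ((cabs (resolvent_den z (sqn (@split_pair R n e w q))) ^+ 2)^-1)%:E <= (pi ^+ 2 / r)%:E)%E.
Proof.
apply: le_trans (integral_inv_plane _ r0).
have mS : measurable_fun setT (fun w : plane R => @split_pair R n e w q).
  exact: (measurable_split_pair _ _ e id (fun=> q)).
apply: ge0_le_integral => //.
- by move=> w _; rewrite lee_fin invr_ge0 sqr_ge0.
- apply/measurable_EFinP; apply: measurable_funV; apply: measurable_cabs_sqr.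
  by apply: cmeasurable_resolvent_den; exact: measurable_sqn.
- apply/measurable_EFinP; apply: measurable_funV; apply: measurable_funX.
  by apply: measurable_funD; [exact: measurable_cst|apply: measurable_dot2; exact: measurable_id].
- move=> w _; have sp := sqn_split_pair e w q e12; have sq := sqn_merged_ge0 q; have sw := sqn2_ge0 w.
  have s0 := sqn_ge0 _ (@split_pair R n e w q).
  rewrite lee_fin lef_pV2 ?posrE ?exprn_gt0 ?cabs_resolvent_den_gt0//; last by rewrite ltr_wpDr.
  rewrite ler_pXn2r ?nnegrE ?cabs_ge0//; last by rewrite addr_ge0// ltW.
  by apply: le_trans (cabs_resolvent_den z _); rewrite sp; (have hz0 := hz; lra).
Qed.

Definition green_lift u := green_fun z (lift_fun u).

(** The lifted function does not depend on the relative momentum, so only the denominator is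
    integrated along slices; the constant is (2 pi)^-2 pi^2 / r. *)
Lemma energy_green_lift u : cmeasurable u ->
  (energy (green_lift u) <= (((2 * Num.sqrt r)^-1) ^+ 2)%:E * energy u)%E.
Proof.
move=> mu_; have mg : cmeasurable (green_lift u).
  by apply: cmeasurable_green_fun; exact: cmeasurable_lift_fun.
have p0 : 0 < pi :> R by exact: pi_gt0.
have mD q : measurable_fun setT (fun w => ((cabs (resolvent_den z (sqn (@split_pair R n e w q))) ^+ 2)^-1)%:E).
  apply/measurable_EFinP; apply: measurable_funV; apply: measurable_cabs_sqr.
  apply: cmeasurable_resolvent_den; apply: measurable_sqn.
  exact: (measurable_split_pair _ _ e id (fun=> q)).
have mu2 : measurable_fun setT (fun q => (cabs (u q) ^+ 2)%:E).
  by apply/measurable_EFinP; exact: measurable_cabs_sqr.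
rewrite (energy_split e)// /energy -ge0_integralZl_EFin ?sqr_ge0//; last first.
  by move=> q _; rewrite lee_fin sqr_ge0.
apply: ge0_le_integral => //.
- by move=> q _; apply: integral_ge0 => w _; rewrite lee_fin sqr_ge0.
- apply: (measurable_integral_split e (fun p => (cabs (green_lift u p) ^+ 2)%:E) e12).
  by apply/measurable_EFinP; exact: measurable_cabs_sqr.
- exact: measurable_funeM.
move=> q _.
rewrite (eq_integral (fun w => ((((2 * pi)^-1) ^+ 2 * cabs (u q) ^+ 2)%:E *
    ((cabs (resolvent_den z (sqn (@split_pair R n e w q))) ^+ 2)^-1)%:E)%E)); last first.
  move=> w _; rewrite -EFinM; congr EFin; rewrite /green_lift /green_fun /lift_fun split_pairK//.
  by rewrite !cabsM cabsV cabs_real !exprMn real_normK ?num_real// !exprVn.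
rewrite ge0_integralZl_EFin//; first last.
- by rewrite mulr_ge0 ?sqr_ge0.
- by move=> w _; rewrite lee_fin invr_ge0 sqr_ge0.
apply: (le_trans (lee_wpmul2l _ (integral_den_slice q))); first by rewrite lee_fin mulr_ge0 ?sqr_ge0.
rewrite -!EFinM lee_fin le_eqVlt; apply/orP; left; apply/eqP.
rewrite !exprVn ![(2 * _) ^+ 2]exprMn sqr_sqrtr ?(ltW r0)//.
have := r0; move: r (pi : R) p0 => x P p0 x0; field.
by rewrite !gt_eqF.
Qed.

Lemma linear_bounded_green_lift : linear_bounded green_lift (2 * Num.sqrt r)^-1.
Proof.
have k0 : 0 <= (2 * Num.sqrt r)^-1 by rewrite invr_ge0 mulr_ge0 ?sqrtr_ge0.
split => //.
- by move=> u [mu_ _]; apply: cmeasurable_green_fun; exact: cmeasurable_lift_fun.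
- by move=> u [mu_ _]; apply: Lp_norm2_le_energies => //; exact: energy_green_lift.
- move=> c u v _ _; apply: aeW => p; rewrite /green_lift /green_fun /lift_fun.
  by rewrite mulrDr mulrDl [_ * (c * _)]mulrCA !mulrA.
Qed.

(** A lifted function is constant in the relative momentum w, but the weight is at most 1 / (1 +
    |w|^2), whose square is integrable over the plane; the constant 1/4 is (2 pi)^-2 pi^2. *)
Lemma L2_sobolev_lift u : L2 u ->
  L2 (fun p => ((1 + sqn p) `^ (- 2 / 2))%:C%C * lift_fun u p).
Proof.
move=> uL; have mu_ := L2_measurable _ uL.
have eW p : (1 + sqn p) `^ (- 2 / 2) = (1 + @sqn R n p)^-1.
  by rewrite mulNr divff// powR_inv1// addr_ge0// sqn_ge0.
rewrite (_ : (fun p => _) = (fun p => (((1 + sqn p)^-1)%:C)%C * lift_fun u p)); last first.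
  by apply/funext => p; rewrite eW.
have ms : measurable_fun setT (fun p : config R n => sqn p) by exact: measurable_sqn.
have mw : measurable_fun setT (fun p : config R n => (1 + sqn p)^-1).
  by apply: measurable_funV; apply: measurable_funD => //; exact: measurable_cst.
have mh : cmeasurable (fun p => (((1 + sqn p)^-1)%:C)%C * lift_fun u p).
  by apply: cmeasurableM; [exact: cmeasurable_real|exact: cmeasurable_lift_fun].
have p0 : 0 < pi :> R by exact: pi_gt0.
have mu2 : measurable_fun setT (fun q => (cabs (u q) ^+ 2)%:E).
  by apply/measurable_EFinP; exact: measurable_cabs_sqr.
apply/L2P; split => //; apply: (@le_lt_trans _ _ ((4^-1)%:E * energy u)%E); last first.
  by rewrite lte_mul_pinfty ?lee_fin ?invr_ge0//; have [] := (L2P u).1 uL.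
rewrite (energy_split e)// /energy -ge0_integralZl_EFin ?invr_ge0//; last first.
  by move=> q _; rewrite lee_fin sqr_ge0.
apply: ge0_le_integral => //.
- by move=> q _; apply: integral_ge0 => w _; rewrite lee_fin sqr_ge0.
- apply: (measurable_integral_split e (fun p => (cabs ((((1 + sqn p)^-1)%:C)%C * lift_fun u p) ^+ 2)%:E) e12).
  by apply/measurable_EFinP; exact: measurable_cabs_sqr.
- exact: measurable_funeM.
move=> q _.
have mS : measurable_fun setT (fun w : plane R => @split_pair R n e w q).
  exact: (measurable_split_pair _ _ e id (fun=> q)).
apply: (@le_trans _ _ (\int[leb]_w ((((2 * pi)^-1) ^+ 2 * cabs (u q) ^+ 2)%:E * (((1 + sqn2 w) ^+ 2)^-1)%:E))%E).
  apply: ge0_le_integral => //.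
  - by move=> w _; rewrite lee_fin sqr_ge0.
  - apply/measurable_EFinP; apply: measurable_cabs_sqr.
    exact: (cmeasurable_slice e _ q e12 mh).
  - apply: measurable_funeM; apply/measurable_EFinP; apply: measurable_funV; apply: measurable_funX.
    by apply: measurable_funD; [exact: measurable_cst|apply: measurable_dot2; exact: measurable_id].
  - move=> w _; rewrite -EFinM lee_fin /lift_fun split_pairK// !cabsM !cabs_real !exprMn !real_normK ?num_real//.
    rewrite [leLHS]mulrC !exprVn ler_wpM2l ?mulr_ge0 ?invr_ge0 ?sqr_ge0 ?cabs_ge0//.
    have sp := sqn_split_pair e w q e12; have sq := sqn_merged_ge0 q; have sw := sqn2_ge0 w.
    rewrite lef_pV2 ?posrE ?exprn_gt0//; try by (have hz0 := hz; lra).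
    rewrite sp; move: sq sw; move: (sqn_merged _) (sqn2 _) => A B A0 B0.
    by rewrite ler_pXn2r// ?nnegrE; lra.
rewrite ge0_integralZl_EFin//; first last.
- by rewrite mulr_ge0 ?sqr_ge0.
- apply/measurable_EFinP; apply: measurable_funV; apply: measurable_funX.
  by apply: measurable_funD; [exact: measurable_cst|apply: measurable_dot2; exact: measurable_id].
- by move=> w _; rewrite lee_fin invr_ge0 sqr_ge0.
apply: (le_trans (lee_wpmul2l _ (integral_inv_plane _ ltr01))); first by rewrite lee_fin mulr_ge0 ?sqr_ge0.
rewrite -!EFinM lee_fin le_eqVlt; apply/orP; left; apply/eqP.
rewrite divr1 exprVn; move: (pi : R) p0 => P p0; field.
by rewrite gt_eqF.
Qed.

Lemma represents_green_lift :
  represents (op_comp (green z) (trace_adj (n := n) e)) green_lift.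
Proof.
move=> u uL w; have mu_ := L2_measurable _ uL; have ml := cmeasurable_lift_fun _ mu_; split.
  move=> [v [_ [mv av]] gv].
  have vL : L2 (fun p => ((1 + sqn p) `^ (- 2 / 2))%:C%C * v p).
    apply: (version_L2 _ _ _ (L2_sobolev_lift _ uL)); split; last by apply: filterS av => p ->.
    apply: cmeasurableM => //; have eW p : (1 + sqn p) `^ (- 2 / 2) = (1 + @sqn R n p)^-1.
      by rewrite mulNr divff// powR_inv1// addr_ge0// sqn_ge0.
    rewrite (_ : (fun p => _) = (fun p : config R n => (((1 + sqn p)^-1)%:C)%C)); last by apply/funext => p; rewrite eW.
    apply: cmeasurable_real; apply: measurable_funV; apply: measurable_funD; first exact: measurable_cst.
    exact: measurable_sqn.
  have wv := (green_spec z hz v w mv vL).1 gv; apply: version_trans wv _.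
  split; first exact: cmeasurable_green_fun.
  by apply: filterS av => p; rewrite /green_lift /green_fun => ->.
move=> wF; exists (lift_fun u); first by split => //; exact: version_refl.
by apply/(green_spec z hz _ w ml (L2_sobolev_lift _ uL)).
Qed.

(** The estimate dual to [energy_green_lift], with the same constant: Cauchy-Schwarz on each slice
    separates f from the denominator. *)
Lemma abs_trace_green_bound f : L2 f ->
  (\int[lebesgue m.+1]_q (abs_trace e (green_fun z f) q * abs_trace e (green_fun z f) q) <=
   ((2 * pi * (2 * Num.sqrt r)^-1) ^+ 2)%:E * energy f)%E.
Proof.
move=> [mf _]; have p0 : 0 < pi :> R by exact: pi_gt0.
have mS q : measurable_fun setT (fun w : plane R => @split_pair R n e w q).
  exact: (measurable_split_pair _ _ e id (fun=> q)).
have mD q : cmeasurable (fun w => resolvent_den z (sqn (@split_pair R n e w q))).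
  by apply: cmeasurable_resolvent_den; exact: measurable_sqn.
have mg := cmeasurable_green_fun z f mf.
have -> : (2 * pi * (2 * Num.sqrt r)^-1) ^+ 2 = pi ^+ 2 / r.
  rewrite !exprMn exprVn exprMn sqr_sqrtr ?(ltW r0)//.
  by have := r0; move: r => x x0; field; rewrite gt_eqF.
have pr0 : 0 <= pi ^+ 2 / r by rewrite divr_ge0 ?sqr_ge0// ltW.
have me : measurable_fun setT (fun q => \int[leb]_w (cabs (f (@split_pair R n e w q)) ^+ 2)%:E)%E.
  apply: (measurable_integral_split e (fun p => (cabs (f p) ^+ 2)%:E) e12).
  by apply/measurable_EFinP; exact: measurable_cabs_sqr.
have e0 q : (0 <= \int[leb]_w (cabs (f (@split_pair R n e w q)) ^+ 2)%:E)%E.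
  by apply: integral_ge0 => w _; rewrite lee_fin sqr_ge0.
rewrite (energy_split e f)// -ge0_integralZl_EFin//.
apply: ge0_le_integral => //.
- by move=> q _; rewrite mule_ge0// abs_trace_ge0.
- by apply: emeasurable_funM; exact: measurable_abs_trace.
- exact: measurable_funeM.
move=> q _.
have h : (abs_trace e (green_fun z f) q <=
    sqrte (\int[leb]_w (cabs (f (@split_pair R n e w q)) ^+ 2)%:E) * sqrte (pi ^+ 2 / r)%:E)%E.
  have := cauchy_schwarz leb (fun w => cabs (f (@split_pair R n e w q)))
    (fun w => (cabs (resolvent_den z (sqn (@split_pair R n e w q))))^-1)
    (measurable_cabs _ (cmeasurable_slice e f q e12 mf)) (measurable_funV _ (measurable_cabs _ (mD q))).
  rewrite (_ : (\int[leb]_w (`|_| * _)%:E)%E = abs_trace e (green_fun z f) q); last first.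
    apply: eq_integral => w _; rewrite /green_fun cabsM cabsV ger0_norm ?cabs_ge0//.
    by rewrite ger0_norm// invr_ge0 cabs_ge0.
  move/le_trans; apply; apply: lee_wpmul2l; first exact: sqrte_ge0.
  rewrite lee_sqrt//.
  apply: le_trans (integral_den_slice q).
  by rewrite le_eqVlt; apply/orP; left; apply/eqP; apply: eq_integral => w _; rewrite exprVn.
apply: (le_trans (lee_pmul (abs_trace_ge0 _ _ _) (abs_trace_ge0 _ _ _) h h)).
rewrite muleACA -!expe2 !sqr_sqrte// ?lee_fin// muleC; exact: lexx.
Qed.

End GreenTrace.

(** * The Schur test *)

Section SchurKernel.
Context {R : realType}.
Local Notation leb := (@plane_lebesgue R).

(** One coordinate of the weighted Schur integrand: [s] is |a_c| and [B] is |b_c| + rho. *)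
Definition schur_line (rho B s : R) : R := Num.sqrt (B / (s + rho)) / (s + rho + B).

Lemma schur_line_ge0 (rho B s : R) : 0 < rho -> 0 < B -> 0 <= s -> 0 <= schur_line rho B s.
Proof. by move=> r0 B0 s0; rewrite divr_ge0 ?sqrtr_ge0//; lra. Qed.

Lemma continuous_schur_line (rho B x : R) : 0 < rho -> 0 < B -> 0 <= x ->
  {for x, continuous (schur_line rho B)}.
Proof.
move=> r0 B0 x0; apply: cvgM.
  apply: (cvg_comp (fun s : R => B / (s + rho)) Num.sqrt); last exact: sqrt_continuous.
  apply: cvgM; first exact: cvg_cst.
  apply: cvgV; first by rewrite gt_eqF//; lra.
  by apply: cvgD; [exact: cvg_id|exact: cvg_cst].
apply: cvgV; first by rewrite gt_eqF//; lra.
by apply: cvgD; [apply: cvgD; [exact: cvg_id|exact: cvg_cst]|exact: cvg_cst].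
Qed.

(** The substitution t = sqrt ((s + rho) / B) turns the integrand into 2 / (1 + t^2). *)
Lemma is_derive_schur_line (rho B x : R) : 0 < rho -> 0 < B -> 0 <= x ->
  is_derive x 1 (fun s : R => 2 * atan (Num.sqrt ((s + rho) / B))) (schur_line rho B x).
Proof.
move=> r0 B0 x0; have y0 : 0 < (x + rho) / B by rewrite divr_gt0//; lra.
have h1 : is_derive x 1 (fun s : R => (s + rho) / B) B^-1.
  rewrite (_ : (fun s => _) = B^-1 *: (id \+ cst rho)); last by apply/funext => s /=; rewrite mulrC.
  by apply: is_derive_eq; rewrite addr0 /GRing.scale/= mulr1.
have h2 : is_derive x 1 (Num.sqrt \o (fun s : R => (s + rho) / B))
    ((2 * Num.sqrt ((x + rho) / B))^-1 * B^-1).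
  by apply: (@is_derive1_comp _ _ (fun s : R => (s + rho) / B)); exact: is_derive1_sqrt.
have h3 : is_derive x 1 (atan \o (Num.sqrt \o (fun s : R => (s + rho) / B)))
    ((1 + Num.sqrt ((x + rho) / B) ^+ 2)^-1 * ((2 * Num.sqrt ((x + rho) / B))^-1 * B^-1)).
  exact: (@is_derive1_comp _ _ (Num.sqrt \o (fun s : R => (s + rho) / B))).
rewrite (_ : (fun s => _) = 2 *: (atan \o (Num.sqrt \o (fun s : R => (s + rho) / B))))//.
apply: is_derive_eq; rewrite /GRing.scale/= /schur_line.
have -> : B / (x + rho) = ((x + rho) / B)^-1 by rewrite invf_div.
rewrite sqrtrV ?ltW//; set t := Num.sqrt _.
have t0 : 0 < t by rewrite sqrtr_gt0.
have tt : x + rho = t ^+ 2 * B by rewrite sqr_sqrtr ?ltW// divfK// gt_eqF.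
rewrite tt; have u0 : 0 < 1 + t ^+ 2 by rewrite ltr_pwDl// sqr_ge0.
move: t0 u0; move: t {tt} => t t0 u0; field.
by rewrite !gt_eqF//; have := mulr_gt0 B0 u0; lra.
Qed.

Lemma cvg_schur_line (rho B : R) : 0 < rho -> 0 < B ->
  2 * atan (Num.sqrt ((s + rho) / B)) @[s --> +oo] --> (pi : R).
Proof.
move=> r0 B0; have h : Num.sqrt ((s + rho) / B) @[s --> +oo] --> +oo.
  apply/cvgryPge => A; near=> s.
  have : `|A| ^+ 2 * B <= s by near: s; apply: nbhs_pinfty_ge; rewrite num_real.
  move=> hs; apply: (le_trans (ler_norm A)).
  rewrite -(@ler_pXn2r _ 2)// ?nnegrE ?sqrtr_ge0// sqr_sqrtr; last first.
    rewrite divr_ge0 ?(ltW B0)//; have := mulr_ge0 (sqr_ge0 `|A|) (ltW B0); lra.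
  by rewrite ler_pdivlMr//; lra.
have h2 := cvg_comp _ _ h (@cvgy_atan R).
rewrite (_ : pi = 2 * (pi / 2)); last by rewrite mulrC divfK.
by apply: cvgM; [exact: cvg_cst|exact: h2].
Unshelve. all: by end_near. Qed.

(** Each half-line contributes at most pi, the limit of the antiderivative. The bound involves
    neither [rho] nor [B], which is why the final estimate is uniform in z. *)
Lemma integral_schur_line (rho B : R) : 0 < rho -> 0 < B ->
  (\int[@lebesgue_measure R]_s (schur_line rho B `|s|)%:E <= (2 * pi)%:E)%E.
Proof.
move=> r0 B0; rewrite integral_even; first last.
- by move=> x x0; exact: continuous_schur_line.
- by move=> x x0; exact: schur_line_ge0.
rewrite (ge0_integral_halfline _ _ _ (fun x x0 => schur_line_ge0 rho B x r0 B0 x0)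
  (fun x x0 => continuous_schur_line rho B x r0 B0 x0)
  (fun x x0 => is_derive_schur_line rho B x r0 B0 x0) (cvg_schur_line rho B r0 B0)).
rewrite -EFinB -EFinM lee_fin ler_wpM2l// lerBlDr lerDl mulr_ge0//.
by rewrite -(@atan0 R); apply: le_atan; exact: sqrtr_ge0.
Qed.

Definition schur_weight (rho : R) (a b : plane R) : R :=
  Num.sqrt ((`|b.1 : R| + rho) / (`|a.1 : R| + rho)) * Num.sqrt ((`|b.2 : R| + rho) / (`|a.2 : R| + rho)).

Lemma schur_weight_gt0 rho a b : 0 < rho -> 0 < schur_weight rho a b.
Proof.
move=> r0; have h (x : R) : 0 < `|x| + rho by rewrite ltr_wpDl.
by rewrite mulr_gt0// sqrtr_gt0 divr_gt0.
Qed.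

Lemma schur_weightV rho a b : 0 < rho -> (schur_weight rho a b)^-1 = schur_weight rho b a.
Proof.
move=> r0; have h (x : R) : 0 <= `|x| + rho by rewrite addr_ge0// ltW.
by rewrite /schur_weight invfM -!sqrtrV ?divr_ge0// !invf_div.
Qed.

Lemma measurable_schur_weight rho d (T : measurableType d) (f g : T -> plane R) :
  measurable_fun setT f -> measurable_fun setT g ->
  measurable_fun setT (fun x => schur_weight rho (f x) (g x)).
Proof.
move=> mf mg.
have msqrt : measurable_fun setT (@Num.sqrt R).
  by apply: continuous_measurable_fun => x; exact: sqrt_continuous.
have ma (h : T -> R) : measurable_fun setT h -> measurable_fun setT (fun x => `|h x| + rho).
  move=> mh; apply: measurable_funD; last exact: measurable_cst.
  exact: (measurableT_comp (@normr_measurable R setT) mh).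
by apply: measurable_funM; apply: (measurableT_comp msqrt); apply: measurable_funM;
  try apply: measurable_funV; apply: ma;
  first [exact: measurable_plane_fst | exact: measurable_plane_snd].
Qed.

(** With t = sqrt r, the two shifts t/2 in each coordinate add up to t. Then (x_1 + y_1 + t) (x_2 +
    y_2 + t) is at most half the sum of the two squares, and each square is at most 3 times the sum
    of the squares of its three terms. *)
Lemma schur_pointwise (r : R) (a b : plane R) : 0 < r ->
  schur_weight (Num.sqrt r / 2) a b / ((sqn2 a + sqn2 b) / 2 + r) <=
  3 * (schur_line (Num.sqrt r / 2) (`|b.1 : R| + Num.sqrt r / 2) `|a.1 : R| *
       schur_line (Num.sqrt r / 2) (`|b.2 : R| + Num.sqrt r / 2) `|a.2 : R|).
Proof.
move=> r0; set t := Num.sqrt r; have t0 : 0 < t by rewrite sqrtr_gt0.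
have tt : r = t ^+ 2 by rewrite sqr_sqrtr// ltW.
have hr (x y v w : R) : 3 * (x * v * (y * w)) = x * y * (3 * (v * w)) by ring.
rewrite (_ : 3 * _ = schur_weight (t / 2) a b * (3 * ((`|a.1 : R| + t / 2 + (`|b.1 : R| + t / 2))^-1 *
    (`|a.2 : R| + t / 2 + (`|b.2 : R| + t / 2))^-1))); last by exact: hr.
apply: ler_wpM2l; first by rewrite mulr_ge0 ?sqrtr_ge0.
have := normr_ge0 (a.1 : R); have := normr_ge0 (a.2 : R).
have := normr_ge0 (b.1 : R); have := normr_ge0 (b.2 : R).
rewrite /sqn2 /dot2 -!expr2 -[_.1 ^+ 2]real_normK ?num_real// -[_.2 ^+ 2]real_normK ?num_real//.
rewrite -[(b.1 : R) ^+ 2]real_normK ?num_real// -[(b.2 : R) ^+ 2]real_normK ?num_real// tt.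
move: `|a.1 : R| `|a.2 : R| `|b.1 : R| `|b.2 : R| => x1 x2 y1 y2 y20 y10 x20 x10.
rewrite -invfM.
have S1 : 0 < x1 + t / 2 + (y1 + t / 2) by lra.
have S2 : 0 < x2 + t / 2 + (y2 + t / 2) by lra.
have D0 : 0 < (x1 ^+ 2 + x2 ^+ 2 + (y1 ^+ 2 + y2 ^+ 2)) / 2 + t ^+ 2.
  by rewrite ltr_wpDl ?exprn_gt0// divr_ge0// !addr_ge0// sqr_ge0.
rewrite -[leLHS]div1r ler_pdivrMr// mulrAC ler_pdivlMr ?mulr_gt0// mul1r.
have := sqr_ge0 (x1 + y1 - (x2 + y2)); have := sqr_ge0 (x1 - y1); have := sqr_ge0 (x2 - y2).
have := sqr_ge0 (x1 - t); have := sqr_ge0 (x2 - t); have := sqr_ge0 (y1 - t); have := sqr_ge0 (y2 - t).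
by rewrite !expr2; nra.
Qed.

(** The pointwise bound separates the coordinates; 12 pi^2 is 3 times (2 pi)^2. *)
Lemma integral_schur_plane (r : R) (b : plane R) : 0 < r ->
  (\int[leb]_a (schur_weight (Num.sqrt r / 2) a b / ((sqn2 a + sqn2 b) / 2 + r))%:E
   <= (12 * pi ^+ 2)%:E)%E.
Proof.
move=> r0; set rho := Num.sqrt r / 2.
have rho0 : 0 < rho by rewrite divr_gt0// sqrtr_gt0.
have B0 (x : R) : 0 < `|x| + rho by rewrite ltr_wpDl.
have mabs : measurable_fun setT (fun s : R => `|s|) by exact: (@normr_measurable R setT).
have ml (y : R) : measurable_fun setT (fun s : R => schur_line rho (`|y| + rho) `|s|).
  have msqrt : measurable_fun setT (@Num.sqrt R).
    by apply: continuous_measurable_fun => x; exact: sqrt_continuous.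
  apply: measurable_funM; last first.
    apply: measurable_funV; apply: measurable_funD; last exact: measurable_cst.
    by apply: measurable_funD => //; exact: measurable_cst.
  apply: (measurableT_comp msqrt); apply: measurable_funM; first exact: measurable_cst.
  by apply: measurable_funV; apply: measurable_funD => //; exact: measurable_cst.
have l0 (y s : R) : 0 <= schur_line rho (`|y| + rho) `|s| by exact: schur_line_ge0.
apply: (@le_trans _ _ (\int[leb]_a (3%:E * (schur_line rho (`|b.1 : R| + rho) `|a.1 : R| *
    schur_line rho (`|b.2 : R| + rho) `|a.2 : R|)%:E))%E).
  apply: ge0_le_integral => //.
  - move=> a _; rewrite lee_fin divr_ge0 ?(ltW (schur_weight_gt0 _ _ _ rho0))//.
    by rewrite addr_ge0 ?(ltW r0)// divr_ge0// addr_ge0// sqn2_ge0.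
  - apply/measurable_EFinP; apply: measurable_funM.
      by apply: measurable_schur_weight => //; exact: measurable_cst.
    apply: measurable_funV; apply: measurable_funD; last exact: measurable_cst.
    apply: measurable_funM; last exact: measurable_cst.
    apply: measurable_funD; last exact: measurable_cst.
    by apply: measurable_dot2; exact: measurable_id.
  - apply: measurable_funeM; apply/measurable_EFinP; apply: measurable_funM.
      exact: (measurableT_comp (ml b.1) measurable_fst).
    exact: (measurableT_comp (ml b.2) measurable_snd).
  - by move=> a _; rewrite -EFinM lee_fin; exact: schur_pointwise.
rewrite ge0_integralZl_EFin//; last 2 first.
- by move=> a _; rewrite lee_fin mulr_ge0.
- apply/measurable_EFinP; apply: measurable_funM.
    exact: (measurableT_comp (ml b.1) measurable_fst).
  exact: (measurableT_comp (ml b.2) measurable_snd).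
rewrite (ge0_integral_plane_prod (fun s => schur_line rho (`|b.1 : R| + rho) `|s|)
  (fun s => schur_line rho (`|b.2 : R| + rho) `|s|))//.
have -> : 12 * pi ^+ 2 = 3 * (2 * pi * (2 * pi)) :> R by ring.
rewrite !EFinM; apply: lee_wpmul2l => //; rewrite -EFinM.
by apply: lee_pmul; try (by apply: integral_ge0 => s _; rewrite lee_fin); exact: integral_schur_line.
Qed.

End SchurKernel.

Section SchurTest.
Context {R : realType} {m : nat}.
Local Notation C := R[i].
Local Notation n := m.+2.
Local Notation pair := ('I_n * 'I_n)%type.
Local Notation leb := (@plane_lebesgue R).
Variable z : C.
Hypothesis hz : 0 < - complex.Re z.
Local Notation r := (- complex.Re z).
Local Notation rho := (Num.sqrt r / 2).

Let rho0 : 0 < rho. Proof. by rewrite divr_gt0// sqrtr_gt0. Qed.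

(** The weight divided by sqn p / 2 + r, the lower bound on the modulus of the resolvent
    denominator; exchanging [i] and [k] inverts the weight. *)
Definition schur_kernel (i k : 'I_n) (p : config R n) : R :=
  schur_weight rho (tnth p i) (tnth p k) / (sqn p / 2 + r).

Lemma schur_den_gt0 (p : config R n) : 0 < sqn p / 2 + r.
Proof. by rewrite ltr_wpDl// divr_ge0// sqn_ge0. Qed.

Lemma schur_kernel_ge0 i k p : 0 <= schur_kernel i k p.
Proof. by rewrite divr_ge0 ?(ltW (schur_den_gt0 p))// ltW// schur_weight_gt0. Qed.

Lemma measurable_schur_kernel i k d (T : measurableType d) (f : T -> config R n) :
  measurable_fun setT f -> measurable_fun setT (fun x => schur_kernel i k (f x)).
Proof.
move=> mf; apply: measurable_funM.
  by apply: measurable_schur_weight; exact: measurable_tnth_comp.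
apply: measurable_funV; apply: measurable_funD; last exact: measurable_cst.
by apply: measurable_funM; [exact: measurable_sqn|exact: measurable_cst].
Qed.

(** Only two of the n momenta are kept in the denominator: the bounds below no longer depend on
    n. *)
Lemma schur_kernel_le i k p : i != k ->
  schur_kernel i k p <= schur_weight rho (tnth p i) (tnth p k) /
    ((sqn2 (tnth p i) + sqn2 (tnth p k)) / 2 + r).
Proof.
move=> ik; apply: ler_wpM2l; first by rewrite ltW// schur_weight_gt0.
have h : sqn2 (tnth p i) + sqn2 (tnth p k) <= sqn p.
  rewrite /sqn (bigD1 i)//= (bigD1 k)/=; last by rewrite eq_sym.
  by rewrite addrA lerDl; apply: sumr_ge0 => j _; exact: sqn2_ge0.
have d0 : 0 < (sqn2 (tnth p i) + sqn2 (tnth p k)) / 2 + r.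
  by rewrite ltr_wpDl// divr_ge0// addr_ge0// sqn2_ge0.
by rewrite lef_pV2 ?posrE ?schur_den_gt0// lerD2r ler_wpM2r ?invr_ge0.
Qed.

(** Along the slice the momentum p_k stays fixed, since k is outside the pair, while p_i is a
    translate or a reflection of w; so the integral over w is an integral over p_i. *)
Lemma integral_schur_slice (e : pair) i k q : e.1 != e.2 -> (i == e.1) || (i == e.2) ->
  k != e.1 -> k != e.2 ->
  (\int[leb]_w (schur_kernel i k (@split_pair R n e w q))%:E <= (12 * pi ^+ 2)%:E)%E.
Proof.
move=> e12 ie k1 k2; have ik : i != k.
  by apply/eqP => ik; move: ie; rewrite ik (negbTE k1) (negbTE k2).
pose b := component q (index k (others e)).+1.
pose G (a : plane R) := (schur_weight rho a b / ((sqn2 a + sqn2 b) / 2 + r))%:E.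
have mG : measurable_fun setT G.
  apply/measurable_EFinP; apply: measurable_funM.
    by apply: measurable_schur_weight => //; exact: measurable_cst.
  apply: measurable_funV; apply: measurable_funD; last exact: measurable_cst.
  apply: measurable_funM; last exact: measurable_cst.
  apply: measurable_funD; last exact: measurable_cst.
  by apply: measurable_dot2; exact: measurable_id.
have G0 a : (0 <= G a)%E.
  rewrite lee_fin divr_ge0 ?(ltW (schur_weight_gt0 _ _ _ rho0))//.
  by rewrite addr_ge0 ?(ltW hz)// divr_ge0// addr_ge0// sqn2_ge0.
have mS : measurable_fun setT (fun w : plane R => @split_pair R n e w q).
  exact: (measurable_split_pair _ _ e id (fun=> q)).
apply: (@le_trans _ _ (\int[leb]_w G (tnth (@split_pair R n e w q) i))%E).
  apply: ge0_le_integral => //.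
  - by move=> w _; rewrite lee_fin schur_kernel_ge0.
  - by apply/measurable_EFinP; exact: measurable_schur_kernel.
  - by apply: (measurableT_comp mG); exact: measurable_tnth_comp.
  - move=> w _; rewrite lee_fin.
    by have := schur_kernel_le i k (@split_pair R n e w q) ik; rewrite (tnth_split_pair3 e w q k k1 k2).
apply: le_trans (integral_schur_plane r b hz); rewrite -/rho -/(G _).
rewrite le_eqVlt; apply/orP; left; apply/eqP.
case/orP: ie => /eqP ->.
  rewrite (ge0_integral_preserves _ _ _ (preserves_add2 (half2 (component q 0))) G mG G0).
  by apply: eq_integral => w _; rewrite tnth_split_pair1 add2C.
rewrite (ge0_integral_preserves _ _ _ (preserves_sub2 (half2 (component q 0))) G mG G0).
by apply: eq_integral => w _; rewrite tnth_split_pair2.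
Qed.

Lemma ordered_pair_neq (e : pair) : ordered_pair e -> e.1 != e.2.
Proof. by move=> h; apply/eqP => h'; move: h; rewrite /ordered_pair h' ltnn. Qed.

(** Distinct increasing pairs are distinct as sets; the ordering excludes the case where one pair is
    the other reversed. *)
Lemma ordered_pair_diff (e e' : pair) : ordered_pair e -> ordered_pair e' -> e != e' ->
  exists i, [/\ (i == e.1) || (i == e.2), i != e'.1 & i != e'.2].
Proof.
case: e e' => [a b] [c d]; rewrite /ordered_pair/= => ab cd ne.
have [h1|h1] := boolP ((a != c) && (a != d)).
  by case/andP: h1 => ? ?; exists a; rewrite eqxx.
have [h2|h2] := boolP ((b != c) && (b != d)).
  by case/andP: h2 => ? ?; exists b; rewrite eqxx orbT.
exfalso; move: h1 h2; rewrite !negb_and !negbK => /orP[]/eqP ha /orP[]/eqP hb.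
- by move: ab; rewrite ha hb ltnn.
- by move: ne; rewrite ha hb eqxx.
- by move: ab cd; rewrite ha hb => h1 h2; have := ltn_trans h1 h2; rewrite ltnn.
- by move: ab; rewrite ha hb ltnn.
Qed.

(** Choose i in e outside e', and k in e' outside e. Since the weights for (i, k) and (k, i) are
    inverse to each other, 1/D is the product of the square roots of the two kernels. Cauchy-Schwarz
    on a slice of e leaves one kernel alone, with integral at most 12 pi^2, and puts the other with
    |u|^2 into [V]. Altogether (2 pi)^-1 times 12 pi^2 is 2 pi times 3. *)
Lemma schur_bound (e e' : pair) (u : cfun R m.+1) : ordered_pair e -> ordered_pair e' -> e != e' ->
  L2 u ->
  (\int[lebesgue m.+1]_q (abs_trace e (green_lift z e' u) q * abs_trace e (green_lift z e' u) q) <=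
   ((2 * pi * 3) ^+ 2)%:E * energy u)%E.
Proof.
move=> oe oe' ne [mu_ _]; have e12 := ordered_pair_neq e oe; have e12' := ordered_pair_neq e' oe'.
have [i [ie i1 i2]] := ordered_pair_diff e e' oe oe' ne.
have [k [ke k1 k2]] := ordered_pair_diff e' e oe' oe ltac:(by rewrite eq_sym).
have p0 : 0 < pi :> R by exact: pi_gt0.
pose D (p : config R n) : R := sqn p / 2 + r.
have D0 p : 0 < D p by exact: schur_den_gt0.
have mm : measurable_fun setT (fun p : config R n => @merge_pair R n e' p).
  exact: measurable_merge_pair.
have mum : cmeasurable (fun p : config R n => u (@merge_pair R n e' p)).
  exact: (cmeasurable_comp _ _ u _ mu_ mm).
have mg : cmeasurable (green_lift z e' u).
  by apply: cmeasurable_green_fun; exact: cmeasurable_lift_fun.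
pose V (p : config R n) : R := cabs (u (@merge_pair R n e' p)) ^+ 2 * schur_kernel k i p.
have V0 p : 0 <= V p by rewrite mulr_ge0 ?sqr_ge0 ?schur_kernel_ge0.
have mV : measurable_fun setT (fun p => (V p)%:E).
  apply/measurable_EFinP; apply: measurable_funM; first exact: measurable_cabs_sqr.
  exact: measurable_schur_kernel.
have hV : (\int[lebesgue m.+1]_q \int[leb]_w (V (@split_pair R n e w q))%:E <=
    (12 * pi ^+ 2)%:E * energy u)%E.
  (* The slices of e are reassembled into the full integral, which is cut again along e': there u
     does not vary with w, and the second kernel integrates to at most 12 pi^2. *)
  rewrite -(ge0_integral_split e (fun p => (V p)%:E))//.
  rewrite (ge0_integral_split e' (fun p => (V p)%:E))//.
  have mu2 : measurable_fun setT (fun q => (cabs (u q) ^+ 2)%:E).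
    by apply/measurable_EFinP; exact: measurable_cabs_sqr.
  rewrite /energy -ge0_integralZl_EFin//; first last.
  - by rewrite mulr_ge0// sqr_ge0.
  - by move=> q _; rewrite lee_fin sqr_ge0.
  apply: ge0_le_integral => //.
  - by move=> q _; apply: integral_ge0 => w _; rewrite lee_fin.
  - exact: (measurable_integral_split e' (fun p => (V p)%:E)).
  - exact: measurable_funeM.
  move=> q _; rewrite (eq_integral (fun w => ((cabs (u q) ^+ 2)%:E * (schur_kernel k i (@split_pair R n e' w q))%:E)%E)); last first.
    by move=> w _; rewrite -EFinM /V split_pairK.
  rewrite ge0_integralZl_EFin ?sqr_ge0//; first last.
  - apply/measurable_EFinP; apply: measurable_schur_kernel.
    exact: (measurable_split_pair _ _ e' id (fun=> q)).
  - by move=> w _; rewrite lee_fin schur_kernel_ge0.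
  rewrite muleC; apply: lee_wpmul2r; first by rewrite lee_fin sqr_ge0.
  exact: integral_schur_slice.
apply: (@le_trans _ _ (\int[lebesgue m.+1]_q (3%:E * \int[leb]_w (V (@split_pair R n e w q))%:E))%E); last first.
  rewrite ge0_integralZl_EFin//.
  - apply: (le_trans (lee_wpmul2l _ hV)) => //; rewrite muleA -EFinM.
    by rewrite (_ : 3 * _ = (2 * pi * 3) ^+ 2)//; ring.
  - by move=> q _; apply: integral_ge0 => w _; rewrite lee_fin.
  - exact: (measurable_integral_split e (fun p => (V p)%:E)).
apply: ge0_le_integral => //.
- by move=> q _; rewrite mule_ge0// abs_trace_ge0.
- by apply: emeasurable_funM; exact: measurable_abs_trace.
- by apply: measurable_funeM; exact: (measurable_integral_split e (fun p => (V p)%:E)).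
move=> q _.
have mS : measurable_fun setT (fun w : plane R => @split_pair R n e w q).
  exact: (measurable_split_pair _ _ e id (fun=> q)).
have msqrt : measurable_fun setT (@Num.sqrt R).
  by apply: continuous_measurable_fun => x; exact: sqrt_continuous.
have mf1 : measurable_fun setT (fun w => Num.sqrt (schur_kernel i k (@split_pair R n e w q))).
  by apply: (measurableT_comp msqrt); exact: measurable_schur_kernel.
have mf2 : measurable_fun setT (fun w => Num.sqrt (V (@split_pair R n e w q))).
  apply: (measurableT_comp msqrt); apply: measurable_funM.
    exact: (measurableT_comp (measurable_cabs_sqr _ mum) mS).
  exact: measurable_schur_kernel.
have cs := cauchy_schwarz leb _ _ mf1 mf2.
have h : (abs_trace e (green_lift z e' u) q <= ((2 * pi)^-1)%:E *
    (sqrte (12 * pi ^+ 2)%:E * sqrte (\int[leb]_w (V (@split_pair R n e w q))%:E)))%E.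
  have k1' : (\int[leb]_w (schur_kernel i k (@split_pair R n e w q))%:E <= (12 * pi ^+ 2)%:E)%E.
    exact: integral_schur_slice.
  apply: (@le_trans _ _ (((2 * pi)^-1)%:E * \int[leb]_w (`|Num.sqrt (schur_kernel i k (@split_pair R n e w q))| *
      `|Num.sqrt (V (@split_pair R n e w q))|)%:E)%E).
    rewrite -ge0_integralZl_EFin//; first last.
    - by rewrite invr_ge0 mulr_ge0// ltW.
    - apply/measurable_EFinP; apply: measurable_funM; apply: (measurableT_comp (@normr_measurable R setT)); [exact: mf1|exact: mf2].
    apply: ge0_le_integral => //.
    - by move=> w _; rewrite lee_fin cabs_ge0.
    - by apply: measurable_cabsE; exact: cmeasurable_slice.
    - apply: measurable_funeM; apply/measurable_EFinP.
      by apply: measurable_funM; apply: (measurableT_comp (@normr_measurable R setT)); [exact: mf1|exact: mf2].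
    move=> w _; set p := @split_pair R n e w q; rewrite -EFinM lee_fin.
    rewrite !ger0_norm ?sqrtr_ge0// -sqrtrM ?schur_kernel_ge0// /V mulrCA.
    have -> : schur_kernel i k p * schur_kernel k i p = ((D p)^-1) ^+ 2.
      rewrite /schur_kernel -/(D p) mulrACA -[schur_weight _ (tnth p k) _]schur_weightV//.
      by rewrite mulfV ?mul1r// gt_eqF// schur_weight_gt0.
    rewrite -exprMn sqrtr_sqr ger0_norm; last by rewrite mulr_ge0 ?cabs_ge0// invr_ge0 ltW.
    rewrite /green_lift /green_fun /lift_fun !cabsM cabsV cabs_real ger0_norm; last first.
      by rewrite invr_ge0 mulr_ge0// ltW.
    rewrite -mulrA; apply: ler_wpM2l; first by rewrite invr_ge0 mulr_ge0// ltW.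
    apply: ler_wpM2l; first exact: cabs_ge0.
    have sp : 0 <= sqn p by exact: sqn_ge0.
    by rewrite lef_pV2 ?posrE ?cabs_resolvent_den_gt0//; exact: cabs_resolvent_den.
  apply: lee_wpmul2l; first by rewrite lee_fin invr_ge0 mulr_ge0// ltW.
  apply: (le_trans cs).
  have -> : (\int[leb]_w (Num.sqrt (schur_kernel i k (@split_pair R n e w q)) ^+ 2)%:E =
      \int[leb]_w (schur_kernel i k (@split_pair R n e w q))%:E)%E.
    by apply: eq_integral => w _; rewrite sqr_sqrtr// schur_kernel_ge0.
  have -> : (\int[leb]_w (Num.sqrt (V (@split_pair R n e w q)) ^+ 2)%:E =
      \int[leb]_w (V (@split_pair R n e w q))%:E)%E.
    by apply: eq_integral => w _; rewrite sqr_sqrtr.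
  apply: lee_wpmul2r; first exact: sqrte_ge0.
  by rewrite lee_sqrt// lee_fin mulr_ge0// sqr_ge0.
apply: (le_trans (lee_pmul (abs_trace_ge0 _ _ _) (abs_trace_ge0 _ _ _) h h)).
have I0 : (0 <= \int[leb]_w (V (@split_pair R n e w q))%:E)%E.
  by apply: integral_ge0 => w _; rewrite lee_fin.
rewrite muleACA [X in (_ * X)%E]muleACA -!expe2 !sqr_sqrte// ?lee_fin ?mulr_ge0 ?sqr_ge0 ?pi_ge0//.
rewrite muleA expe2 -!EFinM (_ : (2 * pi)^-1 * _ * _ = 3)//.
by move: (pi : R) p0 => P p0; field; rewrite gt_eqF.
Qed.

End SchurTest.

(** * The propagator *)

Section LogMeasurable.
Context {R : realType}.
Local Notation C := R[i].

(** The bounds are strict because the argument uses continuity of acos on the open interval only. *)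
Lemma measurable_acos_comp d (T : measurableType d) (g : T -> R) : measurable_fun setT g ->
  (forall x, -1 < g x < 1) -> measurable_fun setT (fun x => acos (g x)).
Proof.
move=> mg g1; pose I : set R := `]-1, 1[%classic.
have mI : measurable I by exact: measurable_itv.
have gI : g @` setT `<=` I by move=> _ [x _ <-]; rewrite /I /= in_itv /= g1.
have ma : measurable_fun I (@acos R).
  apply: subspace_continuous_measurable_fun => //.
  apply: continuous_in_subspaceT => x; rewrite inE /I /= in_itv/= => hx.
  exact: continuous_acos.
exact: measurable_comp mI gI ma mg.
Qed.

Lemma cmeasurable_clog_resolvent d (T : measurableType d) (z : C) (f : T -> R) :
  0 < - complex.Re z -> measurable_fun setT f -> (forall x, 0 <= f x) ->
  cmeasurable (fun x => clog (resolvent_den z (f x))).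
Proof.
move=> hz mf f0; have mD := cmeasurable_resolvent_den z _ _ f mf.
have [mRe _] := mD; have mabs := measurable_cabs _ mD; split.
  exact: (measurableT_comp (@measurable_ln R) mabs).
pose g x := complex.Re (resolvent_den z (f x)) / cabs (resolvent_den z (f x)).
have mg : measurable_fun setT g by apply: measurable_funM => //; exact: measurable_funV.
have eI x : complex.Im (resolvent_den z (f x)) = - complex.Im z by rewrite cImD cImN/= add0r.
have macos : measurable_fun setT (fun x => acos (g x)).
  have [z0|z0] := eqVneq (complex.Im z) 0.
    rewrite (_ : (fun x => _) = (fun=> acos 1)); first exact: measurable_cst.
    apply/funext => x; congr acos; have c0 := cabs_resolvent_den_gt0 z hz _ (f0 x).
    have Re0 : 0 <= complex.Re (resolvent_den z (f x)).
      rewrite cReD cReN/=; have := f0 x; have := hz; move: (complex.Re z : R) (f x) => a b; lra.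
    rewrite /g; suff -> : complex.Re (resolvent_den z (f x)) = cabs (resolvent_den z (f x)) by rewrite divff// gt_eqF.
    apply/eqP; rewrite -(@eqrXn2 _ 2)// ?cabs_ge0// cabs_sqr eI z0 oppr0.
    by rewrite expr0n addr0.
  apply: measurable_acos_comp => // x; have c0 := cabs_resolvent_den_gt0 z hz _ (f0 x).
  rewrite -ltr_norml normrM normfV [`|cabs _|]ger0_norm ?cabs_ge0//.
  rewrite ltr_pdivrMr// mul1r -(@ltr_pXn2r _ 2)// ?nnegrE ?cabs_ge0//.
  by rewrite cabs_sqr real_normK ?num_real// ltrDl eI sqrrN exprn_even_gt0//.
rewrite (_ : (fun x => _) = (fun x => if - complex.Im z < 0 then - acos (g x) else acos (g x))).
  by case: (- complex.Im z < 0) => //; exact: measurable_funN.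
by apply/funext => x; rewrite /clog/= /carg eI.
Qed.

End LogMeasurable.

Section Propagator.
Context {R : realType} {m : nat}.
Local Notation C := R[i].
Local Notation n := m.+2.
Variables (z : C) (beta c : R).
Hypotheses (hz : 0 < - complex.Re z) (c0 : 0 < c) (hc : c <= ln (- complex.Re z) - beta).
Local Notation r := (- complex.Re z).
Local Notation sq := (@sqn_merged R n).

Definition propagator_den (q : config R m.+1) : C := clog (resolvent_den z (sq q)) - beta%:C%C.

Lemma cmeasurable_propagator_den : cmeasurable propagator_den.
Proof.
apply: cmeasurableB; last exact: cmeasurable_cst.
apply: cmeasurable_clog_resolvent => //; first by apply: measurable_sqn_merged; exact: measurable_id.
by move=> q; exact: sqn_merged_ge0.
Qed.

Lemma propagator_den_ln q : ln (sq q / 2 + r) - beta <= cabs (propagator_den q).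
Proof.
apply: le_trans (cabs_Re _); apply: le_trans (ler_norm _).
rewrite cReD cReN/= lerD2r; have s0 := sqn_merged_ge0 q.
have d0 : 0 < sq q / 2 + r by rewrite ltr_wpDl// divr_ge0.
by rewrite ler_ln ?posrE ?cabs_resolvent_den_gt0//; exact: cabs_resolvent_den.
Qed.

Lemma propagator_den_ge q : c <= cabs (propagator_den q).
Proof.
apply: le_trans (propagator_den_ln q); apply: (le_trans hc); rewrite lerD2r.
have s0 := sqn_merged_ge0 q.
by rewrite ler_ln ?posrE// ?ltr_wpDl ?lerDr ?divr_ge0.
Qed.

Lemma propagator_den_neq0 q : propagator_den q != 0.
Proof. by rewrite -cabs_eq0 gt_eqF// (lt_le_trans c0)// propagator_den_ge. Qed.

(** Needed for the domain of J_z: dividing by [propagator_den] must leave a function that is still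
    in L^2 after multiplication by ln (|p|^2 + 1). Since (2 + 1/r) (s/2 + r) >= s + 1, the two
    logarithms differ by at most a constant, which is absorbed because the denominator is at least c
    in modulus. *)
Lemma log_domination : exists2 K : R, 0 <= K &
  forall q, ln (sq q + 1) <= K * cabs (propagator_den q).
Proof.
pose M : R := 2 + r^-1; have M0 : 0 < M by rewrite addr_gt0// invr_gt0.
exists (`|ln M + beta| / c + 1) => [|q]; first by rewrite addr_ge0// divr_ge0// ltW.
have s0 := sqn_merged_ge0 q; have d0 : 0 < sq q / 2 + r by rewrite ltr_wpDl// divr_ge0.
have h1 : ln (sq q + 1) <= ln M + ln (sq q / 2 + r).
  rewrite -lnM ?posrE// ler_ln ?posrE ?mulr_gt0//; last by rewrite ltr_wpDl.
  have e : M * (sq q / 2 + r) = sq q + 1 + (2 * r + sq q * r^-1 / 2).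
    by rewrite /M; have := hz; move: r (sq q) => a b a0; field; rewrite gt_eqF.
  by rewrite e lerDl addr_ge0 ?mulr_ge0 ?divr_ge0// ?invr_ge0 ?ltW.
have h2 := propagator_den_ln q; have h3 := propagator_den_ge q.
have h4 := ler_norm (ln M + beta).
apply: (@le_trans _ _ (`|ln M + beta| + cabs (propagator_den q))).
  by apply: (le_trans h1); move: (ln M) (ln _) (cabs _) `|_| h2 h4 => a b d e; lra.
rewrite mulrDl mul1r lerD2r -[leLHS]mulr1 -mulrA ler_wpM2l//.
by rewrite mulrC ler_pdivlMr// mul1r.
Qed.

Definition inv_log_fun (u : cfun R m.+1) : cfun R m.+1 := fun q => u q / propagator_den q.

Lemma cmeasurable_inv_log_fun u : cmeasurable u -> cmeasurable (inv_log_fun u).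
Proof.
by move=> mu_; apply: cmeasurableM => //; apply: cmeasurableV; exact: cmeasurable_propagator_den.
Qed.

Lemma cabs_inv_log_fun u q : cabs (inv_log_fun u q) <= c^-1 * cabs (u q).
Proof.
rewrite cabsM cabsV mulrC ler_wpM2r ?cabs_ge0// lef_pV2 ?posrE//.
  exact: propagator_den_ge.
by rewrite (lt_le_trans c0)// propagator_den_ge.
Qed.

Lemma linear_bounded_inv_log : linear_bounded inv_log_fun c^-1.
Proof.
have ci : 0 <= c^-1 by rewrite invr_ge0 ltW.
split => //.
- by move=> u [mu_ _]; exact: cmeasurable_inv_log_fun.
- move=> u [mu_ _]; apply: Lp_norm2_le => //; first exact: cmeasurable_inv_log_fun.
  by apply: aeW => q; exact: cabs_inv_log_fun.
- by move=> k u v _ _; apply: aeW => q; rewrite /inv_log_fun mulrDl mulrA.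
Qed.

Lemma represents_inv_log : represents (op_inv (shifted_log (n := n) z beta)) inv_log_fun.
Proof.
move=> u uL w; have mu_ := L2_measurable _ uL; have mF := cmeasurable_inv_log_fun _ mu_; split.
  move=> [a [b [[wL _ [_ aa]] [k [d [_ [_ ad]] [_ ak]] [_ ab]] [_ au]]]].
  have mw := L2_measurable _ wL; split => //.
  have h1 : {ae lebesgue m.+1, forall q, a q = clog ((sq q / 2)%:C%C - z) * w q /\ d q = w q}.
    by apply: filterS2 aa ad.
  have h2 : {ae lebesgue m.+1, forall q, k q = beta%:C%C * d q /\ b q = -1 * k q}.
    by apply: filterS2 ak ab.
  apply: filterS3 h1 h2 au => q [ha hd] [hk hb] hu.
  rewrite /inv_log_fun hu ha hb hk hd mulN1r -mulrBl -/(resolvent_den z (sq q)) -/(propagator_den q).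
  by rewrite mulrAC divff ?mul1r// propagator_den_neq0.
move=> [mw aw].
have wL : L2 w.
  by apply: (version_L2 (inv_log_fun u)); [split|exact: linear_bounded_L2 linear_bounded_inv_log uL].
have mq : measurable_fun setT (fun q : config R m.+1 => sq q).
  by apply: measurable_sqn_merged; exact: measurable_id.
have mlog : cmeasurable (fun q => clog (resolvent_den z (sq q))).
  by apply: cmeasurable_clog_resolvent => // q; exact: sqn_merged_ge0.
have mb : cmeasurable (fun q => beta%:C%C * w q) by apply: cmeasurableM => //; exact: cmeasurable_cst.
have mlw : cmeasurable (fun q => clog (resolvent_den z (sq q)) * w q) by exact: cmeasurableM.
exists (fun q => clog (resolvent_den z (sq q)) * w q), (fun q => -1 * (beta%:C%C * w q)); split.
- split; [exact: wL| |exact: version_refl].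
  have [K K0 hK] := log_domination.
  have mln : measurable_fun setT (fun q : config R m.+1 => ln (sq q + 1)).
    apply: (measurableT_comp (@measurable_ln R)); apply: measurable_funD => //; exact: measurable_cst.
  apply: (L2_dom _ u K) => //; first by apply: cmeasurableM => //; exact: cmeasurable_real.
  apply: filterS aw => q ->; rewrite /inv_log_fun !cabsM cabsV cabs_real ger0_norm; last first.
    by rewrite ln_ge0// lerDr sqn_merged_ge0.
  have D0 : 0 < cabs (propagator_den q) by rewrite (lt_le_trans c0)// propagator_den_ge.
  rewrite -mulrA [K * _]mulrC; apply: ler_wpM2l; first exact: cabs_ge0.
  by rewrite mulrC ler_pdivrMr.
- exists (fun q => beta%:C%C * w q).
    by exists w; [split => //; exact: version_refl|exact: version_refl].
  by apply: version_refl; apply: cmeasurableM => //; exact: cmeasurable_cst.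
- split => //; apply: filterS aw => q ->.
  by rewrite mulN1r -mulrBl -/(propagator_den q) /inv_log_fun mulrC divfK// propagator_den_neq0.
Qed.

Definition propagator_fun (u : cfun R m.+1) : cfun R m.+1 :=
  fun q => (4 * pi)%:C%C * inv_log_fun u q.

Lemma linear_bounded_propagator : linear_bounded propagator_fun (4 * pi / c).
Proof.
have := linear_bounded_scale _ _ _ _ ((4 * pi)%:C)%C linear_bounded_inv_log.
by rewrite cabs_real ger0_norm// mulr_ge0// pi_ge0.
Qed.

Lemma represents_propagator : represents (propagator (n := n) z beta) propagator_fun.
Proof. exact: represents_scale represents_inv_log linear_bounded_inv_log. Qed.

End Propagator.

Lemma op_compA (R : realType) a b c d (A : op R c d) (B : op R b c) (D : op R a b) :
  op_comp (op_comp A B) D = op_comp A (op_comp B D).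
Proof.
apply/funext => u; apply/funext => w; apply/propext; split.
  by move=> [v Dv [x Bx Ax]]; exists x => //; exists v.
by move=> [x [v Dv Bx] Ax]; exists v => //; exists x.
Qed.

(** * The series over diagrams *)

Section Diagrams.
Context {R : realType} {m : nat}.
Local Notation C := R[i].
Local Notation n := m.+2.
Local Notation pair := ('I_n * 'I_n)%type.
Variables (z : C) (beta c : R).
Hypotheses (hz : 0 < - complex.Re z) (c0 : 0 < c) (hc : c <= ln (- complex.Re z) - beta).
Local Notation r := (- complex.Re z).
Local Notation K1 := ((2 * Num.sqrt r)^-1).
Local Notation KP := (4 * pi / c).
Local Notation P := (propagator_fun (m := m) z beta).
Local Notation GS e := (green_lift z e).
Implicit Types (e : pair) (d : seq pair).

Definition trace_green e : cfun R n -> cfun R m.+1 := trace_fun e \o green_fun z.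

Definition pair_kernel e e' : cfun R m.+1 -> cfun R m.+1 := trace_fun e \o GS e'.

Lemma K1_ge0 : 0 <= K1. Proof. by rewrite invr_ge0 mulr_ge0// sqrtr_ge0. Qed.

Lemma KP_ge0 : 0 <= KP. Proof. by rewrite divr_ge0 ?mulr_ge0 ?pi_ge0// ltW. Qed.

Lemma trace_green_spec e : ordered_pair e ->
  linear_bounded (trace_green e) K1 /\ represents (op_comp (trace (n := n) e) (green z)) (trace_green e).
Proof.
move=> oe; have e12 := ordered_pair_neq e oe; have bG := @linear_bounded_green R n z hz.
have h u (uL : L2 u) := abs_trace_green_bound z e hz e12 u uL; split.
  exact: (linear_bounded_trace e _ _ _ e12 bG K1_ge0 h).
exact: (represents_trace e _ _ _ e12 bG h _ (represents_green z hz)).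
Qed.

Lemma pair_kernel_spec e e' : ordered_pair e -> ordered_pair e' -> e != e' ->
  linear_bounded (pair_kernel e e') 3 /\
  represents (op_comp (op_comp (trace (n := n) e) (green z)) (trace_adj (n := n) e')) (pair_kernel e e').
Proof.
move=> oe oe' ne; have e12 := ordered_pair_neq e oe; have e12' := ordered_pair_neq e' oe'.
have bG := linear_bounded_green_lift z e' hz e12'.
have h u (uL : L2 u) := schur_bound z hz e e' u oe oe' ne uL; split.
  by apply: (linear_bounded_trace e _ _ _ e12 bG _ h).
rewrite op_compA.
exact: (represents_trace e _ _ _ e12 bG h _ (represents_green_lift z e' hz e12')).
Qed.

(** All factors of a diagram to the right of its first propagator. Leaving out the leftmost G S*
    gives a recursion that adds one vertex on the left at each step. *)
Fixpoint chain_fun e d : cfun R n -> cfun R m.+1 :=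
  if d is e' :: d' then pair_kernel e e' \o P \o chain_fun e' d' else trace_green e.

Definition diagram_fun e d : cfun R n -> cfun R n := GS e \o P \o chain_fun e d.

Lemma chain_spec e d : dgm (e :: d) ->
  linear_bounded (chain_fun e d) ((3 * KP) ^+ size d * K1) /\
  represents (op_comp
      (foldr (@op_comp R m.+1 m.+1 m.+1) (@op_id R m.+1)
        [seq op_comp (op_comp (op_comp (trace (n := n) s.1) (green z)) (trace_adj (n := n) s.2))
               (propagator (n := n) z beta) | s <- zip (e :: d) d])
      (op_comp (trace (n := n) (last e d)) (green z))) (chain_fun e d).
Proof.
elim: d e => [|e' d IH] e.
  rewrite /dgm/= !andbT => oe; have [b1 r1] := trace_green_spec e oe; split.
    by rewrite expr0 mul1r.
  exact: represents_comp (@represents_id R m.+1) (@linear_bounded_id R m.+1) r1 b1.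
rewrite /dgm/= => /andP[/andP[oe /andP[oe' od]] /andP[ne pd]].
have [|bI rI] := IH e'; first by rewrite /dgm/= oe' od.
have [bT rT] := pair_kernel_spec e e' oe oe' ne.
have bP := linear_bounded_propagator (m := m) z beta c hz c0 hc.
have rP := represents_propagator (m := m) z beta c hz c0 hc.
have bTP := linear_bounded_comp _ _ _ _ _ _ _ bT bP.
have rTP := represents_comp _ _ _ _ _ _ _ _ _ rT bT rP bP.
split; first by rewrite exprS -mulrA; exact: linear_bounded_comp bTP bI.
rewrite op_compA; exact: represents_comp rTP bTP rI bI.
Qed.

Lemma diagram_spec e d : dgm (e :: d) ->
  linear_bounded (diagram_fun e d) (K1 * KP * ((3 * KP) ^+ size d * K1)) /\
  represents (diagram_op (n := n) z beta e d) (diagram_fun e d).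
Proof.
move=> hd; have [bI rI] := chain_spec e d hd.
have oe : ordered_pair e by move: hd; rewrite /dgm/= => /andP[/andP[]].
have e12 := ordered_pair_neq e oe.
have bG := linear_bounded_green_lift z e hz e12.
have rG := represents_green_lift z e hz e12.
have bP := linear_bounded_propagator (m := m) z beta c hz c0 hc.
have rP := represents_propagator (m := m) z beta c hz c0 hc.
have bGP := linear_bounded_comp _ _ _ _ _ _ _ bG bP.
have rGP := represents_comp _ _ _ _ _ _ _ _ _ rG bG rP bP.
split; first exact: linear_bounded_comp bGP bI.
exact: represents_comp rGP bGP rI bI.
Qed.

End Diagrams.

(** * Operators defined by geometrically convergent series *)

Section SeriesOperator.
Context {R : realType} {a b : nat}.
Local Notation C := R[i].
Local Notation N2 f := (@Lp_norm R _ 2 f%R).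
Variables (F : nat -> cfun R a -> cfun R b) (K : R).
Hypothesis bF : forall k, linear_bounded (F k) (K * 2^-1 ^+ k).

Definition series_fun (u : cfun R a) : cfun R b := L2_series (fun k => F k u).

Definition partial_fun M (u : cfun R a) : cfun R b := fun x => \sum_(k < M) F k u x.

Let K0 : 0 <= K.
Proof. by have [h _ _ _] := bF 0; rewrite expr0 mulr1 in h. Qed.

Let h0 M : 0 <= 2^-1 ^+ M :> R. Proof. by rewrite exprn_ge0// invr_ge0. Qed.

Lemma fine_Lp_norm2_ge0 (u : cfun R a) : 0 <= fine (N2 u).
Proof. by rewrite fine_ge0// Lp_norm2_ge0. Qed.

Let termN u : L2 u -> forall k, (N2 (F k u) <= ((K * fine (N2 u)) * 2^-1 ^+ k)%:E)%E.
Proof.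
move=> uL k; have [_ _ nF _] := bF k; apply: (le_trans (nF _ uL)).
by rewrite -(fineK (Lp_norm2_fin _ uL)) -EFinM lee_fin mulrAC.
Qed.

Let termM u : L2 u -> forall k, cmeasurable (F k u).
Proof. by move=> uL k; have [_ mF _ _] := bF k; exact: mF. Qed.

Lemma cmeasurable_series_fun u : L2 u -> cmeasurable (series_fun u).
Proof. by move=> uL; apply: cmeasurable_L2_series; exact: termM. Qed.

Lemma series_fun_dist u M : L2 u ->
  (N2 (fun x => series_fun u x - partial_fun M u x)%R <= (2 * K * 2^-1 ^+ M)%:E * N2 u)%E.
Proof.
move=> uL; apply: (le_trans (L2_series_dist _ (termM u uL) _ (termN u uL) M)).
by rewrite -(fineK (Lp_norm2_fin _ uL)) -EFinM lee_fin le_eqVlt; apply/orP; left; apply/eqP; ring.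
Qed.

Let series_fun_dist_fin u M : L2 u ->
  (N2 (fun x => series_fun u x - partial_fun M u x)%R <= (2 * K * 2^-1 ^+ M * fine (N2 u))%:E)%E.
Proof.
by move=> uL; rewrite [X in (_ <= X)%E]EFinM fineK ?Lp_norm2_fin//; exact: series_fun_dist.
Qed.

Lemma linear_bounded_partial M : linear_bounded (partial_fun M) (\sum_(k < M) K * 2^-1 ^+ k).
Proof.
exact: (linear_bounded_sum _ _ 'I_M xpredT (fun k : 'I_M => F k) (fun k : 'I_M => K * 2^-1 ^+ k) (fun k _ => bF k)).
Qed.

Lemma geometric_small (B e : R) : 0 < e -> exists M, B * 2^-1 ^+ M <= e.
Proof.
move=> e0; have h : B * 2^-1 ^+ k @[k --> \oo] --> (0 : R).
  apply: (@cvg_geometric R B 2^-1); rewrite ger0_norm ?invr_ge0//.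
  by rewrite invf_lt1// ltr1n.
have /cvgr_lt/(_ e e0) [M _ hM] := h; exists M; apply: ltW; exact: (hM M (leqnn M)).
Qed.

(** The cut-off set of [L2_series] depends on the input, so the limits cannot be compared term by
    term. Both sides are approximated by partial sums, which are linear almost everywhere, up to an
    error that tends to 0. *)
Lemma series_fun_lin (c : C) u v : L2 u -> L2 v ->
  version (series_fun (fun y => c * u y + v y)) (fun x => c * series_fun u x + series_fun v x).
Proof.
move=> uL vL; have lL : L2 (fun y => c * u y + v y) by exact: L2D (L2Z _ _ uL) vL.
have mu_ := cmeasurable_series_fun u uL; have mv := cmeasurable_series_fun v vL.
have ml := cmeasurable_series_fun _ lL.
have mc (f g : cfun R b) : cmeasurable f -> cmeasurable g -> cmeasurable (fun x => c * f x + g x).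
  by move=> mf mg; apply: cmeasurableD => //; apply: cmeasurableM => //; exact: cmeasurable_cst.
apply: version_dist_lt => //; first exact: mc.
move=> e e0; pose B := 2 * K * (fine (N2 (fun y => c * u y + v y)%R) + (cabs c * fine (N2 u) + fine (N2 v))).
have [M hM] := geometric_small B e e0; apply: (@le_trans _ _ (B * 2^-1 ^+ M)%:E); last by rewrite lee_fin.
have [_ mP _ lP] := linear_bounded_partial M.
have mPu := mP _ uL; have mPv := mP _ vL; have mPl := mP _ lL.
have mcP := mc _ _ mPu mPv; have mcS := mc _ _ mu_ mv.
apply: (le_trans (le_Lp_norm2B (partial_fun M (fun y => c * u y + v y)) _ _ ml mcS mPl)).
have -> : B * 2^-1 ^+ M = 2 * K * 2^-1 ^+ M * fine (N2 (fun y => c * u y + v y)%R) +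
   (cabs c * (2 * K * 2^-1 ^+ M * fine (N2 u)) + 2 * K * 2^-1 ^+ M * fine (N2 v)) by rewrite /B; ring.
rewrite EFinD; apply: leeD.
  exact: series_fun_dist_fin.
rewrite Lp_norm2BC.
have -> : N2 (fun x => c * series_fun u x + series_fun v x - partial_fun M (fun y => c * u y + v y) x)%R =
    N2 (fun x => c * (series_fun u x - partial_fun M u x) + (series_fun v x - partial_fun M v x))%R.
  apply: Lp_norm2_ae.
  - exact: cmeasurableB.
  - by apply: mc; exact: cmeasurableB.
  - by apply: filterS (lP c _ _ uL vL) => x ->; ring.
have mD1 := cmeasurableB _ _ mu_ mPu; have mD2 := cmeasurableB _ _ mv mPv.
have mcD : cmeasurable (fun x => c * (series_fun u x - partial_fun M u x)).
  by apply: cmeasurableM => //; exact: cmeasurable_cst.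
apply: (le_trans (le_Lp_norm2D _ _ mcD mD2)); rewrite EFinD; apply: leeD.
  rewrite Lp_norm2Z// EFinM; apply: lee_wpmul2l; first by rewrite lee_fin cabs_ge0.
  exact: series_fun_dist_fin.
exact: series_fun_dist_fin.
Qed.

Lemma linear_bounded_series : linear_bounded series_fun (2 * K).
Proof.
split.
- by rewrite mulr_ge0.
- exact: cmeasurable_series_fun.
- move=> u uL; have := series_fun_dist u 0 uL; rewrite expr0 mulr1.
  by congr (_ <= _)%E; congr Lp_norm; apply/funext => x; rewrite /partial_fun big_ord0 subr0.
- by move=> c u v uL vL; have [] := series_fun_lin c u v uL vL.
Qed.

Lemma linear_bounded_remainder M :
  linear_bounded (fun u x => series_fun u x + (-1) * partial_fun M u x) (2 * K * 2^-1 ^+ M).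
Proof.
have bP := linear_bounded_scale _ _ _ _ (-1) (linear_bounded_partial M).
have [_ mS _ lS] := linear_bounded_add _ _ _ _ _ _ linear_bounded_series bP.
split => //; first by rewrite !mulr_ge0.
move=> u uL; have := series_fun_dist u M uL; congr (_ <= _)%E; congr Lp_norm.
by apply/funext => x; rewrite mulN1r.
Qed.

End SeriesOperator.

Section ResolventSeries.
Context {R : realType} {m : nat}.
Local Notation C := R[i].
Local Notation n := m.+2.
Local Notation pair := ('I_n * 'I_n)%type.
Local Notation N2 f := (@Lp_norm R _ 2 f%R).
Variables (z : C) (beta c : R).
Hypotheses (hz : 0 < - complex.Re z) (c0 : 0 < c) (hc : c <= ln (- complex.Re z) - beta).
Local Notation r := (- complex.Re z).
Local Notation K1 := ((2 * Num.sqrt r)^-1).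
Local Notation KP := (4 * pi / c).
Local Notation N := ((n * n)%:R : R).
Hypothesis hsmall : N * (3 * KP) <= 2^-1.
Local Notation P := (propagator_fun (m := m) z beta).
Local Notation GS e := (green_lift z e).

Let K10 : 0 <= K1 := K1_ge0 z.
Let KP0 : 0 <= KP := KP_ge0 c c0.

Definition diagram_bound (k : nat) : R := K1 * KP * ((3 * KP) ^+ k * K1).

Lemma diagram_bound_ge0 k : 0 <= diagram_bound k.
Proof.
by apply: mulr_ge0; apply: mulr_ge0 => //; apply: exprn_ge0; exact: mulr_ge0.
Qed.

Definition layer_bound : R := N * (K1 * KP * K1).

Lemma layer_bound_ge0 : 0 <= layer_bound.
Proof. by apply: mulr_ge0 => //; apply: mulr_ge0 => //; exact: mulr_ge0. Qed.

Lemma dgm_tuple_spec k (d : k.+1.-tuple pair) : dgm d ->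
  linear_bounded (diagram_fun z beta (thead d) (behead d)) (diagram_bound k) /\
  represents (diagram_op (n := n) z beta (thead d) (behead d)) (diagram_fun z beta (thead d) (behead d)).
Proof.
move=> hd; have := diagram_spec z beta c hz c0 hc (thead d) (behead d).
have -> : size (behead d) = k by rewrite size_behead size_tuple.
by apply; move: hd; rewrite {1}(tuple_eta d).
Qed.

Definition layer_fun (k : nat) : cfun R n -> cfun R n := fun u x =>
  \sum_(d : k.+1.-tuple pair | dgm d) diagram_fun z beta (thead d) (behead d) u x.

(** All (n^2)^(k+1) sequences of pairs are counted, admissible or not; one factor n^2 goes into
    [layer_bound], and each other one joins a factor 3 * 4 pi / c to make at most 1/2. *)
Lemma sum_diagram_bound k :
  \sum_(d : k.+1.-tuple pair | dgm d) diagram_bound k <= layer_bound * 2^-1 ^+ k.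
Proof.
apply: (@le_trans _ _ (\sum_(d : k.+1.-tuple pair) diagram_bound k)).
  by rewrite [leRHS](bigID (fun d : k.+1.-tuple pair => dgm d))/= lerDl sumr_ge0// => d _; exact: diagram_bound_ge0.
rewrite sumr_const card_tuple card_prod !card_ord -[leLHS]mulr_natl natrX.
have -> : N ^+ k.+1 * diagram_bound k = layer_bound * (N * (3 * KP)) ^+ k.
  by rewrite /diagram_bound /layer_bound exprS [(N * _) ^+ k]exprMn; move: ((3 * KP) ^+ k) (N ^+ k) => x y; ring.
apply: ler_wpM2l; first exact: layer_bound_ge0.
by apply: lerXn2r => //; rewrite nnegrE ?invr_ge0//; apply: mulr_ge0 => //; exact: mulr_ge0.
Qed.

Lemma linear_bounded_layer k : linear_bounded (layer_fun k) (layer_bound * 2^-1 ^+ k).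
Proof.
apply: linear_bounded_mono (sum_diagram_bound k).
by apply: linear_bounded_sum => d hd; case: (dgm_tuple_spec k d hd).
Qed.

Lemma diagram_op_norm_summable :
  (\sum_(0 <= k <oo) \sum_(d : k.+1.-tuple pair | dgm d)
     op_norm (unhat (diagram_op (n := n) z beta (thead d) (behead d))) < +oo)%E.
Proof.
have nn k : (0 <= \sum_(d : k.+1.-tuple pair | dgm d)
    op_norm (unhat (diagram_op (n := n) z beta (thead d) (behead d))))%E.
  apply: sume_ge0 => d hd; have [bD rD] := dgm_tuple_spec k d hd.
  by have /andP[] := op_norm_le _ _ _ _ _ (fourier_represents_unhat _ _ _ _ _ rD bD) bD.
apply: (@le_lt_trans _ _ (layer_bound * 2)%:E); last exact: ltry.
apply: lime_le; first by apply: is_cvg_nneseries => k _ _; exact: nn.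
apply: nearW => M.
apply: (@le_trans _ _ (\sum_(0 <= k < M) (layer_bound * 2^-1 ^+ k)%:E)%E).
  apply: lee_sum => k _; apply: (@le_trans _ _ (\sum_(d : k.+1.-tuple pair | dgm d) (diagram_bound k)%:E)%E).
    apply: lee_sum => d hd; have [bD rD] := dgm_tuple_spec k d hd.
    by have /andP[] := op_norm_le _ _ _ _ _ (fourier_represents_unhat _ _ _ _ _ rD bD) bD.
  by rewrite sumEFin lee_fin; exact: sum_diagram_bound.
rewrite sumEFin lee_fin.
(* [geometric_tail] is stated for a sequence of functions with geometric norm bounds; the zero
   sequence meets its hypothesis and leaves the numerical inequality. *)
have h k : (@Lp_norm R 0 2 (fun=> 0%R) <= (layer_bound * 2^-1 ^+ k)%:E)%E.
  by rewrite Lp_norm2_0 lee_fin mulr_ge0 ?layer_bound_ge0// exprn_ge0// invr_ge0.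
by have := @geometric_tail R 0 (fun _ => fun=> 0) layer_bound h 0 M; rewrite expr0 mulr1.
Qed.

Definition resolvent_fun : cfun R n -> cfun R n :=
  fun u x => green_fun z u x + series_fun layer_fun u x.

Lemma linear_bounded_resolvent : linear_bounded resolvent_fun (r^-1 + 2 * layer_bound).
Proof.
exact: (linear_bounded_add _ _ _ _ _ _ (@linear_bounded_green R n z hz)
  (linear_bounded_series layer_fun layer_bound linear_bounded_layer)).
Qed.

Lemma partial_sum_represents M :
  fourier_represents (resolvent_partial_sum (n := n) z beta M)
    (fun u x => green_fun z u x + partial_fun layer_fun M u x).
Proof.
have bG := @linear_bounded_green R n z hz.
have rG := fourier_represents_unhat _ _ _ _ _ (@represents_green R n z hz) bG.
have bP := linear_bounded_partial layer_fun layer_bound linear_bounded_layer M.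
apply: (fourier_represents_add _ _ _ _ _ _ _ _ rG bG _ bP).
apply: (fourier_represents_sum _ _ 'I_M xpredT (fun k : 'I_M => diagram_sum (n := n) z beta k)
  (fun k : 'I_M => layer_fun k) (fun k : 'I_M => layer_bound * 2^-1 ^+ k)) => k _; last exact: linear_bounded_layer.
apply: (fourier_represents_sum _ _ _ _ _ _ (fun _ => diagram_bound k)) => d hd.
  by have [bD rD] := dgm_tuple_spec k d hd; exact: fourier_represents_unhat rD bD.
by have [bD rD] := dgm_tuple_spec k d hd.
Qed.

(** The free parts cancel, so the difference is represented by the remainder of the series over
    layers, which is geometrically small. *)
Lemma resolvent_dist_cvg :
  op_norm (op_sub (unhat_fun resolvent_fun) (resolvent_partial_sum (n := n) z beta M)) @[M --> \oo] --> 0%E.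
Proof.
apply: (cvg0_geometric _ (2 * layer_bound)) => M.
have bP := linear_bounded_partial layer_fun layer_bound linear_bounded_layer M.
have bGP := linear_bounded_add _ _ _ _ _ _ (@linear_bounded_green R n z hz) bP.
have rs := fourier_represents_scale _ _ _ _ _ (-1) (partial_sum_represents M) bGP.
have bs := linear_bounded_scale _ _ _ _ (-1) bGP.
have rd := fourier_represents_add _ _ _ _ _ _ _ _
  (fourier_represents_unhat_fun _ _ _ _ linear_bounded_resolvent) linear_bounded_resolvent rs bs.
apply: (op_norm_le _ _ _ _ _ rd).
have := linear_bounded_remainder layer_fun layer_bound linear_bounded_layer M.
congr linear_bounded; apply/funext => u; apply/funext => x.
by rewrite /resolvent_fun; ring.
Qed.

End ResolventSeries.

Lemma linear_bounded_sub {R : realType} {a b : nat} (F : cfun R a -> cfun R b) K u v :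
  linear_bounded F K -> L2 u -> L2 v ->
  (Lp_norm 2 (fun x => (F u x - F v x)%R) <= K%:E * Lp_norm 2 (fun x => (u x - v x)%R))%E.
Proof.
move=> bF uL vL; have [_ mF nF lF] := bF.
have dL : L2 (fun y => -1 * v y + u y) by exact: L2D (L2Z _ _ vL) uL.
have -> : (fun x => u x - v x) = (fun x => -1 * v x + u x).
  by apply/funext => x; rewrite mulN1r addrC.
apply: le_trans (nF _ dL); rewrite le_eqVlt; apply/orP; left; apply/eqP; apply: Lp_norm2_ae.
- by apply: cmeasurableB; exact: mF.
- exact: mF.
- by apply: filterS (lF (-1) _ _ vL uL) => x ->; rewrite mulN1r addrC.
Qed.

(** * The inverse of the symmetric kernel *)

Section PairCount.
Context {R : realType} {m : nat}.
Local Notation n := m.+2.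
Local Notation pair := ('I_n * 'I_n)%type.

Lemma card_ordered_pair : (#|[pred e : pair | ordered_pair e]| * 2 = n * n.-1)%N.
Proof.
have -> : #|[pred e : pair | ordered_pair e]| = 'C(n, 2).
  rewrite -sum1_card (eq_bigl (fun e : pair => (e.1 < e.2)%N))//.
  rewrite -(pair_big_dep xpredT (fun i j : 'I_n => (i < j)%N) (fun _ _ => 1%N))/=.
  rewrite (exchange_big_dep xpredT)//= -bin2_sum big_mkord; apply: eq_bigr => j _.
  rewrite -(big_ord_widen n (fun=> 1%N) (ltnW (ltn_ord j))).
  by rewrite sum_nat_const card_ord muln1.
by have := bin_ffact n 2; rewrite ffactnS ffactn1.
Qed.

(** The prefactor 2 / (n (n - 1)) is the inverse of the number of pairs, so it turns sums over pairs
    into averages. *)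
Lemma pair_average_count : pair_average R n * (#|[pred e : pair | ordered_pair e]|%:R) = 1.
Proof.
rewrite /pair_average -card_ordered_pair natrM.
have h : (#|[pred e : pair | ordered_pair e]|%:R : R[i]) != 0.
  rewrite pnatr_eq0 -lt0n; have := card_ordered_pair; case: (#|_|) => //.
by rewrite mulrAC [X in X / _]mulrC divff// mulf_neq0// pnatr_eq0.
Qed.

End PairCount.

Section KernelInverse.
Context {R : realType} {m : nat}.
Local Notation C := R[i].
Local Notation n := m.+2.
Local Notation pair := ('I_n * 'I_n)%type.
Local Notation N2 f := (@Lp_norm R _ 2 f%R).
Variables (z : C) (beta c : R).
Hypotheses (hz : 0 < - complex.Re z) (c0 : 0 < c) (hc : c <= ln (- complex.Re z) - beta).
Local Notation KP := (4 * pi / c).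
Local Notation N := ((n * n)%:R : R).
Hypothesis hsmall : N * (3 * KP) <= 2^-1.
Local Notation P := (propagator_fun (m := m) z beta).
Local Notation avg := (pair_average R n).

Let KP0 : 0 <= KP := KP_ge0 c c0.
Let bP := linear_bounded_propagator (m := m) z beta c hz c0 hc.

Definition distinct_pairs (s : pair * pair) : bool :=
  [&& ordered_pair s.1, ordered_pair s.2 & s.1 != s.2].

Definition average_kernel_fun (u : cfun R m.+1) : cfun R m.+1 :=
  fun x => avg * \sum_(s : pair * pair | distinct_pairs s) pair_kernel z s.1 s.2 u x.

Let kernel_spec (s : pair * pair) : distinct_pairs s ->
  linear_bounded (pair_kernel z s.1 s.2) 3 /\
  represents (op_comp (op_comp (trace (n := n) s.1) (green z)) (trace_adj (n := n) s.2)) (pair_kernel z s.1 s.2).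
Proof. by move=> /and3P [ho ho2 ne]; exact: pair_kernel_spec. Qed.

Let bsum : linear_bounded (fun u x => \sum_(s : pair * pair | distinct_pairs s) pair_kernel z s.1 s.2 u x)
  (\sum_(s : pair * pair | distinct_pairs s) 3).
Proof. by apply: linear_bounded_sum => s hs; case: (kernel_spec s hs). Qed.

(** For each first pair there are at most n^2 second pairs, each with norm at most 3; the prefactor
    averages over the first pair and costs nothing. *)
Lemma linear_bounded_average_kernel : linear_bounded average_kernel_fun (N * 3).
Proof.
apply: (linear_bounded_mono _ _ _ _ _ (linear_bounded_scale _ _ _ _ avg bsum)).
apply: (@le_trans _ _ (cabs avg * \sum_(s : pair * pair | ordered_pair s.1) 3)).
  apply: ler_wpM2l; first exact: cabs_ge0.
  rewrite [leRHS](bigID distinct_pairs)/= [X in X + _](eq_bigl distinct_pairs); last first.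
    by move=> s; rewrite /distinct_pairs; case: (ordered_pair s.1).
  by rewrite lerDl sumr_ge0.
have -> : \sum_(s : pair * pair | ordered_pair s.1) (3 : R) =
    \sum_(e : pair | ordered_pair e) \sum_(e' : pair) 3.
  by rewrite pair_big_dep/=; apply: eq_bigl => s; rewrite andbT.
rewrite (eq_bigr (fun=> N * 3)); last first.
  by move=> e _; rewrite sumr_const card_prod !card_ord [RHS]mulr_natl.
rewrite sumr_const -[(N * 3) *+ _]mulr_natl mulrA.
have -> : cabs avg * #|[pred e : pair | ordered_pair e]|%:R = 1; last by rewrite mul1r.
have h := congr1 (@cabs R) (pair_average_count (R := R) (m := m)); rewrite cabsM cabs1 in h.
apply: etrans h; congr (_ * _).
by rewrite -(rmorph_nat (real_complex R)) cabs_real ger0_norm.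
Qed.

Lemma represents_average_kernel :
  represents (op_scale avg (op_sum (fun s : pair * pair => [&& ordered_pair s.1, ordered_pair s.2 & s.1 != s.2])
     (fun s => op_comp (op_comp (trace (n := n) s.1) (green z)) (trace_adj (n := n) s.2))))
  average_kernel_fun.
Proof.
apply: represents_scale bsum; apply: represents_sum => s hs.
  by case: (kernel_spec s hs).
by case: (kernel_spec s hs) => h _; exact: h.
Qed.

Definition neumann_step : cfun R m.+1 -> cfun R m.+1 := P \o average_kernel_fun.

Lemma linear_bounded_step : linear_bounded neumann_step 2^-1.
Proof.
apply: linear_bounded_mono (linear_bounded_comp _ _ _ _ _ _ _ bP linear_bounded_average_kernel) _.
by rewrite (_ : KP * _ = N * (3 * KP))//; ring.
Qed.

(** The term (P A)^k P of the Neumann series for (P^-1 - A)^-1, where P^-1 is (J_z - beta) / (4 pi)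
    and A the averaged kernel. *)
Definition neumann_term k : cfun R m.+1 -> cfun R m.+1 := iter k (fun F => neumann_step \o F) P.

Lemma linear_bounded_neumann k : linear_bounded (neumann_term k) (KP * 2^-1 ^+ k).
Proof.
elim: k => [|k IH]; first by rewrite expr0 mulr1.
rewrite exprS mulrCA; exact: linear_bounded_comp linear_bounded_step IH.
Qed.

Definition kernel_inverse_fun : cfun R m.+1 -> cfun R m.+1 := series_fun neumann_term.

Lemma linear_bounded_kernel_inverse : linear_bounded kernel_inverse_fun (2 * KP).
Proof. exact: linear_bounded_series linear_bounded_neumann. Qed.

Let bK := linear_bounded_kernel_inverse.
Let bS := linear_bounded_step.

(** The partial sums satisfy S_(M+1) u = P u + P A S_M u almost everywhere; since P A is bounded,
    the relation passes to the limit, with an error of order 2^-M. *)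
Lemma kernel_inverse_fixpoint u : L2 u ->
  version (kernel_inverse_fun u) (fun x => P u x + neumann_step (kernel_inverse_fun u) x).
Proof.
move=> uL; have KL := linear_bounded_L2 _ _ _ _ _ bK uL; have mK := L2_measurable _ KL.
have PL := linear_bounded_L2 _ _ _ _ _ bP uL; have SL := linear_bounded_L2 _ _ _ _ _ bS KL.
have RL := L2D _ _ PL SL; apply: version_dist_lt => //; first exact: L2_measurable.
move=> e e0; have [M hM] := geometric_small (2 * (2 * KP) * fine (N2 u)) e e0.
have bpart := linear_bounded_partial neumann_term KP linear_bounded_neumann.
have partL M' := linear_bounded_L2 _ _ _ _ _ (bpart M') uL.
have fterm k : L2 (neumann_term k u) by exact: linear_bounded_L2 (linear_bounded_neumann k) uL.
have part_step : version (partial_fun neumann_term M.+1 u)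
    (fun x => P u x + neumann_step (partial_fun neumann_term M u) x).
  have h := linear_bounded_bigsum _ _ _ _ 'I_M xpredT (fun k : 'I_M => neumann_term k u) bS (fun k _ => fterm k).
  split; first exact: L2_measurable (partL M.+1).
  have [_ ah] := h; apply: filterS ah => x hx.
  by rewrite /partial_fun big_ord_recl hx.
have d M' := series_fun_dist neumann_term KP linear_bounded_neumann u M' uL.
have uf : N2 u = (fine (N2 u))%:E by rewrite fineK// Lp_norm2_fin.
have mR := L2_measurable _ RL; have mp := L2_measurable _ (partL M.+1).
apply: (le_trans (le_Lp_norm2B (partial_fun neumann_term M.+1 u) _ _ mK mR mp)).
have e1 : (N2 (fun x => kernel_inverse_fun u x - partial_fun neumann_term M.+1 u x)%R <=
    ((2 * KP * fine (N2 u)) * 2^-1 ^+ M)%:E)%E.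
  apply: (le_trans (d M.+1)); rewrite {1}uf -EFinM lee_fin exprS.
  have f0 := fine_Lp_norm2_ge0 u; have p0 : 0 <= 2^-1 ^+ M :> R by rewrite exprn_ge0// invr_ge0.
  have := mulr_ge0 (mulr_ge0 KP0 f0) p0; move: (2^-1 ^+ M : R) (fine _) KP => x y k; nra.
have e2 : (N2 (fun x => partial_fun neumann_term M.+1 u x -
     (P u x + neumann_step (kernel_inverse_fun u) x))%R <= ((2 * KP * fine (N2 u)) * 2^-1 ^+ M)%:E)%E.
  have [_ pe] := part_step.
  have -> : N2 (fun x => partial_fun neumann_term M.+1 u x - (P u x + neumann_step (kernel_inverse_fun u) x))%R =
     N2 (fun x => neumann_step (partial_fun neumann_term M u) x - neumann_step (kernel_inverse_fun u) x)%R.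
    apply: Lp_norm2_ae.
    - exact: cmeasurableB.
    - exact: (cmeasurableB _ _ (L2_measurable _ (linear_bounded_L2 _ _ _ _ _ bS (partL M))) (L2_measurable _ SL)).
    - by apply: filterS pe => x ->; ring.
  apply: (le_trans (linear_bounded_sub _ _ _ _ bS (partL M) KL)).
  rewrite Lp_norm2BC; apply: (le_trans (lee_wpmul2l _ (d M))); first by rewrite lee_fin invr_ge0.
  rewrite {1}uf -!EFinM lee_fin.
  have f0 := fine_Lp_norm2_ge0 u; have p0 : 0 <= 2^-1 ^+ M :> R by rewrite exprn_ge0// invr_ge0.
  have := mulr_ge0 (mulr_ge0 KP0 f0) p0; move: (2^-1 ^+ M : R) (fine _) KP => x y k; nra.
apply: (le_trans (leeD e1 e2)); rewrite -EFinD lee_fin; apply: le_trans hM.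
by rewrite le_eqVlt; apply/orP; left; apply/eqP; ring.
Qed.

(** The distance of two solutions is at most half of itself, hence zero. *)
Lemma kernel_inverse_unique u w : L2 u -> L2 w ->
  version w (fun x => P u x + neumann_step w x) -> version w (kernel_inverse_fun u).
Proof.
move=> uL wL [mw aw]; have KL := linear_bounded_L2 _ _ _ _ _ bK uL; have mK := L2_measurable _ KL.
apply/version_dist0 => //; have [_ ak] := kernel_inverse_fixpoint u uL.
have dL : L2 (fun x => w x - kernel_inverse_fun u x) by exact: L2B.
have h : (N2 (fun x => w x - kernel_inverse_fun u x)%R <=
    2^-1%:E * N2 (fun x => w x - kernel_inverse_fun u x)%R)%E.
  apply: le_trans (linear_bounded_sub _ _ _ _ bS wL KL).
  rewrite le_eqVlt; apply/orP; left; apply/eqP; apply: Lp_norm2_ae.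
  - exact: cmeasurableB.
  - exact: (cmeasurableB _ _ (L2_measurable _ (linear_bounded_L2 _ _ _ _ _ bS wL)) (L2_measurable _ (linear_bounded_L2 _ _ _ _ _ bS KL))).
  - by apply: filterS2 aw ak => x {1}-> {1}->; ring.
have := Lp_norm2_ge0 (fun x => w x - kernel_inverse_fun u x).
have fin := Lp_norm2_fin _ dL; move: h fin; case: (N2 _) => // x; rewrite -EFinM !lee_fin => h _ x0.
by congr EFin; lra.
Qed.

(** Multiplying by P, the equation (P^-1 - A) w = u becomes w = P u + P A w. Conversely a solution
    of the latter is an image under P of an element of L^2, which puts it in the domain of J_z. *)
Lemma represents_kernel_inverse : represents (op_inv (sym_kernel (n := n) z beta)) kernel_inverse_fun.
Proof.
have p4 : ((4 * pi)%:C)%C != 0 :> C.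
  by rewrite -cabs_eq0 cabs_real normr_eq0 mulf_neq0// gt_eqF// pi_gt0.
have rI := represents_inv_log (m := m) z beta c hz c0 hc.
have bI := linear_bounded_inv_log (m := m) z beta c hz c0 hc.
have bA := linear_bounded_average_kernel; have rA := represents_average_kernel.
have PE u v (x : config R m.+1) : P (fun q => u q + v q) x = P u x + P v x.
  by rewrite /propagator_fun /inv_log_fun -mulrDr -mulrDl.
have IE u (x : config R m.+1) : inv_log_fun z beta (fun q => ((4 * pi)%:C)%C * u q) x = P u x.
  by rewrite /propagator_fun /inv_log_fun mulrA.
have p4V : ((4 * pi)^-1)%:C%C = (((4 * pi)%:C)%C)^-1 :> C by rewrite fmorphV.
move=> u uL w; have mu_ := L2_measurable _ uL; split.
  move=> [a [b [[s sw [ma aa]] [k /= kw [mb ab]] [_ au]]]].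
  have wL : L2 w by have [? [? [[]]]] := sw.
  have AwL := linear_bounded_L2 _ _ _ _ _ bA wL.
  have [mk ak] := (rA w wL k).1 kw.
  have sE : {ae lebesgue m.+1, forall x, s x = ((4 * pi)%:C)%C * (u x + average_kernel_fun w x)}.
    have h1 : {ae lebesgue m.+1, forall x, k x = average_kernel_fun w x /\ b x = -1 * k x}.
      by apply: filterS2 ak ab.
    apply: filterS3 h1 aa au => x [hk hb] ha ->.
    by rewrite ha hb hk p4V mulN1r addrNK mulrA divff ?mul1r.
  have tL : L2 (fun x => ((4 * pi)%:C)%C * (u x + average_kernel_fun w x)).
    by apply: L2Z; exact: L2D.
  have ms : cmeasurable s by have [? [? [_ _ []]]] := sw.
  have sv : version s (fun x => ((4 * pi)%:C)%C * (u x + average_kernel_fun w x)) by split.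
  have sL := version_L2 _ _ sv tL.
  have wI := (rI s sL w).1 sw.
  have wt := version_trans _ _ _ wI (linear_bounded_version _ _ _ _ _ _ bI tL sv).
  apply: kernel_inverse_unique => //; have [mw aw] := wt; split => //.
  by apply: filterS aw => x ->; rewrite IE PE.
move=> wK; have KL := linear_bounded_L2 _ _ _ _ _ bK uL; have wL := version_L2 _ _ wK KL.
have mw := L2_measurable _ wL.
have wF : version w (fun x => P u x + neumann_step w x).
  have [_ h1] := wK; have [_ h2] := kernel_inverse_fixpoint u uL.
  have [_ h3] := linear_bounded_version _ _ _ _ _ _ bS KL wK.
  split; first exact: mw.
  by apply: filterS3 h1 h2 h3 => x -> -> ->.
have AwL := linear_bounded_L2 _ _ _ _ _ bA wL.
have vL : L2 (fun x => u x + average_kernel_fun w x) by exact: L2D.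
have sL : L2 (fun x => ((4 * pi)%:C)%C * (u x + average_kernel_fun w x)) by exact: L2Z.
exists (fun x => u x + average_kernel_fun w x), (fun x => -1 * average_kernel_fun w x); split.
- exists (fun x => ((4 * pi)%:C)%C * (u x + average_kernel_fun w x)).
    apply: (rI _ sL w).2; split => //; have [_ aw] := wF.
    by apply: filterS aw => x ->; rewrite IE PE.
  split; first exact: L2_measurable.
  by apply: aeW => x; rewrite p4V mulrA mulVf ?mul1r.
- exists (average_kernel_fun w); last first.
    by apply: version_refl; apply: L2_measurable; exact: L2Z.
  by apply: (rA w wL _).2; apply: version_refl; exact: L2_measurable.
- by split => //; apply: aeW => x; rewrite mulN1r addrK.
Qed.

End KernelInverse.

(** * Symmetric functions *)

Section TailSymmetry.
Context {R : realType} {m : nat}.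
Local Notation C := R[i].
Local Notation n := m.+2.
Local Notation pair := ('I_n * 'I_n)%type.
Implicit Types (e : pair) (s : 'S_n).

Definition tail (q : config R m.+1) : seq (R * R) := behead q.

(** Equality up to a permutation of the unmerged momenta. The merged momentum, which has its own
    weight in [sqn_merged], stays in place. *)
Definition tail_equiv (q q' : config R m.+1) : Prop :=
  component q' 0 = component q 0 /\ perm_eq (tail q') (tail q).

(** Required at every point and not just almost everywhere: it is used under slice integrals at
    individual points, where exceptional sets would have to be tracked. *)
Definition tail_symmetric (v : cfun R m.+1) : Prop :=
  forall q q', tail_equiv q q' -> v q' = v q.

Lemma tail_equiv_refl q : tail_equiv q q.
Proof. by split. Qed.

Lemma tnth_cons0 k (a : plane R) (x : config R k) : tnth (cons_config (a, x)) ord0 = a.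
Proof. by []. Qed.

Lemma tnth_consS k (a : plane R) (x : config R k) i : tnth (cons_config (a, x)) (lift ord0 i) = tnth x i.
Proof. by rewrite (tnth_nth a) [RHS](tnth_nth a). Qed.

(** The permutation of the tail is extended by fixing the first two slots, which hold the split
    pair. *)
Lemma pair_front_equiv q q' : tail_equiv q q' -> exists t : 'S_n,
  [/\ t ord0 = ord0, t (inord 1) = inord 1 & forall w, pair_front w q' = permute t (pair_front w q)].
Proof.
move=> [hq /(@tuple_permP _ m _ [tuple of behead q])[p hp]].
have i1 : inord 1 = lift ord0 ord0 :> 'I_n by apply: val_inj; rewrite /= inordK.
exists (lift_perm ord0 ord0 (lift_perm ord0 ord0 p)); split.
- by rewrite lift_perm_id.
- by rewrite i1 lift_perm_lift lift_perm_id.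
move=> w; apply: eq_from_tnth => k; rewrite tnth_permute /pair_front hq.
case: (unliftP ord0 k) => [j ->|->]; last by rewrite lift_perm_id !tnth_cons0.
rewrite lift_perm_lift !tnth_consS.
case: (unliftP ord0 j) => [i ->|->]; last by rewrite lift_perm_id !tnth_cons0.
rewrite lift_perm_lift !tnth_consS.
have h : [tuple of behead q'] = [tuple tnth [tuple of behead q] (p i) | i < m] by apply: val_inj.
by rewrite h tnth_mktuple.
Qed.

(** Both splittings are permutations of [pair_front]; composing one slot permutation, the tail
    permutation and the inverse of the other gives an s that carries e' to e, whatever the relative
    momentum. *)
Lemma split_pair_equiv e e' q q' : e.1 != e.2 -> e'.1 != e'.2 -> tail_equiv q q' ->
  exists s, [/\ s e'.1 = e.1, s e'.2 = e.2 &
    forall w, @split_pair R n e' w q' = permute s (@split_pair R n e w q)].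
Proof.
move=> e12 e12' /pair_front_equiv[t [t0 t1 ht]].
pose a := slot_perm e e12; pose b := slot_perm e' e12'.
have a0 : a e.1 = ord0 by rewrite permE /slot eqxx.
have a1 : a e.2 = inord 1 by rewrite permE /slot eq_sym (negbTE e12) eqxx.
have b0 : b e'.1 = ord0 by rewrite permE /slot eqxx.
have b1 : b e'.2 = inord 1 by rewrite permE /slot eq_sym (negbTE e12') eqxx.
exists (b * (t * a^-1))%g; split.
- by rewrite !permM b0 t0 -a0 permK.
- by rewrite !permM b1 t1 -a1 permK.
move=> w; rewrite (split_pairE e' e12') (split_pairE e e12) ht -!permuteM -/a -/b.
by rewrite -!mulgA mulVg mulg1.
Qed.

Lemma component_merge0 e p : component (@merge_pair R n e p) 0 = add2 (tnth p e.1) (tnth p e.2).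
Proof.
by rewrite /component -[LHS](tnth_nth ((0 : R), (0 : R)) (@merge_pair R n e p) ord0) tnth_mktuple.
Qed.

Lemma tail_merge e p : e.1 != e.2 ->
  tail (@merge_pair R n e p) = [seq (tnth p k : R * R) | k <- others e].
Proof.
move=> e12; apply: (@eq_from_nth _ (0, 0)).
  by rewrite size_behead size_tuple size_map size_others.
rewrite size_behead size_tuple => i im; rewrite nth_behead.
have im' : (i.+1 < m.+1)%N by [].
rewrite -[LHS](tnth_nth ((0 : R), (0 : R)) (@merge_pair R n e p) (Ordinal im')) tnth_mktuple /=.
by [].
Qed.

(** The action of permutations on pairs; the image is put back in increasing order because only such
    pairs index the sums. *)
Definition sort_pair s e : pair :=
  if (s e.1 < s e.2)%N then (s e.1, s e.2) else (s e.2, s e.1).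

Lemma sort_pair_neq s e : e.1 != e.2 -> (sort_pair s e).1 != (sort_pair s e).2.
Proof.
by move=> e12; rewrite /sort_pair; case: ifP => _ /=; rewrite (inj_eq perm_inj)// eq_sym.
Qed.

Lemma sort_pair_ordered s e : e.1 != e.2 -> ordered_pair (sort_pair s e).
Proof.
move=> e12; rewrite /sort_pair /ordered_pair; case: ifP => //= /negbT.
by rewrite -leqNgt leq_eqVlt => /orP[/eqP/val_inj/perm_inj h|//]; rewrite h eqxx in e12.
Qed.

(** Merging after a permutation adds the same two momenta as merging the image pair directly; only
    the order of the others may differ, which a tail-symmetric function does not see. *)
Lemma merge_permute s e p : e.1 != e.2 ->
  tail_equiv (@merge_pair R n (sort_pair s e) p) (@merge_pair R n e (permute s p)).
Proof.
move=> e12; have e12' := sort_pair_neq s e e12; split.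
  rewrite !component_merge0 !tnth_permute /sort_pair; case: ifP => _ //=.
  by rewrite add2C.
rewrite !tail_merge//.
have -> : [seq (tnth (permute s p) k : R * R) | k <- others e] =
    [seq (tnth p k : R * R) | k <- [seq s k | k <- others e]].
  by rewrite -map_comp; apply: eq_map => k /=; rewrite tnth_permute.
apply: perm_map; apply: uniq_perm.
- by rewrite map_inj_uniq ?uniq_others//; exact: perm_inj.
- exact: uniq_others.
move=> k; rewrite mem_others; have -> : k = s (s^-1 k)%g by rewrite permKV.
rewrite mem_map; last exact: perm_inj.
rewrite mem_others /sort_pair; case: ifP => _ /=; rewrite !(inj_eq perm_inj)//.
by rewrite andbC.
Qed.

Lemma sort_pairK s e : ordered_pair e -> sort_pair s^-1%g (sort_pair s e) = e.
Proof.
case: e => i j; rewrite /ordered_pair/= => ij; rewrite /sort_pair/=.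
case: (s i < s j)%N => /=; rewrite !permK ?ij//.
by rewrite ltnNge (ltnW ij).
Qed.

Lemma sqn_merged_equiv q q' : tail_equiv q q' -> @sqn_merged R n q' = @sqn_merged R n q.
Proof.
have e x : @sqn_merged R n x = sqn2 (component x 0) / 2 + \sum_(a <- tail x) sqn2 (a : plane R).
  rewrite /sqn_merged; congr (_ + _); rewrite big_mkcond big_ord_recl/= add0r.
  rewrite (big_nth (0, 0)) size_behead size_tuple big_mkord; apply: eq_bigr => i _.
  by rewrite nth_behead (tnth_nth (0, 0)).
by move=> [h0 h1]; rewrite !e h0; congr (_ + _); apply: perm_big.
Qed.

Variables (z : C) (beta : R).

Lemma propagator_tail_symmetric v : tail_symmetric v -> tail_symmetric (propagator_fun (m := m) z beta v).
Proof.
move=> hv q q' hq; rewrite /propagator_fun /inv_log_fun /propagator_den.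
by rewrite (sqn_merged_equiv _ _ hq) (hv _ _ hq).
Qed.

Lemma green_lift_permute v s e p : tail_symmetric v -> e.1 != e.2 ->
  green_lift z e v (permute s p) = green_lift z (sort_pair s e) v p.
Proof.
move=> hv e12; rewrite /green_lift /green_fun /lift_fun sqn_permute.
by rewrite (hv _ _ (merge_permute s e p e12)).
Qed.

(** A permutation carrying e' to e matches the two slices, and the symmetric f divided by the
    symmetric denominator does not see it. With q = q' this is independence of the pair; with e =
    e', tail symmetry. *)
Lemma trace_green_equiv (f : cfun R n) e e' q q' : (forall s p, f (permute s p) = f p) ->
  e.1 != e.2 -> e'.1 != e'.2 -> tail_equiv q q' ->
  trace_green z e' f q' = trace_green z e f q.
Proof.
move=> hf e12 e12' hq; have [s [_ _ hs]] := split_pair_equiv e e' q q' e12 e12' hq.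
have h : (fun w => green_fun z f (@split_pair R n e' w q')) = (fun w => green_fun z f (@split_pair R n e w q)).
  by apply/funext => w; rewrite hs /green_fun hf sqn_permute.
exact: (congr1 (fun g => ((2 * pi)^-1)%:C%C * cintegral plane_lebesgue g) h).
Qed.

(** A permutation carrying e' to e matches the term of f in the first sum with that of its image in
    the second. Single terms need not be invariant, but f runs over all pairs other than e', and its
    image over all pairs other than e. *)
Lemma pair_kernel_sum_equiv v e e' q q' : tail_symmetric v -> ordered_pair e -> ordered_pair e' ->
  tail_equiv q q' ->
  \sum_(f : pair | ordered_pair f && (e' != f)) pair_kernel z e' f v q' =
  \sum_(f : pair | ordered_pair f && (e != f)) pair_kernel z e f v q.
Proof.
move=> hv oe oe' hq; have e12 := ordered_pair_neq e oe; have e12' := ordered_pair_neq e' oe'.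
have [s [s1 s2 hs]] := split_pair_equiv e e' q q' e12 e12' hq.
have se : sort_pair s e' = e by rewrite /sort_pair s1 s2 [X in if X then _ else _]oe; case: (e).
have se' : sort_pair s^-1%g e = e' by rewrite -se sort_pairK.
have hT f : ordered_pair f -> pair_kernel z e' f v q' = pair_kernel z e (sort_pair s f) v q.
  move=> of_; have h : (fun w => green_lift z f v (@split_pair R n e' w q')) =
      (fun w => green_lift z (sort_pair s f) v (@split_pair R n e w q)).
    by apply/funext => w; rewrite hs green_lift_permute//; exact: ordered_pair_neq.
  exact: (congr1 (fun g => ((2 * pi)^-1)%:C%C * cintegral plane_lebesgue g) h).
rewrite [RHS](reindex_onto (sort_pair s) (sort_pair s^-1%g)); last first.
  by move=> f /andP[of_ _]; rewrite -{1}[s]invgK sort_pairK.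
apply: eq_big => [f|f /andP[of_ _]]; last exact: hT.
apply/idP/idP => [/andP[of_ nf]|/andP[/andP[of_ nf] /eqP hf]].
  rewrite sort_pair_ordered ?ordered_pair_neq// sort_pairK// eqxx andbT/=.
  by apply/eqP => ef; move: nf; rewrite -se' ef sort_pairK// eqxx.
rewrite -hf sort_pair_ordered ?ordered_pair_neq//= hf.
by apply/eqP => ef; move: nf; rewrite -ef se eqxx.
Qed.

(** On tail-symmetric functions all row sums coincide, so their average is any one of them. This is
    why an average over pairs can reproduce the non-repetition rule of diagrams. *)
Lemma average_kernel_sym v e q : tail_symmetric v -> ordered_pair e ->
  average_kernel_fun z v q = \sum_(f : pair | ordered_pair f && (e != f)) pair_kernel z e f v q.
Proof.
move=> hv oe; rewrite /average_kernel_fun.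
have -> : \sum_(s : pair * pair | distinct_pairs s) pair_kernel z s.1 s.2 v q =
    \sum_(f : pair | ordered_pair f) \sum_(g : pair | ordered_pair g && (f != g)) pair_kernel z f g v q.
  by rewrite pair_big_dep/=; apply: eq_bigl => s; rewrite /distinct_pairs.
rewrite (eq_bigr (fun=> \sum_(f : pair | ordered_pair f && (e != f)) pair_kernel z e f v q)); last first.
  by move=> f of_; apply: pair_kernel_sum_equiv => //; exact: tail_equiv_refl.
rewrite sumr_const -[X in _ * X]mulr_natl mulrA.
rewrite (_ : _ * _%:R = 1) ?mul1r//; exact: pair_average_count.
Qed.

Definition first_pair : pair := (ord0, ord_max).

Lemma first_pair_ordered : ordered_pair first_pair. Proof. by []. Qed.

Lemma average_kernel_tail_symmetric v : tail_symmetric v -> tail_symmetric (average_kernel_fun z v).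
Proof.
move=> hv q q' hq; rewrite (average_kernel_sym v _ q' hv first_pair_ordered) (average_kernel_sym v _ q hv first_pair_ordered).
exact: pair_kernel_sum_equiv.
Qed.

Definition symmetrize (f : cfun R n) : cfun R n :=
  fun p => (#|'S_n|%:R : C)^-1 * \sum_(s : 'S_n) f (permute s p).

Lemma symmetrize_permute f s p : symmetrize f (permute s p) = symmetrize f p.
Proof.
rewrite /symmetrize; congr (_ * _); rewrite [RHS](reindex_inj (mulIg s)).
by apply: eq_bigr => t _; rewrite permuteM.
Qed.

(** The transform is symmetric only almost everywhere. Averaging it over the finite group of
    permutations gives a version that is symmetric at every point, as the pointwise arguments
    require. *)
Lemma L2sym_fourier (u : cfun R n) : L2sym u ->
  exists2 uh : cfun R n, fourier u uh & forall s p, uh (permute s p) = uh p.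
Proof.
move=> [uL usym]; have [f uf] := fourier_total _ uL; have [_ fL _] := uf.
have mf := L2_measurable _ fL; have mu_ := L2_measurable _ uL.
have fs s : {ae lebesgue n, forall p, f (permute s p) = f p}.
  have h := fourier_permute s _ _ uf; have [puL _ _] := h.
  have uu : version u (fun x => u (permute s x)) by split.
  have ff : version (fun q => f (permute s q)) (fun q => f (permute s q)).
    by apply: version_refl; exact: (cmeasurable_comp _ _ _ _ mf (measurable_permute s)).
  by have [] := fourier_fun _ _ _ uf (fourier_version _ _ _ _ h uu ff).
exists (symmetrize f); last exact: symmetrize_permute.
apply: (fourier_version _ _ _ _ uf); first exact: version_refl.
split.
  apply: cmeasurableM; first exact: cmeasurable_cst.
  by apply: cmeasurable_sum => s _; exact: (cmeasurable_comp _ _ _ _ mf (measurable_permute s)).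
have ae : {ae lebesgue n, forall p, forall s : 'S_n, f (permute s p) = f p} by exact: filter_forall.
apply: filterS ae => p hp; rewrite /symmetrize (eq_bigr (fun=> f p))// sumr_const -[f p *+ _]mulr_natl mulrA.
by rewrite mulVf ?mul1r// pnatr_eq0 -lt0n card_Sn fact_gt0.
Qed.

End TailSymmetry.

Lemma big_tuple_cons (S : nmodType) (T : finType) k (Q : pred (seq T)) (F : T -> seq T -> S) :
  \sum_(d : k.+1.-tuple T | Q d) F (thead d) (behead d) =
  \sum_(e : T) \sum_(d : k.-tuple T | Q (e :: d)) F e d.
Proof.
rewrite pair_big_dep/= (reindex_onto (fun p : T * k.-tuple T => [tuple of p.1 :: p.2])
  (fun d : k.+1.-tuple T => (thead d, [tuple of behead d]))); last by move=> d _; rewrite -tuple_eta.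
apply: eq_big => [[e d]/=|[e d] _ //].
rewrite theadE [X in _ && (X == _)](_ : _ = (e, d)) ?eqxx ?andbT//.
by congr pair; apply: val_inj.
Qed.

Lemma linear_boundedZ {R : realType} {a b : nat} (F : cfun R a -> cfun R b) K (k : R[i]) u :
  linear_bounded F K -> L2 u -> version (F (fun x => k * u x)) (fun x => k * F u x).
Proof.
move=> bF uL; have L0 := @L2_cst0 R a; have [mF0 a0] := linear_bounded_0 _ _ _ _ bF.
have [m1 a1] := linear_bounded_lin _ _ _ _ k _ _ bF uL L0.
have e : (fun y => k * u y + 0) = (fun y => k * u y) by apply/funext => y; rewrite addr0.
rewrite e in m1 a1; split => //.
by apply: filterS2 a0 a1 => x h0 ->; rewrite h0 addr0.
Qed.

(** * Resummation of the diagrams on symmetric functions *)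

Section SymmetricResolvent.
Context {R : realType} {m : nat}.
Local Notation C := R[i].
Local Notation n := m.+2.
Local Notation pair := ('I_n * 'I_n)%type.
Local Notation N2 f := (@Lp_norm R _ 2 f%R).
Variables (z : C) (beta c : R).
Hypotheses (hz : 0 < - complex.Re z) (c0 : 0 < c) (hc : c <= ln (- complex.Re z) - beta).
Local Notation r := (- complex.Re z).
Local Notation K1 := ((2 * Num.sqrt r)^-1).
Local Notation KP := (4 * pi / c).
Local Notation N := ((n * n)%:R : R).
Hypothesis hsmall : N * (3 * KP) <= 2^-1.
Local Notation P := (propagator_fun (m := m) z beta).
Local Notation avg := (pair_average R n).
Local Notation A := (average_kernel_fun (m := m) z).

Let bP := linear_bounded_propagator (m := m) z beta c hz c0 hc.
Let bA := linear_bounded_average_kernel (m := m) z hz.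
Let bK := linear_bounded_kernel_inverse (m := m) z beta c hz c0 hc hsmall.
Let bN := linear_bounded_neumann (m := m) z beta c hz c0 hc hsmall.
Let bL := linear_bounded_layer (m := m) z beta c hz c0 hc hsmall.

Definition green_lift_sum (v : cfun R m.+1) : cfun R n :=
  fun x => \sum_(e : pair | ordered_pair e) green_lift z e v x.

Definition trace_green_sum (u : cfun R n) : cfun R m.+1 :=
  fun q => \sum_(e : pair | ordered_pair e) trace_green z e u q.

Let bGe (e : pair) (oe : ordered_pair e) := linear_bounded_green_lift z e hz (ordered_pair_neq e oe).

Lemma linear_bounded_green_lift_sum :
  linear_bounded green_lift_sum (\sum_(e : pair | ordered_pair e) K1).
Proof. exact: linear_bounded_sum. Qed.

Lemma linear_bounded_trace_green_sum :
  linear_bounded trace_green_sum (\sum_(e : pair | ordered_pair e) K1).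
Proof. by apply: linear_bounded_sum => e oe; case: (trace_green_spec z hz e oe). Qed.

Let bGS := linear_bounded_green_lift_sum.
Let bSG := linear_bounded_trace_green_sum.

Definition resolvent_sym_fun (u : cfun R n) : cfun R n :=
  fun x => green_fun z u x + avg * green_lift_sum (kernel_inverse_fun z beta (trace_green_sum u)) x.

Lemma resolvent_sym_spec : exists K, linear_bounded resolvent_sym_fun K /\
  represents (resolvent_sym (n := n) z beta) resolvent_sym_fun.
Proof.
have bG := @linear_bounded_green R n z hz; have rG := @represents_green R n z hz.
have rK := represents_kernel_inverse (m := m) z beta c hz c0 hc hsmall.
have rGS : represents (op_sum (fun e : pair => ordered_pair e) (fun e => op_comp (green z) (trace_adj (n := n) e))) green_lift_sum.
  apply: (represents_sum _ _ _ _ _ _ (fun _ => K1)) => e oe; last exact: bGe.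
  exact: represents_green_lift z e hz (ordered_pair_neq e oe).
have rSG : represents (op_sum (fun e : pair => ordered_pair e) (fun e => op_comp (trace (n := n) e) (green z))) trace_green_sum.
  by apply: (represents_sum _ _ _ _ _ _ (fun _ => K1)) => e oe; case: (trace_green_spec z hz e oe).
have b1 := linear_bounded_comp _ _ _ _ _ _ _ bGS bK.
have r1 := represents_comp _ _ _ _ _ _ _ _ _ rGS bGS rK bK.
have b2 := linear_bounded_comp _ _ _ _ _ _ _ b1 bSG.
have r2 := represents_comp _ _ _ _ _ _ _ _ _ r1 b1 rSG bSG.
have b3 := linear_bounded_scale _ _ _ _ avg b2.
have r3 := represents_scale _ _ _ _ _ avg r2 b2.
eexists; split; first exact: linear_bounded_add bG b3.
exact: represents_add rG bG r3 b3.
Qed.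

Section SymmetricInput.
Variable uh : cfun R n.
Hypotheses (uL : L2 uh) (us : forall s p, uh (permute s p) = uh p).

(** The function (A P)^k S G u. It is no limit in the topological sense: it is the value shared by
    the sums of all chains with k further vertices, whichever pair is leftmost. *)
Definition chain_limit k : cfun R m.+1 :=
  iter k (fun v => A (P v)) (trace_green z first_pair uh).

Lemma chain_limit_L2 k : L2 (chain_limit k).
Proof.
elim: k => [|k IH].
  have [b1 _] := trace_green_spec (R := R) (m := m) z hz first_pair (@first_pair_ordered m).
  exact: linear_bounded_L2 b1 uL.
exact: linear_bounded_L2 bA (linear_bounded_L2 _ _ _ _ _ bP IH).
Qed.

Lemma chain_limit_tail_symmetric k : tail_symmetric (chain_limit k).
Proof.
have e12 := @ordered_pair_neq m first_pair (@first_pair_ordered m).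
elim: k => [q q' hq|k IH]; first exact: (trace_green_equiv z uh _ _ q q' us e12 e12 hq).
by apply: average_kernel_tail_symmetric; exact: propagator_tail_symmetric.
Qed.

Definition chain_sum k (e : pair) : cfun R m.+1 := fun q =>
  \sum_(d : k.-tuple pair | dgm (e :: d)) chain_fun z beta e d uh q.

Lemma dgm_cons (e e' : pair) (d : seq pair) :
  dgm [:: e, e' & d] = [&& ordered_pair e, e != e' & dgm (e' :: d)].
Proof.
rewrite /dgm/=; case: (ordered_pair e) => //=; case: (e != e') => //=; rewrite andbC//.
Qed.

Lemma dgm_ordered (e : pair) d : dgm (e :: d) -> ordered_pair e.
Proof. by rewrite /dgm/= => /andP[/andP[]]. Qed.

Let chainL2 (e : pair) d : dgm (e :: d) -> L2 (chain_fun z beta e d uh).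
Proof.
move=> hd; have [bC _] := chain_spec z beta c hz c0 hc e d hd.
exact: linear_bounded_L2 bC uL.
Qed.

(** Induction on the length: the pair after e is any f other than e, and by induction the chains
    starting at f sum to a function independent of f. What remains is a row sum of the kernel, equal
    to the average by [average_kernel_sym]. *)
Lemma chain_sum_version k e : ordered_pair e -> version (chain_sum k e) (chain_limit k).
Proof.
elim: k e => [|k IH] e oe.
  have -> : chain_sum 0 e = chain_limit 0.
    apply/funext => q; rewrite /chain_sum (big_pred1 [tuple]); last first.
      by move=> d; rewrite tuple0/= eqxx /dgm/= oe.
    exact: (trace_green_equiv z uh first_pair e q q us (@ordered_pair_neq m first_pair (@first_pair_ordered m)) (ordered_pair_neq e oe) (tail_equiv_refl q)).
  by apply: version_refl; apply: L2_measurable; exact: chain_limit_L2.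
have -> : chain_sum k.+1 e = fun q => \sum_(f : pair | ordered_pair f && (e != f))
    \sum_(d : k.-tuple pair | dgm (f :: d)) (pair_kernel z e f \o P) (chain_fun z beta f d uh) q.
  apply/funext => q; rewrite /chain_sum.
  rewrite (eq_bigr (fun d : k.+1.-tuple pair => chain_fun z beta e (thead d :: behead d) uh q)); last first.
    by move=> d _; rewrite {1}(tuple_eta d).
  rewrite (big_tuple_cons _ _ k (fun d => dgm (e :: d)) (fun f d => chain_fun z beta e (f :: d) uh q)).
  rewrite [RHS]big_mkcond; apply: eq_bigr => f _; case: ifPn => hf.
    by apply: eq_bigl => d; rewrite dgm_cons oe; case/andP: hf => _ ->.
  rewrite big1// => d; rewrite dgm_cons => /and3P[_ ef /dgm_ordered of_].
  by move: hf; rewrite ef of_.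
have -> : chain_limit k.+1 = fun q => \sum_(f : pair | ordered_pair f && (e != f)) pair_kernel z e f (P (chain_limit k)) q.
  apply/funext => q; apply: (average_kernel_sym z (P (chain_limit k)) e q) => //.
  by apply: propagator_tail_symmetric; exact: chain_limit_tail_symmetric.
apply: version_sum => f /andP[of_ ef].
have [bT _] := pair_kernel_spec z hz e f oe of_ ef.
have bTP := linear_bounded_comp _ _ _ _ _ _ _ bT bP.
have h := linear_bounded_bigsum _ _ _ _ _ (fun d : k.-tuple pair => dgm (f :: d))
  (fun d : k.-tuple pair => chain_fun z beta f d uh) bTP (fun d hd => chainL2 f d hd).
have h2 := linear_bounded_version _ _ _ _ _ _ bTP (chain_limit_L2 k) (IH f of_).
apply: version_trans h2; apply: version_sym h.
apply: cmeasurable_sum => d hd; apply: L2_measurable.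
exact: (linear_bounded_L2 _ _ _ _ _ bTP (chainL2 f d hd)).
Qed.

Lemma layer_version k :
  version (layer_fun z beta k uh) (green_lift_sum (P (chain_limit k))).
Proof.
have -> : layer_fun z beta k uh = fun x => \sum_(e : pair | ordered_pair e)
    \sum_(d : k.-tuple pair | dgm (e :: d)) (green_lift z e \o P) (chain_fun z beta e d uh) x.
  apply/funext => x; rewrite /layer_fun.
  rewrite (big_tuple_cons _ _ k (fun d => dgm d) (fun e d => diagram_fun z beta e d uh x)).
  rewrite [RHS]big_mkcond; apply: eq_bigr => e _; case: ifPn => // oe.
  by rewrite big1// => d /dgm_ordered oe'; move: oe; rewrite oe'.
apply: version_sum => e oe.
have bGP := linear_bounded_comp _ _ _ _ _ _ _ (bGe e oe) bP.
have h := linear_bounded_bigsum _ _ _ _ _ (fun d : k.-tuple pair => dgm (e :: d))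
  (fun d : k.-tuple pair => chain_fun z beta e d uh) bGP (fun d hd => chainL2 e d hd).
have h2 := linear_bounded_version _ _ _ _ _ _ bGP (chain_limit_L2 k) (chain_sum_version k e oe).
apply: version_trans h2; apply: version_sym h.
apply: cmeasurable_sum => d hd; apply: L2_measurable.
exact: (linear_bounded_L2 _ _ _ _ _ bGP (chainL2 e d hd)).
Qed.

Local Notation chi := (trace_green z first_pair uh).

Let chiL : L2 chi := chain_limit_L2 0.

(** The associativity (P A)^k P = P (A P)^k links diagrams to the Neumann series. *)
Lemma neumann_chain_limit k : neumann_term z beta k chi = P (chain_limit k).
Proof. by elim: k => [//|k IH]; rewrite /neumann_term /= -/(neumann_term z beta k) IH. Qed.

(** Layer k equals, almost everywhere, the image of the k-th Neumann term; summing to order M and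
    bounding both remainders gives the equality of the limits. *)
Lemma series_layer_version :
  version (series_fun (layer_fun z beta) uh) (green_lift_sum (kernel_inverse_fun z beta chi)).
Proof.
have bser := linear_bounded_series _ _ bL.
have SL := linear_bounded_L2 _ _ _ _ _ bser uL; have KL := linear_bounded_L2 _ _ _ _ _ bK chiL.
have GL := linear_bounded_L2 _ _ _ _ _ bGS KL.
have mS := L2_measurable _ SL; have mG := L2_measurable _ GL.
apply: version_dist_lt => // e e0.
pose L : R := \sum_(e : pair | ordered_pair e) K1.
pose Kl : R := layer_bound (m := m) z c.
pose B : R := 2 * Kl * fine (N2 uh) + L * (2 * KP * fine (N2 chi)).
have [M hM] := geometric_small B e e0; apply: (@le_trans _ _ (B * 2^-1 ^+ M)%:E); last by rewrite lee_fin.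
have bpl := linear_bounded_partial _ _ bL M; have pL := linear_bounded_L2 _ _ _ _ _ bpl uL.
have bpn := linear_bounded_partial _ _ bN M; have pN := linear_bounded_L2 _ _ _ _ _ bpn chiL.
have mp := L2_measurable _ pL.
apply: (le_trans (le_Lp_norm2B (partial_fun (layer_fun z beta) M uh) _ _ mS mG mp)).
have -> : B * 2^-1 ^+ M = 2 * Kl * 2^-1 ^+ M * fine (N2 uh) + L * (2 * KP * 2^-1 ^+ M * fine (N2 chi)).
  by rewrite /B; ring.
rewrite EFinD; apply: leeD.
  by rewrite [X in (_ <= X)%E]EFinM fineK ?Lp_norm2_fin//; exact: (series_fun_dist _ _ bL uh M uL).
have pv : version (partial_fun (layer_fun z beta) M uh) (green_lift_sum (partial_fun (neumann_term z beta) M chi)).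
  have h1 : version (fun x => \sum_(k < M) layer_fun z beta k uh x)
      (fun x => \sum_(k < M) green_lift_sum (neumann_term z beta k chi) x).
    apply: (version_sum _ 'I_M xpredT (fun k : 'I_M => layer_fun z beta k uh)) => k _.
    by rewrite neumann_chain_limit; exact: layer_version.
  have nL (k : 'I_M) : true -> L2 (neumann_term z beta k chi).
    by move=> _; exact: linear_bounded_L2 (bN k) chiL.
  have h2 := linear_bounded_bigsum _ _ _ _ 'I_M xpredT (fun k : 'I_M => neumann_term z beta k chi) bGS nL.
  apply: version_trans h1 _; apply: version_sym h2.
  by apply: cmeasurable_sum => k _; apply: L2_measurable; exact: (linear_bounded_L2 _ _ _ _ _ bGS (nL k isT)).
have GpL := linear_bounded_L2 _ _ _ _ _ bGS pN.
have -> : N2 (fun x => partial_fun (layer_fun z beta) M uh x - green_lift_sum (kernel_inverse_fun z beta chi) x)%R =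
    N2 (fun x => green_lift_sum (partial_fun (neumann_term z beta) M chi) x - green_lift_sum (kernel_inverse_fun z beta chi) x)%R.
  apply: Lp_norm2_ae.
  - exact: cmeasurableB.
  - exact: (cmeasurableB _ _ (L2_measurable _ GpL) mG).
  - by have [_ ap] := pv; apply: filterS ap => x ->.
apply: (le_trans (linear_bounded_sub _ _ _ _ bGS pN KL)); rewrite EFinM; apply: lee_wpmul2l.
  by have [h _ _ _] := bGS; rewrite lee_fin.
rewrite Lp_norm2BC [X in (_ <= X)%E]EFinM fineK ?Lp_norm2_fin//.
exact: (series_fun_dist _ _ bN chi M chiL).
Qed.

(** On a symmetric input the rightmost sum of traces is the number of pairs times a single trace,
    and the prefactor cancels exactly this number. *)
Lemma resolvent_sym_version : version (resolvent_fun z beta uh) (resolvent_sym_fun uh).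
Proof.
have bG := @linear_bounded_green R n z hz; have gL := linear_bounded_L2 _ _ _ _ _ bG uL.
pose No : C := #|[pred e : pair | ordered_pair e]|%:R.
have eSG : trace_green_sum uh = fun q => No * chi q.
  apply/funext => q; rewrite /trace_green_sum (eq_bigr (fun=> chi q)).
    by rewrite sumr_const -[chi q *+ _]mulr_natl.
  move=> e oe; exact: (trace_green_equiv z uh first_pair e q q us (@ordered_pair_neq m first_pair (@first_pair_ordered m)) (ordered_pair_neq e oe) (tail_equiv_refl q)).
have bGK := linear_bounded_comp _ _ _ _ _ _ _ bGS bK.
have [mZ aZ] := linear_boundedZ _ _ No _ bGK chiL.
have [mS aS] := series_layer_version.
have h : {ae lebesgue n, forall x, series_fun (layer_fun z beta) uh x =
    avg * green_lift_sum (kernel_inverse_fun z beta (trace_green_sum uh)) x}.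
  rewrite eSG; apply: filterS2 aS aZ => x -> /= ->.
  by rewrite mulrA pair_average_count mul1r.
split.
  apply: cmeasurableD => //; exact: L2_measurable.
by apply: filterS h => x hx; rewrite /resolvent_fun /resolvent_sym_fun hx.
Qed.

End SymmetricInput.

End SymmetricResolvent.

Theorem proposition1p4 (R : realType) (phi : R * R -> R) (hphi : mollifier phi) :
  exists C : R, forall (beta_fine : R) (n : nat) (z : R[i]),
    (2 <= n)%N ->
    complex.Re z < - expR (C * n%:R ^+ 2 + beta_star phi beta_fine) ->
    let beta := beta_star phi beta_fine in
    [/\ bounded_operator (unhat (@green R n z)),
        bounded_operator (unhat (@propagator R n z beta)),
        forall (m : nat) (d : m.+1.-tuple ('I_n * 'I_n)), dgm d ->
          bounded_operator (unhat (diagram_op z beta (thead d) (behead d))),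
        (\sum_(0 <= m <oo) \sum_(d : m.+1.-tuple ('I_n * 'I_n) | dgm d)
           op_norm (unhat (diagram_op z beta (thead d) (behead d))) < +oo)%E
      & exists Rz : op R n n,
          [/\ bounded_operator Rz,
              op_norm (op_sub Rz (@resolvent_partial_sum R n z beta M))
                @[M --> \oo] --> 0%E,
              bounded_operator (unhat (op_inv (@sym_kernel R n z beta)))
            & forall u, L2sym u ->
                forall w, Rz u w <-> unhat (resolvent_sym z beta) u w]].
Proof.
have p0 : 0 < pi :> R by exact: pi_gt0.
(* 12 pi n^2 / c bounds the ratio of the series, see [hsmall]. *)
exists (24 * pi) => beta_fine n z n2 hRe beta.
(* Writing n as m + 2 makes n - 1 compute to m + 1, the form in which all operators were studied. *)
case: n n2 hRe => [|[|m]]// _ hRe.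
pose c : R := 24 * pi * m.+2%:R ^+ 2.
have hr : expR (c + beta) < - complex.Re z by rewrite ltrNr.
have hz : 0 < - complex.Re z := lt_trans (expR_gt0 _) hr.
have c0 : 0 < c by rewrite !mulr_gt0// exprn_gt0.
have hc : c <= ln (- complex.Re z) - beta.
  by rewrite lerBrDr -[leLHS]expRK ler_ln ?posrE ?expR_gt0// ltW.
have hsmall : (m.+2 * m.+2)%:R * (3 * (4 * pi / c)) <= 2^-1.
  rewrite natrM -expr2 /c le_eqVlt; apply/orP; left; apply/eqP.
  have : m.+2%:R != 0 :> R by rewrite pnatr_eq0.
  by move: (m.+2%:R : R) (pi : R) p0 => x P P0 x0; field; rewrite x0 gt_eqF.
have bG := @linear_bounded_green R m.+2 z hz; have rG := @represents_green R m.+2 z hz.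
have bP := linear_bounded_propagator (m := m) z beta c hz c0 hc.
have rP := represents_propagator (m := m) z beta c hz c0 hc.
have bK := linear_bounded_kernel_inverse (m := m) z beta c hz c0 hc hsmall.
have rK := represents_kernel_inverse (m := m) z beta c hz c0 hc hsmall.
have bR := linear_bounded_resolvent (m := m) z beta c hz c0 hc hsmall.
have hR := fourier_represents_unhat_fun _ _ _ _ bR.
split.
- by case: (bounded_unhat _ _ _ _ _ rG bG).
- by case: (bounded_unhat _ _ _ _ _ rP bP).
- move=> k d hd; have [bD rD] := dgm_tuple_spec (m := m) z beta c hz c0 hc k d hd.
  by case: (bounded_unhat _ _ _ _ _ rD bD).
- exact: (diagram_op_norm_summable z beta c hz c0 hc hsmall).
(* The witness is the L^2 sum of the whole series in Fourier variables, so boundedness is read off a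
   single bound. *)
exists (unhat_fun (resolvent_fun z beta)); split.
- by apply: (bounded_operatorP _ _ _ _ _ hR bR) => u w [uh []].
- exact: (resolvent_dist_cvg z beta c hz c0 hc hsmall).
- by case: (bounded_unhat _ _ _ _ _ rK bK).
(* A pointwise symmetric transform is fixed; the two candidates then agree almost everywhere in
   Fourier variables, and either graph can be changed into the other. *)
move=> u us w; have [uh uuh uhs] := L2sym_fourier u us; have [_ uhL _] := uuh.
have [K [bS rS]] := resolvent_sym_spec (m := m) z beta c hz c0 hc hsmall.
have hS := fourier_represents_unhat _ _ _ _ _ rS bS.
have v := resolvent_sym_version z beta c hz c0 hc hsmall uh uhL uhs.
have vR : version (resolvent_sym_fun z beta uh) (resolvent_fun z beta uh).
  by apply: version_sym v; apply: L2_measurable; exact: linear_bounded_L2 bS uhL.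
have vw : L2 w -> version w w by move=> wL; apply: version_refl; exact: L2_measurable.
split=> [/(hR _ _ uuh) h|/(hS _ _ uuh) h]; have [wL _ _] := h.
  by apply/(hS _ _ uuh); exact: fourier_version h (vw wL) vR.
by apply/(hR _ _ uuh); exact: fourier_version h (vw wL) v.
Qed.
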